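(* Let $M, N$ be von Neumann algebras of type I$_{\infty}$ or III. If $\Psi\colon LS(M)\to LS(N)$ is a ring isomorphism, then there exist a real $^*$-isomorphism $\psi\colon M\to N$ (which extends to a real $^*$-isomorphism, still denoted $\psi$, from $LS(M)$ onto $LS(N)$) and an invertible element $y\in LS(N)$ such that $\Psi(x)=y\psi(x)y^{-1}$ for all $x\in LS(M)$.
   Context: Type I$_\infty$ means type I and properly infinite. For a von Neumann algebra $M\subset B(H)$, a densely defined closed operator $x$ on $H$ is affiliated with $M$ if $yx\subset xy$ for every $y$ in the commutant $M'$. An affiliated operator $x$ is measurable with respect to $M$ if the spectral projection $\chi_{(c,\infty)}(|x|)$ is a finite projection of $M$ for some real $c>0$. It is locally measurable with respect to $M$ if there is an increasing sequence $(p_n)_{n\ge 1}$ of central projections of $M$ with $p_n\nearrow 1$ such that $xp_n$ is measurable for every $n$. $LS(M)$ is the set of all locally measurable operators; it is a $^*$-algebra containing $M$, with sum and product given by the closures of the operator sum and product. A ring isomorphism is an additive and multiplicative bijection (not assumed linear). A real $^*$-isomorphism is a real-linear ring isomorphism $\psi$ with $\psi(x^* )=\psi(x)^*$ for all $x$. *)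

(* Defs.v *)
From HB Require Import structures.
From mathcomp Require Import all_boot all_order all_algebra.
From mathcomp Require Import all_classical all_reals all_analysis.
From mathcomp Require Import complex.
Set Implicit Arguments.
Unset Strict Implicit.
Unset Printing Implicit Defensive.
Import Order.TTheory GRing.Theory Num.Theory.
Import numFieldNormedType.Exports.
Local Open Scope classical_set_scope.
Local Open Scope ring_scope.
Local Open Scope complex_scope.

(** Complex Hilbert spaces. The inner product is linear in its first argument
    and conjugate-linear in the second one. *)
Record hilbertSpace (R : realType) := HilbertSpace {
  hilbert_sort :> completeNormedModType R[i] ;
  inner : {dot hilbert_sort for (@Num.conj R[i])} ;
  inner_norm : forall u : hilbert_sort, inner u u = `|u| ^+ 2 }.

Arguments inner {R h}.

(** Possibly unbounded operators on H are identified with their graphs: x maps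
    u to v when x (u, v). In particular Leibniz equality of operators is
    equality of domains and of values, `<=` is extension of operators, and an
    algebra of bounded operators on H and the algebra of its (locally)
    measurable operators are subsets of the same type. *)
Definition operator (R : realType) (H : hilbertSpace R) := set (H * H).

Section Operators.
Variables (R : realType) (H : hilbertSpace R).
Implicit Types (x y a : operator H).

Definition op_of_fun (f : H -> H) : operator H := [set p | p.2 = f p.1].
Definition op0 : operator H := op_of_fun (fun=> 0).
Definition op1 : operator H := op_of_fun idfun.

Definition dom x : set H := [set u | exists v, x (u, v)].

Definition op_add x y : operator H :=
  [set p | exists v w, [/\ x (p.1, v), y (p.1, w) & p.2 = v + w]].
(** first y, then x *)
Definition op_mul x y : operator H :=
  [set p | exists2 v, y (p.1, v) & x (v, p.2)].
Definition op_scale (c : R[i]) x : operator H :=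
  [set p | exists2 v, x (p.1, v) & p.2 = c *: v].
(** (v, w) is in the graph of x^* when <x u, v> = <u, w> for all u in dom x *)
Definition op_adj x : operator H :=
  [set p | forall u xu, x (u, xu) -> inner xu p.1 = inner u p.2].

Definition linear_op x : Prop :=
  [/\ x 0,
      forall (c : R[i]) (p q : H * H), x p -> x q -> x (c *: p + q) &
      forall u v w, x (u, v) -> x (u, w) -> v = w].

Definition closed_densely_defined x : Prop :=
  [/\ linear_op x, closed x & dense (dom x)].

Definition bounded_op x : Prop :=
  exists2 f : {linear H -> H}, continuous f & x = op_of_fun f.

Definition self_adjoint x : Prop :=
  closed_densely_defined x /\ op_adj x = x.

(** 0 <= c in R[i] means that c is a nonnegative real. *)
Definition positive_op x : Prop :=
  forall u v, x (u, v) -> 0 <= inner v u.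

(** [a] is |x|, the positive self-adjoint square root of x^* x. *)
Definition is_abs x a : Prop :=
  [/\ self_adjoint a, positive_op a & op_mul a a = op_mul (op_adj x) x].

Definition projection x : Prop :=
  [/\ bounded_op x, op_adj x = x & op_mul x x = x].

Definition proj_le x y : Prop := op_mul y x = x.

End Operators.

Arguments op0 {R} H.
Arguments op1 {R} H.

Section SpectralMeasure.
Variables (R : realType) (H : hilbertSpace R).

Definition pvm_weight (E : set (measurableTypeR R) -> H -> H) (u : H)
    (B : set (measurableTypeR R)) : \bar R :=
  (complex.Re (inner (E B u) (E B u)))%:E.

(** Projection-valued Borel measures on the real line. *)
Record pvm := PVM {
  pvm_fun :> set (measurableTypeR R) -> H -> H ;
  pvm_projection : forall B, measurable B -> projection (op_of_fun (pvm_fun B)) ;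
  pvm_set0 : pvm_fun set0 = fun=> 0 ;
  pvm_setT : pvm_fun setT = idfun ;
  pvm_setI : forall A B, measurable A -> measurable B ->
    pvm_fun (A `&` B) = pvm_fun A \o pvm_fun B ;
  pvm_sigma_additive : forall u, semi_sigma_additive (pvm_weight pvm_fun u) }.

(** The measure B |-> <E(B) u, u> = |E(B) u|^2 (the second form also makes
    sense on non-measurable sets, where E is unconstrained). *)
Definition pvm_measure (E : pvm) (u : H) := pvm_weight E u.

Section Measure.
Variables (E : pvm) (u : H).

Let pvm_measure0 : pvm_measure E u set0 = 0%E.
Proof.
by rewrite /pvm_measure /pvm_weight pvm_set0 inner_norm normr0 expr0n.
Qed.

Let pvm_measure_ge0 (B : set (measurableTypeR R)) : (0 <= pvm_measure E u B)%E.
Proof.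
rewrite /pvm_measure /pvm_weight lee_fin inner_norm.
have : 0 <= `|pvm_fun E B u| ^+ 2 by rewrite exprn_ge0.
by rewrite lecE => /andP[].
Qed.

Let pvm_measure_sigma_additive : semi_sigma_additive (pvm_measure E u).
Proof. exact: pvm_sigma_additive. Qed.

HB.instance Definition _ := isMeasure.Build _ _ _ (pvm_measure E u)
  pvm_measure0 pvm_measure_ge0 pvm_measure_sigma_additive.

End Measure.

(** [a] is the integral of t dE(t): u is in dom a exactly when t is
    square-integrable for <E(.) u, u>, and then <a u, u> is the integral of t;
    for the (linear) operator a this determines a u by polarization. *)
Definition spectral_measure_of (a : operator H) (E : pvm) : Prop :=
  (forall u, dom a u <->
     (\int[pvm_measure E u]_(t in setT) ((t : R) ^+ 2)%:E < +oo)%E) /\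
  (forall u v, a (u, v) ->
     inner v u = (\int[pvm_measure E u]_(t in setT) (t : R))%R%:C).

End SpectralMeasure.

Section VonNeumannAlgebras.
Variables (R : realType) (H : hilbertSpace R).
Implicit Types (M : set (operator H)) (x y p q z : operator H).

Definition commutant M : set (operator H) :=
  [set y | bounded_op y /\ forall x, M x -> op_mul y x = op_mul x y].

Definition von_neumann_algebra M : Prop :=
  [/\ M `<=` @bounded_op R H,
      forall x, M x -> M (op_adj x) &
      commutant (commutant M) = M].

Definition projection_in M p : Prop := M p /\ projection p.

Definition central_projection M z : Prop :=
  projection_in M z /\ commutant M z.

Definition mvn_equiv M p q : Prop :=
  exists v, [/\ M v, op_mul (op_adj v) v = p & op_mul v (op_adj v) = q].

Definition finite_projection M p : Prop :=
  projection_in M p /\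
  forall q, projection_in M q -> proj_le q p -> mvn_equiv M p q -> q = p.

Definition abelian_projection M p : Prop :=
  projection_in M p /\
  forall x y, M x -> M y ->
    let px := op_mul p (op_mul x p) in let py := op_mul p (op_mul y p) in
    op_mul px py = op_mul py px.

Definition type_I M : Prop :=
  forall z, central_projection M z -> z <> op0 H ->
  exists p, [/\ abelian_projection M p, p <> op0 H & proj_le p z].

Definition properly_infinite M : Prop :=
  forall z, central_projection M z -> finite_projection M z -> z = op0 H.

Definition type_I_infty M : Prop := type_I M /\ properly_infinite M.

Definition type_III M : Prop :=
  forall p, finite_projection M p -> p = op0 H.

Definition affiliated M x : Prop :=
  closed_densely_defined x /\
  forall y, commutant M y -> op_mul y x `<=` op_mul x y.

Definition measurable_op M x : Prop :=
  affiliated M x /\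
  exists a (E : pvm H) (c : R),
    [/\ is_abs x a, spectral_measure_of a E, 0 < c &
        finite_projection M (op_of_fun (E `]c, +oo[%classic))].

(** p_n increases to 1: the convergence is in the strong operator topology. *)
Definition locally_measurable M x : Prop :=
  affiliated M x /\
  exists p : nat -> H -> H,
    [/\ forall n, central_projection M (op_of_fun (p n)),
        forall n, proj_le (op_of_fun (p n)) (op_of_fun (p n.+1)),
        forall u, (p n u @[n --> \oo] --> u) &
        forall n, measurable_op M (op_mul x (op_of_fun (p n)))].

Definition LS M : set (operator H) := [set x | locally_measurable M x].

(** The operations of LS(M): closures of the algebraic ones. On bounded
    everywhere defined operators they are the usual operations. *)
Definition ls_add x y : operator H := closure (op_add x y).
Definition ls_mul x y : operator H := closure (op_mul x y).
Definition ls_scale (c : R[i]) x : operator H := closure (op_scale c x).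

End VonNeumannAlgebras.

Section Isomorphisms.
Variables (R : realType) (H K : hilbertSpace R).
Implicit Types (A : set (operator H)) (B : set (operator K)).
Implicit Types f : operator H -> operator K.

(** Only the values of f on A matter. *)
Definition ring_isomorphism A B f : Prop :=
  [/\ set_bij A B f,
      forall x y, A x -> A y -> f (ls_add x y) = ls_add (f x) (f y) &
      forall x y, A x -> A y -> f (ls_mul x y) = ls_mul (f x) (f y)].

Definition real_star_isomorphism A B f : Prop :=
  [/\ ring_isomorphism A B f,
      forall (r : R) x, A x -> f (ls_scale r%:C x) = ls_scale r%:C (f x) &
      forall x, A x -> f (op_adj x) = op_adj (f x)].

End Isomorphisms.

(* Main.v *)
(** In types I_infinity and III an operator is locally measurable iff it is
    affiliated and its restrictions to a dense family of central projections are
    bounded; so a ring isomorphism Psi can be studied on central pieces.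

    Boundedness is automatic: Cuntz isometries s1, s2 give isometries s1^k s2 with
    orthogonal ranges, along which a gliding hump packs bounded elements into a
    single one, so Psi cannot be unbounded on a dense family of pieces.

    On a piece where Psi acts as a bounded map P, averaging sums of P(a)^* P(a) over
    words in s1, s2 and passing to an ultralimit gives an invertible positive k with
    P(x)^* k P(x) <= k for all contractions x.  Applied to unitaries and their
    inverses this is an equality, whence k P(x^* ) = P(x)^* k, and conjugation by
    the square root of k makes P star-preserving.  The pieces are patched along a
    maximal orthogonal family of central projections.

    A star-preserving ring isomorphism preserves the relation 1 - x^* x = s^* s,
    hence maps contractions to contractions and is real-linear. *)
Require Import Defs.
From HB Require Import structures.
From mathcomp Require Import all_boot all_order all_algebra.
From mathcomp Require Import all_classical all_reals all_analysis.
From mathcomp Require Import measurable_realfun complex ring lra.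
Set Implicit Arguments.
Unset Strict Implicit.
Unset Printing Implicit Defensive.
Import Order.TTheory GRing.Theory Num.Theory.
Import numFieldNormedType.Exports.
Local Open Scope classical_set_scope.
Local Open Scope ring_scope.
Local Open Scope complex_scope.

(** * Real geometry of complex Hilbert spaces *)

(** The delicate step leads from an averaged form to an invariant one. The natural candidate, the
    supremum over contractions [a] of the form at [P a u], is a quadratic form only if finitely many
    vectors admit a common near-maximiser. The average over words makes [P s1] and [P s2] isometric
    with orthogonal ranges for the form, so that near-maximisers found on orthogonal projections can
    be stacked by [s1] and [s2]. The centre is sliced into levels of the expansion ratio, with
    factor [rho] close to 1, so that a local maximiser is uniformly good on a slice; a limit over
    finite sets of vectors gives [k]. Since [Psi] is only additive, scalars other than integers, in
    particular i, may not be moved through it; adjoints are not respected before [k] is found, so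
    idempotents take the place of projections until then. The definition of [LS] speaks of spectral
    measures and finite projections, which forces two bridges: a shift argument that turns finite
    projections into central cut-offs in type I, and the construction of a spectral measure for
    bounded positive operators. *)

Section RealInner.
Variables (R : realType) (H : hilbertSpace R).
Implicit Types (u v w : H) (r s : R).
Notation Re := complex.Re.
Notation Im := complex.Im.

(** Estimates are phrased with the real part of the inner product and with squared norms, so that
    they live in [R] and are open to [lra] and [nra]. Complex orthogonality to [u] becomes real
    orthogonality to [u] and to [im u]. *)
Definition ip u v : R := Re (inner u v).
Definition n2 u : R := ip u u.
Definition rs r u : H := r%:C *: u.
Definition im u : H := 'i%C *: u.

Lemma innerDl u v w : inner (u + v) w = inner u w + inner v w.
Proof. exact: linearDl. Qed.
Lemma innerZl (c : R[i]) u v : inner (c *: u) v = c * inner u v.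
Proof. exact: linearZl_LR. Qed.
Lemma innerZr (c : R[i]) u v : inner u (c *: v) = conjc c * inner u v.
Proof. exact: linearZr_LR. Qed.

Lemma ipC u v : ip u v = ip v u.
Proof.
rewrite /ip; have -> : inner u v = conjc (inner v u).
  by rewrite -[RHS]mul1r -(expr0 (-1)); exact: hermC.
by case: (inner v u).
Qed.

Lemma ipDl u v w : ip (u + v) w = ip u w + ip v w.
Proof. rewrite /ip innerDl; case: (inner u w) => a b; case: (inner v w) => c d //. Qed.

Lemma ipDr u v w : ip u (v + w) = ip u v + ip u w.
Proof. by rewrite ipC ipDl !(ipC _ u). Qed.

Lemma ipZl r u v : ip (rs r u) v = r * ip u v.
Proof.
rewrite /ip /rs innerZl; case: (inner u v) => a b /=; by rewrite mul0r subr0.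
Qed.

Lemma ipZr r u v : ip u (rs r v) = r * ip u v.
Proof. by rewrite ipC ipZl ipC. Qed.

Lemma rsN1 u : rs (-1) u = - u.
Proof. by rewrite /rs rmorphN1 scaleN1r. Qed.

Lemma ipNl u v : ip (- u) v = - ip u v.
Proof. by rewrite -rsN1 ipZl mulN1r. Qed.

Lemma ipNr u v : ip u (- v) = - ip u v.
Proof. by rewrite ipC ipNl ipC. Qed.

Lemma ipBl u v w : ip (u - v) w = ip u w - ip v w.
Proof. by rewrite ipDl ipNl. Qed.

Lemma ipBr u v w : ip u (v - w) = ip u v - ip u w.
Proof. by rewrite ipDr ipNr. Qed.

Lemma ip0l u : ip 0 u = 0.
Proof. by rewrite -(subrr 0) ipBl subrr. Qed.

Lemma ip0r u : ip u 0 = 0.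
Proof. by rewrite ipC ip0l. Qed.

Lemma ip_iml u v : ip (im u) v = - ip u (im v).
Proof.
rewrite /ip /im innerZl innerZr /=.
by case: (inner u v) => a b /=; rewrite !mul0r !mul1r !add0r mulN1r opprK.
Qed.

Lemma imim u : im (im u) = - u.
Proof. by rewrite /im scalerA -expr2 sqr_i scaleN1r. Qed.

Lemma ip_im u v : ip (im u) (im v) = ip u v.
Proof. by rewrite ip_iml imim ipNr opprK. Qed.

Lemma innerE u v : inner u v = Complex (ip u v) (ip u (im v)).
Proof.
rewrite /ip /im innerZr /=.
by case: (inner u v) => a b /=; rewrite !mul0r mulN1r opprK add0r.
Qed.

Lemma scaleE (c : R[i]) u : c *: u = rs (Re c) u + im (rs (Im c) u).
Proof. by rewrite /rs /im scalerA -scalerDl -complexE. Qed.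

Lemma rsDl r s u : rs (r + s) u = rs r u + rs s u.
Proof. by rewrite /rs rmorphD scalerDl. Qed.
Lemma rs0l u : rs 0 u = 0. Proof. by rewrite /rs scale0r. Qed.
Lemma rs1 u : rs 1 u = u. Proof. by rewrite /rs scale1r. Qed.
Lemma rsA r s u : rs r (rs s u) = rs (r * s) u.
Proof. by rewrite /rs scalerA rmorphM. Qed.
Lemma rs_im r u : rs r (im u) = im (rs r u).
Proof. by rewrite /rs /im !scalerA mulrC. Qed.
Lemma imN u : im (- u) = - im u. Proof. exact: scalerN. Qed.

Lemma n2E u : inner u u = (n2 u)%:C.
Proof.
have := inner_norm u; have : 0 <= `|u| ^+ 2 by rewrite exprn_ge0.
rewrite /n2 /ip => h ->; move: h; case: (`|u| ^+ 2) => a b.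
by rewrite lecE /= => /andP[/eqP -> _].
Qed.

Lemma n2_norm u : (n2 u)%:C = `|u| ^+ 2.
Proof. by rewrite -n2E inner_norm. Qed.

Lemma n2_ge0 u : 0 <= n2 u.
Proof. by rewrite -lecR n2_norm exprn_ge0. Qed.

Lemma n2_eq0 u : n2 u = 0 -> u = 0.
Proof.
by move=> h; have := n2_norm u; rewrite h => /esym/eqP; rewrite expf_eq0 /= normr_eq0 => /eqP.
Qed.

Lemma n20 : n2 0 = 0. Proof. exact: ip0l. Qed.
Lemma n2N u : n2 (- u) = n2 u. Proof. by rewrite /n2 ipNl ipNr opprK. Qed.
Lemma n2i u : n2 (im u) = n2 u. Proof. exact: ip_im. Qed.
Lemma n2Z r u : n2 (rs r u) = r ^+ 2 * n2 u.
Proof. by rewrite /n2 ipZl ipZr mulrA. Qed.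
Lemma n2D u v : n2 (u + v) = n2 u + 2 * ip u v + n2 v.
Proof. by rewrite /n2 ipDl !ipDr (ipC v u); ring. Qed.
Lemma n2B u v : n2 (u - v) = n2 u - 2 * ip u v + n2 v.
Proof. by rewrite n2D ipNr n2N; ring. Qed.
Lemma n2Bc u v : n2 (u - v) = n2 (v - u).
Proof. by rewrite -n2N opprB. Qed.
Lemma n2D_le u v : n2 (u + v) <= 2 * n2 u + 2 * n2 v.
Proof. by have := n2_ge0 (u - v); rewrite n2B n2D; lra. Qed.
Lemma n2_tri u v w : n2 (u - w) <= 2 * n2 (u - v) + 2 * n2 (v - w).
Proof. by have := n2D_le (u - v) (v - w); rewrite addrA subrK. Qed.
Lemma n2_scale (c : R[i]) u : n2 (c *: u) = (Re c ^+ 2 + Im c ^+ 2) * n2 u.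
Proof. by rewrite scaleE n2D n2i !n2Z -rs_im ipZl ipZr ipC ip_iml; 
 have -> : ip u (im u) = 0; [have := ip_iml u u; rewrite ipC; lra | ring]. Qed.

Lemma CS u v : ip u v ^+ 2 <= n2 u * n2 v.
Proof.
have [h|h] := eqVneq (n2 v) 0.
  by rewrite (n2_eq0 h) ip0r n20 expr0n mulr0.
have v0 : 0 < n2 v by rewrite lt_neqAle eq_sym h n2_ge0.
have := n2_ge0 (rs (n2 v) u - rs (ip u v) v).
rewrite n2B !n2Z ipZl ipZr.
have -> : n2 v ^+ 2 * n2 u - 2 * (n2 v * (ip u v * ip u v)) + ip u v ^+ 2 * n2 v
  = n2 v * (n2 u * n2 v - ip u v ^+ 2) by ring.
by rewrite pmulr_rge0 // subr_ge0.
Qed.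

Lemma ip_ext u v : (forall w, ip u w = ip v w) -> u = v.
Proof.
by move=> h; apply/eqP; rewrite -subr_eq0; apply/eqP/n2_eq0; rewrite /n2 ipBl h subrr.
Qed.

Lemma inner_ext u v u' v' : ip u v = ip u' v' -> ip u (im v) = ip u' (im v') ->
  inner u v = inner u' v'.
Proof. by rewrite !innerE => -> ->. Qed.

Lemma norm_lt u (e : R) : 0 < e -> (`|u| < e%:C) = (n2 u < e ^+ 2).
Proof.
move=> e0; rewrite -ltcR n2_norm rmorphXn /=.
by rewrite ltr_pXn2r // ?nnegrE // ler0c ltW.
Qed.

Lemma posC (e : R[i]) : 0 < e -> exists2 r : R, 0 < r & e = r%:C.
Proof. by case: e => a b; rewrite ltcE /= => /andP[/eqP -> ?]; exists a. Qed.

Lemma posC' (e : R) : 0 < e -> 0 < e%:C :> R[i].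
Proof. by rewrite ltcR. Qed.

Lemma nbhsP u (P : set H) :
  nbhs u P <-> exists2 e : R, 0 < e & forall v, n2 (u - v) < e -> P v.
Proof.
split=> [/nbhs_ballP[e /posC[r r0 ->]] sub|[e e0 sub]].
  exists (r ^+ 2); first by rewrite exprn_gt0.
  by move=> v h; apply: sub; rewrite -ball_normE /= norm_lt.
apply/nbhs_ballP; exists (Num.sqrt e)%:C; first by rewrite /= posC' ?sqrtr_gt0.
move=> v; rewrite -ball_normE /= norm_lt ?sqrtr_gt0 // sqr_sqrtr ?ltW //.
exact: sub.
Qed.

Lemma nbhs2P (p : H * H) (P : set (H * H)) :
  nbhs p P <-> exists2 e : R, 0 < e & forall a b,
    n2 (p.1 - a) < e -> n2 (p.2 - b) < e -> P (a, b).
Proof.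
split.
  case=> -[A B] /= [/nbhsP[e e0 eA] /nbhsP[f f0 fB]] sub.
  exists (Num.min e f); first by rewrite lt_min e0.
  move=> a b; rewrite !lt_min => /andP[h1 _] /andP[_ h2].
  by apply: sub; split; [exact: eA|exact: fB].
case=> e e0 sub; exists ([set a | n2 (p.1 - a) < e], [set b | n2 (p.2 - b) < e]).
  by split; apply/nbhsP; exists e.
by move=> [a b] /= [h1 h2]; apply: sub.
Qed.

Lemma closure2P (A : set (H * H)) p : closure A p <->
  forall e : R, 0 < e -> exists a b, [/\ A (a, b), n2 (p.1 - a) < e & n2 (p.2 - b) < e].
Proof.
split=> [cl e e0|h B /nbhs2P[e e0 sub]].
  have /cl[[a b] [Aab [h1 h2]]] :
      nbhs p [set q | n2 (p.1 - q.1) < e /\ n2 (p.2 - q.2) < e].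
    by apply/nbhs2P; exists e.
  by exists a, b.
by have [a [b [Aab h1 h2]]] := h _ e0; exists (a, b); split=> //; exact: sub.
Qed.

Lemma closed2P (A : set (H * H)) : closed A <-> forall p,
  (forall e : R, 0 < e -> exists a b, [/\ A (a, b), n2 (p.1 - a) < e & n2 (p.2 - b) < e]) ->
  A p.
Proof.
split=> [cl p h|h p cl]; first by apply: cl; apply/closure2P.
by apply: h; apply/closure2P.
Qed.

Lemma denseP (A : set H) : dense A <->
  forall u (e : R), 0 < e -> exists2 a, A a & n2 (u - a) < e.
Proof.
split=> [dA u e e0|h O [u Ou] oO].
  have [||a [/= aO Aa]] := dA (interior [set a | n2 (u - a) < e]).
  - by exists u; apply/nbhsP; exists e.
  - exact: open_interior.
  exists a => //; exact: (interior_subset aO).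
have /nbhsP[e e0 sub] : nbhs u O by apply: open_nbhs_nbhs.
by have [a Aa /sub Oa] := h u e e0; exists a.
Qed.

Lemma complete (x : nat -> H) :
  (forall e, 0 < e -> exists N, forall n m, (N <= n)%N -> (N <= m)%N -> n2 (x n - x m) < e) ->
  exists l, forall e, 0 < e -> exists N, forall n, (N <= n)%N -> n2 (x n - l) < e.
Proof.
move=> cx.
have : cauchy (x @ \oo).
  apply/cauchy_ballP => e /posC[r r0 ->].
  have [N hN] := cx (r ^+ 2) (exprn_gt0 _ r0).
  exists ([set y | exists2 n, (N <= n)%N & y = x n], [set y | exists2 n, (N <= n)%N & y = x n]).
    by split; exists N => //= n Nn; exists n.
  move=> [a b] /= [[n Nn ->] [m Nm ->]].
  by rewrite -ball_normE /= norm_lt //; exact: hN.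
move/cauchy_cvg => /cvg_ex[l xl]; exists l => e e0.
have /xl[N _ hN] : nbhs l [set y | n2 (y - l) < e].
  by apply/nbhsP; exists e => // v; rewrite n2Bc.
by exists N => n Nn; apply: hN.
Qed.

Lemma cvgP_n2 (x : nat -> H) l : x n @[n --> \oo] --> l <->
  forall e, 0 < e -> exists N, forall n, (N <= n)%N -> n2 (x n - l) < e.
Proof.
split=> [xl e e0|h].
  have /xl[N _ hN] : nbhs l [set y | n2 (y - l) < e].
    by apply/nbhsP; exists e => // v; rewrite n2Bc.
  by exists N => n Nn; apply: hN.
move=> P /nbhsP[e e0 sub]; have [N hN] := h e e0.
by exists N => // n Nn /=; apply: sub; rewrite n2Bc; apply: hN.
Qed.

End RealInner.

(** The first-variation argument behind Riesz and Cauchy-Schwarz; testing at [t = a / (b + 1)]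
    includes the case [b = 0]. *)
Lemma quad_lin0 (R : realType) (a b : R) : 0 <= b ->
  (forall t, 2 * t * a <= t ^+ 2 * b) -> a = 0.
Proof.
move=> b0 h; have := h (a / (b + 1)).
have b1 : 0 < b + 1 by lra.
rewrite exprMn exprVn -subr_ge0 => h1.
have := mulr_ge0 (ltW (exprn_gt0 2 b1)) h1.
have -> : (b + 1) ^+ 2 * (a ^+ 2 / (b + 1) ^+ 2 * b - 2 * (a / (b + 1)) * a) =
   - (a ^+ 2 * (b + 2)).
  by field; rewrite gt_eqF.
rewrite oppr_ge0 pmulr_lle0; last lra.
by move=> h2; apply/eqP; rewrite -sqrf_eq0 eq_le h2 sqr_ge0.
Qed.

Definition iv (R : realType) (n : nat) : R := n.+1%:R^-1.
Lemma iv_gt0 (R : realType) n : 0 < iv R n. Proof. by rewrite invr_gt0. Qed.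
Lemma inv_small (R : realType) (e : R) : 0 < e -> exists N : nat, forall n, (N <= n)%N -> iv R n < e.
Proof.
rewrite /iv; move=> e0; exists (Num.truncn e^-1) => n Nn.
rewrite invf_plt ?posrE ?ltr0n //.
apply: lt_le_trans (_ : (Num.truncn e^-1).+1%:R <= _); last by rewrite ler_nat.
by apply: truncnS_gt.
Qed.

(** * Riesz representation on closed real subspaces of pairs *)

Section Pairs.
Variables (R : realType) (H : hilbertSpace R).
Implicit Types (p q g h : H * H).

Definition ip2 p q : R := ip p.1 q.1 + ip p.2 q.2.
Definition rs2 (r : R) p : H * H := (rs r p.1, rs r p.2).

Lemma ip2C p q : ip2 p q = ip2 q p.
Proof. by rewrite /ip2 !(ipC p.1) !(ipC p.2). Qed.
Lemma ip2Dl p q g : ip2 (p + q) g = ip2 p g + ip2 q g.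
Proof. by rewrite /ip2 /= !ipDl; ring. Qed.
Lemma ip2Zl r p q : ip2 (rs2 r p) q = r * ip2 p q.
Proof. by rewrite /ip2 /= !ipZl; ring. Qed.
Lemma ip2Dr p q g : ip2 g (p + q) = ip2 g p + ip2 g q.
Proof. by rewrite ip2C ip2Dl !(ip2C _ g). Qed.
Lemma ip2Zr r p q : ip2 p (rs2 r q) = r * ip2 p q.
Proof. by rewrite ip2C ip2Zl ip2C. Qed.
Lemma ip2_ge0 p : 0 <= ip2 p p.
Proof. by rewrite addr_ge0 // n2_ge0. Qed.
Lemma ip2N p q : ip2 (- p) q = - ip2 p q.
Proof. by rewrite /ip2 /= !ipNl opprD. Qed.

(** Pairs rather than vectors: graphs of unbounded operators are direct instances, and subspaces of
    [H] are read off the first coordinate. *)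
Definition closed_rsub (G : set (H * H)) := [/\ G 0, forall p q, G p -> G q -> G (p + q),
  forall r p, G p -> G (rs2 r p) &
  forall p, (forall e : R, 0 < e -> exists2 q, G q & ip2 (p - q) (p - q) < e) -> G p].

(** The representing vector minimises [J p = |p|^2 - 2 phi p] over [G]: the parallelogram law makes
    minimising sequences Cauchy, and the first variation of [J] at the limit is the
    representation. *)
Lemma riesz_sub (G : set (H * H)) (phi : H * H -> R) (C : R) : closed_rsub G -> 0 <= C ->
  (forall p q, phi (p + q) = phi p + phi q) -> (forall r p, phi (rs2 r p) = r * phi p) ->
  (forall p, phi p ^+ 2 <= C * ip2 p p) ->
  exists2 g, G g & forall h, G h -> ip2 g h = phi h.
Proof.
move=> [G0 GD GZ Gc] C0 phiD phiZ phiC.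
pose J p : R := ip2 p p - 2 * phi p.
have JD t p h : J (p + rs2 t h) = J p + 2 * t * (ip2 p h - phi h) + t ^+ 2 * ip2 h h.
  by rewrite /J phiD phiZ ip2Dl !ip2Dr !ip2Zl !ip2Zr (ip2C h p); ring.
have Jlb p : - C <= J p.
  rewrite /J; have := phiC p; have := ip2_ge0 p.
  move: (ip2 p p) (phi p) => a b a0 h.
  have := sqr_ge0 (a - C); nra.
pose S := [set J p | p in G].
have hS : has_inf S by split; [exists (J 0), 0|exists (- C) => _ [p _ <-]].
pose d : R := inf S.
have dle p : G p -> d <= J p by move=> Gp; apply: ge_inf; [exact: hS.2|exists p].
have near n : exists q, G q /\ J q < d + iv R n.
  have e0 := iv_gt0 R n.
  by have [_ [q Gq <-] h] := inf_adherent e0 hS; exists q.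
have [x xP] := choice near.
have subD p q : p - q = p + rs2 (-1) q by rewrite /rs2 !rsN1; case: p q => [? ?] [? ?].
(* The midpoint of [p] and [q] stays in [G], so [J] there is at least the infimum [d]. *)
have parl p q : G p -> G q -> ip2 (p - q) (p - q) <= 2 * (J p - d) + 2 * (J q - d).
  move=> Gp Gq; have := dle _ (GZ (1/2) _ (GD _ _ Gp Gq)).
  have -> : J (rs2 (1/2) (p + q)) = (J p + J q) / 2 - ip2 (p - q) (p - q) / 4.
    rewrite /J subD phiZ phiD !(ip2Dl,ip2Dr,ip2Zl,ip2Zr) (ip2C q p); lra.
  lra.
have cau (e : R) : 0 < e -> exists N, forall n m, (N <= n)%N -> (N <= m)%N ->
   ip2 (x n - x m) (x n - x m) < e.
  move=> e0; have e4 : 0 < e / 4 by lra.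
  have [N hN] := inv_small e4; exists N => n m Nn Nm.
  have := parl _ _ (xP n).1 (xP m).1; have := (xP n).2; have := (xP m).2.
  have := hN _ Nn; have := hN _ Nm; lra.
have [g1 hg1] : exists l, forall e : R, 0 < e -> exists N, forall n, (N <= n)%N -> n2 ((x n).1 - l) < e.
  apply: complete => e /cau[N hN]; exists N => n m Nn Nm; have := hN n m Nn Nm.
  by rewrite /ip2 /= -!/(n2 _); have := n2_ge0 ((x n).2 - (x m).2); lra.
have [g2 hg2] : exists l, forall e : R, 0 < e -> exists N, forall n, (N <= n)%N -> n2 ((x n).2 - l) < e.
  apply: complete => e /cau[N hN]; exists N => n m Nn Nm; have := hN n m Nn Nm.
  by rewrite /ip2 /= -!/(n2 _); have := n2_ge0 ((x n).1 - (x m).1); lra.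
have cvg (e : R) : 0 < e -> exists N, forall n, (N <= n)%N -> ip2 (x n - (g1, g2)) (x n - (g1, g2)) < e.
  move=> e0; have e2 : 0 < e / 2 by lra.
  have [N1 h1] := hg1 _ e2; have [N2 h2] := hg2 _ e2; exists (maxn N1 N2) => n.
  rewrite geq_max => /andP[/h1 a /h2 b]; rewrite /ip2 /= -!/(n2 _); lra.
exists (g1, g2).
  apply: Gc => e /cvg[N hN]; exists (x N); first exact: (xP N).1.
  by have := hN N (leqnn _); rewrite -[X in ip2 X _]opprB -[X in ip2 _ X]opprB ip2N ip2C ip2N opprK.
move=> h Gh; apply/eqP; rewrite -subr_eq0; apply/eqP.
(* The variation is taken at [x n] instead of the limit; the factor 2 pays for the cross term
   between [h] and the error [p]. *)
apply: (@quad_lin0 _ _ (2 * ip2 h h)); first by rewrite mulr_ge0 ?ip2_ge0.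
move=> t; apply/ler_addgt0Pr => e e0.
have e2 : 0 < e / 2 by lra.
have [N1 h1] := cvg _ e2; have [N2 h2] := inv_small e2.
pose n := maxn N1 N2; have := h1 n (leq_maxl _ _); have := h2 n (leq_maxr _ _).
set p := x n - (g1, g2) => l2 l1.
have xE : x n = p + (g1, g2) by rewrite /p subrK.
have := dle _ (GD _ _ (xP n).1 (GZ (- t) _ Gh)); rewrite JD; have := (xP n).2.
rewrite xE; clearbody p.
have := ip2_ge0 (p + rs2 t h).
rewrite ip2Dl !ip2Dr !ip2Zl !ip2Zr (ip2Dl p _ h) sqrrN. rewrite (ip2C h p).
nra.
Qed.
End Pairs.

(** * Bounded operators *)

Section Bop.
Variables (R : realType) (H : hilbertSpace R).

(** Bounded operators carried as functions with proofs: proof irrelevance makes them extensional, so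
    they form a ring. The bound is on squared norms. *)
Record bop := Bop {
  bf :> H -> H ;
  bf_lin : forall (c : R[i]) u v, bf (c *: u + v) = c *: bf u + bf v ;
  bf_bd : exists C : R, forall u, n2 (bf u) <= C * n2 u }.

Lemma bop_ext (a b : bop) : (forall u, a u = b u) -> a = b.
Proof.
case: a b => [f fl fb] [g gl gb] /= /funext e; subst g.
by rewrite (Prop_irrelevance fl gl) (Prop_irrelevance fb gb).
Qed.

HB.instance Definition _ := gen_eqMixin bop.
HB.instance Definition _ := gen_choiceMixin bop.

Lemma bd_pos (a : bop) : exists2 C : R, 0 < C & forall u, n2 (a u) <= C * n2 u.
Proof.
have [C h] := bf_bd a; exists (`|C| + 1) => [|u]; first by have := normr_ge0 C; lra.
apply: le_trans (h u) _; rewrite ler_wpM2r ?n2_ge0 //.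
by have := ler_norm C; lra.
Qed.

Fact badd_lin (a b : bop) (c : R[i]) u v :
  a (c *: u + v) + b (c *: u + v) = c *: (a u + b u) + (a v + b v).
Proof. by rewrite !bf_lin scalerDr addrACA. Qed.
Fact badd_bd (a b : bop) : exists C : R, forall u, n2 (a u + b u) <= C * n2 u.
Proof.
have [C _ hC] := bd_pos a; have [D _ hD] := bd_pos b.
exists (2 * C + 2 * D) => u; apply: le_trans (n2D_le _ _) _.
by have := hC u; have := hD u; lra.
Qed.
Definition badd a b := Bop (badd_lin a b) (badd_bd a b).

Fact bopp_lin (a : bop) (c : R[i]) u v : - a (c *: u + v) = c *: - a u + - a v.
Proof. by rewrite bf_lin opprD scalerN. Qed.
Fact bopp_bd (a : bop) : exists C : R, forall u, n2 (- a u) <= C * n2 u.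
Proof. by have [C _ hC] := bd_pos a; exists C => u; rewrite n2N. Qed.
Definition bopp a := Bop (bopp_lin a) (bopp_bd a).

Fact bzero_lin (c : R[i]) (u v : H) : 0 = c *: 0 + 0 :> H.
Proof. by rewrite scaler0 addr0. Qed.
Fact bzero_bd : exists C : R, forall u : H, n2 (0 : H) <= C * n2 u.
Proof. by exists 0 => u; rewrite n20 mul0r. Qed.
Definition bzero := @Bop (fun=> 0) bzero_lin bzero_bd.

Fact bone_bd : exists C : R, forall u : H, n2 u <= C * n2 u.
Proof. by exists 1 => u; rewrite mul1r. Qed.
Definition bone := @Bop id (fun _ _ _ => erefl) bone_bd.

Fact bmul_lin (a b : bop) (c : R[i]) u v :
  a (b (c *: u + v)) = c *: a (b u) + a (b v).
Proof. by rewrite !bf_lin. Qed.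
Fact bmul_bd (a b : bop) : exists C : R, forall u, n2 (a (b u)) <= C * n2 u.
Proof.
have [C C0 hC] := bd_pos a; have [D _ hD] := bd_pos b.
exists (C * D) => u; apply: le_trans (hC _) _.
by rewrite -mulrA ler_wpM2l // ltW.
Qed.
Definition bmul a b := Bop (bmul_lin a b) (bmul_bd a b).

Lemma bf0 (a : bop) : a 0 = 0.
Proof. by have := bf_lin a (-1) 0 0; rewrite scaler0 addr0 scaleN1r addNr. Qed.
Lemma bfD (a : bop) u v : a (u + v) = a u + a v.
Proof. by have := bf_lin a 1 u v; rewrite !scale1r. Qed.
Lemma bfZ (a : bop) (c : R[i]) u : a (c *: u) = c *: a u.
Proof. by have := bf_lin a c u 0; rewrite !addr0 bf0 addr0. Qed.
Lemma bfN (a : bop) u : a (- u) = - a u.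
Proof. by rewrite -scaleN1r bfZ scaleN1r. Qed.
Lemma bfB (a : bop) u v : a (u - v) = a u - a v.
Proof. by rewrite bfD bfN. Qed.
Lemma bfi (a : bop) u : a (im u) = im (a u). Proof. exact: bfZ. Qed.
Lemma bfr (a : bop) r u : a (rs r u) = rs r (a u). Proof. exact: bfZ. Qed.

Fact baddA : associative badd.
Proof. by move=> a b c; apply: bop_ext => u /=; rewrite addrA. Qed.
Fact baddC : commutative badd.
Proof. by move=> a b; apply: bop_ext => u /=; rewrite addrC. Qed.
Fact badd0 : left_id bzero badd.
Proof. by move=> a; apply: bop_ext => u /=; rewrite add0r. Qed.
Fact baddN : left_inverse bzero bopp badd.
Proof. by move=> a; apply: bop_ext => u /=; rewrite addNr. Qed.
HB.instance Definition _ := GRing.isZmodule.Build bop baddA baddC badd0 baddN.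
Fact bmulA : associative bmul. Proof. by move=> a b c; apply: bop_ext. Qed.
Fact bmul1l : left_id bone bmul. Proof. by move=> a; apply: bop_ext. Qed.
Fact bmul1r : right_id bone bmul. Proof. by move=> a; apply: bop_ext. Qed.
Fact bmulDl : left_distributive bmul badd. Proof. by move=> a b c; apply: bop_ext. Qed.
Fact bmulDr : right_distributive bmul badd.
Proof. by move=> a b c; apply: bop_ext => u /=; rewrite bfD. Qed.
HB.instance Definition _ :=
  GRing.Zmodule_isPzRing.Build bop bmulA bmul1l bmul1r bmulDl bmulDr.

Implicit Types (a b : bop) (u v w : H).

Lemma bD a b u : (a + b) u = a u + b u. Proof. by []. Qed.
Lemma bN a u : (- a) u = - a u. Proof. by []. Qed.
Lemma bB a b u : (a - b) u = a u - b u. Proof. by []. Qed.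
Lemma bM a b u : (a * b) u = a (b u). Proof. by []. Qed.
Lemma b1 u : (1 : bop) u = u. Proof. by []. Qed.
Lemma b0 u : (0 : bop) u = 0. Proof. by []. Qed.
Definition bE := (bD, bB, bN, bM, b1, b0).

Fact bsc_lin (s : R[i]) (c : R[i]) u v : s *: (c *: u + v) = c *: (s *: u) + s *: v.
Proof. by rewrite scalerDr !scalerA mulrC. Qed.
Fact bsc_bd (s : R[i]) : exists C : R, forall u, n2 (s *: u) <= C * n2 u.
Proof. by eexists => u; rewrite n2_scale. Qed.
Definition bsc s : bop := Bop (bsc_lin s) (bsc_bd s).
Lemma bscE s u : bsc s u = s *: u. Proof. by []. Qed.
Lemma bscC s a : bsc s * a = a * bsc s.
Proof. by apply: bop_ext => u; rewrite !bE /= bfZ. Qed.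

(** [C] bounds the square of the operator norm; thus [nle a 1] is contractivity, and the constants
    of products multiply. *)
Definition nle a (C : R) := forall u, n2 (a u) <= C * n2 u.
Lemma nleP a : exists2 C : R, 0 < C & nle a C. Proof. exact: bd_pos. Qed.
Lemma nle_mono a (C D : R) : C <= D -> nle a C -> nle a D.
Proof. by move=> CD h u; apply: le_trans (h u) _; rewrite ler_wpM2r ?n2_ge0. Qed.
Lemma nleM a b (C D : R) : 0 <= C -> nle a C -> nle b D -> nle (a * b) (C * D).
Proof. by move=> C0 h k u; apply: le_trans (h _) _; rewrite -mulrA ler_wpM2l. Qed.
Lemma nle1 : nle 1 1. Proof. by move=> u; rewrite mul1r. Qed.

(** Complex orthogonal complements of sets of vectors and of pairs; biorthogonals
    play the role of closed linear spans. *)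
Definition oc (S : set H) : set H := [set v | forall u, S u -> ip u v = 0 /\ ip (im u) v = 0].
Definition im2 (p : H * H) : H * H := (im p.1, im p.2).
Definition perp (S : set (H * H)) : set (H * H) :=
  [set q | forall p, S p -> ip2 p q = 0 /\ ip2 (im2 p) q = 0].

Lemma perp_closed S : closed_rsub (perp S).
Proof.
split.
- by move=> p _; rewrite /ip2 /= !ip0r addr0.
- by move=> p q hp hq s Ss; have [a b] := hp _ Ss; have [c d] := hq _ Ss; rewrite !ip2Dr a b c d addr0.
- by move=> r p hp s Ss; have [a b] := hp _ Ss; rewrite !ip2Zr a b mulr0.
move=> p h s Ss.
suff gen t : (forall q, perp S q -> ip2 t q = 0) -> ip2 t p = 0.
  by split; apply: gen => q /(_ _ Ss)[].
move=> tq; apply: (@quad_lin0 _ _ (ip2 t t)); first exact: ip2_ge0.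
move=> r; apply/ler_addgt0Pr => e e0; have [q Sq l] := h e e0.
have := ip2_ge0 (p - q + rs2 (- r) t).
have tpq : ip2 t (p - q) = ip2 t p by rewrite ip2C ip2Dl ip2N !(ip2C _ t) (tq q) // subr0.
move: tpq l; move: (p - q) => d tpq l.
rewrite ip2Dl !ip2Dr !ip2Zl !ip2Zr (ip2C d t) tpq; lra.
Qed.

Lemma perp_sub S S' : S `<=` S' -> perp S' `<=` perp S.
Proof. by move=> SS p h q /SS /h. Qed.

Lemma perp_i S p : perp S p -> perp S (im2 p).
Proof.
move=> h q Sq; have [h1 h2] := h q Sq; split.
- by move: h2; rewrite /ip2 /= !ip_iml; lra.
- by rewrite /ip2 /= !ip_im.
Qed.

Lemma perp2 S : S `<=` perp (perp S).
Proof.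
move=> p Sp q hq; have [h1 h2] := hq p Sp; split; first by rewrite ip2C.
by rewrite ip2C; move: h2; rewrite /ip2 /= !ip_iml; lra.
Qed.

Lemma perp3 S : perp (perp (perp S)) = perp S.
Proof. by apply/seteqP; split; [exact/perp_sub/perp2|exact: perp2]. Qed.

(** Riesz for the functional [ip2 p] on the biorthogonal. The biorthogonal is stable under i, so
    real orthogonality to it is complex orthogonality. *)
Lemma projS S p : exists2 g, perp (perp S) g & perp S (p - g).
Proof.
have [|||g Gg hg] := @riesz_sub _ _ (perp (perp S)) (ip2 p) (ip2 p p) (perp_closed _) (ip2_ge0 p).
- by move=> *; rewrite ip2Dr.
- by move=> *; rewrite ip2Zr.
- move=> q; have := ip2_ge0 (rs2 (ip2 q q) p + rs2 (- ip2 p q) q).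
  rewrite !(ip2Dl, ip2Dr, ip2Zl, ip2Zr) (ip2C q p) => h.
  have [q0|q0] := eqVneq (ip2 q q) 0.
    move: h; rewrite q0 => h; have : ip2 p q = 0; last by move->; rewrite expr0n mulr0.
    apply: (@quad_lin0 _ _ (ip2 p p)) => [|t]; first exact: ip2_ge0.
    have := ip2_ge0 (rs2 t p + rs2 (-1) q).
    rewrite !(ip2Dl, ip2Dr, ip2Zl, ip2Zr) (ip2C q p) q0; lra.
  have {}q0 : 0 < ip2 q q by rewrite lt_neqAle eq_sym q0 ip2_ge0.
  by rewrite -subr_ge0 -(pmulr_rge0 _ q0); move: h; congr (_ <= _); ring.
exists g => //; rewrite -perp3 => h Gh; split.
  by rewrite ip2C ip2Dl ip2N hg // subrr.
by rewrite ip2C ip2Dl ip2N hg ?subrr //; exact: perp_i.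
Qed.

Lemma oc_perp S v w : perp [set (s, 0) | s in S] (v, w) <-> oc S v.
Proof.
split=> h.
  by move=> u Su; have [|] := h (u, 0); [exists u|rewrite /ip2 /= ip0l addr0 /im scaler0 ip0l addr0].
by move=> _ [u Su <-]; have [a b] := h u Su; rewrite /ip2 /= /im scaler0 !ip0l !addr0.
Qed.

Lemma projH S u : exists2 g, oc (oc S) g & oc S (u - g).
Proof.
have [[g1 g2] h1 h2] := projS [set (s, 0) | s in S] (u, 0); exists g1.
  move=> v hv; have [|] := h1 (v, 0); first by apply/oc_perp.
  by rewrite /ip2 /= ip0l addr0 /im scaler0 ip0l addr0.
by move: h2 => /oc_perp.
Qed.

Lemma oc0 S : oc S 0. Proof. by move=> u _; rewrite !ip0r. Qed.
Lemma ocD S u v : oc S u -> oc S v -> oc S (u + v).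
Proof. by move=> hu hv s Ss; have [a b] := hu s Ss; have [c d] := hv s Ss; rewrite !ipDr a b c d addr0. Qed.
Lemma oci S u : oc S u -> oc S (im u).
Proof. by move=> h s Ss; have [a b] := h s Ss; rewrite ip_im a; split=> //; move: b; rewrite ip_iml; lra. Qed.
Lemma ocZ S (c : R[i]) u : oc S u -> oc S (c *: u).
Proof.
move=> h; have r s x : oc S x -> oc S (rs s x).
  by move=> hx y Sy; have [a b] := hx y Sy; rewrite !ipZr a b mulr0.
by rewrite scaleE; apply: ocD; [apply: r|apply: oci; apply: r].
Qed.
Lemma ocN S u : oc S u -> oc S (- u).
Proof. by rewrite -scaleN1r; exact: ocZ. Qed.
Lemma ocB S u v : oc S u -> oc S v -> oc S (u - v).
Proof. by move=> hu hv; apply: ocD => //; exact: ocN. Qed.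
Lemma oc_sub S S' : S `<=` S' -> oc S' `<=` oc S.
Proof. by move=> SS p h q /SS /h. Qed.
Lemma oc2 S : S `<=` oc (oc S).
Proof.
move=> u Su v hv; have [h1 h2] := hv u Su; rewrite ipC; split=> //.
by move: h2; rewrite ip_iml (ipC (im v)); lra.
Qed.
Lemma oc_triv S u : oc S u -> oc (oc S) u -> u = 0.
Proof. by move=> h1 h2; have [h _] := h2 _ h1; exact: n2_eq0. Qed.
Lemma oc_uniq S u g g' : oc (oc S) g -> oc S (u - g) -> oc (oc S) g' -> oc S (u - g') -> g = g'.
Proof.
move=> h1 h2 h3 h4; apply/eqP; rewrite -subr_eq0; apply/eqP.
apply: (@oc_triv S); last exact: ocB.
have -> : g - g' = (u - g') - (u - g) by rewrite opprB [RHS]addrC addrA subrK.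
exact: ocB.
Qed.

Definition prj_fun S u : H := projT1 (cid2 (projH S u)).
Fact prj_in_ S u : oc (oc S) (prj_fun S u). Proof. by rewrite /prj_fun; case: cid2. Qed.
Fact prj_oc_ S u : oc S (u - prj_fun S u). Proof. by rewrite /prj_fun; case: cid2. Qed.
Fact prj_lin S (c : R[i]) u v : prj_fun S (c *: u + v) = c *: prj_fun S u + prj_fun S v.
Proof.
apply: (@oc_uniq S (c *: u + v)); [exact: prj_in_|exact: prj_oc_| |].
  by apply: ocD; [apply: ocZ|]; exact: prj_in_.
rewrite opprD addrACA -scalerBr; apply: ocD; [apply: ocZ|]; exact: prj_oc_.
Qed.
Fact prj_bd_ S u : n2 (prj_fun S u) <= 1 * n2 u.
Proof.
rewrite mul1r; have [h _] := @prj_in_ S u _ (@prj_oc_ S u).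
have -> : n2 u = n2 (u - prj_fun S u + prj_fun S u) by rewrite subrK.
by rewrite n2D h; have := n2_ge0 (u - prj_fun S u); lra.
Qed.
Fact prj_bd S : exists C : R, forall u, n2 (prj_fun S u) <= C * n2 u.
Proof. by exists 1; exact: prj_bd_. Qed.
(** The orthogonal projection onto the closed complex span of an arbitrary set of vectors. *)
Definition prj S : bop := Bop (prj_lin S) (prj_bd S).
Lemma prj_in S u : oc (oc S) (prj S u). Proof. exact: prj_in_. Qed.
Lemma prj_oc S u : oc S (u - prj S u). Proof. exact: prj_oc_. Qed.
Lemma prj_id S u : oc (oc S) u -> prj S u = u.
Proof. by move=> h; apply: (@oc_uniq S u) => //; [exact: prj_in|exact: prj_oc|rewrite subrr; exact: oc0]. Qed.
Lemma prj_S S u : S u -> prj S u = u. Proof. by move=> /oc2 /prj_id. Qed.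
Lemma prj_0 S u : oc S u -> prj S u = 0.
Proof. by move=> h; apply: (@oc_uniq S u) => //; [exact: prj_in|exact: prj_oc|exact: oc0|rewrite subr0]. Qed.
Lemma prj_0P S u : prj S u = 0 -> oc S u.
Proof. by move=> h; have := @prj_oc S u; rewrite h subr0. Qed.

Lemma nle_prj S : nle (prj S) 1. Proof. exact: prj_bd_. Qed.

Lemma riesz (phi : H -> R) (C : R) : 0 <= C -> (forall u v, phi (u + v) = phi u + phi v) ->
  (forall r u, phi (rs r u) = r * phi u) -> (forall u, phi u ^+ 2 <= C * n2 u) ->
  exists v, forall u, ip v u = phi u.
Proof.
move=> C0 hD hZ hb.
have [||||g _ hg] := @riesz_sub _ _ [set: H * H] (fun p => phi p.1) C _ C0.
- by [].
- by move=> p q; exact: hD.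
- by move=> r p; exact: hZ.
- move=> p; apply: le_trans (hb _) _; rewrite ler_wpM2l // /ip2 -!/(n2 _).
  by have := n2_ge0 p.2; lra.
by exists g.1 => u; rewrite -(hg (u, 0)) // /ip2 /= ip0r addr0.
Qed.

(** Riesz turns a bounded real bilinear form into a real-linear operator; invariance under the
    simultaneous action of [im] on both arguments is what makes this operator complex linear. *)
Lemma form_op (f : H -> H -> R) (C : R) : 0 <= C ->
  (forall u v w, f (u + v) w = f u w + f v w) -> (forall u v w, f w (u + v) = f w u + f w v) ->
  (forall r u v, f (rs r u) v = r * f u v) -> (forall r u v, f u (rs r v) = r * f u v) ->
  (forall u v, f (im u) (im v) = f u v) ->
  (forall u v, f u v ^+ 2 <= C * n2 u * n2 v) ->
  exists2 a : bop, nle a C & forall u v, ip (a u) v = f u v.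
Proof.
move=> C0 hDl hDr hZl hZr hi hb.
have ex u : exists x, forall v, ip x v = f u v.
  apply: (@riesz _ (C * n2 u)) => //; first by rewrite mulr_ge0 ?n2_ge0.
have [g hg] := choice ex.
have gD u v : g (u + v) = g u + g v by apply: ip_ext => w; rewrite ipDl !hg hDl.
have gr r u : g (rs r u) = rs r (g u) by apply: ip_ext => w; rewrite ipZl !hg hZl.
have gi u : g (im u) = im (g u).
  apply: ip_ext => w; rewrite ip_iml !hg.
  have := hi u (- im w); have -> : im (- im w) = w by rewrite imN imim opprK.
  by rewrite -rsN1 hZr => ->; lra.
have lin (c : R[i]) u v : g (c *: u + v) = c *: g u + g v.
  by rewrite gD !scaleE gD gi !gr.
have bd u : n2 (g u) <= C * n2 u.
  have := hb u (g u); rewrite -hg -/(n2 _).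
  have [->|n0] := eqVneq (n2 (g u)) 0; first by rewrite mulr_ge0 ?n2_ge0.
  have {}n0 : 0 < n2 (g u) by rewrite lt_neqAle eq_sym n0 n2_ge0.
  by rewrite expr2 ler_pM2r.
by exists (Bop lin (ex_intro _ C bd)).
Qed.

Lemma adj_ex a : exists b, forall u v, ip (a u) v = ip u (b v).
Proof.
have [C C0 hC] := nleP a.
have [||||||b _ hb] := @form_op (fun u v => ip u (a v)) C (ltW C0).
- by move=> *; rewrite ipDl.
- by move=> *; rewrite bfD ipDr.
- by move=> *; rewrite ipZl.
- by move=> *; rewrite bfr ipZr.
- by move=> *; rewrite bfi ip_im.
- move=> u v; apply: le_trans (CS _ _) _; rewrite (mulrC C) -mulrA ler_wpM2l ?n2_ge0 //.
by exists b => u v; rewrite ipC -hb ipC.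
Qed.

Definition star a := projT1 (cid (adj_ex a)).
Lemma ip_star a u v : ip (a u) v = ip u (star a v).
Proof. by rewrite /star; case: cid. Qed.
Lemma ip_starl a u v : ip (star a u) v = ip u (a v).
Proof. by rewrite ipC -ip_star ipC. Qed.
Lemma star_uniq a b : (forall u v, ip (a u) v = ip u (b v)) -> b = star a.
Proof. by move=> h; apply: bop_ext => u; apply: ip_ext => v; rewrite ipC -h ip_starl ipC. Qed.
Lemma starK a : star (star a) = a.
Proof. by apply/esym/star_uniq => u v; rewrite ip_starl. Qed.
Lemma starM a b : star (a * b) = star b * star a.
Proof. by apply/esym/star_uniq => u v; rewrite !bE !ip_star. Qed.
Lemma starD a b : star (a + b) = star a + star b.
Proof. by apply/esym/star_uniq => u v; rewrite !bE ipDl ipDr !ip_star. Qed.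
Lemma starN a : star (- a) = - star a.
Proof. by apply/esym/star_uniq => u v; rewrite !bE ipNl ipNr !ip_star. Qed.
Lemma starB a b : star (a - b) = star a - star b.
Proof. by rewrite starD starN. Qed.
Lemma star1 : star 1 = 1. Proof. by apply/esym/star_uniq. Qed.
Lemma star0 : star 0 = 0. Proof. by apply/esym/star_uniq => u v; rewrite !b0 ip0l ip0r. Qed.
Lemma star_inj a b : star a = star b -> a = b.
Proof. by move=> h; rewrite -(starK a) h starK. Qed.
Lemma nle_star a (C : R) : 0 <= C -> nle a C -> nle (star a) C.
Proof.
move=> C0 h u; have := CS (a (star a u)) u; rewrite ip_star -/(n2 _).
have := h (star a u); have := n2_ge0 u; have := n2_ge0 (star a u).
set x := n2 (star a u); set z := n2 (a _) => x0 y0 h2 h1.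
have [->|n0] := eqVneq x 0; first by rewrite mulr_ge0.
have {}n0 : 0 < x by rewrite lt_neqAle eq_sym n0 x0.
rewrite -(ler_pM2r n0); nra.
Qed.
Lemma sc_star (s : R[i]) : star (bsc s) = bsc (conjc s).
Proof.
apply/esym/star_uniq => u v; rewrite !bscE !scaleE; case: s => x y /=.
by rewrite ipDl ipDr ip_iml -!rs_im !ipZl !ipZr; lra.
Qed.

End Bop.
Arguments prj {R H} S : simpl never.
Arguments star {R H} a : simpl never.
Arguments bsc {R H} s : simpl never.

(** * Ultrafilter limits and weak limits of bounded operators *)

Lemma uq_lim (R : realType) (I : Type) (U : set_system I) (g : I -> R) (l l' : R) :
  ProperFilter U -> g i @[i --> U] --> l -> g i @[i --> U] --> l' -> l = l'.
Proof. by move=> FU h1 h2; apply: (@cvg_unique R (@Rhausdorff R) _ _ _ _ h1 h2). Qed.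

Section Ulim.
Variables (R : realType) (I : Type) (U : set_system I).
Hypothesis UU : UltraFilter U.

Lemma ultra_fmap (T : Type) (f : I -> T) : UltraFilter (f @ U).
Proof.
have FU := @ultra_proper _ _ UU.
split=> [|G GP sub]; first exact: fmap_proper_filter.
apply/seteqP; split=> [A GA|]; last exact: sub.
have [//|h] := in_ultra_setVsetC (f @^-1` A) UU.
have : G (~` A) by apply: sub.
by move=> /(filterI GA); rewrite setICr => /filter_not_empty.
Qed.

Lemma ucvg (f : I -> R) (M : R) : (forall i, `|f i| <= M) -> exists l : R, f i @[i --> U] --> l.
Proof.
move=> fM; have := @segment_compact R (- M) M; rewrite compact_ultra => /(_ (f @ U) (ultra_fmap f)).
case=> [|l [_ h]]; last by exists l.
have FU := @ultra_proper _ _ UU.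
suff : U (f @^-1` `[- M, M]%classic) by [].
apply: filterS (@filterT _ U _) => i _ /=.
by have := fM i; rewrite in_itv /= ler_norml.
Qed.
End Ulim.

Section Wlim.
Variables (R : realType) (H : hilbertSpace R).
Implicit Types (a b : bop H) (u v w : H).

(** Weak compactness of balls: the ultrafilter selects a limit of every matrix coefficient, and
    these limits constitute a bounded form to which [form_op] applies. *)
Lemma wlim (I : Type) (U : set_system I) (A : I -> bop H) (C : R) : UltraFilter U ->
  0 <= C -> (forall i, nle (A i) C) ->
  exists2 B : bop H, nle B C & forall u v, ip (A i u) v @[i --> U] --> ip (B u) v.
Proof.
move=> UU C0 hA.
have FU := @ultra_proper _ _ UU.
have bd i u v : ip (A i u) v ^+ 2 <= C * n2 u * n2 v.
  by apply: le_trans (CS _ _) _; rewrite ler_wpM2r ?n2_ge0 //; exact: hA.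
have ex (p : H * H) : exists l : R, ip (A i p.1) p.2 @[i --> U] --> l.
  apply: (@ucvg _ _ _ UU _ (C * n2 p.1 * n2 p.2 + 1)) => i.
  have := bd i p.1 p.2; move: (C * _ * _) => x h; rewrite ler_norml; apply/andP; split; nra.
have [f hf] := choice ex.
have [||||||B hB1 hB] := @form_op R H (fun u v => f (u, v)) C C0.
- move=> u v w; apply: (uq_lim FU (hf _)) => /=.
  under eq_fun do rewrite bfD ipDl; apply: cvgD; exact: hf.
- move=> u v w; apply: (uq_lim FU (hf _)) => /=.
  under eq_fun do rewrite ipDr; apply: cvgD; exact: hf.
- move=> r u v; apply: (uq_lim FU (hf _)) => /=.
  under eq_fun do rewrite bfr ipZl; apply: cvgM; [exact: cvg_cst|exact: hf].
- move=> r u v; apply: (uq_lim FU (hf _)) => /=.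
  under eq_fun do rewrite ipZr; apply: cvgM; [exact: cvg_cst|exact: hf].
- move=> u v; apply: (uq_lim FU (hf _)) => /=.
  under eq_fun do rewrite bfi ip_im; exact: hf.
- move=> u v; apply: (@cvgr_to_le _ U _ _ (fun i => ip (A i u) v ^+ 2)).
    rewrite expr2; under eq_fun do rewrite expr2; apply: cvgM; exact: hf.
  exact: nearW.
by exists B => // u v; rewrite hB; exact: (hf (u, v)).
Qed.

Lemma wlim_comm (I : Type) (U : set_system I) (A : I -> bop H) (B y : bop H) : UltraFilter U ->
  (forall u v, ip (A i u) v @[i --> U] --> ip (B u) v) ->
  (forall i, A i * y = y * A i) -> B * y = y * B.
Proof.
move=> UU h c; have FU := @ultra_proper _ _ UU.
apply: bop_ext => u; apply: ip_ext => v; rewrite !bE [RHS]ip_star.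
apply: (uq_lim FU (h (y u) v)).
have -> : (fun i => ip (A i (y u)) v) = (fun i => ip (A i u) (star y v)).
  by apply/funext => i; rewrite -ip_star -!bM c.
exact: h.
Qed.

(** A family of pairs stable under the commutant determines an operator that commutes with the
    commutant, hence an element of the algebra. *)
Definition stable (S : set (H * H)) (y : bop H) := forall p, S p -> S (y p.1, y p.2).

Lemma perp_stable S y : stable S (star y) -> stable (perp S) y.
Proof.
move=> h q hq p Sp; have [a b] := hq _ (h _ Sp); split.
  by move: a; rewrite /ip2 /= !ip_starl.
by move: b; rewrite /ip2 /= -!bfi !ip_starl.
Qed.

Lemma bistable S y : stable S y -> stable (perp (perp S)) y.
Proof. by move=> h; apply/perp_stable/perp_stable; rewrite starK. Qed.

Definition stable1 (S : set H) (y : bop H) := forall u, S u -> S (y u).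

Lemma oc_stable S y : stable1 S (star y) -> stable1 (oc S) y.
Proof.
move=> h q hq p Sp; have [a b] := hq _ (h _ Sp); split; first by rewrite -ip_starl.
by rewrite -ip_starl bfi.
Qed.

Lemma prj_comm (S : set H) y : stable1 S y -> stable1 S (star y) -> prj S * y = y * prj S.
Proof.
move=> h k; apply: bop_ext => u; rewrite !bE.
apply: (@oc_uniq _ _ S (y u)); [exact: prj_in|exact: prj_oc| |].
  by apply: oc_stable (@prj_in _ _ S u); apply: oc_stable; rewrite starK.
by rewrite -bfB; apply: oc_stable => //; exact: prj_oc.
Qed.

Lemma prj_idem (S : set H) : prj S * prj S = prj S.
Proof. by apply: bop_ext => u; rewrite bM prj_id //; exact: prj_in. Qed.

Lemma prj_star (S : set H) : star (prj S) = prj S.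
Proof.
apply/esym/star_uniq => u v.
have [h1 _] := @prj_in _ _ S u _ (@prj_oc _ _ S v).
have [h2 _] := @prj_in _ _ S v _ (@prj_oc _ _ S u).
by move: h1 h2; rewrite !ipBl (ipC (prj S u) v) (ipC (prj S u) (prj S v)); lra.
Qed.

(** Equality of complex Gram matrices, the condition under which [p.1 -> p.2] extends to an isometry
    between closed spans. *)
Definition gram (S : set (H * H)) := forall p q, S p -> S q ->
  ip p.1 q.1 = ip p.2 q.2 /\ ip (im p.1) q.1 = ip (im p.2) q.2.
Definition domS (S : set (H * H)) : set H := [set p.1 | p in S].
Definition ranS (S : set (H * H)) : set H := [set p.2 | p in S].

(** Equality of the Gram entries against [q] says that [(q.1, - q.2)] is orthogonal to [S], hence to
    the closed span of [S]; using this in one variable after the other extends the identity. *)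
Lemma gramG S p q : gram S -> perp (perp S) p -> perp (perp S) q -> ip p.1 q.1 = ip p.2 q.2.
Proof.
move=> gS; have aux q' : perp (perp S) q' -> (forall p', S p' -> ip p'.1 q'.1 = ip p'.2 q'.2 /\
    ip (im p'.1) q'.1 = ip (im p'.2) q'.2) ->
    forall p', perp (perp S) p' -> ip p'.1 q'.1 = ip p'.2 q'.2.
  move=> _ h p' hp'; have [|e _] := hp' (q'.1, - q'.2).
    by move=> s /h[e1 e2]; rewrite /ip2 /= !ipNr e1 e2 !subrr.
  by move: e; rewrite /ip2 /= ipNl (ipC q'.1) (ipC q'.2); lra.
move=> hp hq; apply: (aux q) => // s Ss; split.
  rewrite ipC (ipC s.2); apply: (aux s) => //; [exact: perp2|] => r Sr; exact: gS.
rewrite ipC (ipC (im s.2)); have : perp (perp S) (im2 s) by apply/perp_i/perp2.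
move=> h; apply: (aux (im2 s)) => //= r Sr; rewrite !ip_im.
have [e1 e2] := gS _ _ Sr Ss; split=> //.
by move: e2; rewrite !ip_iml; lra.
Qed.

Lemma partial_isometry S : gram S -> exists v : bop H,
  [/\ forall p, S p -> v p.1 = p.2, star v * v = prj (domS S), v * star v = prj (ranS S) &
      forall y : bop H, stable S y -> stable S (star y) -> v * y = y * v].
Proof.
move=> gS; set G := perp (perp S); set P := prj (domS S).
have GS p : S p -> G p by exact: perp2.
have iso p q : G p -> G q -> ip p.1 q.1 = ip p.2 q.2 := gramG gS.
have [G0 GD GZ _] : closed_rsub G := perp_closed _.
(* The projection of [(w, 0)] onto the graph of an isometry [v] is half of [(P w, v (P w))];
   doubling it gives a point of [G] above [P w]. *)
have ex w : exists t, G (P w, t).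
  have [[g h] Gg hh] := projS S (w, 0).
  have -> : P w = rs 2 g; last by exists (rs 2 h); exact: (GZ 2 _ Gg).
  apply: (@oc_uniq _ _ (domS S) w); [exact: prj_in|exact: prj_oc| |].
    move=> x hx; have [|e1 e2] := Gg (x, 0).
      by move=> p Sp; rewrite /ip2 /= !ip0r !addr0; apply: hx; exists p.
    by move: e1 e2; rewrite /ip2 /= /im scaler0 !ip0l !addr0 -/(im _) !ipZr => -> ->; rewrite mulr0.
  move=> _ [p Sp <-]; have [e1 e2] := hh p Sp.
  have i1 := iso _ _ (GS _ Sp) Gg; have i2 := iso _ _ (perp_i (GS _ Sp)) Gg.
  by move: e1 e2 i1 i2; rewrite /ip2 /= !ipBr !ipZr !ip0r; split; lra.
have [f fP] := choice ex.
have Guq g h h' : G (g, h) -> G (g, h') -> h = h'.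
  move=> g1 g2; apply/eqP; rewrite -subr_eq0; apply/eqP/n2_eq0.
  have := GD _ _ g1 (GZ (-1) _ g2); rewrite /rs2 /= !rsN1 => g3.
  by have := iso _ _ g3 g3; rewrite /= subrr ip0l.
have Gsc (c : R[i]) p : G p -> G (c *: p.1, c *: p.2).
  by move=> Gp; rewrite !scaleE -!rs_im; apply: (GD (_, _) (_, _)); [exact: (GZ _ p)|exact: (GZ _ (im2 p) (perp_i Gp))].
have lin (c : R[i]) u v : f (c *: u + v) = c *: f u + f v.
  apply: (Guq (P (c *: u + v))); first exact: fP.
  by rewrite bf_lin; apply: (GD (_, _) (_, _)); [exact: (Gsc c (_, _) (fP u))|exact: fP].
have bd u : n2 (f u) <= 1 * n2 u.
  have -> : n2 (f u) = n2 (P u) := esym (iso _ _ (fP u) (fP u)).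
  exact: nle_prj.
pose v := Bop lin (ex_intro _ 1 bd).
have Pip u w : ip (P u) (P w) = ip u (P w).
  by rewrite ip_star prj_star -bM prj_idem.
have vS p : S p -> v p.1 = p.2.
  move=> Sp; apply: (Guq p.1); last by rewrite -surjective_pairing; exact: GS.
  have e : P p.1 = p.1 by apply: prj_S; exists p.
  by have := fP p.1; rewrite e.
have vv : star v * v = P.
  apply: bop_ext => u; apply: ip_ext => w; rewrite bM ip_starl.
  have -> : ip (v u) (v w) = ip (P u) (P w) := esym (iso _ _ (fP u) (fP w)).
  by rewrite Pip ip_star prj_star.
exists v; split=> //.
  apply: bop_ext => u; apply: (@oc_uniq _ _ (ranS S) u); last exact: prj_oc.
  - rewrite bM => x hx; have [|e1 e2] := fP (star v u) (0, x).
      by move=> p Sp; rewrite /ip2 /= !ip0r !add0r; apply: hx; exists p.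
    by move: e1 e2; rewrite /ip2 /= /im scaler0 !ip0l !add0r -/(im _) => -> ->.
  - have aux s t : v s = t -> P s = s -> ip t (u - (v * star v) u) = 0.
      move=> <- Ps; rewrite ip_star bfB ipBr bM -[star v (v _)]bM vv.
      by rewrite -(ip_starl P) prj_star Ps subrr.
    move=> _ [p Sp <-]; have Pp : P p.1 = p.1 by apply: prj_S; exists p.
    by split; [apply: aux Pp|apply: (aux (im p.1)); rewrite bfi ?Pp] => //; rewrite vS.
  - exact: prj_in.
move=> y h1 h2; apply: bop_ext => u; rewrite !bM.
apply: (Guq (P (y u))); first exact: fP.
have -> : P (y u) = y (P u).
  rewrite -!bM; congr (bf _ u); apply: prj_comm => _ [p Sp <-].
    by exists (y p.1, y p.2) => //; exact: h1.
  by exists (star y p.1, star y p.2) => //; exact: h2.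
exact: (bistable h1 (fP u)).
Qed.

End Wlim.

(** * Positive operators and square roots *)

Section Positive.
Variables (R : realType) (H : hilbertSpace R).
Implicit Types (a b d x y z : bop H) (u v w : H) (A : nat -> bop H).

Definition sym a := star a = a.
Definition pos a := forall u, 0 <= ip (a u) u.
Definition rsc (r : R) : bop H := bsc r%:C.

Lemma rscE r u : rsc r u = rs r u. Proof. by []. Qed.
Lemma rscC r a : rsc r * a = a * rsc r. Proof. exact: bscC. Qed.
Lemma rsc_sym r : sym (rsc r).
Proof. by rewrite /sym sc_star /= oppr0. Qed.
Lemma symE a : sym a -> forall u v, ip (a u) v = ip u (a v).
Proof. by move=> s u v; rewrite ip_star s. Qed.
Lemma symP a : (forall u v, ip (a u) v = ip u (a v)) -> sym a.
Proof. by move=> h; apply/esym/star_uniq. Qed.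
Lemma symD a b : sym a -> sym b -> sym (a + b).
Proof. by rewrite /sym starD => -> ->. Qed.
Lemma symN a : sym a -> sym (- a). Proof. by rewrite /sym starN => ->. Qed.
Lemma symB a b : sym a -> sym b -> sym (a - b).
Proof. by move=> ? ?; apply: symD => //; exact: symN. Qed.
Lemma symM a b : sym a -> sym b -> a * b = b * a -> sym (a * b).
Proof. by rewrite /sym starM => -> ->. Qed.
Lemma sym1 : sym 1. Proof. exact: star1. Qed.
Lemma sym0 : sym 0. Proof. exact: star0. Qed.
Lemma sym_star a : sym (star a * a). Proof. by rewrite /sym starM starK. Qed.
Lemma symSq a : sym a -> sym (a * a). Proof. by move=> s; apply: symM. Qed.
Lemma sym_rsc r a : sym a -> sym (rsc r * a).
Proof. by move=> s; apply: symM => //; [exact: rsc_sym|exact: rscC]. Qed.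
Lemma posD a b : pos a -> pos b -> pos (a + b).
Proof. by move=> h k u; rewrite bE ipDl addr_ge0. Qed.
Lemma pos_star a : pos (star a * a).
Proof. by move=> u; rewrite bM ip_starl n2_ge0. Qed.
Lemma pos_rsc r a : 0 <= r -> pos a -> pos (rsc r * a).
Proof. by move=> r0 h u; rewrite bM rscE ipZl mulr_ge0. Qed.

Lemma pos_CS a u v : sym a -> pos a -> ip (a u) v ^+ 2 <= ip (a u) u * ip (a v) v.
Proof.
move=> s p; have [e|e] := eqVneq (ip (a v) v) 0.
  rewrite e mulr0; have -> : ip (a u) v = 0; last by rewrite expr0n.
  apply: (@quad_lin0 _ _ (ip (a u) u)) => // t.
  have := p (rs t u - v); rewrite bfB bfr !(ipBl, ipBr, ipZl, ipZr) e.
  by rewrite (symE s v u) (ipC v); lra.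
have {}e : 0 < ip (a v) v by rewrite lt_neqAle eq_sym e p.
have := p (rs (ip (a v) v) u - rs (ip (a u) v) v).
rewrite bfB !bfr !(ipBl, ipBr, ipZl, ipZr) (symE s v u) (ipC v) => h.
by rewrite -subr_ge0 -(pmulr_rge0 _ e); move: h; congr (_ <= _); ring.
Qed.

Lemma pos_nle a (c : R) : sym a -> pos a -> 0 <= c -> (forall u, ip (a u) u <= c * n2 u) ->
  nle a (c ^+ 2).
Proof.
move=> s p c0 h u; have := pos_CS u (a u) s p; rewrite -/(n2 _).
have := h u; have := h (a u); have := p u; have := p (a u); have := n2_ge0 u.
have := n2_ge0 (a u).
move: (n2 (a u)) (n2 u) (ip (a u) u) (ip _ _) => x y z t x0 y0 t0 z0 h1 h2 h3.
have [->|e] := eqVneq x 0; first by rewrite mulr_ge0 ?sqr_ge0.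
have {}e : 0 < x by rewrite lt_neqAle eq_sym e x0.
rewrite -(ler_pM2r e) -expr2; apply: le_trans h3 _.
have -> : c ^+ 2 * y * x = (c * y) * (c * x) by ring.
exact: ler_pM.
Qed.

Lemma nle_ip a (c : R) u : 0 <= c -> nle a (c ^+ 2) -> ip (a u) u <= c * n2 u.
Proof.
move=> c0 h; have := CS (a u) u; have := h u; have := n2_ge0 u.
move: (ip _ _) (n2 u) (n2 (a u)) => x y z y0 h1 h2.
have h3 : x ^+ 2 <= (c * y) ^+ 2.
  have e : (c * y) ^+ 2 = c ^+ 2 * y * y by ring.
  by rewrite e; apply: (le_trans h2); exact: ler_wpM2r.
have cy : 0 <= c * y by rewrite mulr_ge0.
by apply: le_trans (ler_norm _) _; rewrite -(ler_pXn2r (n:=2)) ?nnegrE // real_normK // num_real.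
Qed.

Lemma sym_eq0 a : sym a -> (forall u, ip (a u) u = 0) -> a = 0.
Proof.
move=> s h; apply: bop_ext => u; rewrite b0; apply: ip_ext => v; rewrite ip0l.
have := h (u + v); rewrite bfD !(ipDl, ipDr) !h (symE s v u) (ipC v); lra.
Qed.

Definition sconv A b := forall u (e : R), 0 < e -> exists N, forall n, (N <= n)%N ->
  n2 (A n u - b u) < e.

Lemma sconv_ip A b u v : sconv A b -> ip (A n u) v @[n --> \oo] --> ip (b u) v.
Proof.
move=> h; apply/cvgrPdist_lt => e e0.
have d0 : 0 < e ^+ 2 / (n2 v + 1) by rewrite divr_gt0 ?exprn_gt0 // ltr_wpDl ?n2_ge0.
have [N hN] := h u _ d0; exists N => // n Nn /=.
have := hN n Nn; rewrite ltr_pdivlMr ?ltr_wpDl ?n2_ge0 // => h1.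
rewrite -ipBl -[ltRHS]ger0_norm ?ltW // -ltr_sqr ?nnegrE ?normr_ge0 //.
rewrite !real_normK ?num_real //; apply: le_lt_trans (CS _ _) _.
rewrite (n2Bc (b u)); have := n2_ge0 (A n u - b u); lra.
Qed.

Lemma sconv_eq A b c : sconv A b -> sconv A c -> b = c.
Proof.
move=> h k; apply: bop_ext => u; apply: ip_ext => v.
exact: (@uq_lim _ nat \oo _ _ _ _ (sconv_ip h) (sconv_ip k)).
Qed.

Lemma sconvMr A b c : sconv A b -> sconv (fun n => A n * c) (b * c).
Proof. by move=> h u e /h; apply. Qed.

Lemma sconvMl A b c : sconv A b -> sconv (fun n => c * A n) (c * b).
Proof.
move=> h u e e0; have [C C0 hC] := nleP c; have eC : 0 < e / C by rewrite divr_gt0.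
have [N hN] := h u _ eC; exists N => n /hN; rewrite ltr_pdivlMr // => h1.
by rewrite !bM -bfB; apply: le_lt_trans (hC _) _; rewrite mulrC.
Qed.

Lemma sconvD A B b c : sconv A b -> sconv B c -> sconv (fun n => A n + B n) (b + c).
Proof.
move=> h k u e e0; have e4 : 0 < e / 4 by lra.
have [N hN] := h u _ e4; have [M hM] := k u _ e4; exists (maxn N M) => n.
rewrite geq_max => /andP[/hN h1 /hM h2]; rewrite !bE opprD addrACA.
by apply: le_lt_trans (n2D_le _ _) _; lra.
Qed.

Lemma sconv_cst b : sconv (fun=> b) b.
Proof. by move=> u e e0; exists 0 => n _; rewrite subrr n20. Qed.

Lemma sconvM A B b c (C : R) : 0 < C -> (forall n, nle (A n) C) -> sconv A b -> sconv B c ->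
  sconv (fun n => A n * B n) (b * c).
Proof.
move=> C0 hC h k u e e0.
have e4 : 0 < e / 4 by lra.
have eC : 0 < e / 4 / C by rewrite divr_gt0.
have [N hN] := h (c u) _ e4; have [M hM] := k u _ eC; exists (maxn N M) => n.
rewrite geq_max => /andP[/hN h1 /hM]; rewrite ltr_pdivlMr // => h2.
rewrite !bM; apply: le_lt_trans (n2_tri _ (A n (c u)) _) _.
by rewrite -bfB; have := hC n (B n u - c u); lra.
Qed.

Lemma sconv_shift A b : sconv A b -> sconv (fun n => A n.+1) b.
Proof. by move=> h u e /(h u)[N hN]; exists N => n Nn; apply: hN; rewrite leqW. Qed.

Lemma mono_cauchy (s : nat -> R) (M : R) : (forall n, s n <= s n.+1) -> (forall n, s n <= M) ->
  forall e, 0 < e -> exists N, forall n m, (N <= n)%N -> (n <= m)%N -> s m - s n < e.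
Proof.
move=> h k e e0; have mono n m : (n <= m)%N -> s n <= s m.
  by move=> /subnK <-; elim: (m - n)%N => // l IH; rewrite addSn; apply: le_trans IH (h _).
have hs : has_sup [set s n | n in setT] by split; [exists (s 0), 0|exists M => _ [n _ <-]].
have [_ [N _ <-] hN] := sup_adherent e0 hs; exists N => n m Nn nm.
have : s m <= sup [set s n | n in setT] by apply: sup_upper_bound => //; exists m.
by have := mono _ _ Nn; lra.
Qed.

Lemma slim A (C : R) : (forall n, nle (A n) C) ->
  (forall u (e : R), 0 < e -> exists N, forall n m, (N <= n)%N -> (N <= m)%N -> n2 (A n u - A m u) < e) ->
  exists2 b, nle b C & sconv A b.
Proof.
move=> hC hA.
have ex u := complete (hA u); have [f hf] := choice ex.
have lim_eq u l : (forall e : R, 0 < e -> exists N, forall n, (N <= n)%N -> n2 (A n u - l) < e) -> f u = l.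
  move=> h; apply/eqP; rewrite -subr_eq0; apply/eqP/n2_eq0/eqP.
  rewrite eq_le n2_ge0 andbT; apply/ler_addgt0Pr => e e0; rewrite add0r.
  have e4 : 0 < e / 4 by lra.
  have [N hN] := hf u _ e4; have [M hM] := h _ e4.
  have := hN _ (leq_maxl N M); have := hM _ (leq_maxr N M); rewrite (n2Bc _ (f u)) => h1 h2.
  by apply: le_trans (n2_tri _ (A (maxn N M) u) _) _; lra.
have lin (c : R[i]) u v : f (c *: u + v) = c *: f u + f v.
  apply: lim_eq => e e0; pose D := complex.Re c ^+ 2 + complex.Im c ^+ 2 + 1.
  have D0 : 0 < D by rewrite ltr_wpDl // addr_ge0 ?sqr_ge0.
  have e4 : 0 < e / 4 / D by rewrite !divr_gt0.
  have e5 : 0 < e / 4 by lra.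
  have [N hN] := hf u _ e4; have [M hM] := hf v _ e5.
  exists (maxn N M) => n; rewrite geq_max => /andP[/hN]; rewrite ltr_pdivlMr // => h1 /hM h2.
  rewrite bf_lin opprD addrACA -scalerBr; apply: le_lt_trans (n2D_le _ _) _.
  rewrite n2_scale; have := n2_ge0 (A n u - f u); rewrite /D in h1; nra.
have bd u : n2 (f u) <= C * n2 u.
  have w : n2 (A n u) @[n --> \oo] --> n2 (f u).
    apply/cvgrPdist_lt => e e0; pose D := 4 * n2 (f u) + 1.
    have D0 : 0 < D by have := n2_ge0 (f u); rewrite /D; lra.
    pose d := Num.min (e / 2) (e ^+ 2 / 4 / D).
    have d0 : 0 < d by rewrite lt_min !divr_gt0 ?exprn_gt0.
    have [N hN] := hf u _ d0; exists N => // n Nn /=; have := hN n Nn.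
    rewrite lt_min => /andP[h1]; rewrite ltr_pdivlMr // => h2.
    have -> : n2 (f u) - n2 (A n u) = - (n2 (A n u - f u) + 2 * ip (f u) (A n u - f u)).
      by rewrite n2B ipBr (ipC (f u)) -/(n2 _); ring.
    have := CS (f u) (A n u - f u); have := n2_ge0 (A n u - f u).
    move: (n2 (A n u - f u)) (ip _ _) h1 h2 => s t h1 h2 s0 h3.
    have : `|2 * t| < e / 2.
      rewrite -[ltRHS]ger0_norm ?divr_ge0 ?ltW // -ltr_sqr ?nnegrE ?normr_ge0 //.
      rewrite !real_normK ?num_real // !exprMn exprVn; rewrite /D in h2.
      have := n2_ge0 (f u); nra.
    by rewrite normrN; move=> h4; apply: le_lt_trans (ler_normD _ _) _; rewrite (ger0_norm s0); lra.
  by apply: (cvgr_to_le w); apply: nearW => n; exact: hC.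
by exists (Bop lin (ex_intro _ C bd)).
Qed.

(** Polynomials in [d] with nonnegative coefficients. The square-root iteration stays in this cone,
    which yields symmetry, positivity and commutation for its terms and increments at once. *)
Inductive cone (d : bop H) : bop H -> Prop :=
  | cone_pow k : cone d (d ^+ k)
  | coneD a b : cone d a -> cone d b -> cone d (a + b)
  | coneZ r a : 0 <= r -> cone d a -> cone d (rsc r * a).

Lemma coneM d a b : cone d a -> cone d b -> cone d (a * b).
Proof.
elim=> [k|a1 a2 _ IH1 _ IH2 cb|r a1 r0 _ IH cb].
- elim=> [l|b1 b2 _ h1 _ h2|r b1 r0 _ h]; first by rewrite -exprD; constructor.
    by rewrite mulrDr; constructor.
  by rewrite mulrA -rscC -mulrA; constructor.
- by rewrite mulrDl; constructor; [exact: IH1|exact: IH2].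
- by rewrite -mulrA; constructor => //; exact: IH.
Qed.

Lemma cone_comm d z a : d * z = z * d -> cone d a -> a * z = z * a.
Proof.
move=> h; elim=> [k|a1 a2 _ IH1 _ IH2|r a1 _ _ IH].
- elim: k => [|k IH]; first by rewrite mul1r mulr1.
  by rewrite exprS -mulrA IH !mulrA h.
- by rewrite mulrDl IH1 IH2 mulrDr.
- by rewrite -mulrA IH !mulrA rscC.
Qed.

Lemma cone_sym d a : sym d -> cone d a -> sym a.
Proof.
move=> s; elim=> [k|a1 a2 _ IH1 _ IH2|r a1 _ _ IH]; last exact: sym_rsc.
- elim: k => [|k IH]; first exact: sym1.
  by rewrite exprS; apply: symM => //; rewrite -exprS -exprSr.
- exact: symD.
Qed.

Lemma cone_pos d a : sym d -> pos d -> cone d a -> pos a.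
Proof.
move=> s p; elim=> [k|a1 a2 _ IH1 _ IH2|r a1 r0 _ IH]; [|exact: posD|exact: pos_rsc].
have sk l : sym (d ^+ l) by apply: (@cone_sym d) => //; constructor.
(* An even power is a square, and an odd power is [d] between two equal powers. *)
rewrite -(odd_double_half k) -addnn; set l := k./2 => u.
have : (odd k : nat) = 0%N \/ (odd k : nat) = 1%N by case: (odd k); [right|left].
rewrite !exprD; case=> ->; rewrite ?expr1 ?expr0 ?mul1r !bM.
  by rewrite (symE (sk l)) n2_ge0.
have e v : d (bf (d ^+ l) v) = bf (d ^+ l) (d v) by rewrite -!bM -exprS -exprSr.
by rewrite e (symE (sk l)).
Qed.
End Positive.

Section Sqrt.
Variables (R : realType) (H : hilbertSpace R).
Implicit Types (a b d x y z : bop H) (u v w : H).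

Lemma rsc1 : rsc H 1 = 1. Proof. by apply: bop_ext => u; rewrite rscE rs1. Qed.
Lemma rscM r s : rsc H r * rsc H s = rsc H (r * s).
Proof. by apply: bop_ext => u; rewrite bM !rscE rsA. Qed.
Lemma rscDl r s : rsc H (r + s) = rsc H r + rsc H s.
Proof. by apply: bop_ext => u; rewrite bD !rscE rsDl. Qed.

(** For [d = 1 - a] the iteration [y -> (d + y^2) / 2] from 0 increases to a fixed point [Y], and
    the fixed-point equation is [(1 - Y)^2 = a]. *)
Lemma sqrt_ex1 a : sym a -> pos a -> (forall u, ip (a u) u <= n2 u) ->
  exists g, [/\ sym g, pos g, g * g = a & forall z, a * z = z * a -> g * z = z * g].
Proof.
move=> sa pa ale; pose d := 1 - a.
have sd : sym d by apply: symB => //; exact: sym1.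
have pd : pos d by move=> u; rewrite bB b1 ipBl subr_ge0 -/(n2 u).
have nd : nle d 1.
  rewrite -(expr1n _ 2); apply: pos_nle => // u; rewrite bB b1 ipBl mul1r -/(n2 u).
  by have := pa u; lra.
pose y := fix y n := if n is n.+1 then rsc H (1/2) * (d + y n * y n) else 0.
have yS n : y n.+1 = rsc H (1/2) * (d + y n * y n) by [].
have half0 : 0 <= 1/2 :> R by lra.
have cy n : cone d (y n).
  elim: n => [|n IH].
    have -> : y 0 = rsc H 0 * d ^+ 0 by apply: bop_ext => u; rewrite bM rscE rs0l.
    by constructor => //; constructor.
  by rewrite yS; constructor => //; constructor; [rewrite -(expr1 d); constructor|exact: coneM].
have comm a1 a2 : cone d a1 -> cone d a2 -> a1 * a2 = a2 * a1.
  move=> c1 c2; apply: cone_comm c1; apply/esym; apply: cone_comm c2 => //.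
(* The next increment is half the product of the current one with [y n.+1 + y n], so monotonicity
   propagates inside the cone. *)
have cdiff n : cone d (y n.+1 - y n).
  elim: n => [|n IH].
    have -> : y 1 - y 0 = rsc H (1/2) * d ^+ 1 by rewrite yS /= mulr0 addr0 subr0 expr1.
    by constructor => //; constructor.
  have -> : y n.+2 - y n.+1 = rsc H (1/2) * ((y n.+1 - y n) * (y n.+1 + y n)).
    rewrite yS [in X in _ - X]yS -mulrBr opprD addrACA subrr add0r.
    congr (_ * _); rewrite mulrDr !mulrBl (comm (y n.+1) (y n)) //.
    by rewrite addrA subrK.
  by constructor => //; apply: coneM => //; constructor.
have y1 n : nle (y n) 1.
  elim: n => [|n IH] u; first by rewrite mul1r b0 n20 n2_ge0.
  rewrite yS bM rscE n2Z bD bM mul1r.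
  have := n2D_le (d u) (y n (y n u)); have := nd u; have := IH (y n u); have := IH u; lra.
have ysym n : sym (y n) by apply: cone_sym (cy n).
have ypos n : pos (y n) by apply: cone_pos (cy n).
have ymono n m : (n <= m)%N -> sym (y m - y n) /\ pos (y m - y n).
  move=> nm; split; first exact: symB.
  rewrite -(subnK nm); elim: (m - n)%N => [|l IH]; first by rewrite subrr => u; rewrite b0 ip0l.
  rewrite addSn; have -> : y (l + n).+1 - y n = (y (l + n).+1 - y (l + n)) + (y (l + n) - y n).
    by rewrite addrA subrK.
  by apply: posD => //; exact: cone_pos (cdiff _).
have yle n u : ip (y n u) u <= n2 u.
  by rewrite -[leRHS]mul1r; apply: nle_ip => //; rewrite expr1n.
(* Strong convergence of a bounded increasing sequence: for [0 <= T <= 1] the squared norm of [T u]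
   is at most [ip (T u) u]. *)
have [Y Y1 Yc] : exists2 b, nle b 1 & sconv y b.
  apply: slim => // u e e0.
  have [||N hN] := @mono_cauchy R (fun n => ip (y n u) u) (n2 u) _ _ e e0.
  - by move=> n; have [_ p] := ymono n n.+1 (leqnSn _); have := p u; rewrite bB ipBl subr_ge0.
  - by move=> n.
  have aux n m : (N <= n)%N -> (n <= m)%N -> n2 (y m u - y n u) < e.
    move=> Nn nm; have [s p] := ymono n m nm.
    apply: le_lt_trans (hN n m Nn nm); rewrite -bB -ipBl -bB.
    have h := @pos_nle _ _ _ 1 s p ler01; rewrite expr1n in h.
    have {}h : nle (y m - y n) 1.
      apply: h => w; rewrite bB ipBl mul1r; have := yle m w; have := ypos n w; lra.
    have := pos_CS u ((y m - y n) u) s p; rewrite -/(n2 _).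
    have := h ((y m - y n) u); have := CS ((y m - y n) ((y m - y n) u)) ((y m - y n) u).
    have := p ((y m - y n) u); have := p u; rewrite mul1r.
    move: (n2 (bf _ u)) (n2_ge0 (bf (y m - y n) u)) (ip (bf _ u) u) (ip (bf _ (bf _ _)) _) (n2 _).
    move=> x x0 t s1 z t0 s0 h1 h2 h3.
    have [->//|e1] := eqVneq x 0.
    have {}e1 : 0 < x by rewrite lt_neqAle eq_sym e1 x0.
    have s1x : s1 <= x by rewrite -(ler_pXn2r (n:=2)) ?nnegrE //; nra.
    by rewrite -(ler_pM2r e1) -expr2; nra.
  exists N => n m Nn Nm; case: (leqP n m) => nm; first by rewrite n2Bc; exact: aux.
  by apply: aux => //; exact: ltnW.
have YE : Y = rsc H (1/2) * (d + Y * Y).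
  apply: (sconv_eq (sconv_shift Yc)); apply: sconvMl; apply: sconvD; first exact: sconv_cst.
  exact: (sconvM ltr01 y1 Yc Yc).
have Ysym : sym Y.
  apply: symP => u v.
  have h1 := sconv_ip (u:=u) (v:=v) Yc; have h2 := sconv_ip (u:=v) (v:=u) Yc.
  rewrite (ipC u); apply: (@uq_lim _ nat \oo _ _ _ _ h1).
  have -> : (fun n => ip (y n u) v) = (fun n => ip (y n v) u); last exact: h2.
  by apply/funext => n; rewrite (symE (ysym n)) ipC.
have Ycom z : d * z = z * d -> Y * z = z * Y.
  move=> h; apply: (sconv_eq (sconvMr z Yc)).
  have -> : (fun n => y n * z) = (fun n => z * y n) by apply/funext => n; exact: cone_comm (cy n).
  exact: sconvMl.
exists (1 - Y); split.
- by apply: symB => //; exact: sym1.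
- move=> u; rewrite bB b1 ipBl subr_ge0 -/(n2 u) -[leRHS]mul1r.
  by apply: nle_ip => //; rewrite expr1n.
- have h2 : Y + Y = d + Y * Y.
    rewrite {1 2}YE -mulrDl -rscDl; have -> : 1/2 + 1/2 = 1 :> R by lra.
    by rewrite rsc1 mul1r.
  apply: bop_ext => u; apply: ip_ext => v; have : ip ((Y + Y) u) v = ip ((d + Y * Y) u) v by rewrite h2.
  rewrite /d !(bE, bfD, bfB, bfN, ipDl, ipBl, ipNl); lra.
- move=> z h; rewrite mulrBl mulrBr mul1r mulr1 Ycom //.
  by rewrite /d mulrBl mulrBr mul1r mulr1 h.
Qed.

Lemma sqrt_ex a : sym a -> pos a ->
  exists g, [/\ sym g, pos g, g * g = a & forall z, a * z = z * a -> g * z = z * g].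
Proof.
(* [C] bounds the squared norm, so [c] bounds the norm and [a / c] is below 1. *)
move=> sa pa; have [C C0 hC] := nleP a; pose c : R := Num.sqrt C.
have c0 : 0 < c by rewrite sqrtr_gt0.
have [|||g [sg pg gg cg]] := @sqrt_ex1 (rsc H c^-1 * a).
- exact: sym_rsc.
- by apply: pos_rsc => //; rewrite invr_ge0 ltW.
- move=> u; rewrite bM rscE ipZl mulrC ler_pdivrMr // mulrC.
  by apply: nle_ip; [exact: ltW|rewrite sqr_sqrtr // ltW].
pose s : R := Num.sqrt c; have ss : s * s = c by rewrite -expr2 sqr_sqrtr // ltW.
exists (rsc H s * g); split.
- exact: sym_rsc.
- by apply: pos_rsc => //; exact: sqrtr_ge0.
- rewrite mulrA -(mulrA _ g) -rscC mulrA rscM -mulrA gg mulrA rscM ss divff ?gt_eqF //.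
  by rewrite rsc1 mul1r.
- move=> z h; have gz : g * z = z * g by apply: cg; rewrite -mulrA h mulrA rscC -mulrA.
  by rewrite -mulrA gz mulrA rscC -mulrA.
Qed.

(** * Range projections, spectral cuts and polar decomposition *)

Definition range a : set H := [set a u | u in setT].

Lemma oc_range a u : oc (range a) u <-> star a u = 0.
Proof.
split=> [h|h _ [v _ <-]].
  by apply: n2_eq0; have [|e _] := h (a (star a u)); [exists (star a u)|rewrite /n2 ip_starl ipC].
by split; [|rewrite -bfi]; rewrite ip_star h ip0r.
Qed.

Lemma stable_range a y : a * y = y * a -> stable1 (range a) y.
Proof. by move=> h _ [v _ <-]; exists (y v) => //; rewrite -!bM h. Qed.

Lemma star_comm a y : a * y = y * a -> star a * star y = star y * star a.
Proof. by move=> h; rewrite -!starM h. Qed.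

Lemma prj_range_comm a y : a * y = y * a -> a * star y = star y * a ->
  prj (range a) * y = y * prj (range a).
Proof. by move=> h k; apply: prj_comm; exact: stable_range. Qed.

Lemma prj_range_mul a : prj (range a) * a = a.
Proof. by apply: bop_ext => u; rewrite bM prj_S //; exists u. Qed.

Lemma oc_fix (y : bop H) S : (forall s, S s -> y s = s) -> forall u, oc (oc S) u -> y u = u.
Proof.
move=> h u hu; apply/eqP; rewrite -subr_eq0; apply/eqP; apply: ip_ext => w; rewrite ip0l.
have [|e _] := hu (star y w - w); last by rewrite ipBl ip_star -ipBr ipC.
move=> s Ss; split; first by rewrite ipBr -ip_star h // subrr.
by rewrite ipBr -ip_star bfi h // subrr.
Qed.

Lemma oc_kill (y : bop H) S : (forall s, S s -> y s = 0) -> forall u, oc (oc S) u -> y u = 0.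
Proof.
move=> h u hu; have := @oc_fix (1 - y) S _ u hu.
rewrite bB b1 => k; have : u - y u = u by apply: k => s Ss; rewrite bB b1 h // subr0.
by move=> e; rewrite -(subKr u (y u)) e subrr.
Qed.

Lemma fix_of_prj S u : prj S u = u -> oc (oc S) u.
Proof. by move=> <-; exact: prj_in. Qed.

(** [E] is the spectral projection of [T] for the open positive half-line, obtained without spectral
    measures as the range projection of [|T| + T], where [|T|] is the square root of [T^2]. *)
Lemma spec_pos (T : bop H) : sym T -> exists E, [/\ sym E, E * E = E,
  (forall z, T * z = z * T -> E * z = z * E),
  (forall u, E u = u -> 0 <= ip (T u) u /\ (ip (T u) u = 0 -> u = 0)) &
  (forall u, E u = 0 -> ip (T u) u <= 0)].
Proof.
move=> sT; have [||g [sg pg gg cg]] := @sqrt_ex (T * T); first exact: symSq.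
  by move=> u; rewrite bM symE // n2_ge0.
have gT : g * T = T * g by apply: cg; rewrite !mulrA.
(* Since [(g - S) (g + S) = 0], the operators [g] and [S] agree on the range of [g + S], where the
   form is therefore twice that of [g]. *)
have posP S : sym S -> g * S = S * g -> g * g = S * S -> pos (g + S).
  move=> sS gS gS2 u; set Q := prj (range (g + S)).
  have sgS : sym (g + S) := symD sg sS.
  have QgS : Q * (g + S) = g + S := prj_range_mul _.
  have gSQ : (g + S) * Q = g + S by rewrite -[LHS]starK starM prj_star sgS QgS.
  have gQ : (g - S) * Q = 0.
    apply: bop_ext => w; apply: (@oc_kill (g - S) (range (g + S))); last exact: prj_in.
    move=> _ [x _ <-]; rewrite -bM mulrBl !mulrDr gS2 gS.
    by rewrite [S * S + _]addrC subrr.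
  have -> : ip ((g + S) u) u = ip (g (Q u)) (Q u) + ip (S (Q u)) (Q u).
    by rewrite -ipDl -bD -[ip (bf (g + S) (Q u)) _]ip_starl prj_star -!bM QgS gSQ.
  have : ip (((g - S) * Q) u) (Q u) = 0 by rewrite gQ b0 ip0l.
  by rewrite bM bB ipBl; have := pg (Q u); lra.
have pP : pos (g + T) by apply: posP.
have pN : pos (g - T) by apply: posP; rewrite ?mulrN ?mulNr ?gT ?opprK //; exact: symN.
have sP : sym (g + T) := symD sg sT.
have PN : (g - T) * (g + T) = 0 by rewrite mulrBl !mulrDr gg gT [T * T + _]addrC subrr.
have Tip u : 2 * ip (T u) u = ip ((g + T) u) u - ip ((g - T) u) u.
  by rewrite bD bB ipDl ipBl; ring.
exists (prj (range (g + T))); split.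
- exact: prj_star.
- exact: prj_idem.
- move=> z h; have hg : g * z = z * g by apply: cg; rewrite -mulrA h !mulrA h.
  have h' : T * star z = star z * T.
    by have := star_comm h; rewrite sT.
  have hg' : g * star z = star z * g by have := star_comm hg; rewrite sg.
  by apply: prj_range_comm; rewrite mulrDl mulrDr ?h ?hg ?h' ?hg'.
- move=> u /fix_of_prj hu.
  have N0 : (g - T) u = 0.
    by apply: oc_kill hu => _ [w _ <-]; rewrite -bM PN.
  have := Tip u; rewrite N0 ip0l subr0 => e; split; first by have := pP u; lra.
  move=> e0; apply: oc_triv hu; apply/oc_range; rewrite sP.
  have := pos_CS u ((g + T) u) sP pP; rewrite -e e0 mulr0 mul0r -/(n2 _) => h.
  by apply: n2_eq0; apply/eqP; rewrite -sqrf_eq0 eq_le h sqr_ge0.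
- move=> u /prj_0P/oc_range; rewrite sP => e.
  by have := Tip u; rewrite e ip0l; have := pN u; lra.
Qed.

(** The pairs [(|T| u, T u)] have equal Gram matrices, and [v] is the partial isometry that they
    define. Its initial projection is recorded through its kernel, which is the form used later. *)
Lemma polar (T : bop H) : exists v : bop H, [/\ sym (star v * v), (star v * v) * (star v * v) = star v * v,
  forall u, (T u = 0) <-> ((star v * v) u = 0), v * star v = prj (range T) &
  forall y, T * y = y * T -> star T * y = y * star T -> v * y = y * v].
Proof.
have [||g [sg pg gg cg]] := @sqrt_ex (star T * T); [exact: sym_star|exact: pos_star|].
pose S : set (H * H) := [set (g u, T u) | u in setT].
have gT u w : ip (g u) (g w) = ip (T u) (T w).
  by rewrite -(symE sg) -bM gg bM ip_starl.
have [|v [vS vv vv' vc]] := @partial_isometry R H S.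
  by move=> _ _ [u _ <-] [w _ <-] /=; rewrite -!bfi !gT.
have dS : domS S = range g.
  by apply/seteqP; split=> [_ [_ [u _ <-] <-]|_ [u _ <-]]; [exists u|exists (g u, T u) => //; exists u].
have rS : ranS S = range T.
  by apply/seteqP; split=> [_ [_ [u _ <-] <-]|_ [u _ <-]]; [exists u|exists (g u, T u) => //; exists u].
exists v; rewrite vv vv' dS rS; split=> //; [exact: prj_star|exact: prj_idem| |].
- move=> u; have g0 : g u = 0 <-> T u = 0.
    have e2 : n2 (g u) = n2 (T u) by exact: gT.
    by split=> e; apply: n2_eq0; [rewrite -e2|rewrite e2]; rewrite e n20.
  rewrite -g0; split=> [e|/prj_0P/oc_range]; last by rewrite sg.
  by apply: prj_0; apply/oc_range; rewrite sg.
- move=> y h k.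
  have aux z : T * z = z * T -> star T * z = z * star T -> stable S z.
    move=> h1 h2 _ [u _ <-] /=; exists (z u) => //.
    by rewrite -!bM h1 cg // -mulrA h1 !mulrA h2.
  apply: vc; apply: aux => //; first by have := star_comm k; rewrite starK.
  exact: star_comm.
Qed.

End Sqrt.

(** * Von Neumann algebras of bounded operators *)

Section Vna.
Variables (R : realType) (H : hilbertSpace R).
Implicit Types (a b x y z p q w : bop H) (u v : H) (A : set (bop H)).

Definition cm A : set (bop H) := [set y | forall x, A x -> y * x = x * y].
(** The inclusion of the bicommutant already gives closure under the ring operations; membership is
    proved throughout by commuting with [cm A]. *)
Definition vna A := (forall a, A a -> A (star a)) /\
  (forall a, (forall y, cm A y -> y * a = a * y) -> A a).

Definition isproj p := sym p /\ p * p = p.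

Section One.
Variable A : set (bop H).
Hypothesis hA : vna A.

Lemma vna_star a : A a -> A (star a). Proof. exact: hA.1. Qed.
Lemma vnaP a : (forall y, cm A y -> y * a = a * y) -> A a. Proof. exact: hA.2. Qed.
Lemma cm_star y : cm A y -> cm A (star y).
Proof. by move=> h x /vna_star /h e; apply: star_inj; rewrite !starM starK e. Qed.
Lemma vnaM a b : A a -> A b -> A (a * b).
Proof. by move=> Aa Ab; apply: vnaP => y cy; rewrite mulrA cy // -!mulrA cy. Qed.
Lemma vnaD a b : A a -> A b -> A (a + b).
Proof. by move=> Aa Ab; apply: vnaP => y cy; rewrite mulrDl mulrDr !cy. Qed.
Lemma vnaN a : A a -> A (- a).
Proof. by move=> Aa; apply: vnaP => y cy; rewrite mulNr mulrN cy. Qed.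
Lemma vnaB a b : A a -> A b -> A (a - b).
Proof. by move=> Aa Ab; apply: vnaD => //; exact: vnaN. Qed.
Lemma vna1 : A 1. Proof. by apply: vnaP => y _; rewrite mulr1 mul1r. Qed.
Lemma vna0 : A 0. Proof. by apply: vnaP => y _; rewrite mulr0 mul0r. Qed.
Lemma vna_sc c : A (bsc c). Proof. by apply: vnaP => y _; rewrite bscC. Qed.
Lemma vnaX a n : A a -> A (a ^+ n).
Proof. by move=> Aa; elim: n => [|n IH]; [exact: vna1|rewrite exprS; exact: vnaM]. Qed.
Lemma vna_sum (I : Type) (s : seq I) (F : I -> bop H) : (forall i, A (F i)) -> A (\sum_(i <- s) F i).
Proof. by move=> h; elim/big_ind: _ => //; [exact: vna0|exact: vnaD]. Qed.

Lemma vna_prj S : (forall y, cm A y -> stable1 S y) -> A (prj S).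
Proof. by move=> h; apply: vnaP => y cy; apply/esym/prj_comm; apply: h => //; exact: cm_star. Qed.

Lemma vna_prj_range a : A a -> A (prj (range a)).
Proof. by move=> Aa; apply: vna_prj => y cy; apply: stable_range; rewrite cy. Qed.

Lemma vna_spec T : A T -> sym T -> exists E, [/\ A E, isproj E,
  (forall z, T * z = z * T -> E * z = z * E),
  (forall u, E u = u -> 0 <= ip (T u) u /\ (ip (T u) u = 0 -> u = 0)) &
  (forall u, E u = 0 -> ip (T u) u <= 0)].
Proof.
move=> AT sT; have [E [h1 h2 h3 h4 h5]] := spec_pos sT.
by exists E; split=> //; apply: vnaP => y cy; rewrite h3 // cy.
Qed.

Lemma vna_sqrt a : A a -> sym a -> pos a ->
  exists g, [/\ A g, sym g, pos g, g * g = a & forall z, a * z = z * a -> g * z = z * g].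
Proof.
move=> Aa sa pa; have [g [h1 h2 h3 h4]] := sqrt_ex sa pa.
by exists g; split=> //; apply: vnaP => y cy; rewrite h4 // cy.
Qed.

Lemma vna_polar T : A T -> exists v : bop H, [/\ A v, isproj (star v * v),
  (forall u, (T u = 0) <-> ((star v * v) u = 0)) & v * star v = prj (range T)].
Proof.
move=> AT; have [v [h1 h2 h3 h4 h5]] := polar T.
by exists v; split=> //; apply: vnaP => y cy; rewrite h5 // cy //; exact: vna_star.
Qed.

(** The main source of partial isometries in [A]; the Zorn arguments below act on such families of
    pairs instead of on operators. *)
Lemma vna_pi S : gram S -> (forall y, cm A y -> stable S y) -> exists v : bop H,
  [/\ A v, (forall p : H * H, S p -> v p.1 = p.2), star v * v = prj (domS S) & v * star v = prj (ranS S)].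
Proof.
move=> gS st; have [v [h1 h2 h3 h4]] := partial_isometry gS.
exists v; split=> //; apply: vnaP => y cy; rewrite h4 //; first exact: st.
by apply: st; exact: cm_star.
Qed.

Definition proj p := A p /\ isproj p.
Definition cproj z := proj z /\ forall x, A x -> z * x = x * z.

Lemma isproj1 : isproj 1. Proof. by split; [exact: sym1|rewrite mulr1]. Qed.
Lemma isproj0 : isproj 0. Proof. by split; [exact: sym0|rewrite mulr0]. Qed.
Lemma isprj S : isproj (prj S). Proof. by split; [exact: prj_star|exact: prj_idem]. Qed.
Lemma isprojC p : isproj p -> isproj (1 - p).
Proof.
case=> s e; split; first by apply: symB => //; exact: sym1.
by rewrite mulrBr mulr1 mulrBl mul1r e subrr subr0.
Qed.
Lemma isprojM p q : isproj p -> isproj q -> p * q = q * p -> isproj (p * q).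
Proof.
move=> [s e] [s' e'] h; split; first exact: symM.
by rewrite mulrA -(mulrA p) -h mulrA e -mulrA e'.
Qed.
Lemma isprojJ p q : isproj p -> isproj q -> p * q = q * p -> isproj (p + q - p * q).
Proof.
move=> hp hq h; have hu u : p (q u) = q (p u) by rewrite -!bM h.
have -> : p + q - p * q = 1 - (1 - p) * (1 - q).
  by apply: bop_ext => u; apply: ip_ext => v; rewrite !(bE, bfD, bfN, ipDl, ipNl); lra.
apply: isprojC; apply: isprojM; try exact: isprojC.
by apply: bop_ext => u; apply: ip_ext => v; rewrite !(bE, bfD, bfN, hu, ipDl, ipNl); lra.
Qed.
Lemma isproj_nle p : isproj p -> nle p 1.
Proof.
case=> s e u; rewrite mul1r; have h : ip (p u) u = n2 (p u) by rewrite -{1}e bM symE.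
have := n2_ge0 (u - p u); rewrite n2B (ipC u) h; have := n2_ge0 (p u); lra.
Qed.
Lemma isproj_ip p u : isproj p -> ip (p u) u = n2 (p u).
Proof. by case=> s e; rewrite -{1}e bM symE. Qed.
Lemma isproj_n2 p u : isproj p -> n2 u = n2 (p u) + n2 (u - p u).
Proof. by move=> hp; rewrite n2B (ipC u) isproj_ip //; ring. Qed.
Lemma isproj_id p u : isproj p -> p (p u) = p u.
Proof. by case=> _ e; rewrite -bM e. Qed.
Lemma isproj_eq0 p : isproj p -> (forall u, p u = u -> u = 0) -> p = 0.
Proof. by move=> hp h; apply: bop_ext => u; rewrite b0; apply: h; exact: isproj_id. Qed.

Lemma cproj_is z : cproj z -> isproj z. Proof. by case=> [[]]. Qed.
Lemma cproj_A z : cproj z -> A z. Proof. by case=> [[]]. Qed.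
Lemma cproj_c z x : cproj z -> A x -> z * x = x * z. Proof. by case=> _; apply. Qed.
Lemma cproj_i z : cproj z -> z * z = z. Proof. by case=> [[_ []]]. Qed.
Lemma cproj_s z : cproj z -> sym z. Proof. by case=> [[_ []]]. Qed.
Lemma cproj1 : cproj 1.
Proof. by split; [split; [exact: vna1|exact: isproj1]|move=> x _; rewrite mul1r mulr1]. Qed.
Lemma cproj0 : cproj 0.
Proof. by split; [split; [exact: vna0|exact: isproj0]|move=> x _; rewrite mul0r mulr0]. Qed.
Lemma cprojC z : cproj z -> cproj (1 - z).
Proof.
move=> [[Az pz] cz]; split; first by split; [apply: vnaB => //; exact: vna1|exact: isprojC].
by move=> x Ax; rewrite mulrBl mulrBr mul1r mulr1 cz.
Qed.
Lemma cprojM z w : cproj z -> cproj w -> cproj (z * w).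
Proof.
move=> [[Az pz] cz] [[Aw pw] cw]; split.
  by split; [exact: vnaM|apply: isprojM => //; exact: cz].
by move=> x Ax; rewrite -mulrA cw // mulrA cz // mulrA.
Qed.
Lemma cprojJ z w : cproj z -> cproj w -> cproj (z + w - z * w).
Proof.
move=> hz hw; have [[Az pz] cz] := hz; have [[Aw pw] cw] := hw; split.
  by split; [apply: vnaB; [exact: vnaD|exact: vnaM]|apply: isprojJ => //; exact: cz].
by move=> x Ax; rewrite mulrBl mulrBr mulrDl mulrDr (cproj_c (cprojM hz hw) Ax) (cz _ Ax) (cw _ Ax).
Qed.

Lemma cproj_prj S : (forall y, cm A y -> stable1 S y) -> (forall x, A x -> stable1 S x) ->
  cproj (prj S).
Proof.
move=> h k; split; first by split; [exact: vna_prj|exact: isprj].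
by move=> x Ax; apply: prj_comm; apply: k => //; exact: vna_star.
Qed.

(** The central support of [p]. *)
Definition cs p := prj [set u | exists x v, A x /\ u = x (p v)].
Lemma cs_cproj p : A p -> cproj (cs p).
Proof.
move=> Ap; apply: cproj_prj => [y cy _ [x [v [Ax ->]]]|y Ay _ [x [v [Ax ->]]]].
  by exists x, (y v); split=> //; rewrite -(bM y x) (cy _ Ax) bM -(bM y p) (cy _ Ap) bM.
by exists (y * x), v; split=> //; exact: vnaM.
Qed.
Lemma cs_mul p : cs p * p = p.
Proof. by apply: bop_ext => u; rewrite bM; apply: prj_S; exists 1, u; split=> //; exact: vna1. Qed.
Lemma cs_kill p r : A p -> (forall x, A x -> r * x * p = 0) -> r * cs p = 0.
Proof.
move=> Ap h; apply: bop_ext => u; rewrite bM b0; apply: oc_kill; last exact: prj_in.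
by move=> _ [x [v [Ax ->]]]; rewrite -(bM r) -bM h.
Qed.

Definition csup (I : set (bop H)) := prj [set u | exists z v, I z /\ u = z v].
Lemma csup_cproj I : (I `<=` cproj) -> cproj (csup I).
Proof.
move=> hI; apply: cproj_prj => [y cy _ [z [v [Iz ->]]]|y Ay _ [z [v [Iz ->]]]].
  by exists z, (y v); split=> //; rewrite -!bM cy //; exact: (cproj_A (hI _ Iz)).
by exists z, (y v); split=> //; rewrite -!bM (cproj_c (hI _ Iz) Ay).
Qed.
Lemma csup_ub (I : set (bop H)) z : I z -> csup I * z = z.
Proof. by move=> Iz; apply: bop_ext => u; rewrite bM; apply: prj_S; exists z, u. Qed.
Lemma csup_kill (I : set (bop H)) x : (forall z, I z -> x * z = 0) -> x * csup I = 0.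
Proof.
move=> h; apply: bop_ext => u; rewrite bM b0; apply: oc_kill; last exact: prj_in.
by move=> _ [z [v [Iz ->]]]; rewrite -bM h.
Qed.
Lemma csup_le (I : set (bop H)) x : (forall z, I z -> x * z = z) -> x * csup I = csup I.
Proof.
move=> h; apply: bop_ext => u; rewrite bM; apply: oc_fix; last exact: prj_in.
by move=> _ [z [v [Iz ->]]]; rewrite -bM h.
Qed.

Definition directed (I : set (bop H)) := I !=set0 /\ forall z w, I z -> I w -> I (z + w - z * w).
End One.

Definition subsp (D : set H) := D 0 /\ forall (c : R[i]) u v, D u -> D v -> D (c *: u + v).

(** On the closure [G] of [D] the functional [ip u] has a Riesz representative; its difference from
    [u] is orthogonal to [D], hence to [u] and to itself. *)
Lemma subsp_dense (D : set H) u : subsp D -> oc (oc D) u ->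
  forall e : R, 0 < e -> exists2 v, D v & n2 (u - v) < e.
Proof.
move=> [D0 DL] hu.
pose G : set (H * H) := [set p | forall e : R, 0 < e -> exists2 v, D v & n2 (p.1 - v) < e].
have DD (x y : H) : D x -> D y -> D (x + y) by move=> Dx Dy; have := DL 1 _ _ Dx Dy; rewrite scale1r.
have DZ (c : R[i]) (x : H) : D x -> D (c *: x) by move=> Dx; have := DL c _ _ Dx D0; rewrite addr0.
have GZ (c : R[i]) (x : H) : G (x, 0) -> G (c *: x, 0).
  move=> Gx e e0; pose K := complex.Re c ^+ 2 + complex.Im c ^+ 2 + 1.
  have K0 : 0 < K by rewrite ltr_wpDl // addr_ge0 ?sqr_ge0.
  have eK : 0 < e / K by rewrite divr_gt0.
  have [v Dv] := Gx _ eK; rewrite /= ltr_pdivlMr // => h; exists (c *: v); first exact: DZ.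
  rewrite -scalerBr n2_scale; have := n2_ge0 (x - v); rewrite /K in h; nra.
have cG : closed_rsub G.
  split.
  - by move=> e e0; exists 0 => //; rewrite subrr n20.
  - move=> p q Gp Gq e e0; have e4 : 0 < e / 4 by lra.
    have [v Dv hv] := Gp _ e4; have [w Dw hw] := Gq _ e4; exists (v + w); first exact: DD.
    by rewrite /= opprD addrACA; apply: le_lt_trans (n2D_le _ _) _; lra.
  - by move=> r p Gp; exact: (GZ r%:C p.1 Gp).
  - move=> p h e e0; have e4 : 0 < e / 4 by lra.
    have [q Gq] := h _ e4; rewrite /ip2 -!/(n2 _) => hq; have [v Dv hv] := Gq _ e4.
    exists v => //; apply: le_lt_trans (n2_tri _ q.1 _) _.
    by have := n2_ge0 (p - q).2; lra.
have [|||g Gg hg] := @riesz_sub _ _ G (fun p : H * H => ip u p.1) (n2 u) cG (n2_ge0 u).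
- by move=> p q; rewrite ipDr.
- by move=> r p; rewrite ipZr.
- move=> p; apply: le_trans (CS _ _) _; rewrite ler_wpM2l ?n2_ge0 // /ip2 -!/(n2 _).
  by have := n2_ge0 p.2; lra.
have GD (x : H) : D x -> G (x, 0) by move=> Dx e e0; exists x => //; rewrite subrr n20.
have og : oc D (u - g.1).
  have aux (x : H) : D x -> ip x (u - g.1) = 0.
    by move=> Dx; have := hg _ (GD _ Dx); rewrite /ip2 /= ip0r addr0 ipBr !(ipC x) => ->; rewrite subrr.
  by move=> x Dx; split; apply: aux => //; exact: DZ.
have e1 : ip (u - g.1) g.1 = 0.
  by have := hg _ (GZ 1 _ (Gg : G (g.1, 0))); rewrite /ip2 /= scale1r ip0r addr0 ipBl => ->; rewrite subrr.
have e2 : ip (u - g.1) u = 0 by have [] := hu _ og.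
have -> : u = g.1.
  by apply/eqP; rewrite -subr_eq0; apply/eqP/n2_eq0; rewrite /n2 ipBr e1 e2 subrr.
exact: Gg.
Qed.

Section Dir.
Variable A : set (bop H).
Hypothesis hA : vna A.

Lemma csup_mulr (I : set (bop H)) z : I `<=` cproj A -> I z -> z * csup I = z.
Proof.
move=> hI Iz; rewrite -(cproj_c (csup_cproj hA hI)) ?csup_ub //.
exact: (cproj_A (hI _ Iz)).
Qed.

(** Directedness makes the union of the ranges a linear subspace, so [subsp_dense] gives strong
    convergence to the supremum. *)
Lemma csup_approx (I : set (bop H)) u (e : R) : I `<=` cproj A -> directed I -> 0 < e ->
  exists2 z, I z & n2 (csup I u - z u) < e.
Proof.
move=> hI [[z0 Iz0] dI] e0.
pose D : set H := [set v | exists2 z, I z & z v = v].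
have sD : subsp D.
  split; first by exists z0 => //; rewrite bf0.
  move=> c s t [z Iz zx] [w Iw wy]; exists (z + w - z * w); first exact: dI.
  have h : z * w = w * z by apply: cproj_c (hI _ Iz) (cproj_A (hI _ Iw)).
  have e1 : (z + w - z * w) s = s by rewrite h !bE zx addrK.
  have e2 : (z + w - z * w) t = t by rewrite !bE wy addrAC subrr add0r.
  by rewrite bf_lin e1 e2.
have hc : oc (oc D) (csup I u).
  apply: oc_sub (@prj_in _ _ _ u); apply: oc_sub => _ [z [v [Iz ->]]].
  by exists z => //; apply: isproj_id; exact: cproj_is (hI _ Iz).
have [v [z Iz zv] hv] := subsp_dense sD hc e0; exists z => //.
apply: le_lt_trans hv; have pz := cproj_is (hI _ Iz).
have zc : z (csup I u) = z u by rewrite -bM csup_mulr.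
rewrite [leRHS](isproj_n2 _ pz) bfB zv zc.
have -> : csup I u - v - (z u - v) = csup I u - z u by rewrite opprB addrA subrK.
by have := n2_ge0 (z u - v); lra.
Qed.

(** In terms of vectors: a directed family of central projections separates
    vectors iff its supremum is 1. *)
Definition dense_fam (I : set (bop H)) := forall u, (forall z, I z -> z u = 0) -> u = 0.

Lemma dense_csup (I : set (bop H)) : I `<=` cproj A -> dense_fam I -> csup I = 1.
Proof.
move=> hI dI; apply: bop_ext => u; rewrite b1.
apply/esym/eqP; rewrite -subr_eq0; apply/eqP/dI => z Iz.
by rewrite bfB -bM csup_mulr // subrr.
Qed.

Lemma dense_approx (I : set (bop H)) u (e : R) : I `<=` cproj A -> directed I -> dense_fam I ->
  0 < e -> exists2 z, I z & n2 (u - z u) < e.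
Proof.
move=> hI dI sI e0; have [z Iz h] := csup_approx u hI dI e0.
by exists z => //; rewrite dense_csup // in h.
Qed.
End Dir.
End Vna.

(** * Comparison of projections and finiteness *)

Section Compare.
Variables (R : realType) (H : hilbertSpace R).
Implicit Types (a b x y z p q w f r s t v : bop H) (A : set (bop H)).

Lemma pi_mul v : isproj (star v * v) -> v * (star v * v) = v.
Proof.
case=> s e; apply: bop_ext => u; apply/eqP; rewrite -subr_eq0; apply/eqP/n2_eq0.
rewrite bM -bfB /n2 -ip_starl -bM bfB -bM e subrr.
by rewrite ip0l.
Qed.

Lemma pi_star v : isproj (star v * v) -> isproj (v * star v).
Proof.
move=> h; split; first by rewrite /sym starM starK.
by rewrite mulrA -(mulrA v) pi_mul.
Qed.

Lemma pi_mul' v : isproj (star v * v) -> v * star v * v = v.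
Proof. by move=> h; rewrite -mulrA pi_mul. Qed.

Lemma le_mulr p q : sym p -> sym q -> p * q = q -> q * p = q.
Proof. by move=> sp sq h; rewrite -[LHS]starK starM sp sq h sq. Qed.

Lemma le_mull p q : sym p -> sym q -> q * p = q -> p * q = q.
Proof. by move=> sp sq h; rewrite -[LHS]starK starM sp sq h sq. Qed.

Lemma prj_fix y S : (forall u, S u -> y u = u) -> y * prj S = prj S.
Proof. by move=> h; apply: bop_ext => u; rewrite bM; apply: oc_fix h _ (prj_in _). Qed.

Lemma prj_kill y S : (forall u, S u -> y u = 0) -> y * prj S = 0.
Proof. by move=> h; apply: bop_ext => u; rewrite bM; apply: oc_kill h _ (prj_in _). Qed.

Lemma star_sq0 a : star a * a = 0 -> a = 0.
Proof. by move=> h; apply: bop_ext => u; rewrite b0; apply: n2_eq0; rewrite /n2 -ip_starl -bM h b0 ip0l. Qed.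

Variable A : set (bop H).
Hypothesis hA : vna A.

(** Take a maximal Gram-equal family from [f] to [r]. Were [r0 x f0] nonzero for the two leftovers,
    its polar part would enlarge the family. The conclusion keeps this mutual disconnection of the
    leftovers in place of a central splitting. *)
Lemma compare f r : proj A f -> proj A r -> exists v, [/\ A v, isproj (star v * v),
  f * (star v * v) = star v * v, r * v = v &
  forall x, A x -> (r - v * star v) * x * (f - star v * v) = 0].
Proof.
move=> [Af [sf ff]] [Ar [sr rr]].
pose P : set (set (H * H)) := [set S | [/\ gram S,
  (forall p : H * H, S p -> f p.1 = p.1 /\ r p.2 = p.2) & forall y, cm A y -> stable S y]].
have [F FP tF|S [[gS frS stS] maxS]] := @Zorn_bigcup _ P.
  split.
  - move=> p q [X FX Xp] [Y FY Yq].
    by case: (tF _ _ FX FY) => XY; [have [g _ _] := FP _ FY|have [g _ _] := FP _ FX];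
      apply: g => //; exact: XY.
  - by move=> p [X FX Xp]; have [_ h _] := FP _ FX; exact: h.
  - by move=> y cy p [X FX Xp]; have [_ _ h] := FP _ FX; exists X => //; exact: h.
have [v [Av vS vv vv']] := vna_pi hA gS stS.
have pv : isproj (star v * v) by rewrite vv; exact: isprj.
have fv : f * (star v * v) = star v * v.
  by rewrite vv; apply: prj_fix => _ [p Sp <-]; have [] := frS _ Sp.
have rv' : r * (v * star v) = v * star v.
  by rewrite vv'; apply: prj_fix => _ [p Sp <-]; have [] := frS _ Sp.
have rv : r * v = v by rewrite -[in LHS](pi_mul' pv) mulrA rv' pi_mul'.
exists v; split=> // x Ax; set f0 := f - _; set r0 := r - _.
pose T := r0 * x * f0.
have Af0 : A f0 by apply: vnaB => //; apply: vnaM => //; exact: vna_star.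
have Ar0 : A r0 by apply: vnaB => //; apply: vnaM => //; exact: vna_star.
have sv : sym (star v * v) := pv.1; have sv' := (pi_star pv).1.
have sf0 : sym f0 by exact: symB.
have sr0 : sym r0 by exact: symB.
have ff0 : f0 * f0 = f0.
  rewrite /f0 mulrBr mulrBl ff mulrBl fv (le_mulr sf sv fv) pv.2 subrr subr0.
  by [].
have rr0 : r0 * r0 = r0.
  rewrite /r0 mulrBr mulrBl rr mulrBl rv' (le_mulr sr sv' rv') (pi_star pv).2 subrr subr0.
  by [].
have fF0 : f * f0 = f0 by rewrite /f0 mulrBr ff fv.
have rR0 : r * r0 = r0 by rewrite /r0 mulrBr rr rv'.
have AT : A T by apply: vnaM => //; apply: vnaM.
have [w [Aw pw wk wr]] := vna_polar hA AT.
have Tf : T * f0 = T by rewrite /T -mulrA ff0.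
have rT : r0 * T = T by rewrite /T !mulrA rr0.
pose p := star w * w.
have pf : p * f0 = p.
  apply: bop_ext => u; have : p (u - f0 u) = 0.
    by apply/wk; rewrite bfB -bM Tf subrr.
  by rewrite bfB => /eqP; rewrite subr_eq0 => /eqP.
have fp : f0 * p = p by apply: le_mull pf => //; exact: pw.1.
have rw0 : r0 * w = w.
  rewrite -[in LHS](pi_mul' pw) wr mulrA prj_fix -?wr ?pi_mul' // => _ [u _ <-].
  by rewrite -bM rT.
have f0S (q : H * H) : S q -> f0 q.1 = 0.
  by move=> Sq; rewrite bB (frS _ Sq).1 vv prj_S ?subrr //; exists q.
have r0S (q : H * H) : S q -> r0 q.2 = 0.
  by move=> Sq; rewrite bB (frS _ Sq).2 vv' prj_S ?subrr //; exists q.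
have c1 (q : H * H) u : S q -> ip q.1 (p u) = 0 /\ ip (im q.1) (p u) = 0.
  by move=> Sq; rewrite -fp bM -!(symE sf0) bfi f0S // /im scaler0 ip0l.
have c2 (q : H * H) u : S q -> ip q.2 (w u) = 0 /\ ip (im q.2) (w u) = 0.
  by move=> Sq; rewrite -rw0 bM -!(symE sr0) bfi r0S // /im scaler0 ip0l.
have pp u u' : ip (p u) (p u') = ip (w u) (w u').
  by rewrite (symE pw.1) -bM pw.2 bM -ip_star.
pose S' := S `|` [set (p u, w u) | u in setT].
suff nP : ~ (S `<` S').
  apply: contrapT => T0; apply: nP; split; first by move=> q; left.
  move=> sub; apply: T0; apply: bop_ext => u; rewrite b0 -/T; apply/wk.
  have /f0S : S (p u, w u) by apply: sub; right; exists u.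
  by move=> e; have : f0 (p u) = 0 := e; rewrite -bM fp.
move=> /maxS; apply; split.
- move=> q q' [Sq|[u _ <-]] [Sq'|[u' _ <-]].
  + exact: gS.
  + by have [-> ->] := c1 _ u' Sq; have [-> ->] := c2 _ u' Sq.
  + have [e1 e2] := c1 _ u Sq'; have [e3 e4] := c2 _ u Sq'.
    by move: e1 e2 e3 e4 => /= e1 e2 e3 e4; rewrite !ip_iml !(ipC (bf w u)) ipC e1 e3 ipC e2 e4.
  + by split; [exact: pp|rewrite -!bfi; exact: pp].
- move=> q [Sq|[u _ <-]]; first exact: frS.
  by rewrite -[(_, _).1]/(p u) -[(_, _).2]/(w u) -!bM; split; [rewrite -fp mulrA fF0|rewrite -rw0 mulrA rR0].
- move=> y cy q [Sq|[u _ <-]]; first by left; exact: stS.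
  have Ap : A p by apply: vnaM => //; exact: vna_star.
  have e1 : p (y u) = y (p u) by rewrite -!bM (cy _ Ap).
  have e2 : w (y u) = y (w u) by rewrite -!bM (cy _ Aw).
  by right; exists (y u) => //; rewrite e1 e2.
Qed.

Definition finp f := proj A f /\ forall w, A w -> star w * w = f -> f * w = w -> w * star w = f.
Definition pinf := forall z, cproj A z -> finp z -> z = 0.

(** An isometry [w] of the corner of [g] extends by the identity on [f - g] to one of the corner of
    [f]. *)
Lemma finp_sub f g : finp f -> proj A g -> f * g = g -> finp g.
Proof.
move=> [[Af [sf ff]] hf] [Ag [sg gg]] fg; split=> // w Aw wg gw.
have gf : g * f = g by exact: le_mulr.
have wg' : w * g = w by rewrite -wg pi_mul // wg.
have gw' : star w * g = star w by rewrite -[LHS]starK starM starK sg gw.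
have Afg : A (f - g) by exact: vnaB.
have e1 : (f - g) * w = 0 by rewrite mulrBl gw -{1}gw mulrA fg gw subrr.
have e2 : star w * (f - g) = 0.
  by rewrite -gw' -mulrA mulrBr gf gg subrr mulr0.
have e3 : w * (f - g) = 0 by rewrite -wg' -mulrA mulrBr gf gg subrr mulr0.
have e4 : (f - g) * star w = 0.
  by rewrite -[LHS]starK starM starK starB sf sg e3 star0.
have e5 : (f - g) * (f - g) = f - g.
  by rewrite mulrBr !mulrBl ff fg gf gg subrr subr0.
have sfg : sym (f - g) by exact: symB.
have WW : star (w + (f - g)) * (w + (f - g)) = f.
  by rewrite starD sfg mulrDl !(mulrDr _ w) wg e1 e2 e5 addr0 add0r addrC subrK.
have fW : f * (w + (f - g)) = w + (f - g).
  by rewrite mulrDr mulrBr ff fg -[in LHS]gw mulrA fg gw.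
have := hf _ (vnaD hA Aw Afg) WW fW.
rewrite starD sfg mulrDl !(mulrDr _ (star w)) e3 e4 e5 addr0 add0r.
by move=> /(canRL (addrK _)) ->; rewrite opprB addrC subrK.
Qed.

Lemma proj_pi v : A v -> isproj (star v * v) -> proj A (star v * v) /\ proj A (v * star v).
Proof.
move=> Av h; have As := vna_star hA Av.
by split; split=> //; [exact: vnaM|exact: vnaM|exact: pi_star].
Qed.
End Compare.

(** * Cuntz isometries *)

Section Cuntz.
Variables (R : realType) (H : hilbertSpace R).
Implicit Types (x y z p q w f r s t v : bop H).
Variable A : set (bop H).
Hypothesis hA : vna A.

Definition T3 := (H * (H * H))%type.
Definition d3 (S : set T3) : set H := [set e.1 | e in S].
Definition g3 (e e' : T3) := [/\ ip e.2.1 e'.2.1 = ip e.1 e'.1, ip e.2.2 e'.2.2 = ip e.1 e'.1,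
  ip e.2.1 e'.2.2 = 0 & ip e.2.2 e'.2.1 = 0].
Definition i3 (e : T3) : T3 := (im e.1, (im e.2.1, im e.2.2)).
(** Sets of triples (u, v, w) such that u -> v and u -> w define partial
    isometries in A with orthogonal ranges contained in their common domain. *)
Definition P3 (S : set T3) := [/\ forall e e', S e -> S e' -> g3 e e' /\ g3 (i3 e) e',
  forall e, S e -> oc (oc (d3 S)) e.2.1 /\ oc (oc (d3 S)) e.2.2 &
  forall y, cm A y -> forall e, S e -> S (y e.1, (y e.2.1, y e.2.2))].

Lemma P3_max : exists S, P3 S /\ forall B, S `<` B -> ~ P3 B.
Proof.
apply: Zorn_bigcup => F FP tF; split.
- move=> e e' [X FX Xe] [Y FY Ye].
  by case: (tF _ _ FX FY) => XY; [have [g _ _] := FP _ FY|have [g _ _] := FP _ FX];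
    apply: g => //; exact: XY.
- move=> e [X FX Xe]; have [_ h _] := FP _ FX; have [h1 h2] := h _ Xe.
  have sub : d3 X `<=` d3 (\bigcup_(Z in F) Z) by move=> _ [a Xa <-]; exists a => //; exists X.
  by split; [apply: oc_sub h1|apply: oc_sub h2]; exact: oc_sub.
- by move=> y cy e [X FX Xe]; have [_ _ h] := FP _ FX; exists X => //; exact: h.
Qed.

Lemma P3_ops S : P3 S -> exists s t, [/\ A s /\ A t, star s * s = prj (d3 S),
   star t * t = prj (d3 S), prj (d3 S) * s = s /\ prj (d3 S) * t = t & star s * t = 0].
Proof.
move=> [gS dS stS]; pose S1 : set (H * H) := [set (e.1, e.2.1) | e in S].
pose S2 : set (H * H) := [set (e.1, e.2.2) | e in S].
have D1 : domS S1 = d3 S.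
  by apply/seteqP; split=> [_ [_ [e Se <-] <-]|_ [e Se <-]]; [exists e|exists (e.1, e.2.1) => //; exists e].
have D2 : domS S2 = d3 S.
  by apply/seteqP; split=> [_ [_ [e Se <-] <-]|_ [e Se <-]]; [exists e|exists (e.1, e.2.2) => //; exists e].
have [||s [As sS ss ss']] := @vna_pi _ _ A hA S1.
- by move=> _ _ [e Se <-] [e' Se' <-] /=; have [[-> _ _ _] [-> _ _ _]] := gS _ _ Se Se'.
- by move=> y cy _ [e Se <-]; exists (y e.1, (y e.2.1, y e.2.2)) => //; exact: stS.
have [||t [At tS tt tt']] := @vna_pi _ _ A hA S2.
- by move=> _ _ [e Se <-] [e' Se' <-] /=; have [[_ -> _ _] [_ -> _ _]] := gS _ _ Se Se'.
- by move=> y cy _ [e Se <-]; exists (y e.1, (y e.2.1, y e.2.2)) => //; exact: stS.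
rewrite D1 in ss; rewrite D2 in tt.
have ps : isproj (star s * s) by rewrite ss; exact: isprj.
have pt : isproj (star t * t) by rewrite tt; exact: isprj.
exists s, t; split=> //.
  split.
    rewrite -[in LHS](pi_mul' ps) ss' mulrA prj_fix -?ss' ?pi_mul' // => _ [_ [e Se <-] <-].
    by apply: prj_id; have [] := dS _ Se.
  rewrite -[in LHS](pi_mul' pt) tt' mulrA prj_fix -?tt' ?pi_mul' // => _ [_ [e Se <-] <-].
  by apply: prj_id; have [] := dS _ Se.
rewrite -(pi_mul' pt) tt' mulrA prj_kill ?mul0r // => _ [_ [e Se <-] <-].
apply: ip_ext => u; rewrite ip_starl ip0l.
have [] : ip (s u) e.2.2 = 0 /\ ip (im (s u)) e.2.2 = 0; last by rewrite ipC.
suff : oc (oc (ranS S1)) (s u).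
  move=> /(_ e.2.2) h; rewrite ipC (ipC (im (s u))).
  have [|h1 h2] := h _.
    move=> _ [_ [e' Se' <-] <-] /=.
    by have [[_ _ -> _] [_ _ /= -> _]] := gS _ _ Se' Se.
  by split=> //; move: h2; rewrite !ip_iml; lra.
by apply: fix_of_prj; rewrite -ss' -bM pi_mul'.
Qed.

(** [p] is wandering for [v]: the powers of [v] carry it onto mutually orthogonal copies. *)
Lemma shift_orth v p f : isproj p -> isproj f -> star v * v = f -> f * v = v -> star v * p = 0 ->
  f * p = p -> forall n m (u u' : H), p u = u -> p u' = u' ->
  ip ((v ^+ n) u) ((v ^+ m) u') = if n == m then ip u u' else 0.
Proof.
move=> pp pf vv fv vp fp.
have fX n (u : H) : p u = u -> f ((v ^+ n) u) = (v ^+ n) u.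
  case: n => [|n] pu; first by rewrite expr0 b1 -pu -bM fp.
  by rewrite exprS bM -bM fv.
have base n (u u' : H) : p u = u -> ip u ((v ^+ n.+1) u') = 0.
  by move=> pu; rewrite exprS bM -ip_starl -pu -bM vp b0 ip0l.
elim=> [|n IH] [|m] u u' pu pu' //; first by rewrite base.
  by rewrite ipC base.
by rewrite !exprS !bM -ip_starl -bM vv fX // IH // eqSS.
Qed.

(** Were the leftover [f] infinite, an isometry [v] of [f] that is not onto would have a wandering
    projection, and the triples of [v^n u], [v^(2n) u], [v^(2n+1) u] would enlarge [S]. *)
Lemma max_finite S : P3 S -> (forall B, S `<` B -> ~ P3 B) -> finp A (1 - prj (d3 S)).
Proof.
move=> PS maxS; have [gS dS stS] := PS.
set r := prj (d3 S); set f := 1 - r.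
have Ar : A r by apply: (vna_prj hA) => y cy _ [e Se <-]; exists (y e.1, (y e.2.1, y e.2.2)) => //; exact: stS.
have pr : isproj r := isprj _; have pf : isproj f := isprojC pr.
have Af : A f by apply: (vnaB hA) => //; exact: vna1.
have rf0 : r * f = 0 by rewrite mulrBr mulr1 pr.2 subrr.
have fr0 : f * r = 0 by rewrite mulrBl mul1r pr.2 subrr.
clearbody f.
split=> // v Av vv fv.
have pv : isproj (star v * v) by rewrite vv.
have q := pi_star pv; set Q := v * star v in q *.
have fQ : f * Q = Q by rewrite /Q mulrA fv.
pose p := f - Q.
have Qf : Q * f = Q := le_mulr pf.1 q.1 fQ.
have pp : isproj p.
  by split; [apply: symB; [exact: pf.1|exact: q.1]|rewrite mulrBr !mulrBl pf.2 fQ Qf q.2 subrr subr0].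
have vQ : star v * Q = star v.
  by apply: star_inj; rewrite /Q !starM !starK pi_mul'.
have vp : star v * p = 0.
  rewrite mulrBr vQ; apply: star_inj; rewrite star0 starB starM starK pf.1 fv.
  exact: subrr.
have fp : f * p = p by rewrite mulrBr pf.2 fQ.
have sh := shift_orth pp pf vv fv vp fp.
apply/eqP; rewrite eq_sym -subr_eq0; apply/eqP/(isproj_eq0 pp) => xi pxi.
apply: contrapT => xi0.
pose N : set T3 := [set e | exists n u, p u = u /\
  e = ((v ^+ n) u, ((v ^+ n.*2) u, (v ^+ n.*2.+1) u))].
have fX n (u : H) : p u = u -> f ((v ^+ n) u) = (v ^+ n) u.
  case: n => [|n] pu; first by rewrite expr0 b1 -pu -bM fp.
  by rewrite exprS bM -bM fv.
have orth (a b : H) : r a = a -> f b = b -> ip a b = 0.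
  by move=> <- <-; rewrite (symE pr.1) -bM rf0 b0 ip0r.
have orth' (a b : H) : f a = a -> r b = b -> ip a b = 0 by move=> *; rewrite ipC orth.
have rS e : S e -> [/\ r e.1 = e.1, r e.2.1 = e.2.1 & r e.2.2 = e.2.2].
  by move=> Se; have [h1 h2] := dS _ Se; split; apply: prj_id => //; apply: oc2; exists e.
have rS' e : S e -> [/\ r (im e.1) = im e.1, r (im e.2.1) = im e.2.1 & r (im e.2.2) = im e.2.2].
  by move=> /rS[h1 h2 h3]; rewrite !bfi h1 h2 h3.
have fN e : N e -> [/\ f e.1 = e.1, f e.2.1 = e.2.1 & f e.2.2 = e.2.2].
  by move=> [n [u [pu ->]]]; split; apply: fX.
have iN e : N e -> N (i3 e).
  by move=> [n [u [pu ->]]]; exists n, (im u); split; [rewrite bfi pu|rewrite /i3 /= !bfi].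
have NN e e' : N e -> N e' -> g3 e e'.
  move=> [n [u [pu ->]]] [m [u' [pu' ->]]]; split; rewrite /= !sh //.
  - by rewrite -!muln2 eqn_mul2r.
  - by rewrite eqSS -!muln2 eqn_mul2r.
  - by case: eqP => // /(congr1 odd); rewrite /= !odd_double.
  - by case: eqP => // /(congr1 odd); rewrite /= !odd_double.
have SN e e' : [/\ r e.1 = e.1, r e.2.1 = e.2.1 & r e.2.2 = e.2.2] -> N e' -> g3 e e'.
  by move=> [h1 h2 h3] /fN[k1 k2 k3]; split; rewrite !orth.
have NS e e' : N e -> [/\ r e'.1 = e'.1, r e'.2.1 = e'.2.1 & r e'.2.2 = e'.2.2] -> g3 e e'.
  by move=> /fN[k1 k2 k3] [h1 h2 h3]; split; rewrite !orth'.
apply: (maxS (S `|` N)).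
  split; first by move=> e; left.
  move=> sub; apply: xi0.
  have Nx : N (xi, ((v ^+ 0.*2) xi, (v ^+ 0.*2.+1) xi)) by exists 0, xi.
  have [rx _ _] := rS _ (sub _ (or_intror Nx)); have [fx _ _] := fN _ Nx.
  have {}rx : r xi = xi := rx; have {}fx : f xi = xi := fx.
  by rewrite -fx -rx -bM fr0 b0.
have dsub : oc (oc (d3 S)) `<=` oc (oc (d3 (S `|` N))).
  by apply: oc_sub; apply: oc_sub => _ [e Se <-]; exists e => //; left.
split.
- move=> e e' [Se|Ne] [Se'|Ne'].
  + exact: gS.
  + by split; apply: SN => //; [exact: rS|exact: rS'].
  + by split; apply: NS => //; [exact: rS|exact: iN|exact: rS].
  + by split; apply: NN => //; exact: iN.
- move=> e [Se|Ne]; first by have [h1 h2] := dS _ Se; split; exact: dsub.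
  case: Ne => n [u [pu ->]]; split; apply: oc2; last first.
    exists ((v ^+ n.*2.+1) u, ((v ^+ n.*2.+1.*2) u, (v ^+ n.*2.+1.*2.+1) u)) => //.
    by right; exists n.*2.+1, u.
    exists ((v ^+ n.*2) u, ((v ^+ n.*2.*2) u, (v ^+ n.*2.*2.+1) u)) => //.
  by right; exists n.*2, u.
- move=> y cy e [Se|[n [u [pu ->]]]]; first by left; exact: stS.
  right; exists n, (y u).
  have Ap : A p by apply: (vnaB hA) => //; apply: (vnaM hA) => //; exact: vna_star.
  have yv k : y ((v ^+ k) u) = (v ^+ k) (y u) by rewrite -!bM cy //; exact: vnaX.
  by rewrite -bM -(cy _ Ap) bM pu !yv.
Qed.

(** Maximal triples halve a projection [r] with finite complement [f]. Comparing [f] with [r] splits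
    the centre: over [z] the whole of [f] fits into [r]; over [z'] the projection [r] fits into [f],
    is finite as well as halved, hence 0, and proper infiniteness excludes [z']. *)
Lemma cuntz : pinf A -> exists s1 s2, [/\ A s1 /\ A s2, star s1 * s1 = 1, star s2 * s2 = 1 &
  star s1 * s2 = 0].
Proof.
move=> infA; have [S [PS maxS]] := P3_max.
have := max_finite PS maxS; have [s [t [[As At] ss tt [rs rt] st]]] := P3_ops PS.
move: ss tt rs rt; set r := prj _ => ss tt rs rt; set f := 1 - r => finf.
have fE : r + f = 1 by rewrite /f addrC subrK.
have pr : proj A r by split; [rewrite -ss; apply: (vnaM hA) => //; exact: vna_star|exact: isprj].
clearbody f r.
have [v [Av pv fv rv kv]] := compare hA finf.1 pr.
have [pv1 pv2] := proj_pi hA Av pv.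
set r0 := r - v * star v in kv.
have rv' : r * (v * star v) = v * star v by rewrite mulrA rv.
have Ar0 : A r0 by apply: (vnaB hA); [exact: pr.1|exact: pv2.1].
have sr0 : sym r0 by apply: symB; [exact: pr.2.1|exact: pv2.2.1].
pose z := cs A r0.
have cz : cproj A z by exact: cs_cproj.
have f0z : (f - star v * v) * z = 0.
  apply: cs_kill => // x Ax; apply: star_inj; rewrite star0 !starM (starB f).
  by rewrite finf.1.2.1 pv.1 sr0 mulrA; apply: kv; exact: vna_star.
have zr0 : z * r0 = r0 by exact: cs_mul.
pose z' := 1 - z; have cz' : cproj A z' by exact: cprojC.
have z'r0 : z' * r0 = 0 by rewrite mulrBl mul1r zr0 subrr.
have z'r : z' * r = z' * (v * star v).
  by apply/eqP; rewrite -subr_eq0 -mulrBr z'r0.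
have zE : z + z' = 1 by rewrite addrC subrK.
clearbody z'.
have zc x : A x -> z' * x = x * z' by exact: (cproj_c cz').
have zz : z' * z' = z' by exact: (cproj_i cz').
have Az' : A z' by exact: (cproj_A cz').
have Avs : A (star v) by exact: vna_star.
have Ass : A (star s) by exact: vna_star.
have vr : star v * r = star v by rewrite -[LHS]starK starM starK pr.2.1 rv.
have rss : star s * r = star s by rewrite -[LHS]starK starM starK pr.2.1 rs.
have sr : s * r = s by rewrite -ss pi_mul // ss; exact: pr.2.
have vv' : star v * v * star v = star v by apply: star_inj; rewrite !starM starK mulrA pi_mul'.
have k0 : v * star v * z' = r * z' by rewrite -(zc _ pv2.1) -z'r (zc _ pr.1).
have k1 x : v * (star v * (z' * x)) = r * (z' * x).
  by rewrite (mulrA v) (mulrA (v * star v)) k0 -mulrA.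
(* Over [z'] the map [s] conjugated by [v] is an isometry of a finite corner, hence onto; this
   leaves no room for the range of [t]. *)
have z't : z' * t = 0.
  pose g := z' * (star v * v).
  have Ag : A g by apply: (vnaM hA) => //; exact: pv1.1.
  have pg : proj A g.
    by split=> //; apply: isprojM; [exact: (cproj_is cz')|exact: pv|apply: zc; exact: pv1.1].
  have fing : finp A g.
    by apply: (finp_sub hA finf pg); rewrite /g (zc _ pv1.1) mulrA fv.
  pose w := star v * (s * (v * z')).
  have Aw : A w by apply: (vnaM hA) => //; apply: (vnaM hA) => //; exact: (vnaM hA).
  have Asv : A (s * v) by exact: (vnaM hA).
  have wz : w = star v * (z' * (s * v)) by rewrite /w (zc _ Asv) !mulrA.
  have sw : star w = star v * (star s * (v * z')).
    rewrite wz !starM starK (cproj_s cz') -!mulrA; congr (_ * (_ * _)).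
    by rewrite (zc _ Av).
  have Asv' : A (star s * v) by exact: (vnaM hA).
  have sw' : star w = star v * (z' * (star s * v)) by rewrite sw (zc _ Asv') !mulrA.
  have ww : star w * w = g.
    rewrite sw wz -!mulrA (mulrA z' (star v)) (zc _ Avs) -(mulrA (star v) z') (mulrA z' z') zz k1.
    rewrite (mulrA r) -(zc _ pr.1) -mulrA (mulrA r) rs (mulrA (star s)) -(zc _ Ass).
    rewrite -(mulrA z') (mulrA (star s)) ss rv /g.
    by rewrite mulrA -(zc _ Avs) -mulrA.
  have gw : g * w = w.
    have -> : g * w = z' * (star v * v * star v) * (s * (v * z')) by rewrite /g /w !mulrA.
    rewrite vv' -mulrA -/w wz (mulrA z') (zc _ Avs) -mulrA (mulrA z' z') zz.
    by [].
  have := fing.2 w Aw ww gw.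
  have -> : w * star w = z' * (star v * (s * star s) * v).
    rewrite /w sw' -!mulrA (mulrA z' (star v)) (zc _ Avs) -(mulrA (star v) z') (mulrA z' z') zz k1.
    by rewrite (mulrA s r) sr (mulrA s z') -(zc _ As) -mulrA (mulrA (star v) z') -(zc _ Avs) -!mulrA.
  rewrite /g => /esym/eqP; rewrite -subr_eq0 -mulrBr => /eqP e0.
  have e1 : z' * (r - s * star s) = 0.
    have : v * (z' * (star v * v - star v * (s * star s) * v)) * star v = 0.
      by rewrite e0 mulr0 mul0r.
    have -> : star v * v - star v * (s * star s) * v = star v * (r - s * star s) * v.
      by rewrite mulrBr mulrBl vr.
    have Ax : A (r - s * star s) by apply: (vnaB hA); [exact: pr.1|exact: (vnaM hA)].
    have e2 : v * (z' * (star v * (r - s * star s) * v)) * star v =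
       z' * (v * star v) * (r - s * star s) * (v * star v).
      by rewrite (mulrA v) -(zc _ Av) -!mulrA.
    rewrite e2; set X := r - _ in Ax *.
    have rX : r * X = X by rewrite mulrBr pr.2.2 mulrA rs.
    have Xr : X * r = X by rewrite mulrBl pr.2.2 -mulrA rss.
    by rewrite -z'r -(mulrA z' r) rX (zc _ Ax) -mulrA -z'r mulrA -(zc _ Ax) -mulrA Xr.
  rewrite -rt mulrA; have -> : z' * r = z' * (s * star s).
    by apply/eqP; rewrite -subr_eq0 -mulrBr e1.
  by rewrite -!mulrA st !mulr0.
have z'r_0 : z' * r = 0.
  by rewrite -tt mulrA (zc _ (vna_star hA At)) -mulrA z't mulr0.
have fz' : f * z' = z' by rewrite -[RHS]mul1r -fE mulrDl -(zc _ pr.1) z'r_0 add0r.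
have fin_z' : finp A z' by apply: (finp_sub hA finf) => //; exact: cz'.1.
have z'0 : z' = 0 by exact: infA.
have z1 : z = 1 by rewrite -zE z'0 addr0.
move: f0z; rewrite z1 mulr1 => /eqP; rewrite subr_eq0 => /eqP fvv.
(* [v] now carries all of [f] into [r], so [m] is an isometry from 1 into [r], and [s m], [t m] have
   orthogonal ranges. *)
pose m := s + t * v.
have Am : A m by apply: (vnaD hA) => //; exact: (vnaM hA).
have ts : star t * s = 0 by apply: star_inj; rewrite starM starK st star0.
have mm : star m * m = 1.
  rewrite /m starD starM mulrDl !mulrDr ss -(mulrA (star v)) ts mulr0 add0r.
  by rewrite mulrA st mul0r addr0 -(mulrA (star v)) (mulrA (star t)) tt rv -fvv.
have rm : r * m = m by rewrite mulrDr rs mulrA rt.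
exists (s * m), (t * m); split.
- by split; exact: (vnaM hA).
- by rewrite starM -mulrA (mulrA (star s)) ss rm.
- by rewrite starM -mulrA (mulrA (star t)) tt rm.
- by rewrite starM -mulrA (mulrA (star s)) st mul0r mulr0.
Qed.

End Cuntz.

(** * Invariant forms *)

Section Beta.
Variables (R : realType) (H K : hilbertSpace R).
Implicit Types (x y z p r s t a b : bop H) (u v : K).
Variables (A : set (bop H)) (B : set (bop K)).
Hypotheses (hA : vna A) (hB : vna B).
Variables (s1 s2 : bop H).
Hypotheses (As1 : A s1) (As2 : A s2) (s11 : star s1 * s1 = 1) (s22 : star s2 * s2 = 1)
  (s12 : star s1 * s2 = 0).
Variables (P : bop H -> bop K) (w : bop K) (C : R).
Hypotheses (cw : cproj B w) (C0 : 0 < C).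
Hypothesis PB : forall x, A x -> B (P x).
Hypothesis PD : forall x y, A x -> A y -> P (x + y) = P x + P y.
Hypothesis PM : forall x y, A x -> A y -> P (x * y) = P x * P y.
Hypothesis P1 : P 1 = w.
Hypothesis Pb : forall x, A x -> nle x 1 -> nle (P x) C.

Let A1 : A 1. Proof. exact: vna1. Qed.
Lemma P_0 : P 0 = 0.
Proof.
have := PD (vna0 hA) (vna0 hA); rewrite addr0 => /eqP.
by rewrite -subr_eq0 opprD addrA subrr add0r oppr_eq0 => /eqP.
Qed.
Lemma P_N x : A x -> P (- x) = - P x.
Proof.
move=> Ax; apply/eqP; rewrite -subr_eq0 opprK -PD ?addNr ?P_0 //.
exact: (vnaN hA).
Qed.
Lemma P_B x y : A x -> A y -> P (x - y) = P x - P y.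
Proof. by move=> Ax Ay; rewrite PD ?P_N //; exact: (vnaN hA). Qed.
Lemma P_w x : A x -> P x * w = P x. Proof. by move=> Ax; rewrite -P1 -PM // mulr1. Qed.
Lemma w_P x : A x -> w * P x = P x. Proof. by move=> Ax; rewrite -P1 -PM // mul1r. Qed.

Let s21 : star s2 * s1 = 0.
Proof. by apply: star_inj; rewrite starM starK s12 star0. Qed.
(** The ranges of [s1] and [s2] need not span; this is the defect projection. *)
Definition e0 : bop H := 1 - s1 * star s1 - s2 * star s2.
Let Ast1 : A (star s1). Proof. exact: vna_star. Qed.
Let Ast2 : A (star s2). Proof. exact: vna_star. Qed.
Let Ae0 : A e0.
Proof. by do 2?apply: (vnaB hA) => //; exact: (vnaM hA). Qed.
Let sym_e0 : sym e0.
Proof. by do 2?apply: symB; [exact: sym1|rewrite /sym starM starK|rewrite /sym starM starK]. Qed.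
Let e0s1 : e0 * s1 = 0.
Proof. by rewrite !mulrBl mul1r -!mulrA s11 s21 mulr1 mulr0 subrr subr0. Qed.
Let e0s2 : e0 * s2 = 0.
Proof. by rewrite !mulrBl mul1r -!mulrA s22 s12 mulr1 mulr0 subr0 subrr. Qed.
Let s1e0 : star s1 * e0 = 0.
Proof. by rewrite -[LHS]starK starM starK sym_e0 e0s1 star0. Qed.
Let s2e0 : star s2 * e0 = 0.
Proof. by rewrite -[LHS]starK starM starK sym_e0 e0s2 star0. Qed.
Let e0e0 : e0 * e0 = e0.
Proof. by rewrite {1}/e0 !mulrBl mul1r -!mulrA s1e0 s2e0 !mulr0 !subr0. Qed.
Let e0E : e0 + s1 * star s1 + s2 * star s2 = 1.
Proof. by rewrite /e0 addrAC subrK subrK. Qed.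

(** Partial isometries whose supports are orthogonal with sum 1: right multiplication by [star s1]
    and [star s2] places two copies of the previous decomposition under the two ranges, and [e0]
    fills the defect. *)
Fixpoint gl (m : nat) : seq (bop H) :=
  if m is m.+1 then e0 :: [seq a * star s1 | a <- gl m] ++ [seq a * star s2 | a <- gl m] else [:: 1].

Lemma gl_iso m a : a \in gl m -> A a /\ isproj (star a * a).
Proof.
elim: m a => [|m IH] a /=.
  by rewrite inE => /eqP ->; split=> //; rewrite star1 mulr1; exact: isproj1.
rewrite inE mem_cat => /orP[/eqP ->|/orP[/mapP[b bm ->]|/mapP[b bm ->]]].
- by split=> //; rewrite sym_e0 e0e0; split.
- have [Ab [sb bb]] := IH _ bm; split; first exact: (vnaM hA).
  split; first exact: sym_star.
  have -> : star (b * star s1) * (b * star s1) * (star (b * star s1) * (b * star s1)) =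
      s1 * (star b * b) * (star s1 * s1) * (star b * b) * star s1 by rewrite starM starK !mulrA.
  by rewrite s11 mulr1 -(mulrA s1) bb starM starK !mulrA.
- have [Ab [sb bb]] := IH _ bm; split; first exact: (vnaM hA).
  split; first exact: sym_star.
  have -> : star (b * star s2) * (b * star s2) * (star (b * star s2) * (b * star s2)) =
      s2 * (star b * b) * (star s2 * s2) * (star b * b) * star s2 by rewrite starM starK !mulrA.
  by rewrite s22 mulr1 -(mulrA s2) bb starM starK !mulrA.
Qed.

(** All signed sums of the list. For the supports [pl m] they are symmetric unitaries, hence
    contractions to which the bound on [P] applies. *)
Fixpoint Sg (ps : seq (bop H)) : set (bop H) :=
  if ps is p :: ps then [set U | exists2 V, Sg ps V & U = V + p \/ U = V - p] else [set 0].

Lemma Sg_cat ps qs U : Sg (ps ++ qs) U -> exists V W, [/\ Sg ps V, Sg qs W & U = V + W].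
Proof.
elim: ps U => [|p ps IH] U /=; first by exists 0, U; rewrite add0r.
move=> [V /IH[V1 [W [h1 h2 ->]]] [->|->]].
  by exists (V1 + p), W; split=> //; [exists V1 => //; left|rewrite addrAC].
by exists (V1 - p), W; split=> //; [exists V1 => //; right|rewrite addrAC].
Qed.

Lemma Sg_map x y ps U : Sg [seq x * p * y | p <- ps] U -> exists2 V, Sg ps V & U = x * V * y.
Proof.
elim: ps U => [|p ps IH] U /=; first by move=> ->; exists 0 => //; rewrite mulr0 mul0r.
move=> [V /IH[V1 h1 ->] [->|->]].
  by exists (V1 + p); [exists V1 => //; left|rewrite mulrDr mulrDl].
by exists (V1 - p); [exists V1 => //; right|rewrite mulrBr mulrBl].
Qed.

Definition pl (m : nat) : seq (bop H) := [seq star a * a | a <- gl m].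

Lemma plS m : pl m.+1 = e0 :: [seq s1 * p * star s1 | p <- pl m] ++ [seq s2 * p * star s2 | p <- pl m].
Proof.
rewrite /pl /= sym_e0 e0e0 map_cat -!map_comp; congr (_ :: _ ++ _); apply: eq_map => a /=;
  by rewrite starM starK !mulrA.
Qed.

Lemma Sg_unit m U : Sg (pl m) U -> [/\ A U, sym U & U * U = 1].
Proof.
elim: m U => [|m IH] U.
  rewrite /pl /= star1 mulr1 => -[V -> [->|->]]; rewrite ?add0r ?sub0r.
    by split=> //; [exact: sym1|rewrite mulr1].
  by split; [exact: (vnaN hA)|apply: symN; exact: sym1|rewrite mulrNN mulr1].
rewrite plS => -[V /Sg_cat[V1 [V2 [/Sg_map[U1 /IH[A1' y1 i1] ->] /Sg_map[U2 /IH[A2 y2 i2] ->] ->]]]].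
have AA : A (s1 * U1 * star s1 + s2 * U2 * star s2) by apply: (vnaD hA); do 2!apply: (vnaM hA) => //.
set X := _ + _ in AA *.
have sX : sym X by rewrite /sym starD !starM !starK y1 y2 !mulrA.
have XX : X * X = s1 * star s1 + s2 * star s2.
  rewrite /X mulrDl !mulrDr -!mulrA (mulrA (star s1) s1) (mulrA (star s1) s2) (mulrA (star s2) s1)
    (mulrA (star s2) s2) s11 s12 s21 s22 !mul1r !mul0r !mulr0 add0r addr0.
  by rewrite (mulrA U1) i1 (mulrA U2) i2 !mul1r.
have Xe : X * e0 = 0 by rewrite mulrDl -!mulrA s1e0 s2e0 !mulr0 addr0.
have eX : e0 * X = 0 by rewrite mulrDr !mulrA e0s1 e0s2 !mul0r addr0.
have E : s1 * star s1 + s2 * star s2 + e0 = 1 by rewrite addrC addrA e0E.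
clearbody X; case=> ->; split.
- exact: (vnaD hA).
- exact: symD.
- by rewrite (mulrDl X e0) (mulrDr X X e0) (mulrDr e0 X e0) XX Xe eX e0e0 addr0 add0r.
- exact: (vnaB hA).
- exact: symB.
- by rewrite (mulrBl _ X e0) (mulrBr X X e0) (mulrBr e0 X e0) XX Xe eX e0e0 subr0 sub0r opprK.
Qed.

(** The signs are chosen one by one so that each cross term has the favourable sign; this stands in
    for an average over all signs. *)
Lemma Sg_up ps u : (forall p, p \in ps -> A p) ->
  exists2 U, Sg ps U & A U /\ \sum_(p <- ps) n2 (P p u) <= n2 (P U u).
Proof.
elim: ps => [|p ps IH] h; first by exists 0 => //; rewrite big_nil n2_ge0; split=> //; exact: vna0.
have [|U SU [AU le]] := IH; first by move=> q qp; apply: h; rewrite inE qp orbT.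
have Ap : A p by apply: h; rewrite inE eqxx.
rewrite big_cons; have [c|c] := leP 0 (ip (P U u) (P p u)).
  exists (U + p); first by exists U => //; left.
  by split; [exact: (vnaD hA)|rewrite PD // bD n2D; lra].
exists (U - p); first by exists U => //; right.
by split; [exact: (vnaB hA)|rewrite P_B // bB n2B; lra].
Qed.

Lemma Sg_lo ps u : (forall p, p \in ps -> A p) ->
  exists2 U, Sg ps U & A U /\ n2 (P U u) <= \sum_(p <- ps) n2 (P p u).
Proof.
elim: ps => [|p ps IH] h.
  by exists 0 => //; rewrite big_nil P_0 b0 n20; split=> //; exact: vna0.
have [|U SU [AU le]] := IH; first by move=> q qp; apply: h; rewrite inE qp orbT.
have Ap : A p by apply: h; rewrite inE eqxx.
rewrite big_cons; have [c|c] := leP (ip (P U u) (P p u)) 0.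
  exists (U + p); first by exists U => //; left.
  by split; [exact: (vnaD hA)|rewrite PD // bD n2D; lra].
exists (U - p); first by exists U => //; right.
by split; [exact: (vnaB hA)|rewrite P_B // bB n2B; lra].
Qed.

Definition QS m u : R := \sum_(a <- gl m) n2 (P a u).

Lemma QS_ge0 m u : 0 <= QS m u.
Proof. by rewrite /QS; apply: sumr_ge0 => a _; exact: n2_ge0. Qed.

Lemma pl_A m p : p \in pl m -> A p.
Proof. by move=> /mapP[a /gl_iso[Aa _] ->]; apply: (vnaM hA) => //; exact: vna_star. Qed.

Lemma iso_nle a : isproj (star a * a) -> nle a 1.
Proof.
move=> h u; have := isproj_nle h u; have := isproj_ip u h; rewrite bM ip_starl -/(n2 _) => ->.
by [].
Qed.

Lemma unit_nle (U : bop H) : sym U -> U * U = 1 -> nle U 1.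
Proof. by move=> s i u; rewrite mul1r /n2 symE // -bM i b1. Qed.

(** Since [a] is [a] times its support, one factor [C] reduces to the sum over supports; a single
    signed sum dominates that sum and costs the other factor. *)
Lemma QS_le m u : QS m u <= C * C * n2 u.
Proof.
have [U /Sg_unit[AU sU UU] [_ le]] := Sg_up u (@pl_A m).
have h1 : QS m u <= C * \sum_(p <- pl m) n2 (P p u).
  rewrite /QS /pl big_map mulr_sumr !big_seq; apply: ler_sum => a /gl_iso[Aa pa].
  rewrite -{1}(pi_mul pa) PM ?bM; last 2 first.
  - by [].
  - by apply: (vnaM hA) => //; exact: vna_star.
  by apply: Pb => //; exact: iso_nle.
apply: le_trans h1 _; rewrite -mulrA ler_pM2l //; apply: le_trans le _.
by apply: Pb => //; exact: unit_nle.
Qed.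

(** The estimate of [QS_le] reversed: [w] is the square of [P U] for a signed sum [U], and each
    support is [star a * a]. *)
Lemma QS_ge m u : n2 (w u) <= C * C * QS m u.
Proof.
have [U /Sg_unit[AU sU UU] [_ le]] := Sg_lo u (@pl_A m).
have h0 : n2 (w u) <= C * n2 (P U u).
  by rewrite -P1 -UU PM // bM; apply: Pb => //; exact: unit_nle.
apply: le_trans h0 _; rewrite -mulrA ler_pM2l //; apply: le_trans le _.
rewrite /QS /pl big_map mulr_sumr !big_seq; apply: ler_sum => a /gl_iso[Aa pa].
have As : A (star a) by exact: vna_star.
rewrite PM // bM; apply: Pb => //; apply: nle_star; first exact: ler01.
exact: iso_nle.
Qed.

(** The factor [star s1] cancels [s1] and kills [s2], symmetrically for [star s2], and [e0] kills
    both; so level [m.+1] sees [u] and [v] separately at level [m]. *)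
Lemma QSS m u v : QS m.+1 (P s1 u + P s2 v) = QS m u + QS m v.
Proof.
have glw a : a \in gl m -> A a by move=> /gl_iso[].
have e1 : P e0 * P s1 = 0 by rewrite -PM // e0s1 P_0.
have e2 : P e0 * P s2 = 0 by rewrite -PM // e0s2 P_0.
rewrite /QS /= big_cons big_cat !big_map /= bfD -!bM e1 e2 !b0 addr0 n20 add0r.
congr (_ + _); rewrite !big_seq; apply: eq_bigr => a /glw Aa; rewrite bfD -!bM.
  have -> : P (a * star s1) * P s1 = P a by rewrite -(PM (vnaM hA Aa Ast1) As1) -mulrA s11 mulr1.
  have -> : P (a * star s1) * P s2 = 0 by rewrite -(PM (vnaM hA Aa Ast1) As2) -mulrA s12 mulr0 P_0.
  by rewrite b0 addr0.
have -> : P (a * star s2) * P s2 = P a by rewrite -(PM (vnaM hA Aa Ast2) As2) -mulrA s22 mulr1.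
have -> : P (a * star s2) * P s1 = 0 by rewrite -(PM (vnaM hA Aa Ast2) As1) -mulrA s21 mulr0 P_0.
by rewrite b0 add0r.
Qed.

Definition TS m : bop K := \sum_(a <- gl m) star (P a) * P a.
Lemma TS_ip m u : ip (TS m u) u = QS m u.
Proof.
rewrite /TS /QS; elim: (gl m) => [|a s IH]; first by rewrite !big_nil b0 ip0l.
by rewrite !big_cons bD ipDl IH bM ip_starl.
Qed.
Lemma TS_B m : B (TS m).
Proof.
rewrite /TS big_seq; elim/big_ind: _ => [||a /gl_iso[Aa _]]; [exact: vna0|exact: (vnaD hB)|].
by apply: (vnaM hB); [apply: vna_star => //|]; exact: PB.
Qed.
Lemma TS_sym m : sym (TS m).
Proof. by rewrite /TS; elim/big_ind: _ => [||a _]; [exact: sym0|exact: symD|exact: sym_star]. Qed.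

(** Cesaro means: [QSS] shifts the level by one, and in the mean only boundary terms weighted by
    [iv R n] remain. *)
Definition AV n : bop K := rsc K (iv R n) * \sum_(m < n.+1) TS m.
Lemma AV_ip n u : ip (AV n u) u = iv R n * \sum_(m < n.+1) QS m u.
Proof.
rewrite /AV bM rscE ipZl; congr (_ * _).
elim: (index_enum _) => [|i s IH]; first by rewrite !big_nil b0 ip0l.
by rewrite !big_cons bD ipDl IH TS_ip.
Qed.
Lemma AV_sym n : sym (AV n).
Proof.
apply: sym_rsc; elim/big_ind: _ => [||i _]; [exact: sym0|exact: symD|exact: TS_sym].
Qed.
Lemma ivK n : iv R n * n.+1%:R = 1. Proof. by rewrite /iv mulVf // pnatr_eq0. Qed.
Lemma AV_le n u : ip (AV n u) u <= C * C * n2 u.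
Proof.
rewrite AV_ip -[leRHS]mul1r -(ivK n) -mulrA ler_pM2l ?iv_gt0 //.
apply: le_trans (_ : \sum_(m < n.+1) C * C * n2 u <= _); first by apply: ler_sum => i _; exact: QS_le.
by rewrite sumr_const card_ord [leRHS]mulr_natl.
Qed.
Lemma AV_ge n u : n2 (w u) <= C * C * ip (AV n u) u.
Proof.
rewrite AV_ip -[leLHS]mul1r -(ivK n) mulrCA -mulrA ler_pM2l ?iv_gt0 //.
rewrite mulr_sumr; apply: le_trans (_ : \sum_(m < n.+1) n2 (w u) <= _).
  by rewrite sumr_const card_ord [leLHS]mulr_natl.
by apply: ler_sum => i _; exact: QS_ge.
Qed.
Lemma AV_pos n : pos (AV n).
Proof.
move=> u; rewrite AV_ip mulr_ge0 ?(ltW (iv_gt0 _ _)) //; apply: sumr_ge0 => i _.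
exact: QS_ge0.
Qed.

Lemma AV_shift n u v : `|ip (AV n (P s1 u + P s2 v)) (P s1 u + P s2 v) - ip (AV n u) u - ip (AV n v) v|
  <= iv R n * (QS 0 (P s1 u + P s2 v) + C * C * n2 u + C * C * n2 v).
Proof.
set X := P s1 u + P s2 v; have Q0 := QS_ge0.
rewrite !AV_ip -!mulrBr normrM (ger0_norm (ltW (iv_gt0 R n))) ler_pM2l ?iv_gt0 //.
have -> : \sum_(m < n.+1) QS m X - \sum_(m < n.+1) QS m u - \sum_(m < n.+1) QS m v =
    QS 0 X - QS n u - QS n v.
  rewrite big_ord_recl /=; have -> : \sum_(i < n) QS (bump 0 i) X = \sum_(i < n) QS i u + \sum_(i < n) QS i v.
    by rewrite -big_split; apply: eq_bigr => i _; exact: QSS.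
  by rewrite [\sum_(m < n.+1) QS m u]big_ord_recr [\sum_(m < n.+1) QS m v]big_ord_recr /=; ring.
have := QS_le n u; have := QS_le n v; have := Q0 n u; have := Q0 n v; have := Q0 0 X.
by move=> *; rewrite ler_norml; apply/andP; split; lra.
Qed.

(** For this form [P s1] and [P s2] are isometries with orthogonal ranges. It need not yet decrease
    under [P x] for contractions [x]; that is the task of the next part. *)
Lemma beta_ex : exists Bo : bop K, [/\ B Bo, sym Bo,
  forall u, n2 (w u) <= C * C * ip (Bo u) u,
  forall u, ip (Bo u) u <= C * C * n2 u &
  forall u v, ip (Bo (P s1 u + P s2 v)) (P s1 u + P s2 v) = ip (Bo u) u + ip (Bo v) v].
Proof.
have [U [UU sub]] := @ultraFilterLemma nat \oo _.
have FU := @ultra_proper _ _ UU.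
have CC : 0 <= C * C by rewrite mulr_ge0 // ltW.
have [|Bo _ hBo] := @wlim R K nat U AV ((C * C) ^+ 2) UU (sqr_ge0 _).
  by move=> n; apply: pos_nle => //; [exact: AV_sym|exact: AV_pos|exact: AV_le].
exists Bo; split.
- apply: (vnaP hB) => y cy; apply/esym/(wlim_comm UU hBo) => n.
  have BAV : B (AV n).
    apply: (vnaM hB); first exact: vna_sc.
    by elim/big_ind: _ => [||i _]; [exact: vna0|exact: (vnaD hB)|exact: TS_B].
  by rewrite cy.
- apply: symP => u v; rewrite (ipC u); apply: (uq_lim FU (hBo u v)).
  have -> : (fun n => ip (AV n u) v) = (fun n => ip (AV n v) u).
    by apply/funext => n; rewrite (symE (AV_sym n)) ipC.
  exact: hBo.
- move=> u; rewrite -ler_pdivrMl ?mulr_gt0 //.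
  by apply: (cvgr_to_ge (hBo u u)); apply: nearW => n; rewrite ler_pdivrMl ?mulr_gt0 //; exact: AV_ge.
- by move=> u; apply: (cvgr_to_le (hBo u u)); apply: nearW => n; exact: AV_le.
move=> u v; set X := P s1 u + P s2 v.
pose M : R := QS 0 X + C * C * n2 u + C * C * n2 v.
have cv : ip (AV n X) X - ip (AV n u) u - ip (AV n v) v @[n --> U] -->
    (ip (Bo X) X - ip (Bo u) u - ip (Bo v) v : R).
  by apply: cvgB; [apply: cvgB|]; exact: hBo.
have c0 : ip (AV n X) X - ip (AV n u) u - ip (AV n v) v @[n --> U] --> (0 : R).
  apply/cvgrPdist_lt => e e_gt0.
  have M0 : 0 < M + 1.
    have := n2_ge0 u; have := n2_ge0 v; have : 0 <= QS 0 X by exact: QS_ge0.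
    rewrite /M; nra.
  have eM : 0 < e / (M + 1) by rewrite divr_gt0.
  have [N hN] := inv_small eM.
  apply: sub; exists N => // n Nn /=; rewrite sub0r normrN.
  apply: le_lt_trans (AV_shift n u v) _; have := hN n Nn; rewrite ltr_pdivlMr // -/X -/M => h.
  by have := iv_gt0 R n; lra.
have := uq_lim FU cv c0; lra.
Qed.

End Beta.

Section Idem.
Variables (R : realType) (H : hilbertSpace R).
(** For a normal idempotent, [t = e - star e * e] satisfies [star t * t = 0]. *)
Lemma idem_sym (e : bop H) : e * e = e -> star e * e = e * star e -> sym e.
Proof.
move=> ee c; have t0 : e - star e * e = 0.
  apply: star_sq0; rewrite starB starM starK mulrBl !mulrBr.
  have e1 : star e * (star e * e) = star e * e by rewrite mulrA -starM ee.
  have e2 : star e * e * e = star e * e by rewrite -mulrA ee.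
  have e3 : star e * e * (star e * e) = star e * e by rewrite -mulrA (mulrA e) -c e2 e1.
  by rewrite e1 e2 e3 subrr.
by move/eqP: t0; rewrite subr_eq0 => /eqP ->; exact: sym_star.
Qed.

Lemma idem_cproj (A : set (bop H)) (e : bop H) : vna A -> A e -> e * e = e ->
  (forall x, A x -> e * x = x * e) -> cproj A e.
Proof.
move=> hA Ae ee c; split=> //; split=> //; split=> //.
by apply: idem_sym => //; rewrite c //; exact: vna_star.
Qed.

Lemma sandwich_sym (x b : bop H) : sym b -> sym (star x * b * x).
Proof. by move=> s; rewrite /sym !starM starK s mulrA. Qed.
End Idem.

(** * The supremum of the form over contractions *)

Section Core.
Variables (R : realType) (H K : hilbertSpace R).
Implicit Types (x y z p r s t a b : bop H) (u : K).
Variables (A : set (bop H)) (B : set (bop K)).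
Hypotheses (hA : vna A) (hB : vna B).
Variables (s1 s2 : bop H).
Hypotheses (As1 : A s1) (As2 : A s2) (s11 : star s1 * s1 = 1) (s22 : star s2 * s2 = 1)
  (s12 : star s1 * s2 = 0).
Variables (P : bop H -> bop K) (w : bop K) (C : R).
Hypotheses (cw : cproj B w) (C0 : 0 < C).
Hypothesis PB : forall x, A x -> B (P x).
Hypothesis PD : forall x y, A x -> A y -> P (x + y) = P x + P y.
Hypothesis PM : forall x y, A x -> A y -> P (x * y) = P x * P y.
Hypothesis P1 : P 1 = w.
Hypothesis Pb : forall x, A x -> nle x 1 -> nle (P x) C.
Variables (z0 : bop H) (Pi : bop K -> bop H).
Hypothesis cz0 : cproj A z0.
Hypothesis Pker : forall x, A x -> P x = 0 -> x * z0 = 0.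
Hypothesis PiA : forall y : bop K, B y -> A (Pi y).
Hypothesis Piz : forall y : bop K, B y -> Pi y * z0 = Pi y.
Hypothesis PPi : forall y : bop K, B y -> P (Pi y) = w * y.

Let P0 : P 0 = 0. Proof. exact: (P_0 hA PD). Qed.
Let PBB x y : A x -> A y -> P (x - y) = P x - P y. Proof. exact: (P_B hA PD). Qed.
Let Pw x : A x -> P x * w = P x. Proof. exact: (P_w hA PM P1). Qed.
Let wP x : A x -> w * P x = P x. Proof. exact: (w_P hA PM P1). Qed.

(** [P] identifies [A z0] with [w B], with inverse [Pi]; relations in [B] are pulled back to [A]
    through this injectivity. *)
Lemma P_inj x y : A x -> A y -> x * z0 = x -> y * z0 = y -> P x = P y -> x = y.
Proof.
move=> Ax Ay xz yz e; have := Pker (vnaB hA Ax Ay); rewrite PBB // e subrr => /(_ erefl).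
by rewrite mulrBl xz yz => /eqP; rewrite subr_eq0 => /eqP.
Qed.

Lemma P_cproj z : cproj A z -> cproj B (P z).
Proof.
move=> cz; have Az := cproj_A cz; apply: (idem_cproj hB); first exact: PB.
  by rewrite -PM // (cproj_i cz).
move=> y By; have Ay := PiA By.
rewrite -{1}(Pw Az) -mulrA -PPi // -PM // (cproj_c cz) // PM // PPi //.
by rewrite (cproj_c cw By) -mulrA wP.
Qed.

Lemma Pi_cproj (z : bop K) : cproj B z -> w * z = z -> cproj A (Pi z) /\ P (Pi z) = z.
Proof.
move=> cz wz; have Bz := cproj_A cz; have Az := PiA Bz; have e : P (Pi z) = z by rewrite PPi.
split=> //; apply: (idem_cproj hA) => //.
  by apply: P_inj; rewrite ?PM ?e ?(cproj_i cz) //; [exact: (vnaM hA)|rewrite -mulrA Piz|exact: Piz].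
move=> x Ax; apply: P_inj; rewrite ?PM ?e //; try exact: (vnaM hA).
- by rewrite -mulrA -(cproj_c cz0 Ax) mulrA Piz.
- by rewrite -mulrA Piz.
- by rewrite (cproj_c cz) //; exact: PB.
Qed.

Variable Bo : bop K.
Hypotheses (BBo : B Bo) (sBo : sym Bo).
Let D : R := C * C.
Let D0 : 0 < D. Proof. by rewrite mulr_gt0. Qed.
Definition be u : R := ip (Bo u) u.
Hypothesis be_ge : forall u, n2 (w u) <= D * be u.
Hypothesis be_le : forall u, be u <= D * n2 u.
Hypothesis be_s : forall u v, be (P s1 u + P s2 v) = be u + be v.

Lemma be_ge0 u : 0 <= be u.
Proof. by have := le_trans (n2_ge0 _) (be_ge u); rewrite pmulr_rge0. Qed.
Let pBo : pos Bo. Proof. exact: be_ge0. Qed.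

Definition ball a := A a /\ nle a 1.
Lemma ballM a b : ball a -> ball b -> ball (a * b).
Proof. by move=> [Aa na] [Ab nb]; split; [exact: (vnaM hA)|rewrite -(mulr1 1); apply: nleM]. Qed.
Lemma ball1 : ball 1. Proof. by split; [exact: vna1|exact: nle1]. Qed.

Lemma be_split (z : bop K) u v : cproj B z -> z u = u -> z v = 0 -> be (u + v) = be u + be v.
Proof.
move=> cz zu zv; rewrite /be bfD !ipDl !ipDr.
have e : ip (Bo u) v = 0.
  by rewrite -zu -bM -(cproj_c cz BBo) bM (symE (cproj_s cz)) zv ip0r.
by rewrite (symE sBo v) (ipC v) e; ring.
Qed.
Lemma be_cut (z : bop K) u : cproj B z -> be u = be (z u) + be (u - z u).
Proof.
move=> cz; rewrite -(be_split cz) ?bfB ?(isproj_id _ (cproj_is cz)) ?subrr //.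
by rewrite addrC subrK.
Qed.
Lemma be_le_cut (z : bop K) u : cproj B z -> be (z u) <= be u.
Proof. by move=> cz; rewrite (be_cut u cz) lerDl; exact: be_ge0. Qed.

(** Uniformity over the ball is the point: near-maximality may then be checked at a nearby
    vector. *)
Lemma be_cont u (e : R) : 0 < e -> exists2 d : R, 0 < d & forall a v, ball a -> n2 (u - v) < d ->
  be (P a u) <= be (P a v) + e.
Proof.
(* [M] bounds the form at every [P a v] with [v] near [u]; the weight [t] in the estimate of the
   cross term keeps the share of [be x] below [e / 2]. *)
move=> e_gt0; pose M : R := 2 * D * C * (n2 u + 1).
have DC : 0 < D * C by rewrite mulr_gt0.
have M0 : 0 < M by rewrite /M -!mulrA !mulr_gt0 //; have := n2_ge0 u; lra.
pose t : R := e / 2 / M; have t0 : 0 < t by rewrite !divr_gt0.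
have tE : t * M = e / 2 by rewrite /t divfK ?gt_eqF.
clearbody t.
pose N : R := (1 + t^-1) * (D * C).
have ti : 0 < t^-1 by rewrite invr_gt0.
have N0 : 0 < N by rewrite mulr_gt0 //; lra.
pose d : R := Num.min 1 (e / 2 / N).
have d0 : 0 < d by rewrite lt_min ltr01 !divr_gt0.
exists d => // a v [Aa na]; rewrite lt_min => /andP[h1]; rewrite ltr_pdivlMr // => h2.
set x := P a v; set h := P a (u - v).
have nP (y : K) : n2 (P a y) <= C * n2 y := Pb Aa na y.
have -> : P a u = x + h by rewrite /x /h -bfD addrC subrK.
have bh : be h <= D * C * n2 (u - v).
  by apply: le_trans (be_le _) _; rewrite -mulrA ler_pM2l //; exact: nP.
have bx : be x <= M.
  apply: le_trans (be_le _) _; apply: le_trans (_ : D * (C * n2 v) <= _); first by rewrite ler_pM2l //; exact: nP.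
  have := n2D_le (- (u - v)) u; rewrite opprB subrK n2Bc => h3.
  have h4 : n2 v <= 2 * (n2 u + 1) by lra.
  by rewrite /M mulrA; have := ler_wpM2l (ltW DC) h4; lra.
have cross : 2 * ip (Bo x) h <= t * be x + t^-1 * be h.
  have := be_ge0 (rs t x - h); rewrite /be bfB bfr !(ipBl, ipBr, ipZl, ipZr) (symE sBo h x) (ipC h) => h3.
  rewrite -(ler_pM2l t0) mulrDr !mulrA divff ?gt_eqF // mul1r; rewrite /be; lra.
have -> : be (x + h) = be x + 2 * ip (Bo x) h + be h.
  by rewrite /be bfD !ipDl !ipDr (symE sBo h x) (ipC h); ring.
have tM : t * be x <= e / 2.
  by apply: le_trans (ler_wpM2l (ltW t0) bx) _; rewrite tE.
have hN : (1 + t^-1) * be h <= e / 2.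
  apply: le_trans (_ : (1 + t^-1) * (D * C * n2 (u - v)) <= _); first by rewrite ler_wpM2l //; lra.
  by move: h2; rewrite /N; lra.
lra.
Qed.

Lemma be_conts (us : seq K) (e : R) : 0 < e -> exists2 d : R, 0 < d & forall u, u \in us ->
  forall a v, ball a -> n2 (u - v) < d -> be (P a u) <= be (P a v) + e.
Proof.
move=> e_gt0; elim: us => [|u us [d d0 IH]]; first by exists 1.
have [d' d'0 h] := be_cont u e_gt0; exists (Num.min d d'); first by rewrite lt_min d0.
move=> v; rewrite inE => /orP[/eqP ->|vus] a y ba; rewrite lt_min => /andP[h1 h2].
  exact: h.
exact: IH.
Qed.

(** * A central piece on which the expansion ratio lies between [rho * l] and [l] *)

Section Piece.
Variables (d : bop K) (l rho : R).
Hypotheses (cd : cproj B d) (wd : w * d = d) (l0 : 0 < l) (rho0 : 0 < rho) (rho1 : rho < 1).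
Hypothesis ub : forall a u, ball a -> be (P a (d u)) <= l * be (d u).
Hypothesis lb : forall z : bop K, cproj B z -> z * d = z -> z <> 0 ->
  exists a u, ball a /\ rho * l * be (z u) < be (P a (z u)).
Let dh := Pi d.
Let cdh : cproj A dh. Proof. by have [] := Pi_cproj cd wd. Qed.
Let Pdh : P dh = d. Proof. by have [] := Pi_cproj cd wd. Qed.
Let Adh : A dh. Proof. exact: cproj_A cdh. Qed.
Let dhz : dh * z0 = dh. Proof. by rewrite Piz //; exact: cproj_A cd. Qed.
Let rl0 : 0 < rho * l. Proof. by rewrite mulr_gt0. Qed.

(** Projections that a partial isometry [b] moves to a place where a single contraction [x] expands
    the form by at least [rho * l] at every vector. *)
Definition good r := [/\ proj A r, r * dh = r & exists b x, [/\ A b, star b * b = r, ball x &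
  forall u, rho * l * be (P b u) <= be (P (x * b) u)]].

Lemma good0 : good 0.
Proof.
split; [by split; [exact: vna0|exact: isproj0]|by rewrite mul0r|].
exists 0, 1; split; [exact: vna0|by rewrite mulr0|exact: ball1|move=> u].
by rewrite mulr0 P0 b0 /be bf0 ip0l mulr0.
Qed.

Lemma good_sub r v : good r -> A v -> isproj (star v * v) -> r * v = v ->
  star v * v * dh = star v * v -> good (star v * v).
Proof.
move=> [pr _ [b [x [Ab bb bx h]]]] Av pv rv vd; split=> //.
  by split=> //; apply: (vnaM hA) => //; exact: vna_star.
exists (b * v), x; split=> //; first exact: (vnaM hA).
  by rewrite starM -mulrA (mulrA (star b)) bb rv.
have Axb : A (x * b) by apply: (vnaM hA) => //; exact: bx.1.
by move=> u; rewrite mulrA PM // PM // !bM; exact: h.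
Qed.

(** [s1] and [s2] put the two witnesses on orthogonal ranges, and [be_s] adds the two inequalities.
    This is what the averaged form was built for. *)
Lemma good_add r1 r2 : good r1 -> good r2 -> r1 * r2 = 0 -> good (r1 + r2).
Proof.
move=> [p1 d1 [b1 [x1 [Ab1 bb1 [Ax1 nx1] h1]]]] [p2 d2 [b2 [x2 [Ab2 bb2 [Ax2 nx2] h2]]]] r12.
have r21 : r2 * r1 = 0 by apply: star_inj; rewrite starM p1.2.1 p2.2.1 r12 star0.
have s21 : star s2 * s1 = 0 by apply: star_inj; rewrite starM starK s12 star0.
have S1 : A (star s1) by exact: vna_star.
have S2 : A (star s2) by exact: vna_star.
split.
- split; first exact: (vnaD hA p1.1 p2.1).
  split; first exact: (symD p1.2.1 p2.2.1).
  by rewrite mulrDl !mulrDr r12 r21 p1.2.2 p2.2.2 addr0 add0r.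
- by rewrite mulrDl d1 d2.
pose b := s1 * b1 + s2 * b2; pose x := s1 * x1 * star s1 + s2 * x2 * star s2.
have A1 : A (s1 * b1) by exact: (vnaM hA).
have A2 : A (s2 * b2) by exact: (vnaM hA).
have A3 : A (s1 * x1 * star s1) by do 2?apply: (vnaM hA).
have A4 : A (s2 * x2 * star s2) by do 2?apply: (vnaM hA).
have Ab : A b by exact: (vnaD hA).
have nx : nle x 1.
  move=> u; rewrite mul1r /x bD n2D !bM.
  have -> : ip (s1 (x1 (star s1 u))) (s2 (x2 (star s2 u))) = 0.
    by rewrite ip_star -(bM (star s1) s2) s12 b0 ip0r.
  have i1 v : n2 (s1 v) = n2 v by rewrite /n2 -ip_starl -bM s11 bE.
  have i2 v : n2 (s2 v) = n2 v by rewrite /n2 -ip_starl -bM s22 bE.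
  rewrite i1 i2; have := nx1 (star s1 u); have := nx2 (star s2 u).
  have : 0 <= n2 (u - (s1 (star s1 u) + s2 (star s2 u))) by exact: n2_ge0.
  rewrite n2B n2D i1 i2 ipDr.
  have -> : ip (s1 (star s1 u)) (s2 (star s2 u)) = 0 by rewrite ip_star -(bM (star s1) s2) s12 b0 ip0r.
  have -> : ip u (s1 (star s1 u)) = n2 (star s1 u) by rewrite -ip_starl.
  have -> : ip u (s2 (star s2 u)) = n2 (star s2 u) by rewrite -ip_starl.
  lra.
exists b, x; split=> //.
- rewrite /b starD !starM mulrDl !mulrDr -!mulrA (mulrA (star s1) s1) (mulrA (star s1) s2)
    (mulrA (star s2) s1) (mulrA (star s2) s2) s11 s12 s21 s22 !mul1r !mul0r !mulr0 addr0 add0r.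
  by rewrite bb1 bb2.
- by split=> //; exact: (vnaD hA).
move=> u; have Axb1 : A (x1 * b1) by exact: (vnaM hA).
have Axb2 : A (x2 * b2) by exact: (vnaM hA).
have -> : x * b = s1 * (x1 * b1) + s2 * (x2 * b2).
  rewrite /x /b mulrDl !mulrDr -!mulrA (mulrA (star s1) s1) (mulrA (star s1) s2)
    (mulrA (star s2) s1) (mulrA (star s2) s2) s11 s12 s21 s22 !mul1r !mul0r !mulr0 addr0 add0r.
  by [].
rewrite /b !PD ?PM //; try exact: (vnaM hA).
rewrite !bD (bM (P s1)) (bM (P s2)) (bM (P s1)) (bM (P s2)) !be_s -!PM // mulrDr.
exact: lerD.
Qed.

(** The range projection [r'] of [(1 - r1) r2] is orthogonal to [r1] and equivalent to a
    subprojection of [r2], so it inherits goodness and can be added to [r1]. *)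
Lemma good_join r1 r2 : good r1 -> good r2 -> exists r, [/\ good r, r * r1 = r1 & r * r2 = r2].
Proof.
move=> g1 g2; have [[A1 [sr1 i1]] d1 _] := g1; have [[A2 [sr2 i2]] d2 _] := g2.
pose T := (1 - r1) * r2.
have AT : A T by apply: (vnaM hA) => //; apply: (vnaB hA) => //; exact: vna1.
have [v [Av pv kv vr]] := vna_polar hA AT.
have Tr2 : T * r2 = T by rewrite /T -mulrA i2.
have r1T : r1 * T = 0 by rewrite /T mulrA mulrBr mulr1 i1 subrr mul0r.
have vr2 : star v * v * r2 = star v * v.
  apply: bop_ext => u; apply/eqP; rewrite -subr_eq0; apply/eqP.
  by rewrite bM -bfB; apply/kv; rewrite bfB -bM Tr2 subrr.
have r2v : r2 * star v = star v.
  by apply: star_inj; rewrite starM starK sr2 -[in LHS](pi_mul pv) -mulrA vr2 pi_mul.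
pose r' := v * star v.
have pr' : isproj (star (star v) * star v) by rewrite starK; exact: pi_star.
have dr' : r' * dh = r'.
  have -> : r' * dh = dh * r'.
    by rewrite (cproj_c cdh) //; apply: (vnaM hA) => //; exact: vna_star.
  rewrite /r' vr; apply: prj_fix => _ [u _ <-].
  by rewrite -bM (cproj_c cdh AT) /T -mulrA d2.
have g' : good r'.
  rewrite /r' -[X in X * _]starK; apply: (good_sub g2) => //; [exact: vna_star|by rewrite starK].
have r1r' : r1 * r' = 0.
  by rewrite /r' vr; apply: prj_kill => _ [u _ <-]; rewrite -bM r1T.
have r'r1 : r' * r1 = 0.
  by apply: star_inj; rewrite star0 starM sr1 (pi_star pv).1.
have r'T : r' * T = T by rewrite /r' vr prj_range_mul.
exists (r1 + r'); split; first exact: good_add.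
  by rewrite mulrDl i1 r'r1 addr0.
have e2 : r2 = r1 * r2 + T by rewrite /T mulrBl mul1r addrC subrK.
have r'r2 : r' * r2 = T by rewrite {1}e2 mulrDr mulrA r'r1 mul0r add0r r'T.
by rewrite mulrDl r'r2 -e2.
Qed.

(** [lb] over the central support of [p] gives a contraction [x0] whose excess form has a nonzero
    positive spectral projection [E]. As [P] need not respect adjoints, [Pi E] is only an
    idempotent; its range projection [f] serves instead. *)
Lemma claimA p : proj A p -> p * dh = p -> p <> 0 -> exists r, [/\ good r, p * r = r & r <> 0].
Proof.
move=> [Ap pp] pd p0.
have dd x : x * dh = x -> x * z0 = x by move=> e; rewrite -e -mulrA dhz.
have Pp0 : P p <> 0 by move=> /(Pker Ap); rewrite dd.
have ccs := cs_cproj hA Ap; have Acs := cproj_A ccs.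
have cz' := P_cproj ccs; pose z1 := P (cs A p) * d.
have cz1 : cproj B z1 by exact: (cprojM hB).
have z1d : z1 * d = z1 by rewrite /z1 -mulrA (cproj_i cd).
have dP : d * P p = P p by rewrite -Pdh -PM // (cproj_c cdh Ap) pd.
have csP : P (cs A p) * P p = P p by rewrite -PM // cs_mul.
have z1P : z1 * P p = P p by rewrite /z1 -mulrA dP csP.
have z10 : z1 <> 0 by move=> e; apply: Pp0; rewrite -z1P e mul0r.
have [x0 [u0 [bx0 gt]]] := lb cz1 z1d z10.
have [Ax0 nx0] := bx0; have BP := PB Ax0; have Bz1 := cproj_A cz1.
pose G := star (P x0) * Bo * P x0 - rsc K (rho * l) * Bo.
have sG : sym G by apply: symB; [exact: sandwich_sym|exact: sym_rsc].
have BG : B G.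
  apply: (vnaB hB); last by apply: (vnaM hB) => //; exact: (vna_sc hB).
  by apply: (vnaM hB) => //; apply: (vnaM hB) => //; exact: vna_star.
have Gip u : ip (G u) u = be (P x0 u) - rho * l * be u.
  by rewrite /G bB ipBl !bM ip_starl rscE ipZl.
pose T := z1 * G; have z1G : z1 * G = G * z1 by exact: (cproj_c cz1 BG).
have sT : sym T by apply: symM => //; exact: (cproj_s cz1).
have BT : B T by exact: (vnaM hB).
have [E [BE pE Ec Epos Eneg]] := vna_spec hB BT sT.
have Tz1 : T * z1 = z1 * T by rewrite /T -mulrA -z1G mulrA.
have zT : z1 * T = T by rewrite /T mulrA (cproj_i cz1).
have TE : T = z1 * (G * z1) by rewrite -z1G mulrA (cproj_i cz1).
have Tip u : ip (T u) u = ip (G (z1 u)) (z1 u).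
  by rewrite {1}TE !bM (symE (cproj_s cz1)).
have E0 : E <> 0.
  move=> e; have := Eneg u0; rewrite e b0 => /(_ erefl); rewrite Tip Gip; lra.
have z1E : z1 * E = E.
  have cE : E * z1 = z1 * E by exact: Ec.
  have T1 : T * (1 - z1) = 0 by rewrite mulrBr mulr1 Tz1 zT subrr.
  have cE1 : E * (1 - z1) = (1 - z1) * E by rewrite mulrBr mulrBl mulr1 mul1r cE.
  have key : (1 - z1) * E = 0.
    apply: bop_ext => u; rewrite b0; apply: (Epos _ _).2.
      by rewrite -bM mulrA cE1 -mulrA pE.2.
    by rewrite -bM mulrA T1 mul0r b0 ip0l.
  by move: key; rewrite mulrBl mul1r => /eqP; rewrite subr_eq0 => /eqP <-.
have wz1 : w * z1 = z1 by rewrite /z1 mulrA wP.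
pose e := Pi E; have Ae : A e := PiA BE.
have Pe : P e = E by rewrite PPi // -z1E mulrA wz1.
have ez : e * z0 = e by exact: Piz.
have ee : e * e = e.
  by apply: P_inj => //; [exact: (vnaM hA)|rewrite -mulrA ez|rewrite PM // Pe pE.2].
pose f := prj (range e); have Af : A f by exact: vna_prj_range.
have pf : isproj f by exact: isprj.
have ef : e * f = f by apply: prj_fix => _ [u _ <-]; rewrite -bM ee.
have fe : f * e = e by exact: prj_range_mul.
have cse : cs A p * e = e.
  apply: P_inj => //; [exact: (vnaM hA)|by rewrite -mulrA ez|].
  by rewrite PM // Pe -z1E mulrA /z1 mulrA (cproj_i cz').
have csf : cs A p * f = f by apply: prj_fix => _ [u _ <-]; rewrite -bM cse.
clearbody f.
have f0 : f <> 0 by move=> f0; apply: E0; rewrite -Pe -fe f0 mul0r P0.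
(* [f] lies under the central support of [p], so the two are linked by some [y]; the polar part of
   [f y p] then carries a piece of [p] under [f]. *)
have [y [Ay Ty]] : exists y, A y /\ f * y * p <> 0.
  apply: contrapT => no; apply: f0; rewrite -csf (cproj_c ccs) //.
  apply: cs_kill => // x Ax; apply: contrapT => h; apply: no; by exists x.
pose T2 := f * y * p; have AT2 : A T2 by do 2?apply: (vnaM hA).
have [v [Av pv kv vr]] := vna_polar hA AT2.
have T2p : T2 * p = T2 by rewrite /T2 -mulrA pp.2.
pose r := star v * v.
have rp : r * p = r.
  apply: bop_ext => u; apply/eqP; rewrite -subr_eq0; apply/eqP.
  by rewrite bM -bfB; apply/kv; rewrite bfB -bM T2p subrr.
have fv : f * v = v.
  rewrite -[in LHS](pi_mul' pv) vr mulrA prj_fix -?vr ?pi_mul' // => _ [u _ <-].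
  by rewrite -bM /T2 !mulrA pf.2.
have Ar : A r by apply: (vnaM hA) => //; exact: vna_star.
exists r; split; last first.
- by move=> r0; apply: Ty; apply: bop_ext => u; rewrite b0; apply/kv; rewrite -/r r0 b0.
- by apply: le_mull rp; [exact: pp.1|exact: pv.1].
split; first by split.
  by rewrite -rp -mulrA pd.
exists v, x0; split=> // u.
have ev : e * v = v by rewrite -fv mulrA ef.
have EP : E * P v = P v by rewrite -Pe -PM // ev.
have Ez : E (P v u) = P v u by rewrite -bM EP.
have := (Epos _ Ez).1; rewrite Tip Gip -(bM z1).
have -> : z1 * P v = P v by rewrite -EP mulrA z1E.
by rewrite PM // bM subr_ge0.
Qed.

(** The idempotents [P r] need not be self-adjoint, so the span [DD] of their ranges is tested by
    [X = d (1 - prj DD)]: its preimage [x] kills every good projection, and [claimA] on the support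
    of [x] forces [x = 0]. *)
Lemma good_dense u : d u = u -> forall e : R, 0 < e -> exists2 r, good r & n2 (u - P r u) < e.
Proof.
move=> du e e_gt0.
pose DD : set K := [set v | exists2 r, good r & P r v = v].
have gA r : good r -> A r by case=> -[].
have gi r : good r -> r * r = r by case=> -[_ []].
have sD : subsp DD.
  split; first by exists 0; [exact: good0|rewrite bf0].
  move=> c x y [r1 g1 h1] [r2 g2 h2]; have [r [g e1 e2]] := good_join g1 g2.
  exists r => //; rewrite bf_lin -{1}h1 -{1}h2 -!bM -!PM ?e1 ?e2 ?h1 ?h2 //; exact: gA.
have BQ : B (prj DD).
  apply: (vna_prj hB) => y cy v [r g h]; exists r => //.
  by rewrite -bM -cy ?bM ?h //; apply: PB; exact: gA.
have QP r : good r -> prj DD * P r = P r.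
  move=> g; apply: bop_ext => v; rewrite bM; apply: prj_S; exists r => //.
  by rewrite -bM -PM ?gi //; exact: gA.
pose X := d * (1 - prj DD); have Bd := cproj_A cd.
have B1Q : B (1 - prj DD) by apply: (vnaB hB) => //; exact: vna1.
have BX : B X by exact: (vnaM hB).
pose x := Pi X; have Ax : A x := PiA BX.
have Px : P x = X by rewrite PPi // /X mulrA wd.
have xz : x * z0 = x by exact: Piz.
have xd : x * dh = x.
  apply: P_inj => //; [exact: (vnaM hA)|by rewrite -mulrA dhz|].
  by rewrite PM // Px Pdh -(cproj_c cd BX) /X mulrA (cproj_i cd).
have xr r : good r -> x * r = 0.
  move=> g; have Ar := gA _ g; have rd : r * dh = r by case: g.
  apply: P_inj; [exact: (vnaM hA)|exact: vna0| |by rewrite mul0r|].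
    by rewrite -mulrA -{2}rd -[in LHS]rd -!mulrA dhz.
  by rewrite PM // P0 Px /X -mulrA mulrBl mul1r QP // subrr mulr0.
have x0 : x = 0.
  apply: contrapT => xn0; have [v [Av pv kv _]] := vna_polar hA Ax.
  have [||| r [g pr rn0]] := @claimA (star v * v).
  - by split=> //; apply: (vnaM hA) => //; exact: vna_star.
  - apply: bop_ext => y; apply/eqP; rewrite -subr_eq0; apply/eqP.
    by rewrite bM -bfB; apply/kv; rewrite bfB -bM xd subrr.
  - by move=> p0; apply: xn0; apply: bop_ext => y; rewrite b0; apply/kv; rewrite p0 b0.
  apply: rn0; rewrite -pr; apply: bop_ext => y; rewrite bM b0; apply/kv.
  by rewrite -bM xr.
have X0 : X = 0 by rewrite -Px x0 P0.
have uQ : oc (oc DD) u.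
  apply: fix_of_prj; have : X u = 0 by rewrite X0.
  rewrite /X (cproj_c cd B1Q) bM du bB => /eqP; rewrite subr_eq0 => /eqP.
  by rewrite b1.
(* [2 + 2 * C] bounds the squared norm of [1 - P r]. *)
have C2 : 0 < 2 + 2 * C by rewrite addr_gt0 // mulr_gt0.
have e2 : 0 < e / (2 + 2 * C) by rewrite divr_gt0.
have [v [r g h] hv] := subsp_dense sD uQ e2; exists r => //.
have -> : u - P r u = (u - v) - P r (u - v) by rewrite bfB h opprB addrA subrK.
move: hv; rewrite ltr_pdivlMr // => hv; apply: le_lt_trans hv.
apply: le_trans (n2D_le _ _) _; rewrite n2N.
have nP : n2 (P r (u - v)) <= C * n2 (u - v).
  by apply: Pb; [exact: gA|apply: isproj_nle; case: g => -[]].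
by lra.
Qed.

Lemma good_denses (us : seq K) (e : R) : 0 < e -> exists2 r, good r &
  forall u, u \in us -> n2 (d u - P r (d u)) < e.
Proof.
have C2 : 0 < 2 + 2 * C by rewrite addr_gt0 // mulr_gt0.
have aux r r1 v : good r -> good r1 -> r * r1 = r1 ->
    n2 (v - P r v) <= (2 + 2 * C) * n2 (v - P r1 v).
  move=> [[Ar pr] _ _] [[Ar1 _] _ _] e1.
  have -> : v - P r v = (v - P r1 v) - P r (v - P r1 v).
    by rewrite bfB -bM -PM // e1 opprB addrA subrK.
  apply: le_trans (n2D_le _ _) _; rewrite n2N.
  have := Pb Ar (isproj_nle pr) (v - P r1 v); lra.
elim: us e => [|u us IH] e e_gt0; first by exists 0 => //; exact: good0.
have e2 : 0 < e / (2 + 2 * C) by rewrite divr_gt0.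
have [r1 g1 h1] := IH _ e2.
have [|r2 g2 h2] := @good_dense (d u) _ _ e2; first by apply: isproj_id; exact: cproj_is cd.
have [r [g rr1 rr2]] := good_join g1 g2; exists r => // v.
rewrite inE => /orP[/eqP ->|/h1].
  apply: le_lt_trans (aux _ _ _ g g2 rr2) _; move: h2; rewrite ltr_pdivlMr //; lra.
move=> h; apply: le_lt_trans (aux _ _ _ g g1 rr1) _; move: h; rewrite ltr_pdivlMr //; lra.
Qed.

(** The near-maximiser is [x b] for a good [r = star b * b] close to 1 on the given vectors: [P a']
    after [P r] is [P (a' * star b)] after [P b], which expands by at most [l], and [x] recovers all
    but the factor [rho]. *)
Lemma piece (us : seq K) (e : R) : 0 < e -> exists2 a, ball a & forall u, u \in us ->
  forall a', ball a' -> rho * be (P a' (d u)) <= be (P a (d u)) + e.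
Proof.
move=> e_gt0; have [dl dl0 hd] := be_conts [seq d u | u <- us] e_gt0.
have [r [[Ar pr] rd [b [x [Ab bb bx h]]]] hr] := good_denses us dl0.
have pb : isproj (star b * b) by rewrite bb.
have bb' : ball b by split=> //; exact: iso_nle.
exists (x * b); first exact: ballM.
move=> u uus a' ba'; have Aa' := ba'.1; have Asb : A (star b) by exact: vna_star.
have h1 := hd (d u) (map_f _ uus) a' _ ba' (hr _ uus).
have e1 : P a' (P r (d u)) = P (a' * star b) (d (P b u)).
  have e2 : d * P b = P b * d by exact: (cproj_c cd (PB Ab)).
  rewrite -(bM d) e2 bM -!bM -bb -!PM //; try exact: (vnaM hA).
  by rewrite -mulrA.
have bas : ball (a' * star b).
  by apply: ballM => //; split=> //; apply: nle_star; [exact: ler01|exact: bb'.2].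
have := ub (P b u) bas; rewrite -e1 => h2.
have h3 := h (d u).
have e4 : d * P b = P b * d by exact: (cproj_c cd (PB Ab)).
have e3 : d (P b u) = P b (d u) by rewrite -!bM e4.
rewrite e3 in h2.
have : rho * be (P a' (P r (d u))) <= be (P (x * b) (d u)).
  by apply: le_trans h3; rewrite -mulrA ler_pM2l.
move=> h5; have := ler_wpM2l (ltW rho0) h1; rewrite mulrDr => h6.
have h7 : rho * e <= e by rewrite ger_pMl // ltW.
apply: le_trans h6 _; exact: lerD.
Qed.
End Piece.

(** * Slicing the centre by the expansion ratio *)

Section Levels.
Variable rho : R.
Hypotheses (rho0 : 0 < rho) (rho1 : rho < 1).
Definition lvl (l : R) : set (bop K) := [set z | [/\ cproj B z, w * z = z &
  forall a u, ball a -> be (P a (z u)) <= l * be (z u)]].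
Definition Z l := csup (lvl l).

Lemma be_ortho a1 a2 (z d : bop K) u v : A a1 -> A a2 -> cproj B z -> z * d = 0 ->
  be (P a1 (z u) + P a2 (d v)) = be (P a1 (z u)) + be (P a2 (d v)).
Proof.
move=> Aa1 Aa2 cz zd; apply: (be_split cz).
  by rewrite -bM (cproj_c cz (PB Aa1)) bM -(bM z) (cproj_i cz).
by rewrite -bM (cproj_c cz (PB Aa2)) bM -(bM z) zd b0 bf0.
Qed.

Lemma lvl_c l : lvl l `<=` cproj B. Proof. by move=> z []. Qed.
Lemma Z_c l : cproj B (Z l). Proof. exact: (csup_cproj hB (@lvl_c l)). Qed.
Lemma Z_w l : w * Z l = Z l. Proof. by apply: csup_le => z []. Qed.

Lemma lvl_dir l : directed (lvl l).
Proof.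
split.
  exists 0; split; [exact: cproj0|by rewrite mulr0|move=> a u _].
  by rewrite b0 bf0 /be bf0 ip0l mulr0.
move=> z z' [cz wz hz] [cz' wz' hz']; split; first exact: (cprojJ hB).
  by rewrite mulrBr mulrDr mulrA wz wz'.
move=> a u ba; have zz' : z * (z' * (1 - z)) = 0.
  by rewrite (mulrA z) (cproj_c cz (cproj_A cz')) -mulrA mulrBr mulr1 (cproj_i cz) subrr mulr0.
have -> : z + z' - z * z' = z + z' * (1 - z).
  by rewrite mulrBr mulr1 (cproj_c cz (cproj_A cz')) addrA.
rewrite bD bfD be_ortho ?ba.1 //.
have E := @be_ortho 1 1 z (z' * (1 - z)) u u (vna1 hA) (vna1 hA) cz zz'.
rewrite P1 -!bM (mulrA w z') wz' wz in E; rewrite E (mulrDr l); apply: lerD; first exact: hz.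
  by rewrite bM; exact: hz'.
all: exact: ba.1.
Qed.

(** Strong approximation of the supremum together with the uniform continuity of [be_cont]; so [Z l]
    is itself the largest member of the level. *)
Lemma Z_ub l a u : 0 <= l -> ball a -> be (P a (Z l u)) <= l * be (Z l u).
Proof.
move=> l0 ba; apply/ler_addgt0Pr => e e_gt0; have [d d0 hd] := be_cont (Z l u) e_gt0.
have [z Iz h] := csup_approx hB u (@lvl_c l) (lvl_dir l) d0.
apply: le_trans (hd a _ ba h) _; rewrite lerD2r; have [cz wz hz] := Iz.
apply: le_trans (hz a u ba) _; apply: ler_wpM2l => //.
by rewrite -(csup_mulr hB (@lvl_c l) Iz) bM; exact: be_le_cut.
Qed.

Lemma Z_max l (z : bop K) : lvl l z -> Z l * z = z. Proof. exact: csup_ub. Qed.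

Lemma Z_mono l l' : 0 <= l -> l <= l' -> Z l' * Z l = Z l.
Proof.
move=> l0 ll'; apply: Z_max; split; [exact: Z_c|exact: Z_w|move=> a u ba].
by apply: le_trans (Z_ub u l0 ba) _; apply: ler_wpM2r => //; exact: be_ge0.
Qed.

(** At a level below 1 the contraction 1 already violates the bound. *)
Lemma Z_lt1 l : 0 <= l -> l < 1 -> Z l = 0.
Proof.
move=> l0 l1; apply: bop_ext => u; rewrite b0; apply: n2_eq0.
have := Z_ub u l0 ball1; rewrite P1 -bM Z_w => h.
have := be_ge (Z l u); rewrite -bM Z_w => h'.
have := n2_ge0 (Z l u); have := be_ge0 (Z l u) => h1 h2.
have h3 : be (Z l u) = 0 by nra.
by apply/eqP; rewrite eq_le h2 andbT; move: h'; rewrite h3 mulr0.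
Qed.

(** The constant collects [D] for the form against the norm, [C] for [P a], and [D] for the norm
    against the form. *)
Lemma Z_big l : D * C * D <= l -> Z l = w.
Proof.
move=> h; have : Z l * w = w.
  apply: Z_max; split=> //; first exact: (cproj_i cw).
  move=> a u [Aa na]; apply: le_trans (be_le _) _.
  have h1 := Pb Aa na (w u); have h2 := be_ge (w u).
  rewrite -bM (cproj_i cw) in h2.
  apply: (@le_trans _ _ (D * (C * n2 (w u)))); first by rewrite ler_pM2l.
  rewrite mulrA; apply: (@le_trans _ _ (D * C * (D * be (w u)))).
    by rewrite ler_pM2l // mulr_gt0.
  by rewrite mulrA; apply: ler_wpM2r => //; exact: be_ge0.
by rewrite -(cproj_c cw (cproj_A (Z_c l))) Z_w.
Qed.

(** The slice [d] between [Z l] and [Z l'] meets the hypotheses of [piece]: the upper bound is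
    [Z_ub], the lower one is maximality of [Z l]. The maximisers on [Z l] and on [d] are combined
    along the central projection [zh]. *)
Lemma level_step l l' (us : seq K) (e : R) : 0 < l -> rho * l' = l -> 0 < e ->
  (exists2 a, ball a & forall u, u \in us -> forall a', ball a' ->
     rho * be (P a' (Z l u)) <= be (P a (Z l u)) + e / 2) ->
  exists2 a, ball a & forall u, u \in us -> forall a', ball a' ->
     rho * be (P a' (Z l' u)) <= be (P a (Z l' u)) + e.
Proof.
move=> l0 ll' e_gt0 [aj bj hj].
have l'0 : 0 < l' by rewrite -(pmulr_rgt0 _ rho0) ll'.
have lel : l <= l' by rewrite -ll' ger_pMl // ltW.
have ZZ := Z_mono (ltW l0) lel.
have cZ := Z_c l; have cZ' := Z_c l'; have BZ := cproj_A cZ; have BZ' := cproj_A cZ'.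
pose d := Z l' * (1 - Z l).
have cd : cproj B d by apply: (cprojM hB) => //; exact: (cprojC hB).
have Zd : Z l * d = 0.
  by rewrite /d (mulrA (Z l)) (cproj_c cZ BZ') -mulrA mulrBr mulr1 (cproj_i cZ) subrr mulr0.
have wd : w * d = d by rewrite /d mulrA Z_w.
have Zl' : Z l' = Z l + d by rewrite /d mulrBr mulr1 ZZ addrC subrK.
have Zl'd : Z l' * d = d by rewrite /d mulrA (cproj_i cZ').
have [||| ad bd hd] := @piece d l' rho cd wd rho0 rho1 _ _ us (e / 2).
- move=> a u ba; have := Z_ub (d u) (ltW l'0) ba.
  by rewrite -(bM (Z l')) Zl'd.
- move=> z cz zd z0n; apply: contrapT => no; apply: z0n.
  have Zz : Z l * z = z.
    apply: Z_max; split=> //.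
      by rewrite -zd (cproj_c cz (cproj_A cd)) mulrA wd.
    move=> a u ba; rewrite leNgt; apply/negP => lt; apply: no.
    by exists a, u; split=> //; rewrite ll'.
  by rewrite -zd (cproj_c cz (cproj_A cd)) -Zz mulrA (cproj_c cd BZ) Zd mul0r.
- by rewrite divr_gt0.
have [cz Pz] := Pi_cproj cZ (Z_w l); set zh := Pi (Z l) in cz Pz.
have Az := cproj_A cz.
have A1z : A (1 - zh) by apply: (vnaB hA) => //; exact: vna1.
pose a := aj * zh + ad * (1 - zh).
have Aa : A a by apply: (vnaD hA); apply: (vnaM hA) => //; [exact: bj.1|exact: bd.1].
have ba : ball a.
  split=> // u; rewrite mul1r /a bD !bM n2D.
  have -> : ip (aj (zh u)) (ad ((1 - zh) u)) = 0.
    have -> : aj (zh u) = zh (aj (zh u)).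
      by rewrite -!bM (mulrA zh) (cproj_c cz bj.1) -mulrA (cproj_i cz).
    have e0 : zh (ad ((1 - zh) u)) = 0.
      by rewrite -(bM zh) (cproj_c cz bd.1) bM -(bM zh) mulrBr mulr1 (cproj_i cz) subrr b0 bf0.
    by rewrite (symE (cproj_s cz)) e0 ip0r.
  have := bj.2 (zh u); have := bd.2 ((1 - zh) u); rewrite !mul1r.
  have := isproj_n2 u (cproj_is cz); rewrite bB bE; lra.
have PaE u : P a (Z l' u) = P aj (Z l u) + P ad (d u).
  have e1 : P a = P aj * Z l + P ad * (w - Z l).
    rewrite PD ?PM ?PBB ?P1 ?Pz //; try exact: vna1; try exact: bj.1; try exact: bd.1.
      by apply: (vnaM hA) => //; exact: bj.1.
    by apply: (vnaM hA) => //; exact: bd.1.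
  rewrite e1 bD -!bM -!mulrA; congr (_ u + _).
    by rewrite (cproj_c cZ BZ') ZZ.
  by have -> : (w - Z l) * Z l' = d by rewrite mulrBl Z_w (cproj_c cZ BZ') ZZ Zl' addrC addKr.
exists a => // u uus a' ba'.
rewrite PaE (be_ortho u u bj.1 bd.1 cZ Zd) Zl' bD bfD (be_ortho u u ba'.1 ba'.1 cZ Zd) mulrDr.
have := hj u uus a' ba'; have := hd u uus a' ba'; lra.
Qed.

(** The climb starts at level [rho < 1], where the projection is 0 and any contraction serves; each
    factor [rho^-1] adds one slice. *)
Lemma level_all (us : seq K) j (e : R) : 0 < e ->
  exists2 a, ball a & forall u, u \in us -> forall a', ball a' ->
     rho * be (P a' (Z (rho * rho^-1 ^+ j) u)) <= be (P a (Z (rho * rho^-1 ^+ j) u)) + e.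
Proof.
elim: j e => [|j IH] e e_gt0.
  exists 1; first exact: ball1.
  move=> u _ a' _; rewrite expr0 mulr1 (Z_lt1 (ltW rho0) rho1) b0 !bf0 /be bf0 ip0l; lra.
apply: level_step (IH (e / 2) _) => //; last by rewrite divr_gt0.
  by rewrite mulr_gt0 // exprn_gt0 // invr_gt0.
by rewrite exprS (mulrA rho rho^-1) divff ?gt_eqF // mul1r.
Qed.

Lemma near_max_rho (us : seq K) (e : R) : 0 < e ->
  exists2 a, ball a & forall u, u \in us -> forall a', ball a' -> rho * be (P a' u) <= be (P a u) + e.
Proof.
move=> e_gt0; have DCD : 0 < D * C * D by rewrite !mulr_gt0.
have [j hj] : exists j, D * C * D <= rho * rho^-1 ^+ j.
  have t0 : 0 < rho / (D * C * D) by rewrite divr_gt0.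
  have cv : rho ^+ n @[n --> \oo] --> (0 : R) by apply: cvg_expr; rewrite gtr0_norm.
  have /cvgrPdist_lt /(_ _ t0) [j _ hj] := cv; exists j.
  have := hj j (leqnn j); rewrite /= sub0r normrN gtr0_norm ?exprn_gt0 // ltr_pdivlMr // => h.
  by rewrite exprVn ler_pdivlMr ?exprn_gt0 // mulrC ltW.
have [a ba h] := level_all us j e_gt0; exists a => // u uus a' ba'.
have := h u uus a' ba'; rewrite (Z_big hj) -!bM !Pw //; [exact: ba.1|exact: ba'.1].
Qed.
End Levels.

Lemma seq_bound (us : seq K) : exists2 M : R, 0 < M & forall u, u \in us -> n2 u <= M.
Proof.
elim: us => [|u us [M M0 h]]; first by exists 1.
exists (M + n2 u); first by have := n2_ge0 u; lra.
move=> v; rewrite inE => /orP[/eqP ->|/h]; [lra|have := n2_ge0 u; lra].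
Qed.

Lemma near_max (us : seq K) (e : R) : 0 < e ->
  exists2 a, ball a & forall u, u \in us -> forall a', ball a' -> be (P a' u) <= be (P a u) + e.
Proof.
move=> e_gt0; have [M M0 hM] := seq_bound us; pose X : R := D * C * M.
have X0 : 0 < X by rewrite /X !mulr_gt0.
(* [X] bounds all values of the form, so replacing the factor [1 - t] by 1 costs at most
   [t * X <= e / 2]. *)
pose t : R := e / 2 / (X + e); have t0 : 0 < t by rewrite !divr_gt0 //; lra.
have tE : t * (X + e) = e / 2 by rewrite /t divfK // gt_eqF //; lra.
have t1 : t < 1 by nra.
have [|||a ba h] := @near_max_rho (1 - t) _ _ us (e / 2); [lra|lra|by rewrite divr_gt0|].
exists a => // u uus a' ba'; have := h u uus a' ba'.
have : be (P a' u) <= X.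
  apply: le_trans (be_le _) _; rewrite /X -mulrA ler_pM2l //.
  by apply: le_trans (Pb ba'.1 ba'.2 u) _; rewrite ler_pM2l //; exact: hM.
nra.
Qed.

Definition Smax (us : seq K) (e : R) : set (bop H) := [set a | ball a /\
  forall u, u \in us -> forall a', ball a' -> be (P a' u) <= be (P a u) + e].
(** Along this filter the form at [P a u] tends to its supremum at every [u] simultaneously, which
    is why the supremum is again a quadratic form. *)
Definition Fmax : set_system (bop H) := [set X | exists us e, 0 < e /\ Smax us e `<=` X].

Lemma Fmax_proper : ProperFilter Fmax.
Proof.
apply: Build_ProperFilter_ex => [X [us [e [e0 sX]]]|].
  by have [a ba h] := near_max us e0; exists a; apply: sX; split.
split=> [|X Y [us [e [e0 sX]]] [us' [e' [e'0 sY]]]|X Y XY [us [e [e0 sX]]]].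
- by exists [::], 1; split=> // a.
- exists (us ++ us'), (Num.min e e'); split; first by rewrite lt_min e0.
  move=> a [ba h]; split; [apply: sX|apply: sY]; split=> // u uus a' ba'.
    have := h u; rewrite mem_cat uus => /(_ isT a' ba'); have : Num.min e e' <= e by rewrite ge_min lexx.
    lra.
  have := h u; rewrite mem_cat uus orbT => /(_ isT a' ba'); have : Num.min e e' <= e' by rewrite ge_min lexx orbT.
  lra.
- by exists us, e; split=> //; apply: subset_trans sX XY.
Qed.

Lemma core_max : exists k : bop K, [/\ B k, sym k, k * w = k,
  forall u, n2 (w u) <= D * ip (k u) u &
  forall x u, ball x -> ip (k (P x u)) (P x u) <= ip (k u) u].
Proof.
have FP := Fmax_proper; have [U [UU sub]] := ultraFilterLemma FP.
have FU := @ultra_proper _ _ UU.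
(* The value 0 off the ball keeps the family uniformly bounded, as [wlim] requires; the filter is
   concentrated on the ball. *)
pose T a : bop K := if pselect (ball a) then star (P a) * Bo * P a else 0.
have TE a : ball a -> T a = star (P a) * Bo * P a by move=> ba; rewrite /T; case: (pselect (ball a)).
have Tip a u : ball a -> ip (T a u) u = be (P a u).
  by move=> ba; rewrite TE // !bM ip_starl.
have nT a : nle (T a) (C * D ^+ 2 * C).
  rewrite /T; case: (pselect (ball a)) => [ba|nba].
    have nP := Pb ba.1 ba.2; apply: nleM => //; last first.
    - apply: nleM; [|exact: (nle_star (ltW C0) nP)|].
        exact: ltW.
      by apply: pos_nle => //; exact: ltW.
    - by rewrite mulr_ge0 ?sqr_ge0 // ltW.
  by move=> u; rewrite b0 n20 mulr_ge0 ?n2_ge0 // mulr_ge0 ?(ltW C0) // mulr_ge0 ?sqr_ge0 // ltW.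
have BT a : B (T a).
  rewrite /T; case: (pselect (ball a)) => [ba|nba]; last exact: vna0.
  by do 2?apply: (vnaM hB) => //; [apply: vna_star => //|]; exact: PB ba.1.
have sT a : sym (T a).
  by rewrite /T; case: (pselect (ball a)) => ba; [exact: sandwich_sym|rewrite /sym star0].
have c0 : 0 <= C * D ^+ 2 * C by rewrite mulr_ge0 ?(ltW C0) // mulr_ge0 ?sqr_ge0 // ltW.
have [k _ hk] := wlim UU c0 nT.
have up a' u : ball a' -> be (P a' u) <= ip (k u) u.
  move=> ba'; apply/ler_addgt0Pr => e e0; rewrite -lerBlDr.
  apply: (cvgr_to_ge (hk u u)); apply: sub; exists [:: u], e; split=> // a [ba h].
  by rewrite /= Tip // lerBlDr; apply: h => //; rewrite inE.
exists k; split.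
- apply: (vnaP hB) => y cy; apply/esym/(wlim_comm UU hk) => a.
  by rewrite cy.
- apply: symP => u v; rewrite (ipC u); apply: (uq_lim FU (hk u v)).
  have -> : (fun a => ip (T a u) v) = (fun a => ip (T a v) u).
    by apply/funext => n; rewrite (symE (sT n)) ipC.
  exact: hk.
- apply: bop_ext => u; apply: ip_ext => v; rewrite bM.
  apply: (uq_lim FU (hk (w u) v)).
  have -> : (fun a => ip (T a (w u)) v) = (fun a => ip (T a u) v).
    apply/funext => a; rewrite -bM /T; case: (pselect (ball a)) => [ba|nba]; last by rewrite mul0r.
    by rewrite -(mulrA _ (P a) w) (Pw ba.1).
  exact: hk.
- move=> u; have := be_ge (w u); rewrite -bM (cproj_i cw) => h.
  apply: le_trans h _; rewrite ler_pM2l //; have := up 1 u ball1; rewrite P1.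
  by [].
(* [a x] is again in the ball, so the supremum at [P x u] runs over some of the values at [u]. *)
move=> x u bx; apply: (cvgr_to_le (hk (P x u) (P x u))); apply: sub.
exists [::], 1; split=> // a [ba _] /=; rewrite Tip // -bM -PM; [|exact: ba.1|exact: bx.1].
exact: up (ballM ba bx).
Qed.
End Core.

Theorem core (R : realType) (H K : hilbertSpace R) (A : set (bop H)) (B : set (bop K))
  (s1 s2 : bop H) (P : bop H -> bop K) (w : bop K) (C : R) (z0 : bop H) (Pi : bop K -> bop H) :
  vna A -> vna B -> A s1 /\ A s2 -> [/\ star s1 * s1 = 1, star s2 * s2 = 1 & star s1 * s2 = 0] ->
  cproj B w -> 0 < C ->
  [/\ forall x, A x -> B (P x), forall x y, A x -> A y -> P (x + y) = P x + P y,
      forall x y, A x -> A y -> P (x * y) = P x * P y, P 1 = w &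
      forall x, A x -> nle x 1 -> nle (P x) C] ->
  cproj A z0 -> (forall x, A x -> P x = 0 -> x * z0 = 0) ->
  [/\ forall y : bop K, B y -> A (Pi y), forall y : bop K, B y -> Pi y * z0 = Pi y &
      forall y : bop K, B y -> P (Pi y) = w * y] ->
  exists k : bop K, [/\ B k, sym k, k * w = k,
    forall u, n2 (w u) <= C * C * ip (k u) u &
    forall x u, A x -> nle x 1 -> ip (k (P x u)) (P x u) <= ip (k u) u].
Proof.
move=> hA hB [As1 As2] [s11 s22 s12] cw C0 [PB PD PM P1 Pb] cz0 Pker [PA Piz PPi].
have [Bo [BBo sBo h1 h2 h3]] := beta_ex hA hB As1 As2 s11 s22 s12 C0 PB PD PM P1 Pb.
have [k [Bk sk kw lo mx]] := core_max hA hB As1 As2 s11 s22 s12 cw C0 PB PD PM P1 Pb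
  cz0 Pker PA Piz PPi BBo sBo h1 h2 h3.
by exists k; split=> // x u Ax nx; apply: mx.
Qed.

(** * Affiliated and locally bounded operators *)

Section Bridge.
Variables (R : realType) (H : hilbertSpace R).
Implicit Types (a b c z w p q : bop H) (u v : H) (x y : operator H) (A : set (bop H)) (M : set (operator H)).

Definition gr a : operator H := op_of_fun a.
Lemma gr_inj a b : gr a = gr b -> a = b.
Proof. by move=> e; apply: bop_ext => u; have : gr b (u, a u) by rewrite -e. Qed.

Fact bop_linear a : linear_for *:%R (a : H -> H).
Proof. by move=> c u v; exact: bf_lin. Qed.
HB.instance Definition _ a := GRing.isLinear.Build _ _ _ _ (a : H -> H) (bop_linear a).

Lemma bop_continuous a : continuous (a : H -> H).
Proof.
move=> u P /nbhsP[e e0 h]; have [C C0 hC] := nleP a.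
apply/nbhsP; exists (e / C); first by rewrite divr_gt0.
move=> v; rewrite ltr_pdivlMr // => hv; apply: h; rewrite -bfB.
by apply: le_lt_trans (hC _) _; rewrite mulrC.
Qed.

Lemma bounded_gr x : bounded_op x <-> exists a, x = gr a.
Proof.
split=> [[f fc ->]|[a ->]]; last by exists (a : {linear H -> H}) => //; exact: bop_continuous.
have fr r u : f (rs r u) = rs r (f u) by rewrite /rs linearZ.
have : nbhs (0 : H) (f @^-1` [set v | n2 v < 1]).
  apply: fc; apply/nbhsP; exists 1 => // v; rewrite linear0 sub0r n2N.
  by [].
move=> /nbhsP[e e0 h].
have bd : exists C : R, forall u, n2 (f u) <= C * n2 u.
  exists (2 / e) => u; have [u0|u0] := eqVneq (n2 u) 0.
    by rewrite (n2_eq0 u0) linear0 n20 mulr0.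
  have {}u0 : 0 < n2 u by rewrite lt_neqAle eq_sym u0 n2_ge0.
  have s0 : 0 < e / (2 * n2 u) by rewrite divr_gt0 ?mulr_gt0.
  (* The vector is rescaled to squared norm [e / 2], inside the neighbourhood given by continuity at
     0. *)
  have := h (rs (Num.sqrt (e / (2 * n2 u))) u).
  rewrite sub0r n2N /= fr !n2Z (sqr_sqrtr (ltW s0)) => h1.
  have E : e / (2 * n2 u) * n2 u = e / 2 by field; rewrite gt_eqF.
  have /h1 : e / (2 * n2 u) * n2 u < e by rewrite E; lra.
  rewrite mulrAC ltr_pdivrMr ?mulr_gt0 // mul1r => h2.
  by rewrite mulrAC ler_pdivlMr // mulrC ltW.
have lin (c : R[i]) u v : f (c *: u + v) = c *: f u + f v by rewrite linearP.
by exists (Bop lin bd).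
Qed.

Lemma op_mul_gr a b : op_mul (gr a) (gr b) = gr (a * b).
Proof.
apply/seteqP; split=> [[u v] [w h1 h2]|[u v] h]; last by exists (b u).
exact: (etrans h2 (congr1 a h1)).
Qed.
Lemma op_adj_gr a : op_adj (gr a) = gr (star a).
Proof.
apply/seteqP; split=> [[v w] /= h|[v w] h u u' e]; last first.
  have {}h : w = star a v := h; have {}e : u' = a u := e.
  by rewrite /= e h !innerE ip_star -bfi ip_star.
apply: ip_ext => u; rewrite (ipC w) (ipC _ u) -ip_star.
by have := h u (a u) erefl; rewrite !innerE => -[-> _].
Qed.
Lemma gr0 : gr 0 = op0 H. Proof. by []. Qed.

Lemma projection_gr p : projection (gr p) <-> isproj p.
Proof.
rewrite /projection /isproj op_adj_gr op_mul_gr; split=> [[_ /gr_inj s /gr_inj i]|[s i]].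
  by split.
by rewrite s i; split=> //; apply/bounded_gr; exists p.
Qed.
Lemma proj_le_gr p q : proj_le (gr p) (gr q) <-> q * p = p.
Proof. by rewrite /proj_le op_mul_gr; split=> [/gr_inj|->]. Qed.

Definition bops M : set (bop H) := [set a | M (gr a)].

Section VN.
Variable M : set (operator H).
Hypothesis hM : von_neumann_algebra M.
Let A := bops M.

Lemma M_gr x : M x -> exists2 a, A a & x = gr a.
Proof.
by case: hM => bM _ _ Mx; have /bounded_gr[a e] := bM _ Mx; exists a => //; rewrite /A /bops /= -e.
Qed.

Lemma commutant_gr c : commutant M (gr c) <-> cm A c.
Proof.
split=> [[_ h] a Aa|h]; first by apply: gr_inj; rewrite -!op_mul_gr h.
split; first by apply/bounded_gr; exists c.
by move=> _ /M_gr[a Aa ->]; rewrite !op_mul_gr h.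
Qed.

Lemma commutant_ex y : commutant M y <-> exists2 c, cm A c & y = gr c.
Proof.
split=> [cy|[c cc ->]]; last exact/commutant_gr.
by have [/bounded_gr[c e] _] := cy; exists c => //; apply/commutant_gr; rewrite -e.
Qed.

Lemma vna_bops : vna A.
Proof.
have [bM sM cM] := hM; split=> a; first by rewrite /A /bops /= -op_adj_gr => /sM.
move=> h; rewrite /A /bops /= -cM; split; first by apply/bounded_gr; exists a.
by move=> y /commutant_ex[c cc ->]; rewrite !op_mul_gr h.
Qed.
Let hA := vna_bops.

Lemma projection_in_gr p : projection_in M (gr p) <-> proj A p.
Proof. by split=> [[Mp /projection_gr pp]|[Ap pp]]; split=> //; exact/projection_gr. Qed.

Lemma central_projection_gr z : central_projection M (gr z) <-> cproj A z.
Proof.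
split=> [[/projection_in_gr pz /commutant_gr cz]|[pz cz]]; split=> //.
  exact/projection_in_gr.
exact/commutant_gr.
Qed.
Lemma central_projection_ex x : central_projection M x -> exists2 z, cproj A z & x = gr z.
Proof.
move=> h; have [[Mx _] _] := h; have [z Az e] := M_gr Mx; exists z => //.
by apply/central_projection_gr; rewrite -e.
Qed.

Lemma finite_projection_gr p : finite_projection M (gr p) <-> finp A p.
Proof.
split=> [[/projection_in_gr [Ap pp] h]|[[Ap pp] h]].
  split=> // w Aw ww pw; have iw : isproj (star w * w) by rewrite ww.
  have [_ [Aww pww]] := proj_pi hA Aw iw.
  apply: gr_inj; apply: h.
  - exact/projection_in_gr.
  - by apply/proj_le_gr; rewrite mulrA pw.
  - by exists (gr w); split=> //; rewrite op_adj_gr op_mul_gr ?ww.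
split; first exact/projection_in_gr.
move=> q [/M_gr[b Ab ->]] _ /proj_le_gr pb [v [/M_gr[w Aw ->]]].
rewrite op_adj_gr !op_mul_gr => /gr_inj ww /gr_inj wb; congr gr; rewrite -wb; apply: h => //.
have iw : isproj (star w * w) by rewrite ww.
by rewrite -{1}(pi_mul' iw) wb mulrA pb -wb pi_mul'.
Qed.

Lemma pinf_gr : properly_infinite M -> pinf A.
Proof.
move=> h z /central_projection_gr cz /finite_projection_gr fz.
by apply: gr_inj; rewrite gr0; exact: h.
Qed.

Definition typeI (B : set (bop H)) := forall z, cproj B z -> z <> 0 -> exists p,
  [/\ proj B p, forall a b, B a -> B b -> p * a * p * (p * b * p) = p * b * p * (p * a * p),
      p <> 0 & z * p = p].
Definition typeIII (B : set (bop H)) := forall p, finp B p -> p = 0.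

Lemma typeI_gr : type_I M -> typeI A.
Proof.
move=> h z /central_projection_gr cz z0.
have [|x [[[Mx px] ab] x0 le]] := h _ cz; first by rewrite -gr0 => /gr_inj.
have [p Ap xE] := M_gr Mx; rewrite {}xE in px ab x0 le.
exists p; split.
- by split=> //; exact/projection_gr.
- move=> a b Aa Ab; have := ab _ _ Aa Ab; rewrite /= !op_mul_gr => /gr_inj.
  by rewrite !mulrA.
- by move=> p0; apply: x0; rewrite p0.
- exact/proj_le_gr.
Qed.
Lemma typeIII_gr : type_III M -> typeIII A.
Proof. by move=> h p /finite_projection_gr /h; rewrite -gr0 => /gr_inj. Qed.
Lemma typeIII_pinf : typeIII A -> pinf A.
Proof. by move=> h z _; exact: h. Qed.

Definition aff (B : set (bop H)) x := closed_densely_defined x /\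
  forall c, cm B c -> forall u v, x (u, v) -> x (c u, c v).

Lemma affiliated_gr x : affiliated M x <-> aff A x.
Proof.
split=> [[cx h]|[cx h]]; split=> //.
  move=> c cc u v xuv; have [||w e] := h (gr c) _ (u, c v); first exact/commutant_gr.
    by exists v.
  by have -> : c u = w := esym e.
move=> _ /commutant_ex[c cc ->] [u w] [v xuv e]; have -> : w = c v := e.
by exists (c u) => //; exact: h.
Qed.
End VN.
End Bridge.

(** * Calculus of bounded central pieces *)

Section LB.
Variables (R : realType) (H : hilbertSpace R).
Implicit Types (a b c z w p q : bop H) (u v : H) (x y T : operator H) (I J : set (bop H)).
Variable A : set (bop H).
Hypothesis hA : vna A.

(** [x z] is everywhere defined and equal to the bounded operator [a]. *)
Definition at_ x z a := forall u, x (z u, a u).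
Definition bd x : set (bop H) := [set z | cproj A z /\ exists a, at_ x z a].
(** Locally bounded operators, the working substitute for [LS]; the two are identified by [LS_lb]
    and [lb_LS]. *)
Definition lb x := aff A x /\ dense_fam (bd x).

Lemma eq0_small u : (forall e : R, 0 < e -> n2 u <= e) -> u = 0.
Proof.
move=> h; apply: n2_eq0; apply/eqP; rewrite eq_le n2_ge0 andbT.
by apply/ler_addgt0Pr => e e0; rewrite add0r; exact: h.
Qed.

Section Aff.
Variable x : operator H.
Hypothesis ax : aff A x.
Lemma aff0 : x (0, 0). Proof. by case: ax => [[[]]]. Qed.
Lemma aff_lin (c : R[i]) u v u' v' : x (u, v) -> x (u', v') -> x (c *: u + u', c *: v + v').
Proof. by case: ax => [[[_ h _] _ _] _] h1 h2; exact: (h c (u, v) (u', v')). Qed.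
Lemma affD u v u' v' : x (u, v) -> x (u', v') -> x (u + u', v + v').
Proof. by move=> h1 h2; have := aff_lin 1 h1 h2; rewrite !scale1r. Qed.
Lemma affN u v : x (u, v) -> x (- u, - v).
Proof. by move=> h1; have := aff_lin (-1) h1 aff0; rewrite !scaleN1r !addr0. Qed.
Lemma affB u v u' v' : x (u, v) -> x (u', v') -> x (u - u', v - v').
Proof. by move=> h1 /affN h2; exact: affD. Qed.
Lemma aff_fun u v (w : H) : x (u, v) -> x (u, w) -> v = w.
Proof. by case: ax => [[[_ _ h] _ _] _]; exact: h. Qed.
Lemma aff_closed : closed x. Proof. by case: ax => [[]]. Qed.
Lemma aff_z z u v : cproj A z -> x (u, v) -> x (z u, z v).
Proof. by case: ax => _ h cz xuv; apply: h xuv => a Aa; exact: (cproj_c cz Aa). Qed.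
Lemma at_uniq z a b : at_ x z a -> at_ x z b -> a = b.
Proof. by move=> ha hb; apply: bop_ext => u; exact: aff_fun (ha u) (hb u). Qed.
Lemma at_zr z a : cproj A z -> at_ x z a -> a * z = a.
Proof.
move=> cz h; apply: bop_ext => u; apply: aff_fun (h u).
by have := h (z u); rewrite -(bM z) (cproj_i cz).
Qed.
Lemma at_A z a : cproj A z -> at_ x z a -> A a.
Proof.
move=> cz h; apply: (vnaP hA) => c cc; apply: bop_ext => u.
have := h (c u); rewrite -(bM z) -(cc z (cproj_A cz)) bM => h1.
by apply: aff_fun h1; case: ax => _ k; apply: k.
Qed.
Lemma at_zl z a : cproj A z -> at_ x z a -> z * a = a.
Proof. by move=> cz h; rewrite (cproj_c cz (at_A cz h)) at_zr. Qed.
Lemma at_v z a u v : cproj A z -> at_ x z a -> x (u, v) -> z v = a u.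
Proof. by move=> cz h xuv; apply: aff_fun (h u); exact: aff_z. Qed.
Lemma at_compat z a z' a' : cproj A z -> cproj A z' -> at_ x z a -> at_ x z' a' -> a * z' = a' * z.
Proof.
move=> cz cz' h h'; apply: (@at_uniq (z * z')) => u; first exact: h.
by rewrite (cproj_c cz (cproj_A cz')); exact: h'.
Qed.
Lemma at_join z a z' a' : cproj A z -> cproj A z' -> at_ x z a -> at_ x z' a' ->
  at_ x (z + z' - z * z') (a + a' - a * z').
Proof. by move=> cz cz' h h' u; rewrite !bE; apply: affB; [apply: affD|exact: (h (z' u))]. Qed.
Lemma at_join_nle z a z' a' (C : R) : cproj A z -> cproj A z' -> at_ x z a -> at_ x z' a' ->
  nle a C -> nle a' C -> nle (a + a' - a * z') C.
Proof.
move=> cz cz' h h' n n' u; rewrite (at_compat cz cz' h h') !bE -addrA -bfB n2D.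
have -> : ip (a u) (a' (u - z u)) = 0.
  rewrite -{1}(at_zl cz h) bM (symE (cproj_s cz)) -bM (cproj_c cz (at_A cz' h')) bM bfB.
  by rewrite isproj_id ?subrr ?bf0 ?ip0r //; exact: cproj_is cz.
have := n (z u); rewrite -bM (at_zr cz h) mulr0 addr0 (isproj_n2 u (cproj_is cz)) mulrDr => h1.
by apply: lerD.
Qed.
Lemma bd_dir : directed (bd x).
Proof.
split; first by exists 0; split; [exact: cproj0|exists 0 => u; exact: aff0].
move=> z z' [cz [a h]] [cz' [a' h']]; split; first exact: cprojJ.
by exists (a + a' - a * z'); exact: at_join.
Qed.
End Aff.

Lemma bd_c x : bd x `<=` cproj A. Proof. by move=> z []. Qed.
Lemma at_mul x z a z' : at_ x z a -> at_ x (z * z') (a * z').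
Proof. by move=> h u; exact: h. Qed.

Lemma dir_approx2 I u v (e : R) : I `<=` cproj A -> directed I -> dense_fam I -> 0 < e ->
  exists2 z, I z & n2 (u - z u) < e /\ n2 (v - z v) < e.
Proof.
move=> hI dI sI e0; have [z1 I1 h1] := dense_approx hA u hI dI sI e0.
have [z2 I2 h2] := dense_approx hA v hI dI sI e0.
have c1 := hI _ I1; have c2 := hI _ I2.
have aux z z' t : cproj A z -> z * z' = z' -> n2 (t - z t) <= n2 (t - z' t).
  move=> cz zz; have -> : t - z t = (1 - z) (t - z' t).
    by rewrite bfB !bB !b1 -(bM z) zz subrr subr0.
  by have := isproj_nle (isprojC (cproj_is cz)) (t - z' t); rewrite mul1r.
have cj := cprojJ hA c1 c2.
exists (z1 + z2 - z1 * z2); first exact: dI.2.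
split; [apply: le_lt_trans h1|apply: le_lt_trans h2]; apply: aux => //.
  by rewrite mulrBl mulrDl (cproj_i c1) -mulrA (cproj_c c2 (cproj_A c1)) mulrA (cproj_i c1) addrK.
by rewrite mulrBl mulrDl (cproj_i c2) -mulrA (cproj_i c2) addrC addKr.
Qed.

(** The graph is closed, and the bounded pieces approximate [u] and [v] simultaneously. *)
Lemma lbP x u v : lb x -> (forall z a, cproj A z -> at_ x z a -> z v = a u) -> x (u, v).
Proof.
move=> [ax dx] h; have /closed2P := aff_closed ax; apply=> e e0; have [z [cz [a za]] [h1 h2]] := dir_approx2 u v (@bd_c x) (bd_dir ax) dx e0.
by exists (z u), (z v); split=> //; rewrite (h z a).
Qed.

(** Identities between locally bounded operators reduce by this to identities between bounded
    ones. *)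
Lemma lb_ext x y I : lb x -> lb y -> dense_fam I ->
  (forall z, I z -> cproj A z /\ exists a, at_ x z a /\ at_ y z a) -> x = y.
Proof.
have aux x' y' : lb x' -> lb y' -> dense_fam I ->
    (forall z, I z -> cproj A z /\ exists a, at_ x' z a /\ at_ y' z a) -> x' `<=` y'.
  move=> [ax _] ly dI h [u v] xuv; apply: lbP => // z' b cz' hb.
  apply/eqP; rewrite -subr_eq0; apply/eqP; apply: dI => z Iz.
  have [cz [a [xa ya]]] := h z Iz; have ay := ly.1.
  have e1 : z (z' v) = a (z' u).
    rewrite -bM (cproj_c cz (cproj_A cz')) bM (at_v ax cz xa xuv) -!bM.
    by rewrite (cproj_c cz') //; exact: (at_A ax cz xa).
  have e2 : z (b u) = a (z' u).
    by rewrite -!bM (cproj_c cz (at_A ay cz' hb)) (at_compat ay cz' cz hb ya).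
  by rewrite bfB e1 e2 subrr.
move=> lx ly dI h; apply/seteqP; split; apply: aux => // z /h[cz [a [h1 h2]]].
by split=> //; exists a.
Qed.

(** The operator with prescribed bounded parts: [F z a] means [x z = a]. *)
Definition patch (F : bop H -> bop H -> Prop) : operator H :=
  [set p | forall z a, F z a -> z p.2 = a p.1].
Definition pdom (F : bop H -> bop H -> Prop) : set (bop H) := [set z | exists a, F z a].
Definition patchable F := [/\ forall z a, F z a -> [/\ cproj A z, A a & a * z = a],
  forall z a z' a', F z a -> F z' a' -> a * z' = a' * z & dense_fam (pdom F)].

Lemma patch_at F z a : patchable F -> F z a -> at_ (patch F) z a.
Proof.
move=> [h1 h2 _] Fz u z' a' Fz' /=; have [cz Aa az] := h1 _ _ Fz; have [cz' _ _] := h1 _ _ Fz'.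
by rewrite -!bM (cproj_c cz' Aa) (h2 _ _ _ _ Fz Fz').
Qed.

Lemma patch_lb F : patchable F -> lb (patch F).
Proof.
move=> pF; have [h1 h2 h3] := pF; have at_F z a : F z a -> at_ (patch F) z a by exact: patch_at.
split; last first.
  move=> u hu; apply: h3 => z [a Fz]; apply: hu; split; first by have [] := h1 _ _ Fz.
  by exists a; exact: at_F.
have lin : linear_op (patch F).
  split.
  - by move=> z a _ /=; rewrite !bf0.
  - by move=> c p q hp hq z a Fz; rewrite /= !bf_lin (hp _ _ Fz) (hq _ _ Fz).
  move=> u v w hv hw; apply/eqP; rewrite -subr_eq0; apply/eqP; apply: h3 => z [a Fz].
  by rewrite bfB (hv _ _ Fz) (hw _ _ Fz) subrr.
split; first split=> //.
- apply/closed2P => -[u v] h z a Fz /=; apply/eqP; rewrite -subr_eq0; apply/eqP.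
  apply: eq0_small => e e0; have [C C0 nC] := nleP a.
  have d0 : 0 < e / (2 + 2 * C) by rewrite divr_gt0 // addr_gt0 // mulr_gt0.
  have [u' [v' [/(_ _ _ Fz) /= zv hu hv]]] := h _ d0.
  have -> : z v - a u = z (v - v') - a (u - u') by rewrite !bfB zv opprB addrA subrK.
  apply: le_trans (n2D_le _ _) _; rewrite n2N.
  have := nC (u - u'); have [cz _ _] := h1 _ _ Fz.
  have := isproj_nle (cproj_is cz) (v - v'); rewrite mul1r.
  move: hu hv; rewrite /= !ltr_pdivlMr ?addr_gt0 ?mulr_gt0 //.
  have := n2_ge0 (u - u'); have := n2_ge0 (v - v'); nra.
- apply/denseP => u e e0.
  have sd : subsp (dom (patch F)).
    split; first by exists 0; case: lin.
    by move=> c u1 u2 [v1 k1] [v2 k2]; exists (c *: v1 + v2); case: lin => _ l _; exact: (l c (u1, v1) (u2, v2)).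
  apply: subsp_dense => // v hv; have -> : v = 0; last by rewrite /im scaler0 !ip0l.
  apply: h3 => z [a Fz]; have [cz _ _] := h1 _ _ Fz.
  have [|k _] := hv (z (z v)); first by exists (a (z v)); exact: at_F.
  apply: n2_eq0; rewrite /n2 -{2}(isproj_id v (cproj_is cz)).
  by rewrite (symE (cproj_s cz)) (isproj_id v (cproj_is cz)) ipC.
move=> c cc u v h z a Fz /=; have [cz Aa _] := h1 _ _ Fz.
by rewrite -!bM -(cc _ (cproj_A cz)) -(cc _ Aa) !bM (h _ _ Fz).
Qed.

(** This computes the closures in the operations of [LS]: an operator lying between the bounded
    pieces and their patch has the patch as closure. *)
Lemma patch_closure F T : patchable F -> directed (pdom F) -> T `<=` patch F ->
  (forall z a u, F z a -> T (z u, a u)) -> closure T = patch F.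
Proof.
move=> pF dF TF FT; have lF := patch_lb pF; have [h1 _ h3] := pF.
apply/seteqP; split=> [p /closure2P h|[u v] h]; last first.
  apply/closure2P => e e0.
  have sF : pdom F `<=` cproj A by move=> z [a /h1[]].
  have [z [a Fz] [k1 k2]] := dir_approx2 u v sF dF h3 e0.
  by exists (z u), (z v); split=> //; rewrite (h _ _ Fz); exact: FT.
have /closed2P := aff_closed lF.1; apply.
by move=> e /h[a [b [/TF Tab ? ?]]]; exists a, b.
Qed.

Section Op2.
Variables (x y : operator H) (f : bop H -> bop H -> bop H).
Hypotheses (lx : lb x) (ly : lb y).
Hypothesis fA : forall a b, A a -> A b -> A (f a b).
Hypothesis fz : forall a b z, A a -> A b -> cproj A z -> f a b * z = f (a * z) (b * z).
Definition F2 z c := exists a b, [/\ cproj A z, at_ x z a, at_ y z b & c = f a b].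
Lemma F2_patch : patchable F2 /\ directed (pdom F2).
Proof.
have [ax dx] := lx; have [ay dy] := ly; split; first split.
- move=> z _ [a [b [cz ha hb ->]]]; have Aa := at_A ax cz ha; have Ab := at_A ay cz hb.
  by split=> //; [exact: fA|rewrite fz // (at_zr ax cz ha) (at_zr ay cz hb)].
- move=> z _ z' _ [a [b [cz ha hb ->]]] [a' [b' [cz' ha' hb' ->]]].
  have Aa := at_A ax cz ha; have Ab := at_A ay cz hb.
  have Aa' := at_A ax cz' ha'; have Ab' := at_A ay cz' hb'.
  by rewrite !fz // (at_compat ax cz cz' ha ha') (at_compat ay cz cz' hb hb').
- move=> u hu; apply: dx => z [cz [a ha]]; apply: dy => z' [cz' [b hb]].
  rewrite -bM; apply: hu; exists (f (a * z') (b * z)), (a * z'), (b * z).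
  split=> //; [exact: cprojM|rewrite (cproj_c cz' (cproj_A cz)); exact: at_mul|exact: at_mul].
split.
  exists 0; exists (f 0 0), 0, 0; split=> //; first exact: cproj0.
    by move=> u; exact: aff0 ax.
  by move=> u; exact: aff0 ay.
move=> z z' [_ [a [b [cz ha hb _]]]] [_ [a' [b' [cz' ha' hb' _]]]].
eexists; exists (a + a' - a * z'), (b + b' - b * z'); split=> //; first exact: cprojJ.
  exact: (at_join ax cz cz' ha ha').
exact: (at_join ay cz cz' hb hb').
Qed.
Lemma F2_closure T : T `<=` patch F2 -> (forall z c u, F2 z c -> T (z u, c u)) ->
  lb (closure T) /\ forall z a b, cproj A z -> at_ x z a -> at_ y z b -> at_ (closure T) z (f a b).
Proof.
move=> h1 h2; have [pF dF] := F2_patch; rewrite (patch_closure pF dF h1 h2); split.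
  exact: patch_lb.
by move=> z a b cz ha hb; apply: patch_at => //; exists a, b.
Qed.
End Op2.

Lemma ls_add_lb x y : lb x -> lb y -> lb (ls_add x y) /\
  forall z a b, cproj A z -> at_ x z a -> at_ y z b -> at_ (ls_add x y) z (a + b).
Proof.
move=> lx ly; apply: (@F2_closure x y (fun a b => a + b)) => //.
- by move=> a b; exact: vnaD.
- by move=> a b z _ _ _; rewrite mulrDl.
- move=> [u s] [v [w [/= h1 h2 ->]]] z _ [a [b [cz ha hb ->]]] /=.
  by rewrite bfD (at_v lx.1 cz ha h1) (at_v ly.1 cz hb h2).
- by move=> z _ u [a [b [cz ha hb ->]]]; exists (a u), (b u); split=> //; [exact: ha|exact: hb].
Qed.

Lemma ls_mul_lb x y : lb x -> lb y -> lb (ls_mul x y) /\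
  forall z a b, cproj A z -> at_ x z a -> at_ y z b -> at_ (ls_mul x y) z (a * b).
Proof.
move=> lx ly; apply: (@F2_closure x y (fun a b => a * b)) => //.
- by move=> a b; exact: vnaM.
- move=> a b z Aa Ab cz; rewrite -(cproj_c cz Ab) (mulrA (a * z)) -(mulrA a z z) (cproj_i cz).
  by rewrite -!mulrA (cproj_c cz Ab).
- move=> [u w] [v /= h1 h2] z _ [a [b [cz ha hb ->]]] /=.
  by rewrite (at_v lx.1 cz ha h2) -(at_v ly.1 cz hb h1) -(bM a z) (at_zr lx.1 cz ha).
- move=> z _ u [a [b [cz ha hb ->]]]; exists (b u); first exact: hb.
  by rewrite -{1}(at_zl ly.1 cz hb); exact: ha.
Qed.

Lemma ls_scale_lb (c : R[i]) x : lb x -> lb (ls_scale c x) /\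
  forall z a, cproj A z -> at_ x z a -> at_ (ls_scale c x) z (bsc c * a).
Proof.
move=> lx; have [||||l h] := @F2_closure x x (fun a b => bsc c * a) lx lx _ _ (op_scale c x); first 4 last.
- by split=> // z a cz ha; exact: h.
- by move=> a b Aa _; apply: (vnaM hA) => //; exact: vna_sc.
- by move=> a b z _ _ _; rewrite mulrA.
- move=> [u s] [v /= h ->] z _ [a [b [cz ha _ ->]]] /=.
  by rewrite bfZ (at_v lx.1 cz ha h).
- by move=> z _ u [a [b [cz ha _ ->]]]; exists (a u) => //; exact: ha.
Qed.

Lemma op_adj_lb x : lb x -> lb (op_adj x) /\
  forall z a, cproj A z -> at_ x z a -> at_ (op_adj x) z (star a).
Proof.
move=> lx; have [ax dx] := lx.
have [|| pF dF] := @F2_patch x x (fun a b => star a) lx lx.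
- by move=> a b Aa _; exact: vna_star.
- move=> a b z Aa _ cz; rewrite starM (cproj_s cz) (cproj_c cz) //; exact: vna_star.
set F := F2 _ _ _ in pF dF.
have adjP v (w : H) : op_adj x (v, w) <-> forall u u', x (u, u') -> ip u' v = ip u w.
  split=> h u u' xu; first by have := h _ _ xu; rewrite /= !innerE => -[].
  rewrite /= !innerE (h _ _ xu); have xi : x (im u, im u').
    by have := aff_lin ax 'i%C xu (aff0 ax); rewrite !addr0.
  have := h _ _ xi; rewrite !ip_iml => /(congr1 -%R); rewrite !opprK => h2.
  by rewrite h2.
have -> : op_adj x = patch F.
  apply/seteqP; split=> [[v w] /adjP h z _ [a [b [cz ha _ ->]]] /=|[v w] h].
    apply: ip_ext => u; rewrite ipC (ipC _ u) -ip_star -(symE (cproj_s cz)).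
    by rewrite (h _ _ (ha u)).
  apply/adjP => u u' xu.
  have key z a : cproj A z -> at_ x z a -> ip u' (z v) = ip u (z w).
    move=> cz ha; have Fz : F z (star a) by exists a, a.
    rewrite (h _ _ Fz) /= -ip_star -(at_v ax cz ha xu).
    by rewrite (symE (cproj_s cz)).
  (* The identity holds after cutting by any bounded piece ([key]); pieces close to the identity at
     [v] and [w] and Cauchy-Schwarz remove the cut. *)
  apply/eqP; rewrite -subr_eq0 -sqrf_eq0 eq_le sqr_ge0 andbT; apply/ler_addgt0Pr => e e0.
  rewrite add0r; pose M : R := 2 * n2 u' + 2 * n2 u + 1.
  have M0 : 0 < M by rewrite /M; have := n2_ge0 u; have := n2_ge0 u'; lra.
  have d0 : 0 < e / M by rewrite divr_gt0.
  have [z [cz [a ha]] [h1 h2]] := dir_approx2 v w (@bd_c x) (bd_dir ax) dx d0.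
  have E : ip u' v - ip u w = ip u' (v - z v) - ip u (w - z w).
    by rewrite !ipBr (key z a) //; ring.
  have := CS u' (v - z v); have := CS u (w - z w); rewrite E.
  move: h1 h2; rewrite !ltr_pdivlMr // /M.
  have := n2_ge0 u; have := n2_ge0 u'; have := n2_ge0 (v - z v); have := n2_ge0 (w - z w).
  move: (ip u' _) (ip u _) (n2 (v - _)) (n2 (w - _)) (n2 u) (n2 u') => r s t1 t2 m1 m2.
  move=> p1 p2 p3 p4 q1 q2 q3 q4.
  have : (r - s) ^+ 2 <= 2 * r ^+ 2 + 2 * s ^+ 2 by have := sqr_ge0 (r + s); lra.
  nra.
split; first exact: patch_lb.
by move=> z a cz ha; apply: patch_at => //; exists a, a.
Qed.

Lemma gr_lb a : A a -> lb (gr a).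
Proof.
move=> Aa; pose F z b := z = 1 /\ b = a; have -> : gr a = patch F.
  apply/seteqP; split=> [[u v] h _ _ [-> ->]|[u v] h]; first exact: h.
  exact: (h 1 a (conj erefl erefl)).
apply: patch_lb; split.
- by move=> _ _ [-> ->]; split=> //; [exact: cproj1|rewrite mulr1].
- by move=> z b z' b' [-> ->] [-> ->].
- by move=> u h; have := h 1 _; rewrite b1; apply; exists a.
Qed.
Lemma gr_at a z : at_ (gr a) z (a * z). Proof. by []. Qed.
Lemma dense1 : dense_fam ([set 1] : set (bop H)).
Proof. by move=> u /(_ 1 erefl). Qed.
Lemma lb_gr x a : lb x -> A a -> at_ x 1 a -> x = gr a.
Proof.
move=> lx Aa h; apply: (lb_ext lx (gr_lb Aa) dense1) => z ->; split; first exact: cproj1.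
by exists a; split=> //; have := @gr_at a 1; rewrite mulr1.
Qed.
Lemma ls_add_gr a b : A a -> A b -> ls_add (gr a) (gr b) = gr (a + b).
Proof.
move=> Aa Ab; have [l h] := ls_add_lb (gr_lb Aa) (gr_lb Ab).
by apply: lb_gr => //; [exact: vnaD|apply: h => //; exact: cproj1].
Qed.
Lemma ls_mul_gr a b : A a -> A b -> ls_mul (gr a) (gr b) = gr (a * b).
Proof.
move=> Aa Ab; have [l h] := ls_mul_lb (gr_lb Aa) (gr_lb Ab).
by apply: lb_gr => //; [exact: vnaM|apply: h => //; exact: cproj1].
Qed.

(** Strong convergence along the directed family, repackaged as an ultrafilter on it so that [wlim]
    can be applied. *)
Lemma csup_ultra I : I `<=` cproj A -> directed I -> exists U : set_system (bop H),
  [/\ UltraFilter U, U I & forall u (v : H), ip ((z : bop H) u) v @[z --> U] --> ip (csup I u) v].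
Proof.
move=> hI dI; pose S (us : seq H) (e : R) : set (bop H) :=
  [set z | I z /\ forall u, u \in us -> n2 (csup I u - z u) < e].
pose FF : set_system (bop H) := [set X | exists us e, 0 < e /\ S us e `<=` X].
have mono z z' u : I z -> I z' -> n2 (csup I u - (z + z' - z * z') u) <= n2 (csup I u - z u).
  move=> Iz Iz'; have cz := hI _ Iz; have cz' := hI _ Iz'; have cs := csup_cproj hA hI.
  have -> : csup I u - (z + z' - z * z') u = (1 - z') (csup I u - z u).
    have e1 : z' (csup I u) = z' u by rewrite -bM (csup_mulr hA hI Iz').
    have e2 : z' (z u) = (z * z') u by rewrite -bM (cproj_c cz' (cproj_A cz)).
    by rewrite [RHS]bB b1 bfB e1 e2 bB bD -addrA opprD addrA.
  by have := isproj_nle (isprojC (cproj_is cz')) (csup I u - z u); rewrite mul1r.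
have FP : ProperFilter FF.
  apply: Build_ProperFilter_ex => [X [us [e [e0 sX]]]|].
    suff [z Sz] : exists z, S us e z by exists z; exact: sX.
    elim: us {sX} => [|u us [z [Iz hz]]].
      by have [[z Iz] _] := dI; exists z; split.
    have [z' Iz' hz'] := csup_approx hA u hI dI e0.
    exists (z + z' - z * z'); split; first exact: dI.2.
    move=> v; rewrite inE => /orP[/eqP ->|/hz h].
      have -> : z + z' - z * z' = z' + z - z' * z.
        by rewrite (cproj_c (hI _ Iz) (cproj_A (hI _ Iz'))) (addrC z).
      by apply: le_lt_trans hz'; exact: mono.
    by apply: le_lt_trans h; exact: mono.
  split=> [|X Y [us [e [e0 sX]]] [us' [e' [e'0 sY]]]|X Y XY [us [e [e0 sX]]]].
  - by exists [::], 1; split=> // a.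
  - exists (us ++ us'), (Num.min e e'); split; first by rewrite lt_min e0.
    move=> z [Iz h]; split; [apply: sX|apply: sY]; split=> // u uus.
      by have := h u; rewrite mem_cat uus lt_min => /(_ isT) /andP[].
    by have := h u; rewrite mem_cat uus orbT lt_min => /(_ isT) /andP[].
  - by exists us, e; split=> //; apply: subset_trans sX XY.
have [U [UU sub]] := ultraFilterLemma FP; exists U; split=> //.
  by apply: sub; exists [::], 1; split=> // z [].
move=> u w; apply/cvgrPdist_lt => e e0; apply: sub.
have d0 : 0 < e ^+ 2 / (n2 w + 1).
  by rewrite divr_gt0 ?exprn_gt0 //; have := n2_ge0 w; lra.
exists [:: u], (e ^+ 2 / (n2 w + 1)); split=> // z [_ /(_ u)]; rewrite inE eqxx => /(_ isT) h /=.
rewrite -ipBl; have := CS (csup I u - z u) w; move: h.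
have w0 := n2_ge0 w; have w1 : 0 < n2 w + 1 by lra.
rewrite ltr_pdivlMr //; have := n2_ge0 (csup I u - z u); move: (n2 (csup I u - z u)) (ip _ w) => t r t0 h k.
rewrite -(ltr_pXn2r (n := 2)) ?nnegrE ?(ltW e0) // real_normK ?num_real //; nra.
Qed.

(** A weak limit of the uniformly bounded parts; compatibility with each bounded piece of [x]
    identifies it as the part at the supremum. *)
Lemma at_csup x I (C : R) : lb x -> 0 <= C -> I `<=` cproj A -> directed I ->
  (forall z, I z -> exists2 a, at_ x z a & nle a C) -> exists2 b, at_ x (csup I) b & nle b C.
Proof.
move=> lx C0 hI dI h; have [ax dx] := lx.
have [U [UU UI hU]] := csup_ultra hI dI; have FU := @ultra_proper _ _ UU.
have [z|g hg] := @choice (bop H) (bop H) (fun z a => nle a C /\ (I z -> at_ x z a)).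
  have [/h[a ha na]|nI] := pselect (I z); first by exists a.
  by exists 0; split=> // u; rewrite b0 n20 mulr_ge0 ?n2_ge0.
have [B nB hB] := wlim UU C0 (fun z => (hg z).1).
exists B => // u; apply: lbP => // z a cz ha.
apply: ip_ext => v; rewrite (symE (cproj_s cz)) (ip_star a).
apply: (uq_lim FU (hB u (z v))).
have := hU u (star a v); apply: cvg_trans; apply: near_eq_cvg.
apply: filterS UI => z' Iz' /=; have cz' := hI _ Iz'.
have h' := (hg z').2 Iz'.
rewrite -(symE (cproj_s cz)) -ip_star -!bM.
by rewrite -(at_compat ax cz' cz h' ha) (cproj_c cz (at_A ax cz' h')).
Qed.

Definition bdC x (C : R) : set (bop H) := [set z | cproj A z /\ exists2 a, at_ x z a & nle a C].
Lemma bdC_c x (C : R) : bdC x C `<=` cproj A. Proof. by move=> z []. Qed.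
Lemma bdC_dir x (C : R) : aff A x -> 0 <= C -> directed (bdC x C).
Proof.
move=> ax C0; split.
  exists 0; split; first exact: cproj0.
  by exists 0 => u; [exact: aff0|rewrite b0 n20 mulr_ge0 ?n2_ge0].
move=> z z' [cz [a h n]] [cz' [a' h' n']]; split; first exact: cprojJ.
by exists (a + a' - a * z'); [exact: (at_join ax cz cz' h h')|exact: (at_join_nle ax cz cz' h h' n n')].
Qed.
(** The family has a largest element, by which an operator is later cut according to its size. *)
Lemma bdC_csup x (C : R) : lb x -> 0 <= C -> bdC x C (csup (bdC x C)).
Proof.
move=> lx C0; split; first exact: csup_cproj (@bdC_c _ _).
have [z [_ [a h n]]|b h n] := at_csup lx C0 (@bdC_c x C) (bdC_dir lx.1 C0).
  by exists a.
by exists b.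
Qed.
Lemma bdC_mul x (C : R) z z' : 0 <= C -> bdC x C z -> cproj A z' -> bdC x C (z * z').
Proof.
move=> C0 [cz [a h n]] cz'; split; first exact: cprojM.
exists (a * z'); first exact: at_mul.
by rewrite -(mulr1 C); apply: nleM => //; exact: isproj_nle (cproj_is cz').
Qed.
Lemma bdC_le x (C : R) z z' : 0 <= C -> bdC x C z -> cproj A z' -> z * z' = z' -> bdC x C z'.
Proof. by move=> C0 h cz' <-; exact: bdC_mul. Qed.
Lemma lb_bounded x (C : R) : lb x -> 0 <= C -> dense_fam (bdC x C) ->
  exists a, [/\ A a, x = gr a & nle a C].
Proof.
move=> lx C0 dx; have [_ [a]] := bdC_csup lx C0; rewrite (dense_csup hA (@bdC_c x C) dx) => h n.
have Aa := at_A lx.1 (cproj1 hA) h.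
by exists a; split=> //; exact: lb_gr.
Qed.
End LB.

(** * Automatic boundedness *)

Section Auto.
Variables (R : realType).
Section Alg.
Variables (H : hilbertSpace R) (A : set (bop H)).
Hypothesis hA : vna A.
Implicit Types (x y : operator H) (a b c z w e : bop H) (u v : H).

Lemma at_dense x w a (I : set (bop H)) : lb A x -> cproj A w -> A a -> dense_fam I ->
  (forall z, I z -> cproj A z /\ at_ x (w * z) (a * z)) -> at_ x w a.
Proof.
move=> lx cw Aa dI h u; apply: (lbP hA) => // z' a' cz' h'.
apply/eqP; rewrite -subr_eq0; apply/eqP; apply: dI => z Iz; have [cz hz] := h z Iz.
have ax := lx.1; have cwz := cprojM hA cw cz.
have E := at_compat ax cwz cz' hz h'.
have e1 : z * z' * a = a' * (w * z).
  by rewrite -E (cproj_c (cprojM hA cz cz') Aa) mulrA.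
have e2 : z * a' * w = a' * (w * z).
  by rewrite (cproj_c cz (at_A hA ax cz' h')) -mulrA (cproj_c cz (cproj_A cw)).
have : (z * z' * a) u = (z * a' * w) u by rewrite e1 e2.
by rewrite !bM bfB => ->; rewrite subrr.
Qed.

Lemma ls_mul1 x : lb A x -> ls_mul x (gr 1) = x.
Proof.
move=> lx; have l1 := gr_lb hA (vna1 hA); have [l h] := ls_mul_lb hA lx l1.
apply: (lb_ext hA l lx lx.2) => z [cz [a ha]]; split=> //; exists a; split=> //.
have h1 : at_ (gr 1) z z by move=> u.
by have := h z a z cz ha h1; rewrite (at_zr lx.1 cz ha).
Qed.
Lemma ls_1mul x : lb A x -> ls_mul (gr 1) x = x.
Proof.
move=> lx; have l1 := gr_lb hA (vna1 hA); have [l h] := ls_mul_lb hA l1 lx.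
apply: (lb_ext hA l lx lx.2) => z [cz [a ha]]; split=> //; exists a; split=> //.
have h1 : at_ (gr 1) z z by move=> u.
by have := h z z a cz h1 ha; rewrite (at_zl hA lx.1 cz ha).
Qed.
Lemma nle_cut z a b (C : R) : cproj A z -> A a -> A b -> nle a C -> nle b C ->
  nle (a * (1 - z) + b * z) C.
Proof.
move=> cz Aa Ab na nb u; rewrite bD !bM n2D.
have -> : ip (a ((1 - z) u)) (b (z u)) = 0.
  have e : b (z u) = z (b (z u)) by rewrite -!bM (mulrA z) (cproj_c cz Ab) -mulrA (cproj_i cz).
  have e2 : z (a ((1 - z) u)) = 0.
    by rewrite -(bM z) (cproj_c cz Aa) bM -(bM z) mulrBr mulr1 (cproj_i cz) subrr b0 bf0.
  by rewrite e -(symE (cproj_s cz)) e2 ip0l.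
have := na ((1 - z) u); have := nb (z u); rewrite bB b1 (isproj_n2 u (cproj_is cz)); lra.
Qed.
End Alg.

(** The inverse [Phi] is explicit so that each result can be applied in both directions. *)
Definition liso (H K : hilbertSpace R) (A : set (bop H)) (B : set (bop K))
    (Psi : operator H -> operator K) (Phi : operator K -> operator H) :=
  [/\ forall x, lb A x -> lb B (Psi x) /\ Phi (Psi x) = x,
      forall y, lb B y -> lb A (Phi y) /\ Psi (Phi y) = y,
      forall x y, lb A x -> lb A y -> Psi (ls_add x y) = ls_add (Psi x) (Psi y) &
      forall x y, lb A x -> lb A y -> Psi (ls_mul x y) = ls_mul (Psi x) (Psi y)].

Lemma liso_sym (H K : hilbertSpace R) (A : set (bop H)) (B : set (bop K)) Psi Phi :
  vna A -> vna B -> liso A B Psi Phi -> liso B A Phi Psi.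
Proof.
move=> hA hB [h1 h2 hD hM]; split=> // x y lx ly.
  have [l1 e1] := h2 _ lx; have [l2 e2] := h2 _ ly.
  by rewrite -{1}e1 -{1}e2 -hD // (h1 _ (ls_add_lb hA l1 l2).1).2.
have [l1 e1] := h2 _ lx; have [l2 e2] := h2 _ ly.
by rewrite -{1}e1 -{1}e2 -hM // (h1 _ (ls_mul_lb hA l1 l2).1).2.
Qed.

Section Iso.
Variables (H K : hilbertSpace R) (A : set (bop H)) (B : set (bop K)).
Hypotheses (hA : vna A) (hB : vna B).
Variables (Psi : operator H -> operator K) (Phi : operator K -> operator H).
Hypothesis iso : liso A B Psi Phi.
Implicit Types (x y a b z : bop H) (p q e w : bop K).

Let iso' := liso_sym hA hB iso.
Lemma iso_lb x : A x -> lb B (Psi (gr x)).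
Proof. by move=> Ax; case: iso => h _ _ _; case: (h _ (gr_lb hA Ax)). Qed.
Lemma iso_D x y : A x -> A y -> Psi (gr (x + y)) = ls_add (Psi (gr x)) (Psi (gr y)).
Proof. by move=> Ax Ay; case: iso => _ _ h _; have := h _ _ (gr_lb hA Ax) (gr_lb hA Ay); rewrite (ls_add_gr hA Ax Ay). Qed.
Lemma iso_M x y : A x -> A y -> Psi (gr (x * y)) = ls_mul (Psi (gr x)) (Psi (gr y)).
Proof. by move=> Ax Ay; case: iso => _ _ _ h; have := h _ _ (gr_lb hA Ax) (gr_lb hA Ay); rewrite (ls_mul_gr hA Ax Ay). Qed.
Lemma val_D x y w p q : A x -> A y -> cproj B w -> at_ (Psi (gr x)) w p -> at_ (Psi (gr y)) w q ->
  at_ (Psi (gr (x + y))) w (p + q).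
Proof.
move=> Ax Ay cw hp hq; rewrite iso_D //.
by have [_] := ls_add_lb hB (iso_lb Ax) (iso_lb Ay); apply.
Qed.
Lemma val_M x y w p q : A x -> A y -> cproj B w -> at_ (Psi (gr x)) w p -> at_ (Psi (gr y)) w q ->
  at_ (Psi (gr (x * y))) w (p * q).
Proof.
move=> Ax Ay cw hp hq; rewrite iso_M //.
by have [_] := ls_mul_lb hB (iso_lb Ax) (iso_lb Ay); apply.
Qed.
Lemma iso_1 : Psi (gr 1) = gr 1.
Proof.
have [h1 h2 _ hM] := iso; have l1 := gr_lb hA (vna1 hA); have l1' := gr_lb hB (vna1 hB).
have [l e] := h2 _ l1'; have [k _] := h1 _ l1.
rewrite -[LHS](ls_1mul hB k) -{1}e -(hM _ _ l l1) (ls_mul1 hA l) //.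
Qed.

Lemma central_at (y : operator K) (p w : bop K) : lb B y -> ls_mul y y = y ->
  (forall q, B q -> ls_mul y (gr q) = ls_mul (gr q) y) -> cproj B w -> at_ y w p -> cproj B p.
Proof.
move=> ly yy yq cw hp; have ay := ly.1; have Bp := at_A hB ay cw hp.
apply: (idem_cproj hB) => //.
  have [_ h] := ls_mul_lb hB ly ly; have := h w p p cw hp hp.
  by rewrite yy => h1; exact: at_uniq ay _ _ _ h1 hp.
move=> q Bq; have lq := gr_lb hB Bq.
have [l1 h1] := ls_mul_lb hB ly lq; have [_ h2] := ls_mul_lb hB lq ly.
have k1 := h1 w _ _ cw hp (gr_at q w); have k2 := h2 w _ _ cw (gr_at q w) hp.
rewrite -yq // in k2; have := at_uniq l1.1 k1 k2.
by rewrite -(cproj_c cw Bq) mulrA (at_zr ay cw hp) (cproj_c cw Bq) -(mulrA q w p) (at_zl hB ay cw hp).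
Qed.

Lemma iso_center z : cproj A z -> exists2 e, cproj B e & Psi (gr z) = gr e.
Proof.
move=> cz; have Az := cproj_A cz; set E := Psi (gr z).
have lE : lb B E by exact: iso_lb.
have EE : ls_mul E E = E by rewrite /E -iso_M // (cproj_i cz).
have Eq q : B q -> ls_mul E (gr q) = ls_mul (gr q) E.
  move=> Bq; have [h1 h2 _ hM] := iso; have [l e] := h2 _ (gr_lb hB Bq).
  have lz := gr_lb hA Az; rewrite -e /E -!hM //; congr Psi.
  have [l1 k1] := ls_mul_lb hA lz l; have [l2 k2] := ls_mul_lb hA l lz.
  apply: (lb_ext hA l1 l2 l.2) => t [ct [a ha]]; split=> //; have Aa := at_A hA l.1 ct ha.
  exists (z * t * a); split; first exact: k1 ct (gr_at z t) ha.
  have := k2 t _ _ ct ha (gr_at z t); congr (at_ _ _ _).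
  by rewrite -(cproj_c (cprojM hA cz ct) Aa).
have cI w p : cproj B w -> at_ E w p -> cproj B p by exact: central_at.
pose I : set (bop K) := [set p | exists2 w, cproj B w & at_ E w p].
have sI : I `<=` cproj B by move=> p [w cw]; exact: cI.
have ce := csup_cproj hB sI; exists (csup I) => //.
apply: (lb_ext hB lE (gr_lb hB (cproj_A ce)) lE.2) => w [cw [p hp]]; split=> //.
exists p; split=> //; have -> : p = csup I * w; last exact: gr_at.
have e1 : csup I * p = p by apply: csup_ub; exists w.
have e2 : (w - p) * csup I = 0.
  apply: csup_kill => p' [w' cw' hp']; rewrite mulrBl.
  have cp := cI _ _ cw hp; have cp' := cI _ _ cw' hp'.
  have -> : p * p' = p * (w' * p') by rewrite (at_zl hB lE.1 cw' hp').
  rewrite mulrA (at_compat lE.1 cw cw' hp hp') -mulrA (cproj_c cw (cproj_A cp')) mulrA (cproj_i cp').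
  by rewrite subrr.
move: e2; rewrite mulrBl => /eqP; rewrite subr_eq0 => /eqP e2.
by rewrite -(cproj_c cw (cproj_A ce)) e2 (cproj_c (cI _ _ cw hp) (cproj_A ce)).
Qed.

Lemma iso_centerC z e : cproj A z -> Psi (gr z) = gr e -> B e -> Psi (gr (1 - z)) = gr (1 - e).
Proof.
move=> cz ez Be; have [e' ce' h] := iso_center (cprojC hA cz); rewrite h; congr gr.
have : Psi (gr ((1 - z) + z)) = gr 1 by rewrite subrK iso_1.
rewrite (iso_D (cproj_A (cprojC hA cz)) (cproj_A cz)) h ez (ls_add_gr hB (cproj_A ce') Be).
by move=> /gr_inj <-; rewrite addrK.
Qed.

(** Locality over the centre: on [e] the image depends only on the part of the argument under
    [z]. *)
Lemma val_cut x y z e w p : A x -> A y -> cproj A z -> cproj B e -> Psi (gr z) = gr e ->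
  x * z = y * z -> cproj B w -> at_ (Psi (gr x)) w p -> at_ (Psi (gr y)) (w * e) (p * e).
Proof.
move=> Ax Ay cz ce ez xy cw hp; have Az := cproj_A cz; have Be := cproj_A ce.
have lx := iso_lb Ax; have ly := iso_lb Ay; have Bp := at_A hB lx.1 cw hp.
apply: (at_dense hB ly (cprojM hB cw ce) (vnaM hB Bp Be) ly.2) => w' [cw' [q hq]]; split=> //.
have k t : at_ (Psi (gr z)) t (e * t) by rewrite ez; exact: gr_at.
have k1 := val_M Ax Az cw hp (k w); have k2 := val_M Ay Az cw' hq (k w').
rewrite -xy in k2; have Axz := vnaM hA Ax Az.
have := at_compat (iso_lb Axz).1 cw cw' k1 k2.
have -> : p * (e * w) = p * e by rewrite (cproj_c ce (cproj_A cw)) mulrA (at_zr lx.1 cw hp).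
have -> : q * (e * w') = q * e by rewrite (cproj_c ce (cproj_A cw')) mulrA (at_zr ly.1 cw' hq).
move=> ->; have -> : w * e * w' = w' * (e * w).
  by rewrite (cproj_c ce (cproj_A cw)) (cproj_c cw' (cproj_A (cprojM hB cw ce))).
by rewrite -mulrA; exact: at_mul.
Qed.

Definition aball x := A x /\ nle x 1.
Definition W (C : R) x := csup (bdC B (Psi (gr x)) C).
Lemma W_bd (C : R) x : A x -> 0 <= C -> bdC B (Psi (gr x)) C (W C x).
Proof. by move=> Ax C0; apply: bdC_csup => //; exact: iso_lb. Qed.
Lemma W_c (C : R) x : A x -> 0 <= C -> cproj B (W C x).
Proof. by move=> Ax C0; have [] := W_bd Ax C0. Qed.
Lemma W_max (C : R) x w : bdC B (Psi (gr x)) C w -> W C x * w = w.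
Proof. exact: csup_ub. Qed.

Lemma bdC_cut (C : R) x y z e w : 0 <= C -> A x -> A y -> cproj A z -> cproj B e ->
  Psi (gr z) = gr e -> x * z = y * z -> bdC B (Psi (gr x)) C w -> bdC B (Psi (gr y)) C (w * e).
Proof.
move=> C0 Ax Ay cz ce ez xy [cw [p hp np]]; split; first exact: (cprojM hB).
exists (p * e); first exact: (val_cut Ax Ay cz ce ez xy cw hp).
by rewrite -(mulr1 C); apply: nleM => //; exact: isproj_nle (cproj_is ce).
Qed.

End Iso.

Lemma iso_center' (H K : hilbertSpace R) (A : set (bop H)) (B : set (bop K)) Psi Phi e :
  vna A -> vna B -> liso A B Psi Phi -> cproj B e -> exists2 z, cproj A z & Psi (gr z) = gr e.
Proof.
move=> hA hB iso ce; have [z cz h] := iso_center hB hA (liso_sym hA hB iso) ce.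
exists z => //; rewrite -h; have [_ k _ _] := iso.
by have [] := k _ (gr_lb hB (cproj_A ce)).
Qed.
End Auto.

Lemma joinC_compl (R : realType) (K : hilbertSpace R) (a b : bop K) :
  1 - a + (1 - b) - (1 - a) * (1 - b) = 1 - a * b.
Proof.
rewrite mulrBl mul1r mulrBr mulr1 opprB [X in _ + X]addrC addrA.
by rewrite -(addrA (1 - a)) subrr addr0 addrA subrK.
Qed.

Section Auto2.
Variables (R : realType) (H K : hilbertSpace R) (A : set (bop H)) (B : set (bop K)).
Hypotheses (hA : vna A) (hB : vna B).
Variables (Psi : operator H -> operator K) (Phi : operator K -> operator H).
Hypothesis iso : liso A B Psi Phi.
Implicit Types (x y a b z : bop H) (p q e w : bop K).
Notation Wp := (W B Psi).
Notation ball := (aball A).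

(** The witness is [y] where the image of [x] is small and [x] elsewhere, so its image is large
    wherever one of the two images is. *)
Lemma W_dir (C : R) x y : 0 <= C -> ball x -> ball y ->
  exists2 t, ball t & Wp C t = Wp C x * Wp C y.
Proof.
move=> C0 [Ax nx] [Ay ny]; pose e := Wp C x.
have ce : cproj B e := W_c hA hB iso Ax C0; have Be := cproj_A ce.
have [z cz Pz] := iso_center' hA hB iso ce; have Az := cproj_A cz.
pose t := x * (1 - z) + y * z.
have c1z := cprojC hA cz; have A1z := cproj_A c1z.
have At : A t by apply: (vnaD hA); exact: (vnaM hA).
exists t; first by split=> //; exact: (nle_cut cz).
have zz : (1 - z) * z = 0 by rewrite mulrBl mul1r (cproj_i cz) subrr.
have zz' : z * (1 - z) = 0 by rewrite mulrBr mulr1 (cproj_i cz) subrr.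
have tz : t * z = y * z by rewrite mulrDl -!mulrA zz (cproj_i cz) mulr0 add0r.
have t1z : t * (1 - z) = x * (1 - z) by rewrite mulrDl -!mulrA zz' (cproj_i c1z) mulr0 addr0.
have P1z := iso_centerC hA hB iso cz Pz Be.
have c1e := cprojC hB ce.
have cy := W_c hA hB iso Ay C0; have ct := W_c hA hB iso At C0.
have h1 := bdC_cut hA hB iso C0 At Ay cz ce Pz tz (W_bd hA hB iso At C0).
have h2 := bdC_cut hA hB iso C0 At Ax c1z c1e P1z t1z (W_bd hA hB iso At C0).
have h3 := bdC_cut hA hB iso C0 Ay At cz ce Pz (esym tz) (W_bd hA hB iso Ay C0).
have k1 := W_max h1; have k2 := W_max h2; have k3 := W_max h3.
have Bt := cproj_A ct; have By := cproj_A cy.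
have e0 : Wp C t * (1 - e) = 0.
  rewrite -k2 -/e (cproj_c ct (cproj_A c1e)) mulrA mulrBr mulr1 (cproj_i ce) subrr mul0r.
  by [].
have te : Wp C t * e = Wp C t.
  by move: e0; rewrite mulrBr mulr1 => /eqP; rewrite subr_eq0 => /eqP <-.
rewrite te in k1; rewrite -/e (cproj_c ce By).
by rewrite -k3 mulrA (cproj_c ct By) k1 te.
Qed.

Definition GC (C : R) : set (bop K) := [set w | cproj B w /\
  forall x, A x -> nle x 1 -> bdC B (Psi (gr x)) C w].

Section Kill.
Variable xi : K.
Hypothesis kill : forall C w, 0 <= C -> GC C w -> w xi = 0.

(** The complement of the supremum of all [1 - Wp C x] belongs to [GC C], so it kills [xi]; by
    [W_dir] that supremum is a directed limit. *)
Lemma W_small (C e : R) : 0 <= C -> 0 < e -> exists2 x, ball x & n2 (Wp C x xi) < e.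
Proof.
move=> C0 e0; pose J : set (bop K) := [set w | exists2 x, ball x & w = 1 - Wp C x].
have cJ : J `<=` cproj B.
  by move=> _ [x [Ax _] ->]; apply: (cprojC hB); exact: (W_c hA hB iso Ax C0).
have dJ : directed J.
  split.
    exists (1 - Wp C 0), 0 => //; split; first exact: vna0.
    by move=> u; rewrite b0 n20 mulr_ge0 ?n2_ge0.
  move=> _ _ [x bx ->] [y by_ ->]; have [t bt ht] := W_dir C0 bx by_; exists t => //.
  by rewrite ht (joinC_compl (Wp C x) (Wp C y)).
have cs := csup_cproj hB cJ.
have g : GC C (1 - csup J).
  split; first exact: (cprojC hB).
  move=> x Ax nx; have cW := W_c hA hB iso Ax C0.
  apply: (bdC_le hB C0 (W_bd hA hB iso Ax C0) (cprojC hB cs)).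
  have Jx : J (1 - Wp C x) by exists x.
  have := csup_mulr hB cJ Jx; rewrite mulrBl mul1r => h.
  have h2 : Wp C x * csup J = csup J - (1 - Wp C x) by rewrite -h opprB addrCA subrr addr0.
  by rewrite mulrBr mulr1 h2 opprB addrA [X in X - _]addrCA subrr addr0.
have s1 : csup J xi = xi.
  by have := kill C0 g; rewrite bB b1 => /eqP; rewrite subr_eq0 => /eqP <-.
have [_ [x bx ->]] := csup_approx hB xi cJ dJ e0.
by rewrite s1 bB b1 opprB addrC subrK => h; exists x.
Qed.

Variables (s1 s2 : bop H).
Hypotheses (As1 : A s1) (As2 : A s2) (s11 : star s1 * s1 = 1) (s22 : star s2 * s2 = 1)
  (s12 : star s1 * s2 = 0).
Let s21 : star s2 * s1 = 0.
Proof. by apply: star_inj; rewrite starM starK s12 star0. Qed.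
Definition shf (k : nat) : bop H := s1 ^+ k * s2.
Lemma shf_A k : A (shf k).
Proof. by apply: (vnaM hA) => //; exact: vnaX. Qed.
Lemma star_powK k : star (s1 ^+ k) * s1 ^+ k = 1.
Proof.
elim: k => [|k IH]; first by rewrite expr0 star1 mulr1.
by rewrite exprS starM mulrA -(mulrA _ (star s1)) s11 mulr1.
Qed.
Lemma shf_orth j k : star (shf j) * shf k = if j == k then 1 else 0.
Proof.
rewrite /shf starM; case: ltngtP => [jk|jk|->].
- rewrite -(subnKC jk) addSnnS exprD mulrA -(mulrA (star s2)) (mulrA (star (s1 ^+ j))) star_powK mul1r.
  by rewrite exprS !mulrA s21 !mul0r.
- rewrite -(subnKC jk) addSnnS exprD starM -!mulrA (mulrA (star (s1 ^+ k))) star_powK mul1r.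
  by rewrite exprS starM -!mulrA s12 !mulr0.
- by rewrite -mulrA (mulrA (star (s1 ^+ k))) star_powK mul1r.
Qed.

(** Orthogonality of the ranges makes the partial sums [S n] contractive, being dominated by the
    projections [T n]; a weak limit then suffices because each corner is eventually constant. *)
Lemma direct_sum (f xs : nat -> bop H) : (forall k, A (f k)) ->
  (forall j k, star (f j) * f k = if j == k then 1 else 0) -> (forall k, ball (xs k)) ->
  exists2 x, ball x & forall k, star (f k) * x * f k = xs k.
Proof.
move=> Af orth bx; pose S n : bop H := \sum_(k < n) f k * xs k * star (f k).
pose T n : bop H := \sum_(k < n) f k * star (f k).
have SS n : S n.+1 = S n + f n * xs n * star (f n) by rewrite /S big_ord_recr.
have TS n : T n.+1 = T n + f n * star (f n) by rewrite /T big_ord_recr.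
have sT0 n m : (n <= m)%N -> star (f m) * T n = 0.
  move=> nm; rewrite /T mulr_sumr big1 // => i _; rewrite mulrA orth gtn_eqF ?mul0r //.
  exact: leq_trans (ltn_ord i) nm.
have sS n m : (n <= m)%N -> star (f m) * S n = 0.
  move=> nm; rewrite /S mulr_sumr big1 // => i _; rewrite !mulrA orth gtn_eqF ?mul0r //.
  exact: leq_trans (ltn_ord i) nm.
have sS1 n m : (m < n)%N -> star (f m) * S n * f m = xs m.
  move=> mn; rewrite /S mulr_sumr mulr_suml (bigD1 (Ordinal mn)) //= big1 => [|i im].
    by rewrite addr0 !mulrA orth eqxx mul1r -mulrA orth eqxx mulr1.
  rewrite !mulrA orth; case: eqP => [e|_]; last by rewrite !mul0r.
  by move: im; rewrite -(inj_eq val_inj) /= -e eqxx.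
have AS n : A (S n).
  by apply: (vna_sum hA) => k; do 2?apply: (vnaM hA); [exact: Af|exact: (bx k).1|apply: (vna_star hA); exact: Af].
have i1 k u : n2 (f k u) = n2 u.
  by rewrite /n2 -ip_starl -bM orth eqxx bE.
have key n u : n2 (S n u) <= n2 (T n u) /\ n2 (T n u) <= n2 u.
  elim: n => [|n [IH1 IH2]].
    by rewrite /S /T !big_ord0 b0 n20; split=> //; exact: n2_ge0.
  pose U := f n; pose y := star U u.
  have o1 v : ip (S n u) (U v) = 0 by rewrite -ip_starl -bM sS // b0 ip0l.
  have o2 v : ip (T n u) (U v) = 0 by rewrite -ip_starl -bM sT0 // b0 ip0l.
  have e1 : n2 (S n.+1 u) = n2 (S n u) + n2 (xs n y).
    by rewrite SS bD !bM n2D o1 i1 mulr0 addr0.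
  have e2 : n2 (T n.+1 u) = n2 (T n u) + n2 y.
    by rewrite TS bD bM n2D o2 i1 mulr0 addr0.
  split.
    by rewrite e1 e2; have := (bx n).2 y; rewrite mul1r; lra.
  have tp m : ip (T m u) u = n2 (T m u).
    elim: m => [|m IHm]; first by rewrite /T big_ord0 b0 ip0l n20.
    rewrite TS bD bM ipDl IHm n2D i1.
    have -> : ip (T m u) (f m (star (f m) u)) = 0 by rewrite -ip_starl -bM sT0 // b0 ip0l.
    by rewrite -{1}[f m]starK ip_starl /n2; ring.
  by have := n2_ge0 (u - T n.+1 u); rewrite n2B ipC tp; lra.
have nS n : nle (S n) 1.
  by move=> u; rewrite mul1r; have [] := key n u => h1 h2; apply: le_trans h1 h2.
have [U [UU sub]] := @ultraFilterLemma nat \oo _.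
have FU := @ultra_proper _ _ UU.
have [x nx hx] := wlim UU ler01 nS; exists x.
  split=> //; apply: (vnaP hA) => y cy; apply/esym/(wlim_comm UU hx) => n.
  by rewrite cy.
move=> k; apply: bop_ext => u; apply: ip_ext => v; rewrite !bM ip_starl.
apply: (uq_lim FU (hx _ _)).
apply: (@cvg_trans _ ((fun=> ip (xs k u) v) @ U)); last exact: cvg_cst.
apply: near_eq_cvg; apply: sub; exists k.+1 => // n kn /=.
by rewrite -(sS1 n k kn) !bM ip_starl.
Qed.

Lemma kill_eq0 : xi = 0.
Proof.
(* The data of the hump [k]: a piece [t.1] nearly fixing [xi], a bound [t.2.1] there for the images
   of [shf k] and its adjoint, and a contraction whose image exceeds the threshold
   [t.2.1 * ((k + 1) * t.2.1)] near [xi]. *)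
have ex k : exists t : bop K * (R * bop H), [/\ cproj B t.1 /\ 0 <= t.2.1, n2 (xi - t.1 xi) < iv R k,
    bdC B (Psi (gr (shf k))) t.2.1 t.1 /\ bdC B (Psi (gr (star (shf k)))) t.2.1 t.1, ball t.2.2 &
    n2 (Wp (t.2.1 * (k.+1%:R * t.2.1)) t.2.2 xi) < iv R k].
  have l1 := iso_lb hA iso (shf_A k); have l2 := iso_lb hA iso (vna_star hA (shf_A k)).
  have [||[_ _ df] dd] := @F2_patch _ _ _ hB _ _ (fun a b : bop K => a + b) l1 l2.
  - by move=> a b; exact: vnaD.
  - by move=> a b z _ _ _; rewrite mulrDl.
  have cF : pdom (F2 B (Psi (gr (shf k))) (Psi (gr (star (shf k)))) (fun a b : bop K => a + b)) `<=` cproj B.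
    by move=> z [_ [a [b [cz _ _ _]]]].
  have [w [_ [a [b [cw ha hb _]]]] hw] := dense_approx hB xi cF dd df (iv_gt0 R k).
  have [Ca Ca0 na] := nleP a; have [Cb Cb0 nb] := nleP b; pose c : R := Ca + Cb.
  have c0 : 0 <= c by rewrite /c; lra.
  have [||x bx hx] := @W_small (c * (k.+1%:R * c)) (iv R k); [by rewrite !mulr_ge0|exact: iv_gt0|].
  exists (w, (c, x)); split=> //=; split; split=> //; [exists a|exists b] => //.
    by apply: nle_mono na; rewrite /c; lra.
  by apply: nle_mono nb; rewrite /c; lra.
have [t ht] := choice ex.
have [|x [Ax nx] hx] := @direct_sum shf (fun k => (t k).2.2) shf_A shf_orth.
  by move=> k; have [] := ht k.
have lx := iso_lb hA iso Ax; apply: lx.2 => w [cw [p hp]]; apply: eq0_small => e e0.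
have [D D0 nD] := nleP p; have e4 : 0 < e / 4 by rewrite divr_gt0.
(* Once [k + 1] exceeds the bound [D] of the packed element on [w], compression by [shf k] stays
   below the threshold on [w v], which therefore lies under [Wp] and nearly kills [xi]. *)
have [N hN] := inv_small e4; pose k := maxn N (Num.truncn D).
have kN := hN k (leq_maxl _ _).
have kD : D <= k.+1%:R.
  apply: le_trans (ltW (truncnS_gt D)) _; rewrite ler_nat ltnS; exact: leq_maxr.
have [[cv c0] hv [[_ [q1 h1 n1]] [_ [q2 h2 n2']]] [Axk nxk] hW] := ht k.
move: cv c0 hv h1 n1 h2 n2' Axk nxk hW (hx k).
move: (t k).1 (t k).2.1 (t k).2.2 => v c xk cv c0 hv h1 n1 h2 n2' Axk nxk hW xkE.
have cwv := cprojM hB cw cv.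
have As : A (star (shf k)) by apply: (vna_star hA); exact: shf_A.
have h1' : at_ (Psi (gr (shf k))) (w * v) (q1 * w).
  by rewrite (cproj_c cw (cproj_A cv)); exact: at_mul.
have h2' : at_ (Psi (gr (star (shf k)))) (w * v) (q2 * w).
  by rewrite (cproj_c cw (cproj_A cv)); exact: at_mul.
have hp' : at_ (Psi (gr x)) (w * v) (p * v) by exact: at_mul.
have h3 := val_M hA hB iso As Ax cwv h2' hp'.
have h4 := val_M hA hB iso (vnaM hA As Ax) (shf_A k) cwv h3 h1'.
rewrite xkE in h4.
have bd : bdC B (Psi (gr xk)) (c * (k.+1%:R * c)) (w * v).
  split=> //; exists (q2 * w * (p * v) * (q1 * w)) => //.
  have m (z q : bop K) (C : R) : 0 <= C -> cproj B z -> nle q C -> nle (q * z) C.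
    move=> C0 cz nq; rewrite -(mulr1 C); apply: nleM => //.
    exact: isproj_nle (cproj_is cz).
  rewrite (mulrA c); apply: nleM; [by rewrite mulr_ge0| |exact: m].
  apply: nleM => //; [exact: m|apply: m => //].
  exact: nle_mono kD nD.
have WE := W_max bd; set Wk := Wp _ _ in WE hW.
have cW : cproj B Wk by apply: (W_c hA hB iso Axk); rewrite !mulr_ge0.
have e1 : n2 (w (v xi)) < iv R k.
  rewrite -bM -WE (cproj_c cW (cproj_A cwv)) bM; apply: le_lt_trans hW.
  by have := isproj_nle (cproj_is cwv) (Wk xi); rewrite mul1r.
have -> : w xi = w (v xi) + w (xi - v xi) by rewrite bfB addrC subrK.
apply: le_trans (n2D_le _ _) _.
have := isproj_nle (cproj_is cw) (xi - v xi); rewrite mul1r; lra.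
Qed.
End Kill.

Lemma autocont : pinf A -> dense_fam [set w | exists2 C, 0 <= C & GC C w].
Proof.
move=> /(cuntz hA)[s1 [s2 [[As1 As2] s11 s22 s12]]] xi h.
apply: (@kill_eq0 xi _ s1 s2) => // C w C0 g.
by apply: h; exists C.
Qed.
End Auto2.

(** * Type I algebras *)

Section TypeI.
Variables (R : realType) (H : hilbertSpace R) (A : set (bop H)).
Hypothesis hA : vna A.
Implicit Types (a b c e v w x z : bop H) (u xi eta y : H).

Lemma finp_equiv v : A v -> isproj (star v * v) -> finp A (v * star v) -> finp A (star v * v).
Proof.
move=> Av pv [_ fin]; have [pf _] := proj_pi hA Av pv; split=> // w Aw ww fw.
have iw : isproj (star w * w) by rewrite ww.
have Asv := vna_star hA Av.
have wf : w * (star v * v) = w by rewrite -ww pi_mul.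
have vf : v * (star v * v) = v by rewrite pi_mul.
have e1 : star (v * w * star v) * (v * w * star v) = v * star v.
  have -> : star (v * w * star v) * (v * w * star v) = v * (star w * (star v * v * w)) * star v.
    by rewrite !starM starK !mulrA.
  by rewrite fw ww vf.
have e2 : v * star v * (v * w * star v) = v * w * star v.
  have -> : v * star v * (v * w * star v) = v * (star v * v * w) * star v by rewrite !mulrA.
  by rewrite fw.
have e3 := fin _ (vnaM hA (vnaM hA Av Aw) Asv) e1 e2.
have : star v * (v * w * star v * star (v * w * star v)) * v = star v * (v * star v) * v by rewrite e3.
rewrite !starM starK.
have -> : star v * (v * w * star v * (v * (star w * star v))) * v =
    (star v * v * w) * (star v * v) * (star w * (star v * v)) by rewrite !mulrA.
rewrite fw wf; have -> : star w * (star v * v) = star w.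
  by rewrite -{1}(pv.1) -starM fw.
by move=> ->; rewrite -!mulrA vf.
Qed.

Definition abelianp e := forall a b, A a -> A b ->
  e * a * e * (e * b * e) = e * b * e * (e * a * e).

(** Subprojections of an abelian [e] are central in its corner, so the leftover [r] of the
    comparison with [D] satisfies [v x r = 0]. With the comparison relation this gives [D x r = 0],
    and [r], lying under the central support of [D], vanishes. *)
Lemma abelian_sub e D : proj A e -> abelianp e -> proj A D ->
  exists w, [/\ A w, star w * w = cs A D * e & D * w = w].
Proof.
move=> [Ae pe] ab [AD pD]; have cc := cs_cproj hA AD; pose f := cs A D * e.
have fC : cs A D * e = e * cs A D := cproj_c cc Ae.
have Af : A f by apply: (vnaM hA) => //; exact: cproj_A cc.
have pf : proj A f by split=> //; apply: isprojM => //; exact: cproj_is cc.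
have [v [Av pv fv Dv k]] := compare hA pf (conj AD pD).
have Ag : A (star v * v) by apply: (vnaM hA) => //; exact: (vna_star hA).
have ef : e * f = f by rewrite /f fC mulrA pe.2.
have fe : f * e = f by rewrite /f -mulrA pe.2.
pose r := f - star v * v; have Ar : A r by exact: (vnaB hA).
have ge : star v * v * e = star v * v.
  by apply: (le_mulr pe.1 pv.1); rewrite -fv mulrA ef.
have eg : e * (star v * v) = star v * v by rewrite -fv mulrA ef.
have er : e * r = r by rewrite mulrBr ef eg.
have re : r * e = r by rewrite mulrBl fe ge.
have rg : r * (star v * v) = 0 by rewrite mulrBl fv pv.2 subrr.
have com x : A x -> e * x * r = r * x * e.
  by move=> Ax; have := ab x r Ax Ar; rewrite er re -(mulrA (e * x)) er !mulrA re.
have rxg x : A x -> r * x * (star v * v) = 0.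
  move=> Ax; have -> : r * x * (star v * v) = r * x * e * (star v * v) by rewrite -(mulrA (r * x)) eg.
  by rewrite -com // -mulrA rg mulr0.
have rxv x : A x -> r * x * star v = 0.
  move=> Ax; have -> : star v = star v * v * star v.
    by rewrite -{1}[v](pi_mul pv) starM pv.1.
  by rewrite mulrA rxg // mul0r.
have sr : star r = r by rewrite /r starB pf.2.1 pv.1.
have vxr x : A x -> v * x * r = 0.
  move=> Ax; apply: star_inj; rewrite !starM sr star0 mulrA rxv //; exact: (vna_star hA).
have Dxr x : A x -> D * x * r = 0.
  move=> Ax; have := k x Ax; rewrite !mulrBl => /eqP; rewrite subr_eq0 => /eqP ->.
  by rewrite -(mulrA v (star v) x); apply: vxr; apply: (vnaM hA) => //; exact: (vna_star hA).
have rD : r * cs A D = 0.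
  apply: cs_kill => // x Ax; apply: star_inj; rewrite !starM sr pD.1 star0 mulrA.
  by apply: Dxr; exact: (vna_star hA).
have r0 : r = 0.
  have cr : cs A D * r = r.
    have cf : cs A D * f = f by rewrite /f mulrA (cproj_i cc).
    have cg : cs A D * (star v * v) = star v * v by rewrite -fv mulrA cf.
    by rewrite /r mulrBr cf cg.
  by rewrite -cr (cproj_c cc Ar) rD.
exists v; split=> //; apply/eqP; rewrite eq_sym -subr_eq0; exact/eqP.
Qed.

Section Chain.
Variable G : nat -> bop H.
Hypotheses (pG : forall n, proj A (G n)) (dG : forall n, G n * G n.+1 = G n.+1)
  (G0 : forall u, (forall n, G n u = u) -> u = 0) (fG : finp A (G 0)).
Variable e : bop H.
Hypotheses (pe : proj A e) (ab : abelianp e) (ce : forall n, cs A (G n) * e = e) (e0 : e <> 0).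

Let D n := G n - G n.+1.
Let AG n : A (G n) := (pG n).1.
Let dG' n : G n.+1 * G n = G n.+1.
Proof. by apply: le_mulr (dG n); [exact: (pG _).2.1|exact: (pG _).2.1]. Qed.
Let dGm n m : (n <= m)%N -> G n * G m = G m.
Proof.
move=> /subnKC <-; elim: (m - n)%N => [|k IH]; first by rewrite addn0 (pG n).2.2.
by rewrite addnS -(dG (n + k)) mulrA IH.
Qed.
Let dGm' n m : (n <= m)%N -> G m * G n = G m.
Proof. by move=> nm; apply: le_mulr (dGm nm); [exact: (pG _).2.1|exact: (pG _).2.1]. Qed.
Let pD n : proj A (D n).
Proof.
split; first by apply: (vnaB hA); exact: AG.
split; first by apply: symB; exact: (pG _).2.1.
by rewrite /D mulrBl !mulrBr dG dG' (pG n).2.2 (pG n.+1).2.2 subrr subr0.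
Qed.
Let DD n m : n != m -> D n * D m = 0.
Proof.
have aux i j : (i < j)%N -> D i * D j = 0.
  move=> ij; rewrite /D mulrBl !mulrBr (dGm (ltnW ij)) (dGm (leqW (ltnW ij))) (dGm ij).
  by rewrite (dGm (leqW ij)) subrr.
rewrite neq_ltn => /orP[/aux //|/aux h]; apply: star_inj.
by rewrite starM (pD n).2.1 (pD m).2.1 h star0.
Qed.
Let c n := cs A (D n).
Let cc n : cproj A (c n). Proof. exact: cs_cproj (pD n).1. Qed.

Lemma chain_w : exists w : nat -> bop H, forall n, [/\ A (w n), star (w n) * w n = c n * e & D n * w n = w n].
Proof.
have [n|w hw] := @choice nat (bop H) (fun n w => [/\ A w, star w * w = c n * e & D n * w = w]).
  by have [w hw] := abelian_sub pe ab (pD n); exists w.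
by exists w.
Qed.

(** Off the supremum of the later [c m] the projections [G m] are constant from [n] on, and their
    common part is 0; so [G n] vanishes there, while its central support covers [e]. *)
Lemma chain_sup n xi : e xi = xi -> (forall m, (n <= m)%N -> c m xi = 0) -> xi = 0.
Proof.
move=> exi h; pose I : set (bop H) := [set z | exists2 m, (n <= m)%N & z = c m].
have cI : I `<=` cproj A by move=> _ [m _ ->]; exact: cc.
have cS := csup_cproj hA cI; pose z := 1 - csup I.
have zD m : (n <= m)%N -> z * D m = 0.
  move=> nm; have Im : I (c m) by exists m.
  have : csup I * D m = D m by rewrite -(cs_mul hA (D m)) mulrA csup_ub.
  by rewrite /z mulrBl mul1r => ->; rewrite subrr.
have zG m : (n <= m)%N -> z * G m = z * G n.
  move=> /subnKC <-; elim: (m - n)%N => [|k IH]; first by rewrite addn0.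
  by rewrite -IH addnS; have := zD (n + k)%N (leq_addr _ _); rewrite mulrBr => /eqP; rewrite subr_eq0 => /eqP.
have cz : cproj A z by exact: (cprojC hA).
have zGn : z * G n = 0.
  apply: bop_ext => u; rewrite b0; apply: G0 => m.
  have [nm|/ltnW mn] := leqP n m.
    rewrite -bM -(zG m nm) (cproj_c cz (AG m)) mulrA (pG m).2.2 //.
  by rewrite -bM (cproj_c cz (AG n)) mulrA dGm.
have zc : z * cs A (G n) = 0.
  apply: cs_kill => // x Ax; by rewrite (cproj_c cz Ax) -mulrA zGn mulr0.
have s0 : csup I xi = 0.
  apply: prj_0 => _ [_ [v [[m nm ->] ->]]].
  by rewrite -bfi !(symE (cproj_s (cc m))) h // !ip0r.
have : z xi = xi by rewrite /z bB b1 s0 subr0.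
by move=> <-; rewrite -exi -(ce n) bM -(bM z) zc b0.
Qed.

(** A vector under [e] has a copy in [D m] for each level [m] at which [c m] is live. Moving each
    copy to its next live level is an isometry inside the finite [G 0] that misses the copies at
    first live levels. *)
Lemma chain_false : False.
Proof.
have [w hw] := chain_w.
have Aw n : A (w n) by case: (hw n).
have wip m n xi eta : e eta = eta -> c m eta = eta -> ip (w m xi) (w n eta) = if m == n then ip xi eta else 0.
  move=> h1 h2; case: eqP => [<-|/eqP mn].
    by have [_ ww _] := hw m; rewrite ip_star -bM ww bM h1 h2.
  have [_ _ <-] := hw m; have [_ _ <-] := hw n.
  by rewrite !bM (symE (pD m).2.1) -(bM (D m)) DD // b0 ip0r.
(* Live at [m] and again at [(m + k).+1], with no live level strictly between. *)
pose ok m k xi := [/\ e xi = xi, c m xi = xi, c (m + k).+1 xi = xi &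
  forall l, (m < l)%N -> (l < (m + k).+1)%N -> c l xi = 0].
pose S : set (H * H) := [set p | exists m k xi, ok m k xi /\ p = (w m xi, w (m + k).+1 xi)].
have okim m k xi : ok m k xi -> ok m k (im xi).
  move=> [h1 h2 h3 h4]; split; rewrite ?bfi ?h1 ?h2 ?h3 // => l l1 l2.
  by rewrite bfi h4 // /im scaler0.
have cip l xi eta : c l xi = xi -> c l eta = 0 -> ip xi eta = 0.
  by move=> <- h; rewrite (symE (cproj_s (cc l))) h ip0r.
have key m k xi n j eta : ok m k xi -> ok n j eta ->
    ip (w m xi) (w n eta) = ip (w (m + k).+1 xi) (w (n + j).+1 eta).
  move=> [h1 h2 h3 h4] [g1 g2 g3 g4].
  have [mn|mn|mn] := ltngtP m n.
  - have L : ip (w m xi) (w n eta) = 0.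
      have [_ _ <-] := hw m; have [_ _ <-] := hw n.
      by rewrite !bM (symE (pD m).2.1) -(bM (D m)) DD ?ltn_eqF // b0 ip0r.
    rewrite L; have [E|NE] := eqVneq (m + k)%N (n + j)%N.
      rewrite E (wip _ _ _ _ g1 g3) eqxx; apply/esym; rewrite ipC; apply: (cip n) => //.
      by apply: h4 => //; rewrite E ltnS leq_addr.
    have [_ _ <-] := hw (m + k).+1; have [_ _ <-] := hw (n + j).+1.
    by rewrite !bM (symE (pD _).2.1) -(bM (D _)) DD ?eqSS // b0 ip0r.
  - have L : ip (w m xi) (w n eta) = 0.
      have [_ _ <-] := hw m; have [_ _ <-] := hw n.
      by rewrite !bM (symE (pD m).2.1) -(bM (D m)) DD ?gtn_eqF // b0 ip0r.
    rewrite L; have [E|NE] := eqVneq (m + k)%N (n + j)%N.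
      rewrite E (wip _ _ _ _ g1 g3) eqxx; apply/esym; apply: (cip m) => //.
      by apply: g4 => //; rewrite -E ltnS leq_addr.
    have [_ _ <-] := hw (m + k).+1; have [_ _ <-] := hw (n + j).+1.
    by rewrite !bM (symE (pD _).2.1) -(bM (D _)) DD ?eqSS // b0 ip0r.
  - subst n; rewrite (wip _ _ _ _ g1 g2) eqxx.
    have [kj|kj|kj] := ltngtP k j.
    + have z : ip xi eta = 0.
        by apply: (cip (m + k).+1) => //; apply: g4; rewrite ltnS ?leq_addr // ltn_add2l.
      rewrite z; have [_ _ <-] := hw (m + k).+1; have [_ _ <-] := hw (m + j).+1.
      by rewrite !bM (symE (pD _).2.1) -(bM (D _)) DD ?b0 ?ip0r // eqSS eqn_add2l ltn_eqF.
    + have z : ip xi eta = 0.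
        by rewrite ipC; apply: (cip (m + j).+1) => //; apply: h4; rewrite ltnS ?leq_addr // ltn_add2l.
      rewrite z; have [_ _ <-] := hw (m + k).+1; have [_ _ <-] := hw (m + j).+1.
      by rewrite !bM (symE (pD _).2.1) -(bM (D _)) DD ?b0 ?ip0r // eqSS eqn_add2l gtn_eqF.
    + by subst j; rewrite (wip _ _ _ _ g1 g3) eqxx.
have gS : gram S.
  move=> _ _ [m [k [xi [h ->]]]] [n [j [eta [g ->]]]] /=; split; first exact: key.
  by rewrite -!bfi; apply: key => //; exact: okim.
have sS (y : bop H) : cm A y -> stable S y.
  move=> cy _ [m [k [xi [[h1 h2 h3 h4] ->]]]]; exists m, k, (y xi); split; last first.
    by rewrite /= -!bM !(cy _ (Aw _)).
  have yc l : c l (y xi) = y (c l xi) by rewrite -!bM (cy _ (cproj_A (cc l))).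
  split; rewrite ?yc ?h2 ?h3 //; first by rewrite -bM -(cy _ pe.1) bM h1.
  by move=> l l1 l2; rewrite yc h4 // bf0.
have [V [AV VS VV VV']] := vna_pi hA gS sS.
(* A vector [y] orthogonal to the domain yields [t], live at [m], with no later live level;
   [chain_sup] makes it vanish. *)
have inP m xi : e xi = xi -> c m xi = xi -> oc (oc (domS S)) (w m xi).
  move=> exi cxi y hy; have hyi := oci hy.
  suff gen : forall y' : H, oc (domS S) y' -> ip y' (w m xi) = 0 by split; apply: gen.
  move=> {y hy hyi} y hy; pose t := e (c m (star (w m) y)).
  have et : e t = t by rewrite /t isproj_id //; exact: pe.2.
  have ct : c m t = t.
    by rewrite /t -(bM e) -(bM (c m)) mulrA (cproj_c (cc m) pe.1) -mulrA (cproj_i (cc m)).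
  have tE eta : e eta = eta -> c m eta = eta -> ip eta (star (w m) y) = ip eta t.
    by move=> h1 h2; rewrite /t -(symE pe.2.1) h1 -(symE (cproj_s (cc m))) h2.
  have ctz k : c (m + k).+1 t = 0.
    elim/ltn_ind: k => k IH; pose eta := c (m + k).+1 t.
    have ccom l l' : c l * c l' = c l' * c l by apply: (cproj_c (cc l)); exact: cproj_A (cc l').
    have oke : ok m k eta.
      split.
      - by rewrite /eta -bM -(cproj_c (cc _) pe.1) bM et.
      - by rewrite /eta -bM ccom bM ct.
      - by rewrite /eta isproj_id //; exact: cproj_is (cc _).
      - move=> l l1 l2; rewrite /eta -bM ccom bM.
        have := IH (l - m.+1)%N; rewrite -addSn subnKC // => ->; first by rewrite bf0.
        by rewrite ltn_subLR // addSn.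
    have [|o _] := hy (w m eta); first by exists (w m eta, w (m + k).+1 eta) => //; exists m, k, eta.
    have [k1 k2 k3 _] := oke; rewrite ip_star (tE _ k1 k2) in o.
    have q : ip eta eta = 0 by rewrite {2}/eta -(symE (cproj_s (cc (m + k).+1))) k3.
    exact: n2_eq0 q.
  have t0 : t = 0.
    apply: (@chain_sup m.+1) => // l ml; have := ctz (l - m.+1)%N.
    by rewrite -addSn subnKC.
  by rewrite ipC ip_star tE // t0 ip0r.
pose P := prj (domS S).
have PQ : P * prj (ranS S) = prj (ranS S).
  apply: prj_fix => _ [_ [m [k [xi [[h1 h2 h3 h4] ->]]]] <-] /=.
  by apply: prj_id; apply: inP.
have AP : A P by rewrite /P -VV; apply: (vnaM hA) => //; exact: (vna_star hA).
have fP : finp A P.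
  apply: (finp_sub hA fG); first by split=> //; exact: isprj.
  apply: prj_fix => _ [_ [m [k [xi [_ ->]]]] <-] /=.
  have [_ _ <-] := hw m; rewrite bM -(bM (G 0)) /D mulrBr !dGm //.
have iV : isproj (star V * V) by rewrite VV; exact: isprj.
have PV : P * V = V by rewrite -{1}(pi_mul' iV) VV' mulrA PQ -VV' pi_mul'.
have QP := fP.2 _ AV VV PV; rewrite VV' in QP.
(* A copy at a first live level lies in the domain but is orthogonal to the range. *)
have [m [xi [exi cxi lxi xi0]]] : exists m xi, [/\ e xi = xi, c m xi = xi,
    forall l, (l < m)%N -> c l xi = 0 & xi <> 0].
  apply: contrapT => no; apply: e0; apply: bop_ext => u; rewrite b0.
  apply: (@chain_sup 0); first by apply: isproj_id; exact: pe.2.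
  move=> m _; elim/ltn_ind: m => m IH; apply: contrapT => n0; apply: no.
  have ee : e (e u) = e u by apply: isproj_id; exact: pe.2.
  exists m, (c m (e u)); split=> //.
  - by rewrite -bM -(cproj_c (cc m) pe.1) bM ee.
  - by apply: isproj_id; exact: cproj_is (cc m).
  - by move=> l lm; rewrite -bM (cproj_c (cc l) (cproj_A (cc m))) bM IH // bf0.
have : P (w m xi) = w m xi by apply: prj_id; exact: inP.
rewrite -QP prj_0 => [|_ [_ [n [k [eta [[h1 h2 h3 h4] ->]]]] <-] /=].
  move=> /esym w0; apply: xi0; have [_ ww _] := hw m.
  by rewrite -cxi -{1}exi -bM -ww bM w0 bf0.
have E t : c n t = t -> ip (w (n + k).+1 t) (w m xi) = 0.
  move=> h; rewrite ipC.
  have [mn|mn] := eqVneq m (n + k).+1; last first.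
    have [_ _ <-] := hw m; have [_ _ <-] := hw (n + k).+1.
    by rewrite !bM (symE (pD m).2.1) -(bM (D m)) DD // b0 ip0r.
  rewrite ipC -mn wip // eqxx; apply: (cip n) => //; apply: lxi.
  by rewrite mn ltnS leq_addr.
split; first exact: E.
by rewrite -bfi; apply: E; rewrite bfi h2.
Qed.
End Chain.

(** [1 - cs A (G n)] kills [G n]. Were the supremum of these not 1, type I would supply an abelian
    projection in the rest, against [chain_false]. *)
Lemma typeI_dense G : typeI A -> (forall n, proj A (G n)) -> (forall n, G n * G n.+1 = G n.+1) ->
  (forall u, (forall n, G n u = u) -> u = 0) -> finp A (G 0%N) ->
  dense_fam [set z | cproj A z /\ exists n, z * G n = 0].
Proof.
move=> tI pG dG G0 fG u hu.
pose I : set (bop H) := [set z | exists n, z = 1 - cs A (G n)].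
have cI : I `<=` cproj A by move=> _ [n ->]; apply: (cprojC hA); exact: (cs_cproj hA (pG n).1).
have cS := csup_cproj hA cI.
have s0 : csup I u = 0.
  apply: prj_0 => _ [z [v [[n ->] ->]]].
  have cn := cprojC hA (cs_cproj hA (pG n).1).
  have k : (1 - cs A (G n)) u = 0.
    by apply: hu; split=> //; exists n; rewrite mulrBl mul1r (cs_mul hA) subrr.
  by rewrite -bfi !(symE (cproj_s cn)) k !ip0r.
have [e00|e00] := pselect (1 - csup I = 0).
  have h : (1 - csup I) u = u by rewrite bB b1 s0 subr0.
  by rewrite -h e00 b0.
have [e [pe ab en ee]] := tI _ (cprojC hA cS) e00.
exfalso; apply: (@chain_false G pG dG G0 fG e pe _ _ en).
  by move=> a b Aa Ab; rewrite !mulrA; have := ab a b Aa Ab; rewrite !mulrA.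
move=> n; have In : I (1 - cs A (G n)) by exists n.
have := csup_mulr hA cI In; rewrite mulrBl mul1r => h.
have k : cs A (G n) * (1 - csup I) = 1 - csup I.
  have h2 : cs A (G n) * csup I = csup I - (1 - cs A (G n)) by rewrite -h opprB addrCA subrr addr0.
  by rewrite mulrBr mulr1 h2 opprB addrA [X in X - _]addrCA subrr addr0.
by rewrite -ee mulrA k.
Qed.
End TypeI.

(** * Spectral resolution and local measurability *)

Section Res.
Variables (R : realType) (H : hilbertSpace R).
Implicit Types (a b c e w z : bop H) (u s v : H) (y : operator H).

Section Closed.
Variable y : operator H.
Hypothesis cy : closed_densely_defined y.
Let ylin (c : R[i]) u v u' v' : y (u, v) -> y (u', v') -> y (c *: u + u', c *: v + v').
Proof. by case: cy => [[_ h _] _ _] h1 h2; exact: (h c (u, v) (u', v')). Qed.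
Let y0 : y (0, 0). Proof. by case: cy => [[]]. Qed.
Let yfun u (v v' : H) : y (u, v) -> y (u, v') -> v = v'.
Proof. by case: cy => [[_ _ h] _ _]; exact: h. Qed.
Let yZ (c : R[i]) u (v : H) : y (u, v) -> y (c *: u, c *: v).
Proof. by move=> h; have := ylin c h y0; rewrite !addr0. Qed.
Let yD u (v u' v' : H) : y (u, v) -> y (u', v') -> y (u + u', v + v').
Proof. by move=> h h'; have := ylin 1 h h'; rewrite !scale1r. Qed.

Lemma dense_ort u : (forall s s', y (s, s') -> ip u s = 0) -> u = 0.
Proof.
move=> h; apply: eq0_small => e e0; case: cy => [_ _ /denseP d].
have [s [s' ys] hs] := d u e e0.
have := CS u (u - s); rewrite ipBr (h _ _ ys) subr0 => k.
have u0 := n2_ge0 u; have [->|n0] := eqVneq (n2 u) 0; first exact: ltW.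
have {}n0 : 0 < n2 u by rewrite lt_neqAle eq_sym n0.
have : n2 u * n2 u <= n2 u * n2 (u - s) by rewrite -expr2.
by rewrite ler_pM2l // => /le_trans; apply; exact: ltW.
Qed.

(** The weak form of [v + y^* v' = u] with [v' = y v], in which the adjoint does not occur. *)
Definition solves u (v v' : H) := y (v, v') /\ forall s s', y (s, s') -> ip v s + ip v' s' = ip u s.

Lemma solves_uniq u (v v' t t' : H) : solves u v v' -> solves u t t' -> v = t /\ v' = t'.
Proof.
move=> [h1 h2] [k1 k2].
have yd : y (v - t, v' - t').
  by apply: yD h1 _; have := yZ (-1) k1; rewrite !scaleN1r.
have := h2 _ _ yd; have := k2 _ _ yd => e1 e2.
have := n2_ge0 (v - t); have := n2_ge0 (v' - t') => p1 p2.
have e3 : n2 (v - t) + n2 (v' - t') = 0.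
  by rewrite /n2 ipBl (ipBl v' t'); lra.
by split; apply/eqP; rewrite -subr_eq0; apply/eqP/n2_eq0; lra.
Qed.

(** Riesz on the graph of y gives (1 + y^* y)^-1. *)
Lemma solve_ex u : exists p : H * H, solves u p.1 p.2.
Proof.
have cG : closed_rsub y.
  split; first exact: y0.
  - by move=> [a b] [a' b']; exact: yD.
  - by move=> r [a b]; exact: yZ.
  move=> p hp; have [_ /closed2P k _] := cy; apply: k => e e0.
  have [[a b] yab h] := hp e e0; exists a, b; move: h; rewrite /ip2 /= -!/(n2 _) => h.
  by split=> //; have := n2_ge0 (p.1 - a); have := n2_ge0 (p.2 - b); lra.
have [|||p yp hp] := @riesz_sub _ _ y (fun p => ip u p.1) (n2 u) cG (n2_ge0 u).
- by move=> a b; rewrite ipDr.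
- by move=> r a; rewrite ipZr.
- move=> a; apply: le_trans (CS _ _) _; rewrite ler_wpM2l ?n2_ge0 // /ip2 -!/(n2 _).
  by have := n2_ge0 a.2; lra.
exists p; split; first by case: p yp {hp}.
by move=> s s' ys; have := hp _ ys.
Qed.

Lemma res_ex : exists b c : bop H, [/\ forall u, solves u (b u) (c u), sym b,
  forall u, n2 (b u) + n2 (c u) = ip (b u) u, nle b 1 & forall u, b u = 0 -> u = 0].
Proof.
have [g hg] := @choice H (H * H)%type (fun u p => solves u p.1 p.2) solve_ex.
have uq u v v' : solves u v v' -> v = (g u).1 /\ v' = (g u).2 by move=> h; exact: solves_uniq h (hg u).
have gD u u' : (g (u + u')).1 = (g u).1 + (g u').1 /\ (g (u + u')).2 = (g u).2 + (g u').2.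
  have [|-> ->] // := uq (u + u') ((g u).1 + (g u').1) ((g u).2 + (g u').2).
  have [h1 h2] := hg u; have [k1 k2] := hg u'; split; first exact: yD.
  by move=> s s' ys; have := h2 _ _ ys; have := k2 _ _ ys; rewrite !ipDl; lra.
have gr_ r u : (g (rs r u)).1 = rs r (g u).1 /\ (g (rs r u)).2 = rs r (g u).2.
  have [|-> ->] // := uq (rs r u) (rs r (g u).1) (rs r (g u).2).
  have [h1 h2] := hg u; split; first exact: yZ.
  by move=> s s' ys; rewrite !ipZl -mulrDr (h2 _ _ ys).
have gi u : (g (im u)).1 = im (g u).1 /\ (g (im u)).2 = im (g u).2.
  have [|-> ->] // := uq (im u) (im (g u).1) (im (g u).2).
  have [h1 h2] := hg u; split; first exact: yZ.
  move=> s s' ys; have := h2 _ _ (yZ 'i%C ys).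
  by rewrite !ip_iml -/(im s) -/(im s'); lra.
have ge u : n2 (g u).1 + n2 (g u).2 = ip (g u).1 u.
  by have [h1 h2] := hg u; rewrite (ipC _ u) -(h2 _ _ h1).
have le u : n2 (g u).1 + n2 (g u).2 <= n2 u.
  have := CS (g u).1 u; rewrite -ge; have := n2_ge0 (g u).1; have := n2_ge0 (g u).2.
  have := n2_ge0 u; move: (n2 (g u).1) (n2 (g u).2) (n2 u) => X Y U U0 Y0 X0 h.
  by rewrite leNgt; apply/negP => lt; nra.
have bd1 : exists C : R, forall u, n2 (g u).1 <= C * n2 u.
  by exists 1 => u; have := le u; have := n2_ge0 (g u).2; lra.
have bd2 : exists C : R, forall u, n2 (g u).2 <= C * n2 u.
  by exists 1 => u; have := le u; have := n2_ge0 (g u).1; lra.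
have lin1 (c : R[i]) u v : (g (c *: u + v)).1 = c *: (g u).1 + (g v).1.
  by rewrite (gD _ _).1 !scaleE (gD _ _).1 (gi _).1 !(gr_ _ _).1.
have lin2 (c : R[i]) u v : (g (c *: u + v)).2 = c *: (g u).2 + (g v).2.
  by rewrite (gD _ _).2 !scaleE (gD _ _).2 (gi _).2 !(gr_ _ _).2.
exists (Bop lin1 bd1), (Bop lin2 bd2); split=> //=.
- apply: symP => u v /=; have [h1 h2] := hg u; have [k1 k2] := hg v.
  by rewrite (ipC _ v) -(k2 _ _ h1) -(h2 _ _ k1) (ipC (g u).1) (ipC (g u).2).
- by move=> u; rewrite mul1r /=; have := le u; have := n2_ge0 (g u).2; lra.
move=> u /= b0u; apply: dense_ort => s s' ys; have [h1 h2] := hg u.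
have c0 : (g u).2 = 0 by apply: yfun h1 _; rewrite b0u.
by rewrite -(h2 _ _ ys) b0u c0 !ip0l addr0.
Qed.
End Closed.

Lemma res_A (A : set (bop H)) y b c : vna A -> aff A y -> (forall u, solves y u (b u) (c u)) -> A b.
Proof.
move=> hA [cy ay] h; apply: (vnaP hA) => t ct; apply: bop_ext => u; rewrite !bM.
have [h1 h2] := h u; have [] // := solves_uniq cy (_ : solves y (t u) (t (b u)) (t (c u))) (h (t u)).
split; first exact: ay.
move=> s s' ys; rewrite !(ip_star t); apply: h2; apply: ay => //.
exact: cm_star.
Qed.

Lemma gr_closed (a : bop H) : closed_densely_defined (gr a).
Proof.
split; first split.
- by rewrite /gr /op_of_fun /= bf0.
- by move=> c [u v] [u' v'] h k; have {}h : v = a u := h; have {}k : v' = a u' := k; rewrite /gr /op_of_fun /= bf_lin h k.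
- move=> u v v' h k; have {}h : v = a u := h; have {}k : v' = a u := k; by rewrite h k.
- apply/closed2P => -[u v] h; suff -> : v = a u by [].
  apply/eqP; rewrite -subr_eq0; apply/eqP/eq0_small => e e0; have [C C0 nC] := nleP a.
  have d0 : 0 < e / (2 + 2 * C) by rewrite divr_gt0 // addr_gt0 // mulr_gt0.
  have [u' [v' [k hu hv]]] := h _ d0; have {}k : v' = a u' := k.
  have -> : v - a u = (v - v') - a (u - u') by rewrite bfB k opprB addrA subrK.
  apply: le_trans (n2D_le _ _) _; rewrite n2N; have := nC (u - u').
  move: hu hv; rewrite /= !ltr_pdivlMr ?addr_gt0 ?mulr_gt0 //.
  have := n2_ge0 (u - u'); have := n2_ge0 (v - v'); nra.
- by apply/denseP => u e e0; exists u; [exists (a u)|rewrite subrr n20].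
Qed.

(** [k / d] is [1 + g^2] with [g] symmetric, so the resolvent construction for the graph of [g]
    inverts it. *)
Lemma binv (A : set (bop H)) k (d : R) : vna A -> A k -> sym k -> 0 < d ->
  (forall u, d * n2 u <= ip (k u) u) -> exists h, [/\ A h, k * h = 1 & h * k = 1].
Proof.
move=> hA Ak sk d0 hk; pose T := rsc H d^-1 * k - 1.
have sT : sym T by apply: symB; [exact: sym_rsc|exact: sym1].
have pT : pos T.
  move=> u; rewrite /T bB b1 ipBl bM rscE ipZl -/(n2 u) subr_ge0 ler_pdivlMl //.
have [g [sg pg gg cg]] := sqrt_ex sT pT.
have [b [c [h sb _ _ _]]] := res_ex (gr_closed g).
have kb : rsc H d^-1 * k * b = 1.
  have -> : rsc H d^-1 * k = 1 + g * g by rewrite gg /T addrC subrK.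
  apply: bop_ext => u; apply: ip_ext => s; have [h1 h2] := h u; have {}h1 : c u = g (b u) := h1.
  have := h2 s (g s) erefl; rewrite h1 -(symE sg) => <-.
  by rewrite bM bD b1 bM ipDl.
pose h' := b * rsc H d^-1; have kh : k * h' = 1.
  by rewrite /h' -rscC mulrA -rscC kb.
clearbody h'.
have hk' : h' * k = 1.
  have e1 : star h' * k = 1 by rewrite -[k]sk -starM kh star1.
  have e2 : h' = star h' by rewrite -[LHS]mul1r -e1 -mulrA kh mulr1.
  by rewrite {1}e2 e1.
exists h'; split=> //; apply: (vnaP hA) => y cy.
rewrite -[y * h']mul1r -{1}hk' -mulrA (mulrA k y) -(cy k Ak) -!mulrA kh mulr1.
by [].
Qed.
End Res.

Section Meas.
Variables (R : realType) (H : hilbertSpace R) (A : set (bop H)).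
Hypothesis hA : vna A.
Implicit Types (b c e w z : bop H) (u s v : H) (y a : operator H).

Variables (y a : operator H) (F : bop H) (k : R).
Hypotheses (ay : aff A y) (sa : self_adjoint a) (pa : positive_op a)
  (aa : op_mul a a = op_mul (op_adj y) y) (fF : finp A F) (k0 : 0 < k).
Hypothesis hF : forall u, F u = 0 -> exists2 v, a (u, v) & ip v u <= k * n2 u.

Let ca : closed_densely_defined a := sa.1.
Let alin (c : R[i]) u v u' v' : a (u, v) -> a (u', v') -> a (c *: u + u', c *: v + v').
Proof. by case: ca => [[_ h _] _ _] h1 h2; exact: (h c (u, v) (u', v')). Qed.
Let apos u (v : H) : a (u, v) -> 0 <= ip v u.
Proof.
by move=> h; have := pa h; rewrite innerE lecE /= => /andP[_].
Qed.
Let asym u (v u' v' : H) : a (u, v) -> a (u', v') -> ip v u' = ip u v'.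
Proof.
move=> h h'; have [_ e] := sa; have : op_adj a (u', v') by rewrite e.
by move=> /(_ _ _ h); rewrite /= !innerE => -[].
Qed.

(** On the kernel of [F] the form of [a] is at most [k], while small [b = (1 + a^2)^-1] means large
    [a]. Commutation of [F] with [b] is not at hand, so the two facts are opposed by
    inequalities. *)
Lemma cut_kill b c : (forall u, solves y u (b u) (c u)) -> sym b ->
  (forall u, n2 (b u) + n2 (c u) = ip (b u) u) -> nle b 1 ->
  exists2 d : R, 0 < d & forall u, F u = 0 -> ip (b u) u <= d * n2 u -> u = 0.
Proof.
(* With [t >= 4 * k] and [eta * t = 1 / 4], the two contributions to [n2 u] in [E1] are at most 1/16
   and 1/4 of it. *)
move=> hs sb hb nb; pose t : R := 4 * k + 1; have t1 : 1 <= t by rewrite /t lerDr mulr_ge0 // ltW.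
have t0 : 0 < t by lra.
pose eta : R := (4 * t)^-1; have eta0 : 0 < eta by rewrite invr_gt0; lra.
have et : eta * t = 1 / 4 by rewrite /eta; field; rewrite gt_eqF.
exists (eta ^+ 2); first by rewrite exprn_gt0.
move=> u Fu hbu; have [v auv hv] := hF Fu.
have [ybc eqbc] := hs u.
(* [w'] is [a (b u)]; the operator [a^2] is [y^* y], which sends [b u] to [u - b u]. *)
have [w' h1 h2] : op_mul a a (b u, u - b u).
  rewrite aa; exists (c u) => // s s' ys; rewrite /=.
  have q := eqbc _ _ ys.
  have q' : ip (b u) (im s) + ip (c u) (im s') = ip u (im s).
    apply: eqbc; have [[_ l _] _ _] := ay.1; have y0 : y 0 by case: ay.1 => [[]].
    by have := l 'i%C (s, s') 0 ys y0; rewrite addr0.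
  apply: inner_ext.
    by rewrite ipC (ipC s) ipBl; lra.
  rewrite -[LHS]opprK -ip_iml -[RHS]opprK -ip_iml; congr (- _).
  by rewrite ipC (ipC (im s)) ipBl; lra.
set w := w' in h1 h2 *.
have N0 := n2_ge0 u.
have E1 : n2 u = ip (b u) u + ip w v.
  have := asym h2 auv; rewrite ipBl -/(n2 u); lra.
have W2 : n2 w <= eta ^+ 2 * n2 u.
  have := asym h2 h1; rewrite ipBl (ipC u) -!/(n2 _) => q.
  by have := n2_ge0 (b u); lra.
have U1 : n2 (u - b u) <= n2 u.
  have := hb u; have := n2_ge0 (c u); rewrite n2B (ipC u); have := n2_ge0 (b u); lra.
have S1 : ip (u - b u) w <= eta * n2 u.
  have := n2_ge0 (rs eta (u - b u) - w); rewrite n2B n2Z ipZl => q.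
  have q1 : eta ^+ 2 * n2 (u - b u) <= eta ^+ 2 * n2 u by rewrite ler_wpM2l ?sqr_ge0.
  rewrite -(ler_pM2l eta0) mulrA -expr2; lra.
(* Positivity of [a] at the vector [u - t w]. *)
have Q1 : 2 * t * ip w v <= ip v u + t ^+ 2 * ip (u - b u) w.
  move: (asym h2 auv) (alin (- t)%:C h2 auv); move: (u - b u) => X E2 auX.
  have := apos auX; rewrite -/(rs _ w) -/(rs _ X) !ipDl !ipDr !ipZl !ipZr E2 (ipC v w); lra.
have e2 : eta <= 1 / 4 by nra.
have e3 : ip w v <= n2 u / 4.
  have q1 : t ^+ 2 * ip (u - b u) w <= t * (n2 u / 4).
    have : t ^+ 2 * ip (u - b u) w <= t ^+ 2 * (eta * n2 u) by rewrite ler_wpM2l ?sqr_ge0.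
    have -> : t ^+ 2 * (eta * n2 u) = t * (eta * t) * n2 u by ring.
    by rewrite et; lra.
  have q2 : ip v u <= t * (n2 u / 4) by apply: le_trans hv _; rewrite /t; nra.
  rewrite -(ler_pM2l t0); nra.
have e4 : eta ^+ 2 <= 1 / 16 by nra.
have e5 : eta ^+ 2 * n2 u <= 1 / 16 * n2 u by rewrite ler_wpM2r.
by apply: n2_eq0; lra.
Qed.

(** The spectral projections [G n] of [b] for values below [d / (n + 1)] decrease to 0 because [b]
    is injective. Where some [G n] vanishes centrally, [b] is bounded below and [y = c b^-1] is
    bounded. *)
Lemma meas_bd : typeI A \/ typeIII A -> dense_fam (bd A y).
Proof.
move=> tA; have [b [c [hs sb hb nb binj]]] := res_ex ay.1.
have Ab : A b := res_A hA ay hs.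
have [d d0 hd] := cut_kill hs sb hb nb.
have pb : pos b by move=> u; rewrite -hb addr_ge0 ?n2_ge0.
pose dn n : R := d * iv R n; have dn0 n : 0 < dn n by rewrite mulr_gt0 ?iv_gt0.
pose T n := rsc H (dn n) - b.
have Tip n u : ip (T n u) u = dn n * n2 u - ip (b u) u by rewrite bB ipBl rscE ipZl.
have AT n : A (T n) by apply: (vnaB hA) => //; exact: vna_sc.
have sT n : sym (T n) by apply: symB => //; exact: rsc_sym.
have [G hG] := @choice nat (bop H) (fun n E => [/\ A E, isproj E,
  (forall z, T n * z = z * T n -> E * z = z * E),
  (forall u, E u = u -> 0 <= ip (T n u) u /\ (ip (T n u) u = 0 -> u = 0)) &
  (forall u, E u = 0 -> ip (T n u) u <= 0)]) (fun n => vna_spec hA (AT n) (sT n)).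
have bG n : b * G n = G n * b.
  have [_ _ h _ _] := hG n; rewrite h // /T mulrBl mulrBr rscC //.
have up n u : G n u = u -> ip (b u) u <= dn n * n2 u.
  by have [_ _ _ h _] := hG n => /h[+ _]; rewrite Tip subr_ge0.
have lo n u : G n u = 0 -> dn n * n2 u <= ip (b u) u.
  by have [_ _ _ _ h] := hG n => /h; rewrite Tip subr_le0.
have pG n : proj A (G n) by have [] := hG n.
have dd n : dn n.+1 < dn n.
  by rewrite ltr_pM2l // /iv ltf_pV2 ?posrE ?ltr0n // ltr_nat.
have dG n : G n * G n.+1 = G n.+1.
  have cG : G n * G n.+1 = G n.+1 * G n.
    have [_ _ h _ _] := hG n; apply: h; rewrite /T mulrBl mulrBr rscC bG //.
  have : (1 - G n) * G n.+1 = 0.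
    apply: bop_ext => u; rewrite b0; set v := _ u; apply: n2_eq0.
    have h1 : G n.+1 v = v.
      have e : G n.+1 * ((1 - G n) * G n.+1) = (1 - G n) * G n.+1.
        rewrite mulrBl mul1r mulrBr (pG n.+1).2.2 (mulrA (G n.+1)) -cG -mulrA.
        by rewrite (pG n.+1).2.2.
      by rewrite /v -(bM (G n.+1)) e.
    have h2 : G n v = 0.
      by rewrite /v -(bM (G n)) mulrA mulrBr mulr1 (pG n).2.2 subrr mul0r b0.
    have := up _ _ h1; have := lo _ _ h2; have := dd n; have := n2_ge0 v; nra.
  by rewrite mulrBl mul1r => /eqP; rewrite subr_eq0 => /eqP <-.
have G0 u : (forall n, G n u = u) -> u = 0.
  move=> h; apply: binj; apply: eq0_small => e e0.
  have nu : 0 < n2 u + 1 by have := n2_ge0 u; lra.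
  have [N hN] := inv_small (divr_gt0 e0 (mulr_gt0 d0 nu)).
  have := hN N (leqnn _); rewrite ltr_pdivlMr ?mulr_gt0 // => k1.
  have := up N u (h N); have := hb u; have := n2_ge0 (c u); rewrite /dn.
  have := iv_gt0 R N; have := n2_ge0 u; nra.
(* By [cut_kill] the projection [F] is injective on [G 0], so the polar part of [F * G 0] makes
   [G 0] equivalent to a subprojection of [F]. *)
have fG : finp A (G 0%N).
  have AF : A F := fF.1.1; have AG := (pG 0%N).1; have AFG := vnaM hA AF AG.
  have [v [Av pv kv vr]] := vna_polar hA AFG.
  have fr : finp A (v * star v).
    apply: (finp_sub hA fF); first by have [] := proj_pi hA Av pv.
    by rewrite vr; apply: prj_fix => _ [u _ <-]; rewrite -bM mulrA fF.1.2.2.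
  have gk u : G 0%N u = 0 <-> (star v * v) u = 0.
    rewrite -kv bM; split=> [->|Fg]; first by rewrite bf0.
    apply: (hd _ Fg); apply: le_trans (up 0%N _ _) _; first by apply: isproj_id; exact: (pG _).2.
    by rewrite /dn /iv invr1 mulr1.
  suff <- : star v * v = G 0%N by exact: finp_equiv.
  have e1 : star v * v * G 0%N = star v * v.
    apply: bop_ext => u; apply/eqP; rewrite -subr_eq0 bM -bfB; apply/eqP/gk.
    by rewrite bfB isproj_id ?subrr //; exact: (pG _).2.
  have e2 : G 0%N * (star v * v) = G 0%N.
    apply: bop_ext => u; apply/eqP; rewrite -subr_eq0 bM -bfB; apply/eqP/gk.
    by rewrite bfB isproj_id ?subrr.
  by rewrite -[RHS]e2; apply: star_inj; rewrite (starM (G 0%N)) pv.1 (pG 0%N).2.1 e1.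
have dz : dense_fam [set z | cproj A z /\ exists n, z * G n = 0].
  case: tA => [tI|tIII]; first exact: (typeI_dense hA tI pG dG G0 fG).
  move=> u h; have := h 1; rewrite b1; apply; split; first exact: cproj1.
  by exists 0%N; rewrite mul1r; exact: tIII.
move=> u hu; apply: dz => z [cz [n zG]]; apply: hu; split=> //.
have Az := cproj_A cz; have c1z := cprojC hA cz.
pose m : R := Num.min (dn n) 1; have m0 : 0 < m by rewrite lt_min dn0 ltr01.
(* The summand [1 - z] makes the cut of [b] invertible on the whole space; the part of [y] at [z] is
   then [c * z * h]. *)
have [|||h [Ah kh _]] := @binv R H A (b * z + (1 - z)) m hA _ _ m0 _.
- by apply: (vnaD hA); [exact: (vnaM hA Ab (cproj_A cz))|exact: cproj_A c1z].
- by apply: symD; [apply: symM => //; [exact: cproj_s cz|rewrite (cproj_c cz Ab)]|exact: cproj_s c1z].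
- move=> s; rewrite bD ipDl bM.
  have bz : b (z s) = z (b (z s)) by rewrite -!bM mulrA (cproj_c cz Ab) -mulrA (cproj_i cz).
  have -> : ip (b (z s)) s = ip (b (z s)) (z s) by rewrite {1}bz (symE (cproj_s cz)).
  have : dn n * n2 (z s) <= ip (b (z s)) (z s).
    by apply: lo; rewrite -bM -(cproj_c cz (pG n).1) zG b0.
  rewrite (isproj_ip s (cproj_is c1z)).
  have -> : n2 s = n2 (z s) + n2 ((1 - z) s) by rewrite (isproj_n2 s (cproj_is cz)) bB b1.
  have m1 : m <= dn n by rewrite ge_min lexx.
  have m2 : m <= 1 by rewrite ge_min lexx orbT.
  by have := n2_ge0 (z s); have := n2_ge0 ((1 - z) s); nra.
exists (c * z * h) => s; have [k1 _] := hs (z (h s)).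
suff <- : b (z (h s)) = z s by rewrite !bM.
have : z * ((b * z + (1 - z)) * h) = z by rewrite kh mulr1.
rewrite mulrA mulrDr (mulrBr z) mulr1 (cproj_i cz) subrr addr0 mulrA (cproj_c cz Ab) -(mulrA b) (cproj_i cz).
by move=> e; rewrite -{2}e !bM.
Qed.
End Meas.

(** * Finite signed measures on the real line *)

Section Csa.
Variable R : realType.
Implicit Types (nu : set (measurableTypeR R) -> R) (m : {measure set (measurableTypeR R) -> \bar R}).

(** Finite signed measures, as countably additive real set functions. *)
Definition csa nu := nu set0 = 0 /\ forall F : (set (measurableTypeR R))^nat,
  (forall n, measurable (F n)) -> trivIset setT F ->
  \sum_(i < n) nu (F i) @[n --> \oo] --> nu (\bigcup_n F n).

Lemma csaD nu nu' : csa nu -> csa nu' -> csa (fun B => nu B + nu' B).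
Proof.
move=> [n0 h] [n0' h']; split=> [|F mF tF]; first by rewrite n0 n0' addr0.
have -> : (fun n => \sum_(i < n) (nu (F i) + nu' (F i))) =
    (fun n => \sum_(i < n) nu (F i) + \sum_(i < n) nu' (F i)).
  by apply/funext => n; rewrite big_split.
by apply: cvgD; [exact: h|exact: h'].
Qed.
Lemma csaZ (r : R) nu : csa nu -> csa (fun B => r * nu B).
Proof.
move=> [n0 h]; split=> [|F mF tF]; first by rewrite n0 mulr0.
have -> : (fun n => \sum_(i < n) (r * nu (F i))) = (fun n => r * \sum_(i < n) nu (F i)).
  by apply/funext => n; rewrite mulr_sumr.
by apply: cvgM; [exact: cvg_cst|exact: h].
Qed.
Lemma csa0 : csa (fun=> 0).
Proof.
split=> // F _ _; have -> : (fun n => \sum_(i < n) (0 : R)) = (fun=> 0).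
  by apply/funext => n; rewrite big1.
exact: cvg_cst.
Qed.
Lemma csa_cap (A : set (measurableTypeR R)) nu : measurable A -> csa nu -> csa (fun B => nu (A `&` B)).
Proof.
move=> mA [n0 h]; split=> [|F mF tF]; first by rewrite setI0.
rewrite setI_bigcupr; apply: h; first by move=> n; exact: measurableI.
exact: trivIset_setIl.
Qed.
Lemma csa_mu m (r : R) : m setT = r%:E -> csa (fun B => fine (m B)).
Proof.
move=> mT; have fin B : measurable B -> m B = (fine (m B))%:E.
  move=> mB; rewrite fineK // ge0_fin_numE //; apply: le_lt_trans (ltry r).
  by rewrite -mT; apply: le_measure; rewrite ?inE.
split=> [|F mF tF]; first by rewrite measure0.
have mU : measurable (\bigcup_n F n) by apply: bigcup_measurable => k _; exact: mF.
have : (fun n => \sum_(0 <= i < n) m (F i))%E @ \oo --> m (\bigcup_n F n).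
  exact: measure_semi_sigma_additive.
rewrite (fin _ mU) => /fine_cvg; apply: cvg_trans; apply: near_eq_cvg; apply: nearW => n /=.
rewrite big_mkord (eq_bigr (fun i : 'I_n => (fine (m (F i)))%:E)); last by move=> i _; exact: fin.
by rewrite sumEFin.
Qed.

Lemma csa_add nu (A B : set (measurableTypeR R)) : csa nu -> measurable A -> measurable B ->
  A `&` B = set0 -> nu (A `|` B) = nu A + nu B.
Proof.
move=> [n0 h] mA mB AB.
have mF n : measurable (bigcup2 A B n) by case: n => [|[|n]] //=; exact: measurable0.
have tF : trivIset setT (bigcup2 A B).
  apply/trivIsetP => -[|[|i]] [|[|j]] _ _ //= _; rewrite ?setI0 ?set0I //.
  by rewrite setIC.
have := h _ mF tF; rewrite bigcup2E => cv.
apply: (cvg_unique _ cv) => //.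
apply: (@cvg_trans _ ((fun=> nu A + nu B) @ \oo)); last exact: cvg_cst.
apply: near_eq_cvg; exists 2%N => // -[|[|n]] // _ /=.
by rewrite !big_ord_recl /= big1 ?addr0 // => i _.
Qed.

(** Open half-lines form a pi-system generating the Borel sets, and the zero sets of a signed
    measure of total mass 0 form a Dynkin system. Signed functions are needed since differences of
    measures are compared. *)
Lemma csa_zero nu : csa nu -> nu setT = 0 -> (forall x : R, nu `]x, +oo[%classic = 0) ->
  forall B, measurable B -> nu B = 0.
Proof.
move=> cn nT nG B mB; have mE := RGenOInfty.measurableE R.
have ind := @dynkin_induction _ (measurableTypeR R) (@RGenOInfty.G R)
  (fun S => nu S = 0) mE.
apply: ind => //.
- move=> _ _ [x ->] [y ->]; exists (Num.max x y); apply/seteqP; split=> t /=.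
    by move=> [] ; rewrite !in_itv /= !andbT => h1 h2; rewrite gt_max h1.
  by rewrite !in_itv /= !andbT gt_max => /andP[].
- by move=> _ [x ->].
- move=> S mS S0; have := csa_add cn mS (measurableC mS) (setICr S).
  by rewrite setUCr nT S0 add0r => <-.
- move=> F mF tF F0; have [_ h] := cn; have := h F mF tF.
  have -> : (fun n => \sum_(i < n) nu (F i)) = (fun=> 0).
    by apply/funext => n; rewrite big1.
  move=> cv; apply/esym; apply: (cvg_unique _ _ cv) => //; exact: cvg_cst.
- change ((@RGenOInfty.G R).-sigma.-measurable B); rewrite -mE; exact: mB.
Qed.

Lemma measure_lim m (F : (set (measurableTypeR R))^nat) (l : R) : (forall n, measurable (F n)) ->
  {homo F : n m / (n <= m)%N >-> (n <= m)%O} ->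
  (exists N, forall n, (N <= n)%N -> m (F n) = l%:E) -> m (\bigcup_n F n) = l%:E.
Proof.
move=> mF nF [N hN].
have h : (m \o F) n @[n --> \oo] --> m (\bigcup_n F n).
  by apply: nondecreasing_cvg_mu => //; apply: bigcup_measurable => k _; exact: mF.
apply: (cvg_unique _ h) => //.
apply: (@cvg_trans _ ((fun=> l%:E) @ \oo)); last exact: cvg_cst.
by apply: near_eq_cvg; exists N => // n /= Nn; rewrite hN.
Qed.

Lemma nat_big (r : R) : exists N, forall n, (N <= n)%N -> r <= n%:R.
Proof.
exists (Num.truncn r).+1 => n Nn; apply: le_trans (ltW (truncnS_gt r)) _.
by rewrite ler_nat.
Qed.

Local Notation id1 := (fun t : measurableTypeR R => (t : R)).
Lemma id1_meas (A : set (measurableTypeR R)) : measurable_fun A id1.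
Proof. exact: measurable_id. Qed.

Lemma int_bd m (A : set (measurableTypeR R)) (al be r : R) : measurable A ->
  (forall t : R, A t -> al <= t <= be) -> m A = r%:E ->
  m.-integrable A (EFin \o id1) /\ al * r <= \int[m]_(t in A) (t : R) <= be * r.
Proof.
move=> mA hA mr; have fA : (m A < +oo)%E by rewrite mr ltry.
have iI : m.-integrable A (EFin \o id1).
  apply: (measurable_bounded_integrable mA fA (@id1_meas A)).
  exists (`|al| + `|be|); split; first exact: num_real.
  move=> M hM t At; have /andP[h1 h2] := hA t At.
  apply: le_trans (ltW hM); rewrite ler_norml.
  have := ler_norm be; have := ler_norm (- al); rewrite normrN.
  by have := normr_ge0 al; have := normr_ge0 be; move=> *; apply/andP; split; lra.
have iC (c : R) : m.-integrable A (EFin \o (fun=> c)).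
  apply: (measurable_bounded_integrable mA fA (@measurable_cst _ _ _ _ A c)).
  by exists `|c|; split; [exact: num_real|move=> M hM t _; exact: ltW].
have rE : r = fine (m A) by rewrite mr.
split=> //; rewrite rE -!Rintegral_cst //; apply/andP; split; apply: le_Rintegral => // t At.
  by have /andP[] := hA t At.
by have /andP[] := hA t At.
Qed.

Lemma supp_int m (A : set (measurableTypeR R)) (al be r : R) : measurable A -> m (~` A) = 0%E ->
  (forall t : R, A t -> al <= t <= be) -> m A = r%:E ->
  (\int[m]_(t in setT) ((t : R) ^+ 2)%:E < +oo)%E /\
  \int[m]_(t in setT) (t : R) = \int[m]_(t in A) (t : R).
Proof.
move=> mA mN hA mr; have mC := measurableC mA.
have TA : setT `\` ~` A = A by rewrite setTD setCK.
have [iI _] := int_bd mA hA mr.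
have sq (D : set (measurableTypeR R)) : measurable_fun D (fun t : measurableTypeR R => (t : R) ^+ 2).
  by apply: measurable_funX; exact: id1_meas.
split.
  rewrite (ge0_negligible_integral mC measurableT _ _ mN) ?TA; last 2 first.
  - by apply/measurable_EFinP; exact: sq.
  - by move=> t _; rewrite lee_fin sqr_ge0.
  pose M : R := (`|al| + `|be|) ^+ 2.
  apply: (@le_lt_trans _ _ (\int[m]_(t in A) (cst M%:E t))%E); last first.
    by rewrite integral_cst // mr -EFinM ltry.
  apply: ge0_le_integral => //.
  - by move=> t _; rewrite lee_fin sqr_ge0.
  - by apply/measurable_EFinP; exact: sq.
  - move=> t At; rewrite lee_fin /M -real_normK ?num_real // ler_pXn2r ?nnegrE ?addr_ge0 //.
    have /andP[h1 h2] := hA t At; rewrite ler_norml.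
    have := ler_norm be; have := ler_norm (- al); rewrite normrN.
    by have := normr_ge0 al; have := normr_ge0 be; move=> *; apply/andP; split; lra.
rewrite /Rintegral (negligible_integral mC measurableT _ mN) ?TA //.
by apply/(negligible_integrable _ _ _ mN) => //; rewrite TA.
Qed.
End Csa.

(** Over [N + 1] equal steps the bounds telescope to mesh size times the total variation of [h],
    which tends to 0. *)
Lemma flat_const (R : realType) (J h : R -> R) (a b : R) : a <= b ->
  (forall x y, a <= x -> x <= y -> y <= b -> `|J y - J x| <= (y - x) * (h x - h y)) -> J a = J b.
Proof.
move=> ab hJ.
have key N : `|J b - J a| <= (b - a) * iv R N * (h a - h b).
  pose d := (b - a) * iv R N; have d0 : 0 <= d by rewrite mulr_ge0 ?subr_ge0 // ltW // iv_gt0.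
  have dN : N.+1%:R * d = b - a by rewrite /d /iv mulrCA divff ?mulr1 // pnatr_eq0.
  have st k : (k <= N.+1)%N -> `|J (a + k%:R * d) - J a| <= d * (h a - h (a + k%:R * d)).
    elim: k => [|k IH] kN; first by rewrite mul0r addr0 !subrr normr0 mulr0.
    have -> : J (a + k.+1%:R * d) - J a = (J (a + k.+1%:R * d) - J (a + k%:R * d)) + (J (a + k%:R * d) - J a).
      by rewrite addrA subrK.
    apply: le_trans (ler_normD _ _) _; have := IH (ltnW kN).
    have kd : 0 <= k%:R * d by rewrite mulr_ge0.
    have k1d : k.+1%:R * d = k%:R * d + d by rewrite -natr1 mulrDl mul1r.
    have k1N : k.+1%:R * d <= b - a by rewrite -dN ler_wpM2r // ler_nat.
    have := hJ (a + k%:R * d) (a + k.+1%:R * d).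
    have -> : a + k.+1%:R * d - (a + k%:R * d) = d by rewrite k1d; ring.
    by move=> /(_ _ _ _) h1 h2; have := h1; rewrite lerDl lerD2l k1d lerDl => /(_ kd d0) h3; have := h3 _; lra.
  have := st N.+1 (leqnn _); rewrite dN; have -> : a + (b - a) = b by rewrite addrC subrK.
  by [].
apply/eqP; rewrite eq_sym -subr_eq0 -normr_eq0 eq_le normr_ge0 andbT.
apply/ler_addgt0Pr => e e0; rewrite add0r.
pose M : R := (b - a) * `|h a - h b| + 1.
have M0 : 0 < M by rewrite /M ltr_wpDl // mulr_ge0 // subr_ge0.
have [N hN] := inv_small (divr_gt0 e0 M0).
apply: le_trans (key N) _; have := hN N (leqnn _); rewrite ltr_pdivlMr // => /ltW; apply: le_trans.
rewrite [X in X * _]mulrC -mulrA ler_pM2l ?iv_gt0 // /M.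
apply: (@le_trans _ _ ((b - a) * `|h a - h b|)); last by rewrite lerDl.
by rewrite ler_wpM2l ?subr_ge0 // ler_norm.
Qed.

(** * The spectral measure of a bounded positive operator *)

Section Resolution.
Variables (R : realType) (H : hilbertSpace R) (g : bop H) (C : R).
Hypotheses (sg : sym g) (pg : pos g) (C0 : 0 <= C) (gC : forall u, ip (g u) u <= C * n2 u).
Implicit Types (u v : H) (x y s t : R) (e z : bop H).

(** The symmetric part of the bicommutant of [g], where all spectral projections live. *)
Definition fcom e := sym e /\ forall z, g * z = z * g -> e * z = z * e.

Lemma P_ex x : exists p : bop H, [/\ isproj p, fcom p,
  forall u, p u = u -> x * n2 u <= ip (g u) u /\ (ip (g u) u = x * n2 u -> u = 0) &
  forall u, p u = 0 -> ip (g u) u <= x * n2 u].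
Proof.
have sT : sym (g - rsc H x) by apply: symB => //; exact: rsc_sym.
have [p [sp pp cp h1 h2]] := spec_pos sT; exists p.
have T u : ip ((g - rsc H x) u) u = ip (g u) u - x * n2 u by rewrite bB ipBl rscE ipZl.
split; first by split.
- by split=> // z gz; apply: cp; rewrite mulrBl mulrBr gz rscC.
- move=> u /h1; rewrite T subr_ge0 => -[h3 h4]; split=> // e; apply: h4.
  by rewrite e subrr.
- by move=> u /h2; rewrite T subr_le0.
Qed.
Definition P x := projT1 (cid (P_ex x)).
Lemma P_is x : isproj (P x). Proof. by rewrite /P; case: cid => p []. Qed.
Lemma P_com x : fcom (P x). Proof. by rewrite /P; case: cid => p []. Qed.
Lemma P_up x u : P x u = u -> x * n2 u <= ip (g u) u /\ (ip (g u) u = x * n2 u -> u = 0).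
Proof. by rewrite /P; case: cid => p [_ _ h _] /=; exact: h. Qed.
Lemma P_lo x u : P x u = 0 -> ip (g u) u <= x * n2 u.
Proof. by rewrite /P; case: cid => p [_ _ _ h] /=; exact: h. Qed.
Lemma Pg x : P x * g = g * P x. Proof. by case: (P_com x) => _; apply. Qed.
Lemma P_cc x e : fcom e -> P x * e = e * P x.
Proof. by move=> [_ ce]; apply: (P_com x).2; apply/esym; rewrite ce. Qed.
Lemma PP x y : x <= y -> P x * P y = P y.
Proof.
rewrite le_eqVlt => /orP[/eqP ->|xy]; first exact: (P_is y).2.
have cPP : P x * P y = P y * P x by exact: P_cc (P_com y).
have : (1 - P x) * P y = 0.
  apply: bop_ext => u; rewrite b0; set v := _ u; apply: n2_eq0.
  have h1 : P y v = v.
    have e : P y * ((1 - P x) * P y) = (1 - P x) * P y.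
      by rewrite mulrBl mul1r mulrBr (P_is y).2 (mulrA (P y)) -cPP -mulrA (P_is y).2.
    by rewrite /v -(bM (P y)) e.
  have h2 : P x v = 0 by rewrite /v -(bM (P x)) mulrA mulrBr mulr1 (P_is x).2 subrr mul0r b0.
  have := (P_up h1).1; have := P_lo h2; have := n2_ge0 v; nra.
by rewrite mulrBl mul1r => /eqP; rewrite subr_eq0 => /eqP <-.
Qed.
Lemma PP' x y : x <= y -> P y * P x = P y.
Proof. by move=> xy; rewrite P_cc ?PP //; exact: P_com. Qed.
Lemma P_neg x : x < 0 -> P x = 1.
Proof.
move=> x0; apply: bop_ext => u; rewrite b1; apply/eqP; rewrite -subr_eq0; apply/eqP/n2_eq0.
have h : P x (P x u - u) = 0 by rewrite bfB isproj_id ?subrr //; exact: P_is.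
have := P_lo h; have := pg (P x u - u); have := n2_ge0 (P x u - u); nra.
Qed.
Lemma P_big x : C <= x -> P x = 0.
Proof.
move=> xC; apply: isproj_eq0; first exact: P_is.
move=> u h; have [h1 h2] := P_up h; apply: h2; have := gC u; have := n2_ge0 u; nra.
Qed.

Definition Fr u x : R := n2 u - n2 (P x u).
Lemma Fr_nd u : {homo Fr u : x y / x <= y}.
Proof.
move=> x y xy; rewrite /Fr lerD2l lerN2 -(PP' xy) bM.
by have := isproj_nle (P_is y) (P x u); rewrite mul1r.
Qed.
(** A vector under [P x] killed by all [P s] with [s > x] would have form exactly [x], which the
    strictness clause of [P_up] excludes; so the ranges of the later [P s] are dense in that of
    [P x]. *)
Lemma P_rc x u (e : R) : 0 < e -> exists2 s, x < s & n2 (P x u) - n2 (P s u) < e.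
Proof.
move=> e0; pose D : set H := [set v | exists2 s, x < s & P s v = v].
have sD : subsp D.
  split; first by exists (x + 1); rewrite ?ltrDl // bf0.
  move=> c v v' [s xs hs] [s' xs' hs']; exists (Num.min s s'); first by rewrite lt_min xs.
  rewrite bf_lin -{1}hs -{1}hs' -!bM !PP ?hs ?hs' // ge_min lexx ?orbT //.
have uD : oc (oc D) (P x u).
  move=> w hw; suff gen : forall w : H, oc D w -> ip w (P x u) = 0.
    by split; apply: gen => //; exact: oci.
  move=> {w hw} w hw; rewrite -(symE (P_is x).1).
  have Ps s : x < s -> P s w = 0.
    move=> xs; apply: n2_eq0; rewrite /n2 (symE (P_is s).1) isproj_id; last exact: P_is.
    by rewrite ipC; apply: (hw (P s w) _).1; exists s => //; apply: isproj_id; exact: P_is.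
  suff -> : P x w = 0 by rewrite ip0l.
  have hx : P x (P x w) = P x w by apply: isproj_id; exact: P_is.
  have [h1 h2] := P_up hx; apply: h2; apply/eqP; rewrite eq_le h1 andbT.
  apply/ler_addgt0Pr => d d0; have n0 := n2_ge0 (P x w).
  have n1 : 0 < n2 (P x w) + 1 by lra.
  have xd : x < x + d / (n2 (P x w) + 1) by rewrite ltrDl divr_gt0.
  have k : P (x + d / (n2 (P x w) + 1)) (P x w) = 0 by rewrite -bM (PP' (ltW xd)) (Ps _ xd).
  have := P_lo k; rewrite mulrDl => /le_trans; apply; rewrite lerD2l.
  by rewrite mulrAC ler_pdivrMr // ler_pM2l //; lra.
have [v [s xs hs] hv] := subsp_dense sD uD e0; exists s => //.
apply: le_lt_trans hv.
have e1 : n2 (P x u) - n2 (P s u) = n2 (P x u - P s u).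
  rewrite (isproj_n2 (P x u) (P_is s)) -bM PP' ?(ltW xs) //; ring.
rewrite e1; have -> : P x u - P s u = (1 - P s) (P x u - v).
  by rewrite bfB !bB !b1 hs subrr subr0 -bM PP' // ltW.
by have := isproj_nle (isprojC (P_is s)) (P x u - v); rewrite mul1r.
Qed.
Lemma Fr_rc u : right_continuous (Fr u).
Proof.
move=> x; apply/cvgrPdist_lt => e e0; have [s xs hs] := P_rc x u e0.
exists (s - x); first by rewrite /= subr_gt0.
move=> t /= ht xt; have ts : t < s by move: ht; rewrite ltr_norml => /andP[]; lra.
have h1 := Fr_nd u (ltW xt); have h2 := Fr_nd u (ltW ts).
rewrite distrC ger0_norm ?subr_ge0 //; move: h1 h2; rewrite /Fr; lra.
Qed.
HB.instance Definition _ u := isCumulative.Build R _ R (Fr u) (Fr_nd u) (@Fr_rc u).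

Definition mu u := lebesgue_stieltjes_measure (Fr u).
Lemma mu_oc u x y : x <= y -> mu u `]x, y] = (n2 (P x u) - n2 (P y u))%:E.
Proof.
move=> xy; rewrite /mu /lebesgue_stieltjes_measure /measure_extension measurable_mu_extE /=; last exact: is_ocitv.
by rewrite wlength_itv_bnd // /Fr; congr EFin; ring.
Qed.

Lemma mu_oy u x : mu u `]x, +oo[ = (n2 (P x u))%:E.
Proof.
have -> : `]x, +oo[%classic = \bigcup_n `]x, x + n%:R]%classic.
  apply/seteqP; split=> t /=; last by move=> [n _]; rewrite /= !in_itv /= andbT => /andP[].
  rewrite in_itv /= andbT => xt; have [n hn] := nat_big (t - x).
  exists n => //=; rewrite in_itv /= xt /=; have := hn n (leqnn _); lra.
apply: measure_lim => [n|n m nm|].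
- exact: measurable_itv.
- apply/subsetPset => t /=; rewrite !in_itv /= => /andP[-> h] /=; apply: le_trans h _.
  by rewrite lerD2l ler_nat.
have [N hN] := nat_big (C - x); exists N => n Nn; have := hN n Nn => h.
apply: etrans (mu_oc u _) _; first by rewrite lerDl.
by rewrite (@P_big (x + n%:R)) ?b0 ?n20 ?subr0 //; lra.
Qed.

Lemma mu_T u : mu u setT = (n2 u)%:E.
Proof.
have -> : [set: R] = \bigcup_n `](- 1 - n%:R), +oo[%classic.
  apply/seteqP; split=> t //= _; have [n hn] := nat_big (- t).
  by exists n => //=; rewrite in_itv /= andbT; have := hn n (leqnn _); lra.
apply: measure_lim => [n|n m nm|].
- exact: measurable_itv.
- apply/subsetPset => t /=; rewrite !in_itv /= !andbT; apply: le_lt_trans.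
  by rewrite lerD2l lerN2 ler_nat.
exists 0%N => n _; apply: etrans (mu_oy u _) _; by rewrite P_neg ?b1.
Qed.

Definition nu u (B : set (measurableTypeR R)) : R := fine (mu u B).
Lemma nu_csa u : csa (nu u). Proof. exact: csa_mu (mu_T u). Qed.
Lemma nu_T u : nu u setT = n2 u. Proof. by rewrite /nu mu_T. Qed.
Lemma nu_oy u x : nu u `]x, +oo[ = ip (P x u) u.
Proof. by rewrite /nu mu_oy /= isproj_ip //; exact: P_is. Qed.
Lemma mu_nu u B : measurable B -> mu u B = (nu u B)%:E.
Proof.
move=> mB; rewrite /nu fineK // ge0_fin_numE //; apply: le_lt_trans (ltry (n2 u)).
by rewrite -(mu_T u); apply: le_measure; rewrite ?inE.
Qed.
Lemma fcom1 : fcom 1.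
Proof. by split=> [|z _]; [exact: sym1|rewrite mul1r mulr1]. Qed.

(** The combination is a signed measure given on half-lines by elements of [fcom], so [csa_zero]
    applies. Every polarisation identity for [ff] is an instance. *)
Lemma nu_lin (I : seq (R * H)) (B : set (measurableTypeR R)) : measurable B ->
  (forall e, fcom e -> \sum_(c <- I) c.1 * ip (e c.2) c.2 = 0) -> \sum_(c <- I) c.1 * nu c.2 B = 0.
Proof.
move=> mB h; apply: (@csa_zero _ (fun B => \sum_(c <- I) c.1 * nu c.2 B)) => //.
- elim: I {h} => [|c I IH].
    by under [X in csa X]eq_fun do rewrite big_nil; exact: csa0.
  under [X in csa X]eq_fun do rewrite big_cons.
  by apply: csaD => //; apply: csaZ; exact: nu_csa.
- rewrite -[RHS](h 1 fcom1); apply: eq_bigr => c _; rewrite nu_T b1 //.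
move=> x; rewrite -[RHS](h (P x) (P_com x)); apply: eq_bigr => c _; rewrite nu_oy //.
Qed.

Definition ff B u v : R := (nu (u + v) B - nu (u - v) B) / 4.
Lemma ff_csa u v : csa (fun B => ff B u v).
Proof.
have -> : (fun B => ff B u v) = (fun B => 4^-1 * nu (u + v) B + (- 4^-1) * nu (u - v) B).
  by apply/funext => B; rewrite /ff; ring.
by apply: csaD; apply: csaZ; exact: nu_csa.
Qed.

Section Form.
Variable B : set (measurableTypeR R).
Hypothesis mB : measurable B.
Let sw e a b : sym e -> ip (e a) b = ip (e b) a.
Proof. by move=> se; rewrite (symE se) ipC. Qed.

Lemma ffC u v : ff B u v = ff B v u.
Proof.
have := @nu_lin [:: (1, u + v); (-1, u - v); (-1, v + u); (1, v - u)] B mB.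
rewrite !big_cons !big_nil /= /ff => h; have := h _; move=> {}h.
suff : 1 * nu (u + v) B + (- 1 * nu (u - v) B + (- 1 * nu (v + u) B + (1 * nu (v - u) B + 0))) = 0 by lra.
apply: h => e [se _]; rewrite !big_cons !big_nil /= !(bfD, bfN, ipDl, ipDr, ipNl, ipNr) (sw v u se); ring.
Qed.
Lemma ffD u v (t : H) : ff B (u + v) t = ff B u t + ff B v t.
Proof.
have := @nu_lin [:: (1, u + v + t); (-1, u + v - t); (-1, u + t); (1, u - t); (-1, v + t); (1, v - t)] B mB.
rewrite !big_cons !big_nil /= /ff => h.
suff : 1 * nu (u + v + t) B + (- 1 * nu (u + v - t) B + (- 1 * nu (u + t) B + (1 * nu (u - t) B +
  (- 1 * nu (v + t) B + (1 * nu (v - t) B + 0))))) = 0 by lra.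
apply: h => e [se _]; rewrite !big_cons !big_nil /= !(bfD, bfN, ipDl, ipDr, ipNl, ipNr).
rewrite (sw v u se) (sw t u se) (sw t v se); ring.
Qed.
Lemma ffZ r u v : ff B (rs r u) v = r * ff B u v.
Proof.
have := @nu_lin [:: (1, rs r u + v); (-1, rs r u - v); (- r, u + v); (r, u - v)] B mB.
rewrite !big_cons !big_nil /= /ff => h.
suff : 1 * nu (rs r u + v) B + (- 1 * nu (rs r u - v) B + (- r * nu (u + v) B + (r * nu (u - v) B + 0))) = 0 by lra.
apply: h => e [se _]; rewrite !big_cons !big_nil /= !(bfD, bfN, bfr, ipDl, ipDr, ipNl, ipNr, ipZl, ipZr).
rewrite (sw v u se); ring.
Qed.
Lemma ffi u v : ff B (im u) (im v) = ff B u v.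
Proof.
have := @nu_lin [:: (1, im u + im v); (-1, im u - im v); (- 1, u + v); (1, u - v)] B mB.
rewrite !big_cons !big_nil /= /ff => h.
suff : 1 * nu (im u + im v) B + (- 1 * nu (im u - im v) B + (- 1 * nu (u + v) B + (1 * nu (u - v) B + 0))) = 0 by lra.
apply: h => e [se _]; rewrite !big_cons !big_nil /= !(bfD, bfN, bfi, ipDl, ipDr, ipNl, ipNr, ip_im); ring.
Qed.
Lemma ff_diag u : ff B u u = nu u B.
Proof.
have := @nu_lin [:: (1, u + u); (-1, u - u); (- 4, u)] B mB.
rewrite !big_cons !big_nil /= /ff => h.
suff : 1 * nu (u + u) B + (- 1 * nu (u - u) B + (- 4 * nu u B + 0)) = 0 by lra.
apply: h => e [se _]; rewrite !big_cons !big_nil /= !(bfD, bfN, ipDl, ipDr, ipNl, ipNr); ring.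
Qed.
Lemma ff_star z u v : g * z = z * g -> ff B (z u) v = ff B u (star z v).
Proof.
move=> gz; have := @nu_lin [:: (1, z u + v); (-1, z u - v); (- 1, u + star z v); (1, u - star z v)] B mB.
rewrite !big_cons !big_nil /= /ff => h.
suff : 1 * nu (z u + v) B + (- 1 * nu (z u - v) B + (- 1 * nu (u + star z v) B + (1 * nu (u - star z v) B + 0))) = 0 by lra.
apply: h => e [se ce]; rewrite !big_cons !big_nil /= !(bfD, bfN, ipDl, ipDr, ipNl, ipNr).
have e1 : ip (e (z u)) v = ip (e u) (star z v) by rewrite -(bM e) (ce _ gz) bM ip_star.
rewrite (sw v (z u) se) (sw (star z v) u se) e1; ring.
Qed.
Lemma nu_ge0 u : 0 <= nu u B. Proof. by rewrite /nu fine_ge0. Qed.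
Lemma nu_le u : nu u B <= n2 u.
Proof. by rewrite -lee_fin -mu_nu // -(mu_T u); apply: le_measure; rewrite ?inE. Qed.

Lemma e_ex : exists e, fcom e /\ forall u v, ip (e u) v = ff B u v.
Proof.
have fDr u v (t : H) : ff B t (u + v) = ff B t u + ff B t v by rewrite ffC ffD !(ffC _ t).
have fZr r u v : ff B u (rs r v) = r * ff B u v by rewrite ffC ffZ (ffC v).
have bd u v : ff B u v ^+ 2 <= 1 * n2 u * n2 v.
  rewrite mul1r; have [u0|u0] := eqVneq (n2 u) 0.
    by rewrite u0 mul0r (n2_eq0 u0) -(rs0l 0) ffZ mul0r expr0n.
  have {}u0 : 0 < n2 u by rewrite lt_neqAle eq_sym u0 n2_ge0.
  pose t := - (ff B u v / n2 u).
  have := nu_ge0 (rs t u + v); rewrite -ff_diag ffD !fDr !ffZ !fZr !ff_diag (ffC v u).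
  have h1 := nu_le u; have h2 := nu_le v; have h3 := nu_ge0 v.
  have tn : t * n2 u = - ff B u v by rewrite /t mulNr divfK // gt_eqF.
  have h4 : t * (t * nu u B) <= t * (t * n2 u).
    by rewrite !mulrA -expr2; apply: ler_wpM2l => //; exact: sqr_ge0.
  rewrite tn in h4; move=> h5; have : 0 <= t * ff B u v + n2 v by lra.
  rewrite -(ler_pM2l u0) mulr0 mulrDr mulrA (mulrC (n2 u)) tn; lra.
have [||e _ he] := @form_op _ _ (ff B) 1 ler01 ffD _ ffZ _ ffi bd; [exact: fDr|exact: fZr|].
exists e; split=> //; split; first by apply: symP => u v; rewrite he ipC he ffC.
move=> z gz; apply: bop_ext => u; apply: ip_ext => v.
by rewrite !bM he ip_star he ff_star.
Qed.
End Form.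

Definition eB (B : set (measurableTypeR R)) : bop H :=
  match pselect (measurable B) with left mB => projT1 (cid (e_ex mB)) | right _ => 0 end.
Lemma eBP B : measurable B -> fcom (eB B) /\ forall u v, ip (eB B u) v = ff B u v.
Proof. by move=> mB; rewrite /eB; case: pselect => // m; case: cid. Qed.
Lemma eB_nu B u : measurable B -> ip (eB B u) u = nu u B.
Proof. by move=> mB; rewrite (eBP mB).2 ff_diag. Qed.
Lemma ff_oy x u v : ff `]x, +oo[ u v = ip (P x u) v.
Proof.
rewrite /ff !nu_oy !(bfD, bfN, ipDl, ipDr, ipNl, ipNr) (symE (P_is x).1 v) (ipC v); lra.
Qed.
Lemma ff_T u v : ff setT u v = ip u v.
Proof. by rewrite /ff !nu_T n2B n2D; lra. Qed.
Lemma eB_oy x : eB `]x, +oo[ = P x.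
Proof. by apply: bop_ext => u; apply: ip_ext => v; rewrite (eBP _).2 ?ff_oy. Qed.
Lemma eB_T : eB setT = 1.
Proof. by apply: bop_ext => u; apply: ip_ext => v; rewrite (eBP _).2 ?ff_T. Qed.
Lemma csaB (n1 n2 : set (measurableTypeR R) -> R) : csa n1 -> csa n2 -> csa (fun B => n1 B - n2 B).
Proof.
move=> h1 h2; have -> : (fun B => n1 B - n2 B) = (fun B => n1 B + (-1) * n2 B).
  by apply/funext => B; ring.
by apply: csaD => //; exact: csaZ.
Qed.
Lemma oyI x y : `]x, +oo[%classic `&` `]y, +oo[%classic = `]Num.max x y, +oo[%classic.
Proof.
apply/seteqP; split=> t /=; rewrite !in_itv /= !andbT gt_max; last by move/andP.
by move=> [-> ->].
Qed.
(** Multiplicativity is extended one factor at a time: half-lines here, then arbitrary Borel sets in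
    [eB_I]. *)
Lemma eB_Ioy B y : measurable B -> eB (B `&` `]y, +oo[) = P y * eB B.
Proof.
move=> mB; have mS : measurable (`]y, +oo[%classic : set (measurableTypeR R)) by exact: measurable_itv.
have mI := measurableI _ _ mB mS.
apply: bop_ext => u; apply: ip_ext => v; rewrite bM (eBP mI).2 (symE (P_is y).1) (eBP mB).2.
apply/eqP; rewrite eq_sym -subr_eq0; apply/eqP.
apply: (@csa_zero _ (fun B => ff B u (P y v) - ff (B `&` `]y, +oo[%classic) u v)) => //.
- apply: csaB; first exact: ff_csa.
  have -> : (fun B => ff (B `&` `]y, +oo[%classic) u v) = (fun B => ff (`]y, +oo[%classic `&` B) u v).
    by apply/funext => X; rewrite setIC.
  by apply: (@csa_cap _ _ (fun X => ff X u v)) => //; exact: ff_csa.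
- by rewrite setTI ff_T ff_oy -(symE (P_is y).1) subrr.
move=> x; rewrite oyI !ff_oy -(symE (P_is y).1).
have [xy|yx] := leP x y.
  by rewrite -bM PP' // subrr.
by rewrite -bM PP ?(ltW yx) // subrr.
Qed.
Lemma eB_I A B : measurable A -> measurable B -> eB (A `&` B) = eB A * eB B.
Proof.
move=> mA mB; have mI := measurableI _ _ mA mB.
have sA := (eBP mA).1.1.
apply: bop_ext => u; apply: ip_ext => v; rewrite bM (eBP mI).2 (symE sA) (eBP mB).2.
apply/eqP; rewrite eq_sym -subr_eq0; apply/eqP.
apply: (@csa_zero _ (fun B => ff B u (eB A v) - ff (A `&` B) u v)) => //.
- by apply: csaB; [exact: ff_csa|apply: (@csa_cap _ _ (fun X => ff X u v)) => //; exact: ff_csa].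
- by rewrite setIT ff_T -(eBP mA).2 (symE sA) subrr.
move=> x; have mS : measurable (`]x, +oo[%classic : set (measurableTypeR R)) by exact: measurable_itv.
have mI' := measurableI _ _ mA mS.
by rewrite ff_oy -(eBP mI').2 eB_Ioy // -(symE sA) -!bM -P_cc ?subrr //; exact: (eBP mA).1.
Qed.
Lemma eB_is B : measurable B -> isproj (eB B).
Proof. by move=> mB; split; [exact: (eBP mB).1.1|rewrite -eB_I // setIid]. Qed.

Let E B u := eB B u.
Fact E_projection B : measurable B -> projection (op_of_fun (E B)).
Proof. by move=> mB; apply/(projection_gr (eB B)); exact: eB_is. Qed.
Fact E_set0 : E set0 = fun=> 0.
Proof.
apply/funext => u; rewrite /E; have m0 := @measurable0 _ (measurableTypeR R).
suff -> : eB set0 = 0 by [].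
by apply: sym_eq0; [exact: (eBP m0).1.1|move=> t; rewrite eB_nu // (nu_csa t).1].
Qed.
Fact E_setT : E setT = idfun. Proof. by apply/funext => u; rewrite /E eB_T. Qed.
Fact E_setI A B : measurable A -> measurable B -> E (A `&` B) = E A \o E B.
Proof. by move=> mA mB; apply/funext => u; rewrite /E eB_I. Qed.
Fact E_weight B u : measurable B -> pvm_weight E u B = mu u B.
Proof. by move=> mB; rewrite mu_nu // -eB_nu // isproj_ip //; exact: eB_is. Qed.
Fact E_sigma u : semi_sigma_additive (pvm_weight E u).
Proof.
move=> F mF tF mU; rewrite E_weight //.
have -> : (fun n => \sum_(0 <= i < n) pvm_weight E u (F i))%E = (fun n => \sum_(0 <= i < n) mu u (F i))%E.
  by apply/funext => n; apply: eq_bigr => i _; rewrite E_weight.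
exact: measure_semi_sigma_additive.
Qed.
Definition spectral_pvm : pvm H := PVM E_projection E_set0 E_setT E_setI E_sigma.

Lemma E_oc u x y : x <= y -> pvm_measure spectral_pvm u `]x, y] = (n2 (P x u) - n2 (P y u))%:E.
Proof.
move=> xy; rewrite /pvm_measure E_weight; last exact: measurable_itv.
exact: mu_oc.
Qed.

Theorem spectral : spectral_measure_of (gr g) spectral_pvm /\ spectral_pvm `]C, +oo[%classic = fun=> 0.
Proof.
split; last by apply/funext => u; rewrite /= /E eB_oy P_big // b0.
pose m u : {measure set (measurableTypeR R) -> \bar R} := pvm_measure spectral_pvm u.
(* The interval is open on the left and must contain 0, which may carry mass, hence a negative left
   end. *)
have C1 : - 1 <= C by apply: le_trans C0; exact: lerN10.
have mA : measurable (`]-1, C]%classic : set (measurableTypeR R)) by exact: measurable_itv.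
have N1 : (- 1 : R) < 0 by rewrite oppr_lt0 ltr01.
have mAr u : m u `]-1, C]%classic = (n2 u)%:E.
  apply: etrans (E_oc u C1) _; by rewrite (P_big (lexx C)) b0 n20 subr0 (P_neg N1) b1.
have mw u B : measurable B -> m u B = (nu u B)%:E.
  by move=> mB; exact: (etrans (E_weight u mB) (mu_nu u mB)).
have mN u : m u (~` `]-1, C]%classic) = 0%E.
  have mC := measurableC mA; apply: etrans (mw u _ mC) _.
  have := csa_add (nu_csa u) mA mC (setICr _); rewrite setUCr nu_T => h.
  have [h2] := etrans (esym (mw u _ mA)) (mAr u).
  by move: h; rewrite h2 => /eqP; rewrite -subr_eq0 opprD addrA subrr sub0r oppr_eq0 => /eqP ->.
have hb : forall t : R, `]-1, C]%classic t -> -1 <= t <= C.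
  by move=> t /=; rewrite in_itv /= => /andP[/ltW -> ->].
split=> [u|u v h]; first by split=> [_|_]; [exact: (supp_int mA (mN u) hb (mAr u)).1|exists (g u)].
have {}h : v = g u := h.
rewrite h innerE (_ : ip (g u) (im u) = 0); last first.
  by have := ip_iml (g u) u; rewrite (symE sg) -bfi ipC; lra.
congr (Complex _ 0); rewrite (supp_int mA (mN u) hb (mAr u)).2.
(* The gap between truncated integral and truncated form: on []x, y]] both lie between [x] and [y]
   times the same mass, so [flat_const] shows that the gap stays 0. *)
pose J x : R := \int[m u]_(t in `]-1, x]%classic) (t : R) - ip (g (u - P x u)) u.
have iJ x y : -1 <= x -> x <= y -> y <= C ->
    (m u).-integrable `]x, y]%classic (EFin \o (fun t : measurableTypeR R => (t : R))) /\
    x * (n2 (P x u) - n2 (P y u)) <= \int[m u]_(t in `]x, y]%classic) (t : R) <= y * (n2 (P x u) - n2 (P y u)).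
  move=> x1 xy yC; apply: int_bd; [exact: measurable_itv| |exact: E_oc].
  by move=> t /=; rewrite in_itv /= => /andP[/ltW -> ->].
have Pm1 : P (-1) u = u by rewrite (P_neg N1) b1.
have JE : J (-1) = J C.
  apply: (@flat_const _ J (fun x => n2 (P x u))) => // x y x1 xy yC.
  have [_ /andP[h1 h2]] := iJ x y x1 xy yC; have [iy _] := iJ (-1) y (lexx _) (le_trans x1 xy) yC.
  have eqU : `]-1, y]%classic = `]-1, x]%classic `|` `]x, y]%classic.
    apply/seteqP; split=> t /=; rewrite !in_itv /=.
      by move=> /andP[a b]; case: (leP t x) => c; [left; rewrite a|right; rewrite b].
    by move=> [/andP[-> a]|/andP[a ->]]; rewrite ?(le_trans a xy) ?(le_lt_trans x1 a).
  have mX : measurable (`]-1, x]%classic : set (measurableTypeR R)) by exact: measurable_itv.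
  have mY : measurable (`]x, y]%classic : set (measurableTypeR R)) by exact: measurable_itv.
  have dXY : [disjoint (`]-1, x]%classic : set (measurableTypeR R)) & `]x, y]%classic].
    apply/disj_setPS => t [/=]; rewrite !in_itv /= => /andP[_ a] /andP[b _].
    by move: (le_lt_trans a b); rewrite ltxx.
  have iU : (m u).-integrable (`]-1, x]%classic `|` `]x, y]%classic) (EFin \o (fun t : measurableTypeR R => (t : R))).
    by rewrite -eqU.
  have -> : J y - J x = \int[m u]_(t in `]x, y]%classic) (t : R) - ip (g (P x u - P y u)) u.
    by rewrite /J eqU (Rintegral_setU mX mY iU dXY) !bfB !ipBl; ring.
  pose vv := P x u - P y u.
  have Pxv : P x vv = vv by rewrite /vv bfB -!bM (P_is x).2 PP.
  have Pyv : P y vv = 0 by rewrite /vv bfB -!bM (P_is y).2 PP' // subrr.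
  have nv : n2 vv = n2 (P x u) - n2 (P y u).
    rewrite (isproj_n2 (P x u) (P_is y)) -bM PP' // /vv; ring.
  have gv : ip (g vv) u = ip (g vv) vv.
    have -> : ip (g vv) vv = ip (g vv) (P x u) - ip (g vv) (P y u) by rewrite -ipBr.
    rewrite -(symE (P_is x).1) -(symE (P_is y).1) -!bM !Pg !bM Pxv Pyv bf0 ip0l subr0.
    by [].
  have a1 := (P_up Pxv).1; have a2 := P_lo Pyv.
  rewrite -/vv gv -nv; rewrite -nv in h1 h2; rewrite ler_norml; apply/andP; split; lra.
have J0 : J (-1) = 0 by rewrite /J set_itvoc0 Rintegral_set0 Pm1 subrr bf0 ip0l subr0.
move: JE; rewrite J0 /J P_big // b0 subr0 => /esym/eqP; rewrite subr_eq0 => /eqP ->.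
by [].
Qed.
End Resolution.

(** * Bounds read off a given spectral measure *)

Section PvmBound.
Variables (R : realType) (H : hilbertSpace R) (a : operator H) (E : pvm H) (c : R).
Hypotheses (pa : positive_op a) (sE : spectral_measure_of a E) (c0 : 0 < c).
Implicit Types (u v : H) (B : set (measurableTypeR R)).
Let m u : {measure set (measurableTypeR R) -> \bar R} := pvm_measure E u.

Lemma pvm_bop B : measurable B -> exists p : bop H, isproj p /\ forall u, E B u = p u.
Proof.
move=> mB; have pB := pvm_projection E mB; have [/bounded_gr[p e] _ _] := pB.
exists p; split; first by apply/projection_gr; rewrite -e.
by move=> u; have : gr p (u, E B u) by rewrite -e.
Qed.
Let mE u B : m u B = (n2 (E B u))%:E. Proof. by []. Qed.
Let mT u : m u setT = (n2 u)%:E. Proof. by rewrite mE pvm_setT. Qed.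
Let EI A B u : measurable A -> measurable B -> E A (E B u) = E (A `&` B) u.
Proof. by move=> mA mB; rewrite pvm_setI. Qed.

Lemma pvm_int u (A : set (measurableTypeR R)) (al be : R) : measurable A -> m u (~` A) = 0%E ->
  (forall t : R, A t -> al <= t <= be) -> exists v, [/\ a (u, v), 0 <= ip v u & al * n2 u <= ip v u <= be * n2 u].
Proof.
move=> mA mN hA; have mAr : m u A = (n2 u)%:E.
  by rewrite -(mT u) -(setUCr A) measureU0 //; exact: measurableC.
have [h1 h2] := supp_int mA mN hA mAr; have [_ h3] := int_bd mA hA mAr.
have [/(_ u)[_ d] i] := sE; have [v auv] := d h1; exists v.
have e : ip v u = \int[m u]_(t in A) (t : R) by rewrite -h2 /ip (i _ _ auv).
split=> //; last by rewrite e.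
by have := pa auv; rewrite innerE lecE /= => /andP[_].
Qed.

Let Bn n : set (measurableTypeR R) := `[- n.+1%:R, - iv R n]%classic.
Let mBn n : measurable (Bn n). Proof. exact: measurable_itv. Qed.

(** On a nonzero vector carried by [Bn n] the form of the positive operator [a] would be
    negative. *)
Lemma pvm_neg n u : E (Bn n) u = 0.
Proof.
have mC := measurableC (mBn n); set v := E (Bn n) u.
have vN : m v (~` Bn n) = 0%E.
  by rewrite mE /v EI // setICl pvm_set0 n20.
have [|w [aw w0 /andP[_ w1]]] := @pvm_int v (Bn n) (- n.+1%:R) (- iv R n) (mBn n) vN.
  by move=> t; rewrite /Bn /= in_itv.
have := iv_gt0 R n; have := n2_ge0 v => v0 i0; apply: n2_eq0; nra.
Qed.

Lemma pvm_fin : exists F : bop H, [/\ gr F = op_of_fun (E `]c, +oo[%classic), isproj F &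
  forall u, F u = 0 -> exists2 v, a (u, v) & ip v u <= c * n2 u].
Proof.
have mc : measurable (`]c, +oo[%classic : set (measurableTypeR R)) by exact: measurable_itv.
have m0 : measurable (`]-oo, 0[%classic : set (measurableTypeR R)) by exact: measurable_itv.
have mA : measurable (`[0, c]%classic : set (measurableTypeR R)) by exact: measurable_itv.
have [F [pF EF]] := pvm_bop mc; exists F; split=> //.
  by rewrite /gr; congr op_of_fun; apply/funext => u; rewrite EF.
move=> u Fu; have neg : m u `]-oo, 0[%classic = 0%E.
  have -> : `]-oo, (0 : R)[%classic = \bigcup_n Bn n.
    apply/seteqP; split=> t /=; rewrite ?in_itv /=.
      move=> t0; have nt : 0 < - t by lra.
      have [N1 h1] := inv_small nt; have [N2 h2] := nat_big (- t).
      exists (maxn N1 N2) => //; rewrite /Bn /= in_itv /=.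
      have a1 := h1 _ (leq_maxl N1 N2); have a2 := h2 _ (leq_maxr N1 N2).
      by apply/andP; split; [rewrite -natr1; lra|lra].
    move=> [n _]; rewrite /Bn /= in_itv /= => /andP[_ h]; have := iv_gt0 R n; lra.
  apply: measure_lim => [n|n k nk|]; first exact: mBn.
    apply/subsetPset => t; rewrite /Bn /= !in_itv /= => /andP[h1 h2]; apply/andP; split.
      by apply: le_trans h1; rewrite lerN2 ler_nat ltnS.
    by apply: le_trans h2 _; rewrite lerN2 /iv lef_pV2 ?posrE ?ltr0n // ler_nat ltnS.
  by exists 0%N => n _; rewrite mE pvm_neg n20.
have mN : m u (~` `[0, c]%classic) = 0%E.
  have -> : ~` `[(0 : R), c]%classic = `]-oo, 0[%classic `|` `]c, +oo[%classic.
    apply/seteqP; split=> t /=; rewrite !in_itv /= ?andbT.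
      by move=> /negP; rewrite negb_and -!ltNge => /orP[->|->]; [left|right].
    by move=> [h|h]; apply/negP; rewrite negb_and -!ltNge h ?orbT.
  by rewrite measureU0 // mE EF Fu n20.
have [|v [auv _ /andP[_ h]]] := @pvm_int u _ 0 c mA mN; first by move=> t /=; rewrite in_itv.
by exists v.
Qed.
End PvmBound.

(** * Locally measurable operators are the locally bounded ones *)

Section LSlb.
Variables (R : realType) (H : hilbertSpace R) (M : set (operator H)).
Hypothesis hM : von_neumann_algebra M.
Let A := bops M.
Let hA : vna A := vna_bops hM.
Implicit Types (x : operator H).

(** [meas_bd] gives each measurable cut of [x] a dense family of bounded pieces; these are pieces of
    [x] as well, and the cuts tend to 1. *)
Lemma LS_lb x : typeI A \/ typeIII A -> LS M x -> lb A x.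
Proof.
move=> tA [/(affiliated_gr hM) ax [p [cp _ lim mp]]]; split=> //.
have pz n : exists z, cproj A z /\ forall u, p n u = z u.
  have [z cz e] := central_projection_ex hM (cp n); exists z; split=> // u.
  by have : gr z (u, p n u) by rewrite -e.
move=> u hu.
have key n : p n u = 0.
  have [z [cz pzE]] := pz n; have [/(affiliated_gr hM) ay [a [E [c [[sa pa aa] sE c0 fF]]]]] := mp n.
  have [F [FE pF hF]] := pvm_fin c pa sE.
  have fin : finp A F by apply/(finite_projection_gr hM); rewrite FE.
  have d := meas_bd hA ay sa pa aa fin c0 hF tA.
  rewrite pzE; apply: d => w [cw [b hb]]; rewrite -bM (cproj_c cw (cproj_A cz)).
  apply: hu; split; first exact: cprojM.
  exists b => t; have [v h1 h2] := hb t; have {}h1 : v = p n (w t) := h1.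
  by rewrite bM -pzE -h1.
apply: n2_eq0; apply/eqP; rewrite eq_le n2_ge0 andbT; apply/ler_addgt0Pr => e e0; rewrite add0r.
have /cvgP_n2 /(_ e e0)[N hN] := lim u; have := hN N (leqnn _).
by rewrite key sub0r n2N => /ltW.
Qed.

(** The definition asks for an actual spectral measure of [|a|]; beyond a bound of [|a|] its
    projection is 0, which is finite. *)
Lemma gr_measurable a : A a -> measurable_op M (gr a).
Proof.
move=> Aa; split; first by apply/(affiliated_gr hM); exact: (gr_lb hA Aa).1.
have As : A (star a * a) by apply: (vnaM hA) => //; exact: (vna_star hA).
have [g [Ag sg pg gg _]] := vna_sqrt hA As (sym_star a) (@pos_star _ _ a).
(* [k] bounds the squared norm, so [k + 1] bounds the quadratic form. *)
have [k k0 nk] := nleP g; have c0 : 0 < k + 1 by lra.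
have gC u : ip (g u) u <= (k + 1) * n2 u.
  by have := nk u; have := n2_ge0 (g u - u); rewrite n2B; have := n2_ge0 u; have := n2_ge0 (g u); lra.
have [sp E0] := spectral sg pg (ltW c0) gC.
exists (gr g), (spectral_pvm sg pg gC), (k + 1); split=> //.
- split.
  + by split; [exact: gr_closed|rewrite op_adj_gr sg].
  + move=> u v h; have {}h : v = g u := h; rewrite h innerE lecE /=.
    have -> : ip (g u) (im u) = 0 by have := ip_iml (g u) u; rewrite (symE sg) -bfi ipC; lra.
    by rewrite eqxx; exact: pg.
  + by rewrite op_adj_gr !op_mul_gr gg.
rewrite E0; apply/(finite_projection_gr hM 0); split.
  by split; [exact: vna0|exact: isproj0].
by move=> w Aw /star_sq0 -> _; rewrite mul0r.
Qed.

(** The increasing sequence consists of the largest central projections [W n] on which [x] has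
    squared norm at most [n]. *)
Lemma lb_LS x : lb A x -> LS M x.
Proof.
move=> lx; have [ax dx] := lx; split; first exact/(affiliated_gr hM).
pose W n := csup (bdC A x n%:R).
have Wb n : bdC A x n%:R (W n) by apply: bdC_csup.
have Wc n : cproj A (W n) by case: (Wb n).
have Wm n m : (n <= m)%N -> W m * W n = W n.
  move=> nm; apply: csup_ub; have [cW [a h na]] := Wb n; split=> //.
  by exists a => //; apply: nle_mono na; rewrite ler_nat.
exists (fun n => W n : H -> H); split.
- by move=> n; apply/(central_projection_gr hM).
- by move=> n; apply/(proj_le_gr (W n) (W n.+1)); exact: Wm.
- move=> u; apply/cvgP_n2 => e e0.
  have [z [cz [a ha]] hz] := dense_approx hA u (@bd_c _ _ A x) (bd_dir hA ax) dx e0.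
  have [k k0 nk] := nleP a; have [N hN] := nat_big k.
  exists N => n Nn; rewrite n2Bc; apply: le_lt_trans hz.
  have zW : W n * z = z.
    by apply: csup_ub; split=> //; exists a => //; apply: nle_mono nk; exact: hN.
  have -> : u - W n u = (1 - W n) (u - z u).
    by rewrite bfB !bB !b1 -(bM (W n)) zW subrr subr0.
  by have := isproj_nle (isprojC (cproj_is (Wc n))) (u - z u); rewrite mul1r.
move=> n; have [cW [a h na]] := Wb n.
have -> : op_mul x (op_of_fun (W n)) = gr a.
  apply/seteqP; split=> [[u w] [v h1 h2]|[u w] h1].
    have {}h1 : v = W n u := h1; rewrite h1 in h2; exact: (aff_fun ax h2 (h u)).
  have {}h1 : w = a u := h1; exists (W n u) => //; rewrite h1; exact: h.
apply: gr_measurable; exact: (at_A hA ax cW h).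
Qed.
End LSlb.

(** * Similarity to a star-preserving map *)

Section Scal.
Variables (R : realType) (H : hilbertSpace R).
Implicit Types (a b x : bop H).
Lemma mulrn_rsc a n : a *+ n = rsc H n%:R * a.
Proof.
elim: n => [|n IH].
  by apply: bop_ext => u; rewrite mulr0n bM rscE rs0l.
by rewrite mulrS IH -natr1 addrC rscDl rsc1 mulrDl mul1r.
Qed.
Lemma rsc_inv (r : R) a : r != 0 -> rsc H r * (rsc H r^-1 * a) = a.
Proof. by move=> r0; rewrite mulrA rscM divff // rsc1 mul1r. Qed.
Lemma mulrn_inj a b n : a *+ n.+1 = b *+ n.+1 -> a = b.
Proof.
have n0 : (n.+1%:R : R) != 0 by rewrite pnatr_eq0.
rewrite !mulrn_rsc => e.
have c x : x = rsc H (n.+1%:R)^-1 * (rsc H n.+1%:R * x).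
  by rewrite mulrA rscM mulVf // rsc1 mul1r.
by rewrite (c a) e -c.
Qed.
Lemma star_mulrn a n : star (a *+ n) = star a *+ n.
Proof. by elim: n => [|n IH]; [rewrite !mulr0n star0|rewrite !mulrS starD IH]. Qed.
(** The scaling is by an integer because an additive map is known to respect no other scalars. *)
Lemma contraction_ex (A : set (bop H)) x : vna A -> A x ->
  exists y n, [/\ A y, nle y 1, x = y *+ n.+1 & sym x -> sym y].
Proof.
move=> hA Ax; have [k k0 nk] := nleP x; have [N hN] := nat_big k.
have n0 : (N.+1%:R : R) != 0 by rewrite pnatr_eq0.
exists (rsc H (N.+1%:R)^-1 * x), N; split.
- by apply: (vnaM hA) => //; exact: (vna_sc hA).
- move=> u; rewrite mul1r bM rscE n2Z exprVn ler_pdivrMl ?exprn_gt0 //.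
  apply: le_trans (nk u) _; apply: ler_wpM2r; first exact: n2_ge0.
  have h := hN N (leqnn _); have : 1 <= N.+1%:R :> R by rewrite ler1n.
  have : (N%:R : R) <= N.+1%:R by rewrite ler_nat.
  by move=> h1 h2; rewrite expr2; nra.
- by rewrite mulrn_rsc rsc_inv.
- by move=> sx; exact: sym_rsc.
Qed.
Lemma sc_i2 : bsc 'i%C * bsc 'i%C = - 1 :> bop H.
Proof. by apply: bop_ext => u; rewrite bM bN b1; exact: imim. Qed.
Lemma sc_istar : star (bsc 'i%C) = - bsc 'i%C :> bop H.
Proof.
apply/esym/star_uniq => u v; rewrite bN ipNr.
by have := ip_iml u v; rewrite /im.
Qed.
Lemma pos_sq_le a : nle a 1 -> pos (1 - star a * a).
Proof.
move=> n u; rewrite bB b1 bM ipBl ip_starl -!/(n2 _) subr_ge0.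
by have := n u; rewrite mul1r.
Qed.
End Scal.

Section Vals.
Variables (R : realType) (H K : hilbertSpace R) (A : set (bop H)) (B : set (bop K)).
Hypotheses (hA : vna A) (hB : vna B).
Variables (Psi : operator H -> operator K) (Phi : operator K -> operator H).
Hypothesis iso : liso A B Psi Phi.
Implicit Types (x y a b z : bop H) (p q e w t : bop K).

Lemma mul_gr_bd (X : operator K) w q : lb B X -> cproj B w -> at_ X w q -> ls_mul X (gr w) = gr q.
Proof.
move=> lX cw hq; have Bq := at_A hB lX.1 cw hq.
have [l h] := ls_mul_lb hB lX (gr_lb hB (cproj_A cw)).
apply: (lb_ext hB l (gr_lb hB Bq) lX.2) => t [ct [a ha]]; split=> //.
exists (a * (w * t)); split; first exact: h ct ha (gr_at w t).
rewrite mulrA (at_compat lX.1 ct cw ha hq) -mulrA (cproj_i ct); exact: gr_at.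
Qed.
Lemma iso_inj x y : A x -> A y -> Psi (gr x) = Psi (gr y) -> x = y.
Proof.
move=> Ax Ay e; have [h _ _ _] := iso; apply: gr_inj.
by rewrite -(h _ (gr_lb hA Ax)).2 e (h _ (gr_lb hA Ay)).2.
Qed.
Lemma iso_0 : Psi (gr 0) = gr 0.
Proof.
have [e ce h] := iso_center hA hB iso (cproj0 hA).
have := iso_D hA iso (vna0 hA) (vna0 hA); rewrite addr0 h (ls_add_gr hB (cproj_A ce) (cproj_A ce)).
move=> /gr_inj /eqP; rewrite -subr_eq0 opprD addrA subrr sub0r oppr_eq0 => /eqP e0.
by rewrite e0.
Qed.

(** A central projection orthogonal to all the images comes from one orthogonal to all of [I], hence
    is 0. *)
Lemma iso_dense (I : set (bop H)) : I `<=` cproj A -> dense_fam I ->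
  dense_fam [set e | cproj B e /\ exists2 z, I z & Psi (gr z) = gr e].
Proof.
move=> cI dI u hu; set J := [set e | _] in hu.
have cJ : J `<=` cproj B by move=> e [].
have cs := csup_cproj hB cJ; have cf := cprojC hB cs.
have [zf czf hf] := iso_center' hA hB iso cf.
have z0 : zf = 0.
  apply: bop_ext => v; rewrite b0; apply: dI => z Iz; have cz := cI _ Iz.
  have [e ce he] := iso_center hA hB iso cz.
  have Je : J e by split=> //; exists z.
  have fe : (1 - csup J) * e = 0 by rewrite mulrBl mul1r csup_ub // subrr.
  have : zf * z = 0.
    apply: iso_inj; [exact: (vnaM hA (cproj_A czf) (cproj_A cz))|exact: vna0|].
    rewrite (iso_M hA iso (cproj_A czf) (cproj_A cz)) hf he.
    by rewrite (ls_mul_gr hB (cproj_A cf) (cproj_A ce)) fe iso_0.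
  by rewrite (cproj_c czf (cproj_A cz)) -bM => ->; rewrite b0.
rewrite z0 iso_0 in hf; have /esym f0 := gr_inj hf.
have s0 : csup J u = 0.
  apply: prj_0 => _ [e [v [Je ->]]].
  by rewrite -bfi !(symE (cproj_s (cJ _ Je))) (hu _ Je) !ip0r.
have h : (1 - csup J) u = u by rewrite bB b1 s0 subr0.
by rewrite -h f0 b0.
Qed.

Lemma val_mulrn x w p n : A x -> cproj B w -> at_ (Psi (gr x)) w p ->
  A (x *+ n) /\ at_ (Psi (gr (x *+ n))) w (p *+ n).
Proof.
move=> Ax cw hp; elim: n => [|n [IH1 IH2]].
  rewrite !mulr0n; split; first exact: vna0.
  by rewrite iso_0 => u; rewrite b0.
rewrite !mulrS; split; first exact: (vnaD hA).
exact: (val_D hA hB iso Ax IH1 cw hp IH2).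
Qed.
Lemma val_ex (C : R) w x : GC A B Psi C w -> A x -> exists p, at_ (Psi (gr x)) w p.
Proof.
move=> [cw h] Ax; have [y [n [Ay ny -> _]]] := contraction_ex hA Ax.
have [_ [p hp _]] := h y Ay ny; exists (p *+ n.+1).
by have [] := val_mulrn n.+1 Ay cw hp.
Qed.
Lemma val_1 w : at_ (Psi (gr 1)) w w.
Proof. by rewrite (iso_1 hA hB iso). Qed.
End Vals.

Section Local.
Variables (R : realType) (H K : hilbertSpace R) (A : set (bop H)) (B : set (bop K)).
Hypotheses (hA : vna A) (hB : vna B) (fA : pinf A) (fB : pinf B).
Variables (Psi : operator H -> operator K) (Phi : operator K -> operator H).
Hypothesis iso : liso A B Psi Phi.
Implicit Types (x y a b z : bop H) (p q e w t g h k : bop K).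
Let iso' := liso_sym hA hB iso.

(** Over [w], conjugation by [g], with inverse [h] in the corner, makes [Psi] respect adjoints. *)
Definition loc w g h := [/\ cproj B w, B g /\ B h, g * h = w /\ h * g = w, w * g = g /\ w * h = h &
  forall x, A x -> exists p q, [/\ at_ (Psi (gr x)) w p, at_ (Psi (gr (star x))) w q &
    star (g * p * h) = g * q * h]].

Lemma loc_cut w g h f : loc w g h -> cproj B f -> loc (w * f) (g * f) (h * f).
Proof.
move=> [cw [Bg Bh] [gh hg] [wg wh] hx] cf; have Bf := cproj_A cf.
have ff t r : B r -> t * f * (r * f) = t * r * f.
  by move=> Br; rewrite -(cproj_c cf Br) (mulrA (t * f)) -(mulrA t f f) (cproj_i cf) -mulrA (cproj_c cf Br) mulrA.
split.
- exact: (cprojM hB).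
- by split; exact: (vnaM hB).
- by rewrite !ff // gh hg.
- by rewrite !ff // wg wh.
move=> x Ax; have [p [q [hp hq e]]] := hx x Ax.
have [lp lq] : aff B (Psi (gr x)) /\ aff B (Psi (gr (star x))).
  by split; [exact: (iso_lb hA iso Ax).1|exact: (iso_lb hA iso (vna_star hA Ax)).1].
have Bp := at_A hB lp cw hp; have Bq := at_A hB lq cw hq.
exists (p * f), (q * f); split; [exact: at_mul|exact: at_mul|].
have cut r : B r -> g * f * (r * f) * (h * f) = g * r * h * f.
  by move=> Br; rewrite ff // ff.
by rewrite !cut // starM (cproj_s cf) e (cproj_c cf) //; apply: (vnaM hB) => //; exact: (vnaM hB).
Qed.

Lemma GC_mul (H1 K1 : hilbertSpace R) (A1 : set (bop H1)) (B1 : set (bop K1)) (F : operator H1 -> operator K1)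
  (C : R) (w f : bop K1) : vna B1 -> 0 <= C -> GC A1 B1 F C w -> cproj B1 f -> GC A1 B1 F C (w * f).
Proof.
move=> hB1 C0 [cw h] cf; split; first exact: (cprojM hB1).
by move=> x Ax nx; apply: bdC_mul => //; exact: h.
Qed.

Section One.
Variables (w : bop K) (C : R) (z0 : bop H) (C' : R).
Hypotheses (C0 : 0 < C) (gw : GC A B Psi C w) (C'0 : 0 <= C') (gz : GC B A Phi C' z0)
  (Pz0 : Psi (gr z0) = gr w).
Let cw : cproj B w. Proof. by case: gw. Qed.
Let cz0 : cproj A z0. Proof. by case: gz. Qed.

Lemma P_exists : exists P : bop H -> bop K, forall x, A x -> at_ (Psi (gr x)) w (P x).
Proof.
have [x|P hP] := @choice (bop H) (bop K) (fun x p => A x -> at_ (Psi (gr x)) w p).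
  have [Ax|nAx] := pselect (A x); last by exists 0.
  by have [p hp] := val_ex hA hB iso gw Ax; exists p.
by exists P.
Qed.

Lemma local_similarity : exists g h, loc w g h.
Proof.
have [P hP] := P_exists.
have aP x : A x -> aff B (Psi (gr x)) by move=> Ax; exact: (iso_lb hA iso Ax).1.
have PB x : A x -> B (P x) by move=> Ax; exact: (at_A hB (aP x Ax) cw (hP x Ax)).
have uq x p : A x -> at_ (Psi (gr x)) w p -> P x = p.
  by move=> Ax hp; exact: (at_uniq (aP x Ax) (hP x Ax) hp).
have PD x y : A x -> A y -> P (x + y) = P x + P y.
  by move=> Ax Ay; apply: uq; [exact: (vnaD hA)|exact: (val_D hA hB iso Ax Ay cw (hP x Ax) (hP y Ay))].
have PM x y : A x -> A y -> P (x * y) = P x * P y.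
  by move=> Ax Ay; apply: uq; [exact: (vnaM hA)|exact: (val_M hA hB iso Ax Ay cw (hP x Ax) (hP y Ay))].
have P1 : P 1 = w by apply: uq; [exact: vna1|exact: (val_1 hA hB iso)].
have Pn x n : A x -> P (x *+ n) = P x *+ n.
  by move=> Ax; have [A1 h1] := val_mulrn hA hB iso n Ax cw (hP x Ax); exact: uq.
have Pb x : A x -> nle x 1 -> nle (P x) C.
  by move=> Ax nx; have [_ h] := gw; have [_ [p hp np]] := h x Ax nx; rewrite (uq x p).
have Pker x : A x -> P x = 0 -> x * z0 = 0.
  move=> Ax Px; have Az := cproj_A cz0; apply: (iso_inj hA iso); [exact: (vnaM hA)|exact: vna0|].
  rewrite (iso_M hA iso Ax Az) Pz0 (iso_0 hA hB iso).
  by apply: (mul_gr_bd hB (iso_lb hA iso Ax) cw); rewrite -Px; exact: hP.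
have [y|Pi hPi] := @choice (bop K) (bop H) (fun (y : bop K) (q : bop H) => B y -> at_ (Phi (gr y)) z0 q).
  have [By|nBy] := pselect (B y); last by exists 0.
  by have [p hp] := val_ex hB hA iso' gz By; exists p.
have lPi (y : bop K) : B y -> lb A (Phi (gr y)) by exact: (iso_lb hB iso').
have PiA (y : bop K) : B y -> A (Pi y) by move=> By; exact: (at_A hA (lPi y By).1 cz0 (hPi y By)).
have Piz (y : bop K) : B y -> Pi y * z0 = Pi y by move=> By; exact: (at_zr (lPi y By).1 cz0 (hPi y By)).
have PPi (y : bop K) : B y -> P (Pi y) = w * y.
  move=> By; apply: uq; first exact: PiA.
  have E : gr (Pi y) = ls_mul (Phi (gr y)) (gr z0).
    by rewrite (mul_gr_bd hA (lPi y By) cz0 (hPi y By)).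
  have [_ h2 _ hM] := iso; have Az := cproj_A cz0.
  rewrite E hM ?Pz0 ?(h2 _ (gr_lb hB By)).2; [|exact: lPi|exact: gr_lb].
  rewrite (ls_mul_gr hB By (cproj_A cw)) (cproj_c cw By).
  by have := gr_at (y * w) w; rewrite -mulrA (cproj_i cw).
have [s1 [s2 [As [s11 s22 s12]]]] : exists s1 s2, (A s1 /\ A s2) /\
    [/\ star s1 * s1 = 1, star s2 * s2 = 1 & star s1 * s2 = 0].
  by have [s1 [s2 [h1 h2 h3 h4]]] := cuntz hA fA; exists s1, s2.
have [k [Bk sk kw lo mx]] := core hA hB As (And3 s11 s22 s12) cw C0
  (And5 PB PD PM P1 Pb) cz0 Pker (And3 PiA Piz PPi).
have wk : w * k = k by rewrite (cproj_c cw Bk).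
have Pw x : A x -> P x * w = P x by move=> Ax; rewrite -P1 -PM ?mulr1 //; exact: vna1.
(* [S] is additive and divisible by integers, but [P] need not commute with multiplication by i; so
   it passes from unitaries to self-adjoint [x] and, separately, to i times such [x]. *)
pose S x := star (P x) * k = k * P (star x).
have SD x y : A x -> A y -> S x -> S y -> S (x + y).
  move=> Ax Ay hx hy; rewrite /S starD !PD ?starD ?mulrDl ?mulrDr ?hx ?hy //; exact: (vna_star hA).
have Sn x n : A x -> S x -> S (x *+ n).
  move=> Ax hx; have As' := vna_star hA Ax.
  by rewrite /S star_mulrn !Pn // star_mulrn mulrnAl mulrnAr hx.
have Sdiv x n : A x -> S (x *+ n.+1) -> S x.
  move=> Ax; have As' := vna_star hA Ax.
  by rewrite /S star_mulrn !Pn // star_mulrn mulrnAl mulrnAr => /mulrn_inj.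
have Sunit u : A u -> star u * u = 1 -> u * star u = 1 -> S u.
  move=> Au uu uu'; have Asu := vna_star hA Au.
  have n1 : nle u 1 by apply: iso_nle; rewrite uu; exact: isproj1.
  have n2' : nle (star u) 1 by apply: iso_nle; rewrite starK uu'; exact: isproj1.
  have PP1 : P (star u) * P u = w by rewrite -PM // uu.
  have PP2 : P u * P (star u) = w by rewrite -PM // uu'.
  have e v : ip (k (P u v)) (P u v) = ip (k v) v.
    apply/eqP; rewrite eq_le mx //=; have := mx (star u) (P u v) Asu n2'.
    by rewrite -(bM (P (star u))) PP1 -(bM k) kw -(symE (cproj_s cw)) -(bM w) wk.
  have T0 : star (P u) * k * P u - k = 0.
    apply: sym_eq0; first by apply: symB => //; exact: sandwich_sym.
    by move=> v; rewrite bB !bM ipBl ip_starl e subrr.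
  have : star (P u) * k * P u * P (star u) = k * P (star u).
    by move/eqP: T0; rewrite subr_eq0 => /eqP ->.
  by rewrite -mulrA PP2 -mulrA kw.
(* The unitary is [x + i y] with [y] the square root of [1 - x^2]. *)
have unit_of x : A x -> sym x -> nle x 1 -> exists u, [/\ A u, star u * u = 1, u * star u = 1 & u + star u = x + x].
  move=> Ax sx nx; have px : pos (1 - x * x) by have := pos_sq_le nx; rewrite sx.
  have [|| y [Ay sy _ yy cy]] := vna_sqrt hA _ _ px.
  - by apply: (vnaB hA); [exact: vna1|exact: (vnaM hA)].
  - by apply: symB; [exact: sym1|exact: symSq].
  have yx : y * x = x * y by apply: cy; rewrite mulrBl mulrBr mul1r mulr1 mulrA.
  pose j : bop H := bsc 'i%C; have jj : j * j = - 1 by exact: sc_i2.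
  have jC c : j * c = c * j by exact: bscC.
  have sj : star (j * y) = - (j * y) by rewrite starM sy sc_istar mulrN -jC.
  have q : j * y * (j * y) = - (y * y).
    by rewrite mulrA -(mulrA j y j) -(jC y) (mulrA j j) jj mulN1r mulNr.
  have Ajy : A (j * y) by apply: (vnaM hA) => //; exact: (vna_sc hA).
  have xj : x * (j * y) = j * y * x by rewrite mulrA -jC -!mulrA yx.
  have su : star (x + j * y) = x - j * y by rewrite starD sx sj.
  clearbody j; exists (x + j * y); rewrite su; split.
  - exact: (vnaD hA).
  - have -> : (x - j * y) * (x + j * y) = x * x - j * y * x + (x * (j * y) - j * y * (j * y)).
      by rewrite mulrDr !mulrBl.
    by rewrite q xj opprK yy addrA subrK addrCA subrr addr0.
  - have -> : (x + j * y) * (x - j * y) = x * x + j * y * x - (x * (j * y) + j * y * (j * y)).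
      by rewrite mulrBr !mulrDl.
    by rewrite q xj opprD opprK yy addrA addrK addrCA subrr addr0.
  - by rewrite addrACA subrr addr0.
have Ssym x : A x -> sym x -> S x.
  move=> Ax sx; have [y [n [Ay ny xE sxy]]] := contraction_ex hA Ax; have sy := sxy sx; rewrite xE.
  apply: Sn => //; apply: (Sdiv y 1%N) => //; rewrite mulr2n.
  have [u [Au u1 u2 <-]] := unit_of y Ay sy ny; have Asu := vna_star hA Au.
  by apply: SD => //; apply: Sunit => //; rewrite starK.
have Sisym x : A x -> sym x -> S (bsc 'i%C * x).
  move=> Ax sx; have [y [n [Ay ny xE sxy]]] := contraction_ex hA Ax; have sy := sxy sx; rewrite xE.
  have Aj : A (bsc 'i%C) := vna_sc hA _; have Ajy := vnaM hA Aj Ay.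
  rewrite mulrnAr; apply: Sn => //; apply: (Sdiv _ 1%N) => //; rewrite mulr2n -mulrDr.
  have [u [Au u1 u2 <-]] := unit_of y Ay sy ny; have Asu := vna_star hA Au.
  have ju (t : bop H) : A t -> star t * t = 1 -> t * star t = 1 -> S (bsc 'i%C * t).
    move=> At t1 t2; apply: Sunit; first exact: (vnaM hA).
      by rewrite starM sc_istar mulrN mulNr -mulrA (mulrA (bsc 'i%C)) sc_i2 mulN1r mulrN opprK.
    rewrite starM sc_istar !mulrN -mulrA (mulrA t) t2 mul1r sc_i2 opprK //.
  by rewrite mulrDr; apply: SD; [exact: (vnaM hA)|exact: (vnaM hA)|exact: ju|apply: ju => //; rewrite starK].
have Sall x : A x -> S x.
  move=> Ax; have As' := vna_star hA Ax; have Aj : A (bsc 'i%C) := vna_sc hA _.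
  apply: (Sdiv x 1%N) => //; rewrite mulr2n.
  pose h2 := - (bsc 'i%C * (x - star x)).
  have -> : x + x = (x + star x) + bsc 'i%C * h2.
    by rewrite /h2 mulrN mulrA sc_i2 mulN1r opprK addrA [in RHS]addrAC addrK.
  have Ah : A h2 by apply: (vnaN hA); apply: (vnaM hA) => //; exact: (vnaB hA).
  apply: SD; [exact: (vnaD hA)|exact: (vnaM hA)| |].
    by apply: Ssym; [exact: (vnaD hA)|rewrite /sym starD starK addrC].
  apply: Sisym => //; rewrite /sym /h2 starN starM starB starK sc_istar mulrN opprK -bscC.
  by rewrite -[in RHS]opprB mulrN opprK.
have CC : 0 < C * C by rewrite mulr_gt0.
have pk : pos k by move=> u; have := le_trans (n2_ge0 _) (lo u); rewrite pmulr_rge0.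
have [g [Bg sg pg gg cg]] := vna_sqrt hB Bk sk pk.
have c1w := cprojC hB cw; have Bw := cproj_A cw.
have gw0 : g * w = g.
  have t0 : g * (1 - w) = 0.
    apply: star_sq0; rewrite starM (cproj_s c1w) sg -mulrA (mulrA g) gg mulrBr mulr1 kw subrr mulr0.
    by [].
  by move: t0; rewrite mulrBr mulr1 => /eqP; rewrite subr_eq0 => /eqP <-.
have wg : w * g = g by rewrite (cproj_c cw Bg).
(* [k] lives on [w]; adding [1 - w] makes it invertible, with lower bound [(C * C)^-1] on [w] from
   [core] and 1 off [w]. *)
pose k1 := k + (1 - w); pose d : R := Num.min (C * C)^-1 1.
have d0 : 0 < d by rewrite lt_min invr_gt0 CC ltr01.
have [|||h0 [Bh0 kh hk]] := @binv R K B k1 d hB _ _ d0 _.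
- by apply: (vnaD hB) => //; exact: cproj_A c1w.
- by apply: symD => //; exact: cproj_s c1w.
- move=> u; rewrite /k1 bD ipDl (isproj_ip u (cproj_is c1w)) (isproj_n2 u (cproj_is cw)) bB b1.
  have h1 : (C * C)^-1 * n2 (w u) <= ip (k u) u by rewrite ler_pdivrMl.
  have d1 : d <= (C * C)^-1 by rewrite ge_min lexx.
  have d2 : d <= 1 by rewrite ge_min lexx orbT.
  have a1 := ler_wpM2r (n2_ge0 (w u)) d1; have a2 := ler_wpM2r (n2_ge0 (u - w u)) d2.
  by rewrite mulrDr; apply: lerD; [exact: le_trans h1|rewrite mul1r in a2].
have gk : g * k1 = k1 * g.
  by rewrite /k1 mulrDr mulrDl -gg mulrA mulrBr mulrBl mulr1 mul1r gw0 wg.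
have hg0 : h0 * g = g * h0.
  by rewrite -[LHS]mulr1 -kh !mulrA -(mulrA h0 g) gk !mulrA hk mul1r.
have kh0 : k * h0 = w.
  have : w * (k1 * h0) = w by rewrite kh mulr1.
  by rewrite mulrA /k1 mulrDr wk mulrBr mulr1 (cproj_i cw) subrr addr0.
clearbody k1.
pose h := g * h0 * w; have Bh : B h by do 2?apply: (vnaM hB).
have gh : g * h = w by rewrite /h !mulrA gg kh0 (cproj_i cw).
have hg : h * g = w by rewrite /h -mulrA wg -mulrA hg0 mulrA gg.
have hw : h * w = h by rewrite /h -mulrA (cproj_i cw).
have wh : w * h = h by rewrite (cproj_c cw Bh).
have sh : star h = h.
  have e : star h * g = w by rewrite -[g]sg -starM gh (cproj_s cw).
  have e2 : star h * w = star h by rewrite -{1}(cproj_s cw) -starM wh.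
  by rewrite -e2 -gh mulrA e wh.
have kh1 : k * h = g by rewrite -gg -mulrA gh gw0.
have hk1 : h * k = g by rewrite -gg mulrA hg wg.
clearbody h; exists g, h; split=> // x Ax; have As' := vna_star hA Ax.
exists (P x), (P (star x)); split; [exact: hP|exact: hP|].
rewrite !starM sh sg -[X in _ * (_ * X)]kh1.
by rewrite (mulrA (star (P x))) (Sall x Ax) -mulrA mulrA hk1 mulrA.
Qed.
End One.

(** [local_similarity] needs bounds for [Psi] on [w] and for [Phi] on the matching projection of the
    source, so dense families for both directions are intersected. Passing to [C + 1] makes the
    constant positive. *)
Lemma loc_dense : dense_fam [set w | exists g h, loc w g h].
Proof.
have cI : [set z | exists2 C : R, 0 <= C & GC B A Phi C z] `<=` cproj A by move=> z [C _ []].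
have dJ := iso_dense hA hB iso cI (autocont hB hA iso' fB).
move=> u hu; apply: (autocont hA hB iso fA) => w [C C0 gw]; apply: dJ => e [ce [z [C' C'0 gz] Pz]].
have cw : cproj B w by case: gw.
have [zw czw Pzw] := iso_center' hA hB iso cw; have cz : cproj A z by case: gz.
have gz' := GC_mul hA C'0 gz czw.
have gw' : GC A B Psi (C + 1) (w * e).
  have [_ h] := GC_mul hB C0 gw ce; split; first exact: (cprojM hB).
  move=> x Ax nx; have [c1 [p hp np]] := h x Ax nx; split=> //; exists p => //.
  by apply: nle_mono np; rewrite lerDl.
have PzE : Psi (gr (z * zw)) = gr (w * e).
  rewrite (iso_M hA iso (cproj_A cz) (cproj_A czw)) Pz Pzw (ls_mul_gr hB (cproj_A ce) (cproj_A cw)).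
  by rewrite (cproj_c ce (cproj_A cw)).
have C1 : 0 < C + 1 by rewrite ltr_wpDl.
have [g [h l]] := local_similarity C1 gw' gz' PzE.
rewrite -bM -(cproj_c cw (cproj_A ce)); apply: hu; by exists g, h.
Qed.
End Local.

(** * Ring identities for locally bounded operators *)

Section RingLaws.
Variables (R : realType) (H : hilbertSpace R) (A : set (bop H)).
Hypothesis hA : vna A.
Implicit Types (x y z : operator H) (a b c w t : bop H).

Lemma dense_mul (I J : set (bop H)) : I `<=` cproj A -> J `<=` cproj A -> dense_fam I -> dense_fam J ->
  dense_fam [set t | exists z w : bop H, [/\ I z, J w & t = z * w]].
Proof.
move=> cI cJ dI dJ u hu; apply: dI => z Iz; apply: dJ => w Jw.
rewrite -bM -(cproj_c (cI _ Iz) (cproj_A (cJ _ Jw))); apply: hu; by exists z, w.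
Qed.

Lemma lb_ext3 x y z s s' : lb A x -> lb A y -> lb A z -> lb A s -> lb A s' ->
  (forall t a b c, cproj A t -> at_ x t a -> at_ y t b -> at_ z t c ->
    exists d, at_ s t d /\ at_ s' t d) -> s = s'.
Proof.
move=> lx ly lz ls ls' h.
have d1 := dense_mul (@bd_c _ _ A x) (@bd_c _ _ A y) lx.2 ly.2.
set I := [set t | _] in d1; have cI : I `<=` cproj A.
  by move=> _ [t [w [[ct _] [cw _] ->]]]; exact: cprojM.
have d2 := dense_mul cI (@bd_c _ _ A z) d1 lz.2.
apply: (lb_ext hA ls ls' d2) => _ [_ [r [[t [w [[ct [a ha]] [cw [b hb]] ->]]] [cr [c hc]] ->]]].
have ctw := cprojM hA ct cw; split; first exact: cprojM.
apply: (h (t * w * r) (a * (w * r)) (b * (t * r)) (c * (t * w))).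
- exact: cprojM.
- by rewrite -mulrA; exact: at_mul.
- by rewrite (cproj_c ct (cproj_A cw)) -mulrA; exact: at_mul.
- by rewrite (cproj_c ctw (cproj_A cr)); exact: at_mul.
Qed.

Lemma ls_mulA x y z : lb A x -> lb A y -> lb A z -> ls_mul x (ls_mul y z) = ls_mul (ls_mul x y) z.
Proof.
move=> lx ly lz; have [l1 h1] := ls_mul_lb hA ly lz; have [l2 h2] := ls_mul_lb hA lx l1.
have [l3 h3] := ls_mul_lb hA lx ly; have [l4 h4] := ls_mul_lb hA l3 lz.
apply: (lb_ext3 lx ly lz l2 l4) => t a b c ct ha hb hc; exists (a * (b * c)); split.
  by apply: h2 => //; exact: h1.
by rewrite mulrA; apply: h4 => //; exact: h3.
Qed.
Lemma ls_mulDr x y z : lb A x -> lb A y -> lb A z -> ls_mul x (ls_add y z) = ls_add (ls_mul x y) (ls_mul x z).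
Proof.
move=> lx ly lz; have [l1 h1] := ls_add_lb hA ly lz; have [l2 h2] := ls_mul_lb hA lx l1.
have [l3 h3] := ls_mul_lb hA lx ly; have [l4 h4] := ls_mul_lb hA lx lz.
have [l5 h5] := ls_add_lb hA l3 l4.
apply: (lb_ext3 lx ly lz l2 l5) => t a b c ct ha hb hc; exists (a * (b + c)); split.
  by apply: h2 => //; exact: h1.
by rewrite mulrDr; apply: h5 => //; [exact: h3|exact: h4].
Qed.
Lemma ls_mulDl x y z : lb A x -> lb A y -> lb A z -> ls_mul (ls_add y z) x = ls_add (ls_mul y x) (ls_mul z x).
Proof.
move=> lx ly lz; have [l1 h1] := ls_add_lb hA ly lz; have [l2 h2] := ls_mul_lb hA l1 lx.
have [l3 h3] := ls_mul_lb hA ly lx; have [l4 h4] := ls_mul_lb hA lz lx.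
have [l5 h5] := ls_add_lb hA l3 l4.
apply: (lb_ext3 lx ly lz l2 l5) => t a b c ct ha hb hc; exists ((b + c) * a); split.
  by apply: h2 => //; exact: h1.
by rewrite mulrDl; apply: h5 => //; [exact: h3|exact: h4].
Qed.
Lemma ls_scale_mul (r : R) x : lb A x -> ls_scale r%:C x = ls_mul (gr (rsc H r)) x.
Proof.
move=> lx; have Ar : A (rsc H r) := vna_sc hA _; have [l1 h1] := ls_scale_lb hA r%:C lx.
have [l2 h2] := ls_mul_lb hA (gr_lb hA Ar) lx.
apply: (lb_ext hA l1 l2 lx.2) => z [cz [a ha]]; split=> //; exists (rsc H r * a); split; first exact: h1.
have := h2 z _ _ cz (gr_at (rsc H r) z) ha.
by rewrite -mulrA (at_zl hA lx.1 cz ha).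
Qed.
End RingLaws.

(** * Patching the local similarities *)

Section Glue.
Variables (R : realType) (H K : hilbertSpace R) (A : set (bop H)) (B : set (bop K)).
Hypotheses (hA : vna A) (hB : vna B) (fA : pinf A) (fB : pinf B).
Variables (Psi : operator H -> operator K) (Phi : operator K -> operator H).
Hypothesis iso : liso A B Psi Phi.
Implicit Types (x y a b z : bop H) (p q e w t g h k : bop K).
Notation loc := (loc A B Psi).

Definition orth (D : set (bop K)) := forall w w', D w -> D w' -> w <> w' -> w * w' = 0.
Definition ofam D := (forall w, D w -> exists g h, loc w g h) /\ orth D.

(** By [loc_cut] a local similarity can be cut down to the complement of the supremum, so a maximal
    orthogonal family leaves nothing over. *)
Lemma ofam_dense : exists D, ofam D /\ dense_fam D.
Proof.
have [|D [oD mD]] := @Zorn_bigcup (bop K) ofam.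
  move=> F FP tF; split; first by move=> w [X FX Xw]; exact: (FP _ FX).1.
  move=> w w' [X FX Xw] [Y FY Yw'] n; have [XY|YX] := tF X Y FX FY.
    by apply: (FP _ FY).2 => //; exact: XY.
  by apply: (FP _ FX).2 => //; exact: YX.
exists D; split=> //; have [lD orD] := oD.
have cD : D `<=` cproj B by move=> w /lD[g [h []]].
have cS := csup_cproj hB cD; pose f := 1 - csup D; have cf : cproj B f by exact: (cprojC hB).
have fD w : D w -> f * w = 0 by move=> Dw; rewrite /f mulrBl mul1r csup_ub // subrr.
move=> u hu; have s0 : csup D u = 0.
  apply: prj_0 => _ [e [v [De ->]]].
  by rewrite -bfi !(symE (cproj_s (cD _ De))) (hu _ De) !ip0r.
have fu : f u = u by rewrite /f bB b1 s0 subr0.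
apply: (loc_dense hA hB fA fB iso) => w [g [h l]]; apply: contrapT => wu.
have l2 := loc_cut hA hB iso l cf; have cw : cproj B w by case: l.
have wf0 : w * f <> 0 by move=> e; apply: wu; rewrite -fu -bM e b0.
have wfD w' : D w' -> w * f * w' = 0 by move=> Dw'; rewrite -mulrA fD // mulr0.
have wfD' w' : D w' -> w' * (w * f) = 0.
  by move=> Dw'; rewrite -(cproj_c (cprojM hB cw cf) (cproj_A (cD _ Dw'))) wfD.
apply: (mD (D `|` [set w * f])).
  split; first by move=> w1 D1; left.
  move=> sub; have /wfD := sub (w * f) (or_intror erefl).
  by rewrite (cproj_i (cprojM hB cw cf)).
split; first by move=> w' [/lD //|->]; exists (g * f), (h * f).
move=> w1 w2 [D1|->] [D2|->] n //; [exact: orD|exact: wfD'|exact: wfD].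
Qed.

Section Patch.
Variable D : set (bop K).
Hypotheses (oD : ofam D) (dD : dense_fam D).
Variables (G T : bop K -> bop K).
Hypothesis hGT : forall w, D w -> loc w (G w) (T w).
Let cD w : D w -> cproj B w. Proof. by move=> /hGT[]. Qed.

Lemma patch_orth (F : bop K -> bop K) : (forall w, D w -> B (F w) /\ w * F w = F w) ->
  lb B (patch (fun w p => D w /\ p = F w)) /\
  forall w, D w -> at_ (patch (fun w p => D w /\ p = F w)) w (F w).
Proof.
move=> hF; have pF : patchable B (fun w p => D w /\ p = F w).
  split.
  - by move=> w _ [Dw ->]; have [BF wF] := hF w Dw; split=> //; [exact: cD|rewrite -(cproj_c (cD Dw) BF)].
  - move=> w _ w' _ [Dw ->] [Dw' ->]; have [BF wF] := hF w Dw; have [BF' wF'] := hF w' Dw'.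
    have [<-//|n] := pselect (w = w').
    have c1 := cD Dw; have c2 := cD Dw'.
    rewrite -(cproj_c c2 BF) -wF mulrA (oD.2 _ _ Dw' Dw (not_eq_sym n)) mul0r.
    by rewrite -(cproj_c c1 BF') -wF' mulrA (oD.2 _ _ Dw Dw' n) mul0r.
  - move=> u hu; apply: dD => w Dw; apply: hu; by exists (F w).
split; first exact: (patch_lb pF).
by move=> w Dw; apply: (patch_at pF).
Qed.
Let hG w : D w -> B (G w) /\ w * G w = G w. Proof. by move=> /hGT[_ [? _] _ [? _] _]. Qed.
Let hT w : D w -> B (T w) /\ w * T w = T w. Proof. by move=> /hGT[_ [_ ?] _ [_ ?] _]. Qed.
Definition yg := patch (fun w p => D w /\ p = G w).
Definition yt := patch (fun w p => D w /\ p = T w).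
Lemma yg_lb : lb B yg. Proof. by have [] := patch_orth hG. Qed.
Lemma yt_lb : lb B yt. Proof. by have [] := patch_orth hT. Qed.
Lemma yg_at w : D w -> at_ yg w (G w). Proof. by have [_ h] := patch_orth hG; exact: h. Qed.
Lemma yt_at w : D w -> at_ yt w (T w). Proof. by have [_ h] := patch_orth hT; exact: h. Qed.
Lemma ygt : ls_mul yg yt = gr 1.
Proof.
have [l h] := ls_mul_lb hB yg_lb yt_lb.
apply: (lb_ext hB l (gr_lb hB (vna1 hB)) dD) => w Dw; split; first exact: cD.
exists w; split=> //; have [_ _ [gh _] _ _] := hGT Dw.
by have := h w _ _ (cD Dw) (yg_at Dw) (yt_at Dw); rewrite gh.
Qed.
Lemma ytg : ls_mul yt yg = gr 1.
Proof.
have [l h] := ls_mul_lb hB yt_lb yg_lb.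
apply: (lb_ext hB l (gr_lb hB (vna1 hB)) dD) => w Dw; split; first exact: cD.
exists w; split=> //; have [_ _ [_ hg] _ _] := hGT Dw.
by have := h w _ _ (cD Dw) (yt_at Dw) (yg_at Dw); rewrite hg.
Qed.

Definition psi (X : operator H) := ls_mul (ls_mul yg (Psi X)) yt.
Definition phi (Y : operator K) := Phi (ls_mul (ls_mul yt Y) yg).
Let lM (X Y : operator K) : lb B X -> lb B Y -> lb B (ls_mul X Y).
Proof. by move=> lX lY; have [] := ls_mul_lb hB lX lY. Qed.
Let lPsi X : lb A X -> lb B (Psi X). Proof. by move=> lX; have [h _ _ _] := iso; have [] := h _ lX. Qed.
Let yl := yg_lb. Let tl := yt_lb.

Lemma conj_id (X : operator K) : lb B X -> ls_mul (ls_mul yt (ls_mul (ls_mul yg X) yt)) yg = X.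
Proof.
move=> lX; rewrite -(ls_mulA hB tl (lM (lM yl lX) tl) yl) -(ls_mulA hB (lM yl lX) tl yl) ytg.
rewrite (ls_mul1 hB (lM yl lX)) (ls_mulA hB tl yl lX) ytg; exact: (ls_1mul hB).
Qed.
Lemma conj_id' (X : operator K) : lb B X -> ls_mul (ls_mul yg (ls_mul (ls_mul yt X) yg)) yt = X.
Proof.
move=> lX; rewrite -(ls_mulA hB yl (lM (lM tl lX) yl) tl) -(ls_mulA hB (lM tl lX) yl tl) ygt.
rewrite (ls_mul1 hB (lM tl lX)) (ls_mulA hB yl tl lX) ygt; exact: (ls_1mul hB).
Qed.
Lemma psi_Psi X : lb A X -> Psi X = ls_mul (ls_mul yt (psi X)) yg.
Proof. by move=> lX; rewrite conj_id //; exact: lPsi. Qed.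

Lemma psi_liso : liso A B psi phi.
Proof.
have [h1 h2 hD hM] := iso; split.
- move=> X lX; have [lP e] := h1 _ lX; split; first exact: lM (lM yl lP) tl.
  by rewrite /phi /psi conj_id.
- move=> Y lY; have [lP e] := h2 _ (lM (lM tl lY) yl); split=> //.
  by rewrite /psi /phi e conj_id'.
- move=> X Y lX lY; have lX' := lPsi lX; have lY' := lPsi lY.
  by rewrite /psi hD // (ls_mulDr hB yl lX' lY') (ls_mulDl hB tl (lM yl lX') (lM yl lY')).
move=> X Y lX lY; have lX' := lPsi lX; have lY' := lPsi lY; rewrite /psi hM //.
rewrite (ls_mulA hB (lM (lM yl lX') tl) (lM yl lY') tl); congr ls_mul.
rewrite -(ls_mulA hB (lM yl lX') tl (lM yl lY')) (ls_mulA hB tl yl lY') ytg (ls_1mul hB lY').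
by rewrite (ls_mulA hB yl lX' lY').
Qed.

Lemma psi_val x w p : A x -> D w -> at_ (Psi (gr x)) w p -> at_ (psi (gr x)) w (G w * p * T w).
Proof.
move=> Ax Dw hp; have lX := iso_lb hA iso Ax; have cw := cD Dw.
have [l1 k1] := ls_mul_lb hB yl lX; have [l2 k2] := ls_mul_lb hB l1 tl.
by apply: k2 => //; [apply: k1 => //; exact: yg_at|exact: yt_at].
Qed.

Lemma psi_star_gr x : A x -> psi (gr (star x)) = op_adj (psi (gr x)).
Proof.
move=> Ax; have As := vna_star hA Ax; have iP := psi_liso.
have l1 := iso_lb hA iP As; have [l2 k2] := op_adj_lb hB (iso_lb hA iP Ax).
apply: (lb_ext hB l1 l2 dD) => w Dw; split; first exact: cD.
have [_ _ _ _ hx] := hGT Dw; have [p [q [hp hq e]]] := hx x Ax.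
exists (G w * q * T w); split; first exact: psi_val.
by rewrite -e; apply: k2; [exact: cD|exact: psi_val].
Qed.

(** After multiplication by the image [e] of a bounded piece [z] of [X], both sides come from a
    bounded element and its adjoint, where [psi_star_gr] applies. *)
Lemma psi_star X : lb A X -> psi (op_adj X) = op_adj (psi X).
Proof.
move=> lX; have iP := psi_liso; have [h1 h2 hD hM] := iP.
have [lX' kX] := op_adj_lb hA lX; have [l1 _] := h1 _ lX'; have [l2 _] := h1 _ lX.
have [l3 k3] := op_adj_lb hB l2.
have dJ := iso_dense hA hB iP (@bd_c _ _ A X) lX.2.
apply: (lb_ext3 hB l1 l2 l2 l1 l3) => t p b c ct hp hb _; exists p; split=> //.
have Bp := at_A hB l1.1 ct hp; have Bb := at_A hB l2.1 ct hb.
suff -> : p = star b by exact: k3.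
apply: bop_ext => u; apply/eqP; rewrite -subr_eq0; apply/eqP; apply: dJ => e [ce [z [cz [a ha]] he]].
have Aa := at_A hA lX.1 cz ha; have Be := cproj_A ce.
have e1 : ls_mul (psi X) (gr e) = psi (gr a).
  by rewrite -he -hM ?(mul_gr_bd hA lX cz ha) //; exact: (gr_lb hA (cproj_A cz)).
have e2 : ls_mul (psi (op_adj X)) (gr e) = psi (gr (star a)).
  by rewrite -he -hM ?(mul_gr_bd hA lX' cz (kX _ _ cz ha)) //; exact: (gr_lb hA (cproj_A cz)).
have [m1 n1] := ls_mul_lb hB l2 (gr_lb hB Be); have [m2 n2'] := ls_mul_lb hB l1 (gr_lb hB Be).
have v1 := n1 t _ _ ct hb (gr_at e t); have v2 := n2' t _ _ ct hp (gr_at e t).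
rewrite e1 in v1; rewrite e2 psi_star_gr // in v2.
have [m3 n3] := op_adj_lb hB (iso_lb hA iP Aa).
have := at_uniq m3.1 v2 (n3 t _ ct v1).
rewrite (cproj_c ce (cproj_A ct)) !mulrA (at_zr l1.1 ct hp) (at_zr l2.1 ct hb) starM (cproj_s ce).
rewrite -(cproj_c ce Bp) => E.
by rewrite bfB -!bM E subrr.
Qed.
End Patch.
End Glue.

(** * Boundedness and real-linearity of adjoint-preserving isomorphisms *)

Section StarIso.
Variables (R : realType) (H K : hilbertSpace R) (A : set (bop H)) (B : set (bop K)).
Hypotheses (hA : vna A) (hB : vna B).
Variables (psi : operator H -> operator K) (phi : operator K -> operator H).
Hypothesis iso : liso A B psi phi.
Hypothesis psis : forall X, lb A X -> psi (op_adj X) = op_adj (psi X).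
Implicit Types (x y a b z : bop H) (p q w t : bop K).

Lemma star_val x t p : A x -> cproj B t -> at_ (psi (gr x)) t p -> at_ (psi (gr (star x))) t (star p).
Proof.
move=> Ax ct hp; rewrite -op_adj_gr psis; last exact: gr_lb.
by have [_ h] := op_adj_lb hB (iso_lb hA iso Ax); exact: h.
Qed.

Lemma star_bounded1 x : A x -> nle x 1 -> exists y : bop K, B y /\ psi (gr x) = gr y.
Proof.
move=> Ax nx; have Asx := vna_star hA Ax; have px := pos_sq_le nx.
have [|| s [As ss _ sq _]] := vna_sqrt hA _ _ px.
- by apply: (vnaB hA); [exact: vna1|exact: (vnaM hA)].
- by apply: symB; [exact: sym1|exact: sym_star].
have lx := iso_lb hA iso Ax; have ls := iso_lb hA iso As.
have d := dense_mul (@bd_c _ _ B _) (@bd_c _ _ B _) lx.2 ls.2.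
have [|y [By ye _]] := @lb_bounded _ _ B hB (psi (gr x)) 1 lx ler01; last by exists y.
move=> u hu; apply: d => _ [w [t [[cw [p hp]] [ct [q hq]] ->]]]; apply: hu.
have cwt := cprojM hB cw ct; split=> //; exists (p * t); first exact: at_mul.
have hq' : at_ (psi (gr s)) (w * t) (q * w) by rewrite (cproj_c cw (cproj_A ct)); exact: at_mul.
have hp' : at_ (psi (gr x)) (w * t) (p * t) by exact: at_mul.
move: (p * t) (q * w) (w * t) cwt hp' hq' => {}p {}q {}w {}cw {}hp {}hq.
have v1 := val_M hA hB iso Asx Ax cw (star_val Ax cw hp) hp.
have v2 := val_M hA hB iso (vna_star hA As) As cw (star_val As cw hq) hq.
have v3 := val_D hA hB iso (vnaM hA Asx Ax) (vnaM hA (vna_star hA As) As) cw v1 v2.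
rewrite ss sq addrC subrK (iso_1 hA hB iso) in v3.
have E : star p * p + star q * q = w.
  have v4 : at_ (gr 1) w w by [].
  exact: (at_uniq (gr_lb hB (vna1 hB)).1 v3 v4).
move=> v; rewrite mul1r; have := isproj_nle (cproj_is cw) v; have := isproj_ip v (cproj_is cw).
rewrite -{1}E bD !bM ipDl !ip_starl -!/(n2 _) mul1r => <-.
by have := n2_ge0 (q v); lra.
Qed.

Lemma star_bounded x : A x -> exists y : bop K, B y /\ psi (gr x) = gr y.
Proof.
move=> Ax; have [x' [n [Ax' nx -> _]]] := contraction_ex hA Ax.
have [y [By e]] := star_bounded1 Ax' nx; exists (y *+ n.+1).
have h1 : at_ (psi (gr x')) 1 y by rewrite e.
have [A1 h2] := val_mulrn hA hB iso n.+1 Ax' (cproj1 hB) h1.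
have By' : B (y *+ n.+1).
  by elim: (n.+1) => [|m IH]; [exact: vna0|rewrite mulrS; exact: (vnaD hB)].
by split=> //; apply: (lb_gr hB (iso_lb hA iso A1)).
Qed.

Lemma psi_gr_D x y (x' y' : bop K) : A x -> A y -> psi (gr x) = gr x' -> psi (gr y) = gr y' -> B x' -> B y' ->
  psi (gr (x + y)) = gr (x' + y').
Proof. by move=> Ax Ay e1 e2 Bx By; rewrite (iso_D hA iso Ax Ay) e1 e2 (ls_add_gr hB Bx By). Qed.
Lemma psi_gr_nat n : psi (gr (1 *+ n)) = gr (1 *+ n).
Proof.
elim: n => [|n IH]; first by rewrite !mulr0n; exact: (iso_0 hA hB iso).
have nA (L : hilbertSpace R) (E : set (bop L)) m : vna E -> E (1 *+ m).
  by move=> hE; elim: m => [|m IHm]; [exact: vna0|rewrite mulrS; apply: (vnaD hE) => //; exact: vna1].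
rewrite !mulrS; apply: psi_gr_D => //; try exact: vna1; try exact: nA.
exact: (iso_1 hA hB iso).
Qed.
Lemma psi_gr_N x (x' : bop K) : A x -> psi (gr x) = gr x' -> B x' -> psi (gr (- x)) = gr (- x').
Proof.
move=> Ax e Bx; have AN := vnaN hA Ax; have [y [By ey]] := star_bounded AN.
have := psi_gr_D Ax AN e ey Bx By; rewrite subrr (iso_0 hA hB iso) => /gr_inj/esym/eqP.
by rewrite addrC addr_eq0 => /eqP <-.
Qed.
Lemma psi_gr_pos x (x' : bop K) : A x -> sym x -> pos x -> psi (gr x) = gr x' -> B x' -> pos x'.
Proof.
move=> Ax sx px e Bx; have [s [As ss _ sq _]] := vna_sqrt hA Ax sx px.
have [y [By ey]] := star_bounded As; have As' := vna_star hA As.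
have ys : psi (gr (star s)) = gr (star y) by rewrite -op_adj_gr psis ?ey ?op_adj_gr //; exact: gr_lb.
have := iso_M hA iso As' As; rewrite ys ey (ls_mul_gr hB (vna_star hB By) By) ss sq e => /gr_inj ->.
exact: pos_star.
Qed.

(** Natural multiples of 1 are fixed and positivity is preserved, as positive elements are squares;
    enclosing [n * t] between consecutive integers [m] and [m + 1] pins the image of [t] to within
    [1 / n]. *)
Lemma psi_gr_real (r : R) : psi (gr (rsc H r)) = gr (rsc K r).
Proof.
have AR (t : R) : A (rsc H t) := vna_sc hA _; have BR (t : R) : B (rsc K t) := vna_sc hB _.
suff pos_case : forall t : R, 0 <= t -> psi (gr (rsc H t)) = gr (rsc K t).
  have [r0|r0] := leP 0 r; first exact: pos_case.
  have e (L : hilbertSpace R) : rsc L r = - rsc L (- r).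
    by apply: bop_ext => u; rewrite bN !rscE /rs -scaleNr -rmorphN opprK.
  rewrite (e H) (e K); apply: psi_gr_N => //; apply: pos_case; lra.
move=> t t0; have [y [By ey]] := star_bounded (AR t); rewrite ey; congr gr.
have sy : sym y.
  apply: gr_inj; rewrite -op_adj_gr -ey -psis; last exact: gr_lb.
  by rewrite op_adj_gr rsc_sym.
have NA (L : hilbertSpace R) (E : set (bop L)) m : vna E -> E (1 *+ m).
  by move=> hE; rewrite mulrn_rsc; apply: (vnaM hE); [exact: (vna_sc hE)|exact: vna1].
have An n : A (rsc H t *+ n) by rewrite mulrn_rsc; exact: (vnaM hA).
have Bn n : B (y *+ n) by rewrite mulrn_rsc; exact: (vnaM hB).
have en n : psi (gr (rsc H t *+ n)) = gr (y *+ n).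
  elim: n => [|n IH]; first by rewrite !mulr0n; exact: (iso_0 hA hB iso).
  by rewrite !mulrS; apply: psi_gr_D.
have key n u : `|ip (y u) u - t * n2 u| * n%:R <= n2 u.
  pose m := Num.truncn (n%:R * t); have nt0 : 0 <= n%:R * t by rewrite mulr_ge0.
  have /andP[m1 m2] := truncn_itv nt0; rewrite -/m in m1 m2.
  have s1 k : sym (1 *+ k : bop H) by rewrite mulrn_rsc; apply: sym_rsc; exact: sym1.
  have st k : sym (rsc H t *+ k) by rewrite mulrn_rsc; apply: sym_rsc; exact: rsc_sym.
  have ipn (L : hilbertSpace R) (a : bop L) k v : ip ((a *+ k) v) v = k%:R * ip (a v) v.
    by rewrite mulrn_rsc bM rscE ipZl.
  have p1 : pos (rsc H t *+ n + - (1 *+ m)).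
    move=> v; rewrite bD bN ipDl ipNl !ipn b1 rscE ipZl -/(n2 v) mulrA -mulrBl.
    by rewrite mulr_ge0 ?n2_ge0 // subr_ge0.
  have p2 : pos (1 *+ m.+1 + - (rsc H t *+ n)).
    move=> v; rewrite bD bN ipDl ipNl !ipn b1 rscE ipZl -/(n2 v) mulrA -mulrBl.
    by rewrite mulr_ge0 ?n2_ge0 // subr_ge0 ltW.
  have N1 k := psi_gr_N (NA H A k hA) (psi_gr_nat k) (NA K B k hB).
  have e1 := psi_gr_D (An n) (vnaN hA (NA H A m hA)) (en n) (N1 m) (Bn n) (vnaN hB (NA K B m hB)).
  have N2 := psi_gr_N (An n) (en n) (Bn n).
  have e2 := psi_gr_D (NA H A m.+1 hA) (vnaN hA (An n)) (psi_gr_nat m.+1) N2 (NA K B m.+1 hB) (vnaN hB (Bn n)).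
  have q1 := psi_gr_pos (vnaD hA (An n) (vnaN hA (NA H A m hA))) (symD (st n) (symN (s1 m))) p1 e1
    (vnaD hB (Bn n) (vnaN hB (NA K B m hB))) u.
  have q2 := psi_gr_pos (vnaD hA (NA H A m.+1 hA) (vnaN hA (An n))) (symD (s1 m.+1) (symN (st n))) p2 e2
    (vnaD hB (NA K B m.+1 hB) (vnaN hB (Bn n))) u.
  move: q1 q2; rewrite !bD !bN !ipDl !ipNl !ipn b1 -/(n2 u) -natr1 => q1 q2.
  have u0 := n2_ge0 u; have f1 := ler_wpM2r u0 m1; have f2 := ler_wpM2r u0 (ltW m2).
  rewrite -natr1 in f2.
  rewrite -[X in _ * X]ger0_norm // -normrM ler_norml mulrBl; apply/andP; split; lra.
apply/eqP; rewrite -subr_eq0; apply/eqP; apply: sym_eq0.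
  by apply: symB => //; exact: rsc_sym.
move=> u; rewrite bB ipBl rscE ipZl -/(n2 u); apply/eqP; rewrite -normr_eq0 eq_le normr_ge0 andbT.
apply/ler_addgt0Pr => e e0; rewrite add0r; have [N hN] := nat_big (n2 u / e).
have k1 := key N.+1 u; have k2 := hN N.+1 (leqnSn N); rewrite ler_pdivrMr // in k2.
have Np : 0 < N.+1%:R :> R by rewrite ltr0n.
by rewrite -(ler_pM2r Np); apply: le_trans k1 _; rewrite mulrC.
Qed.
End StarIso.

(** * Passage from [LS] to locally bounded operators and final assembly *)

Section Main.
Variables (R : realType) (H K : hilbertSpace R) (M : set (operator H)) (N : set (operator K)).

Lemma LS_lbE (L : hilbertSpace R) (Q : set (operator L)) : von_neumann_algebra Q ->
  type_I_infty Q \/ type_III Q -> LS Q = [set x | lb (bops Q) x] /\ pinf (bops Q).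
Proof.
move=> hQ tQ; split.
  apply/seteqP; split=> x; last exact: lb_LS.
  apply: LS_lb => //; case: tQ => [[tI _]|tIII]; [left; exact: typeI_gr|right; exact: typeIII_gr].
case: tQ => [[_ pi]|tIII]; first exact: pinf_gr.
by apply: typeIII_pinf; exact: typeIII_gr.
Qed.

Lemma iso_liso (Psi : operator H -> operator K) (A : set (bop H)) (B : set (bop K)) :
  ring_isomorphism [set x | lb A x] [set x | lb B x] Psi -> exists Phi, liso A B Psi Phi.
Proof.
move=> [[hf hi hs] hD hM].
have [y|Phi hPhi] := @choice (operator K) (operator H) (fun y x => lb B y -> lb A x /\ Psi x = y).
  have [ly|nly] := pselect (lb B y); last by exists set0.
  by have [x lx e] := hs y ly; exists x.
exists Phi; split=> // x lx; have lP : lb B (Psi x) by exact: hf.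
split=> //; have [l e] := hPhi _ lP.
by apply: hi => //; rewrite inE.
Qed.
End Main.

Theorem theoremB (R : realType) (H K : hilbertSpace R)
  (M : set (operator H)) (N : set (operator K))
  (hM : von_neumann_algebra M) (hN : von_neumann_algebra N)
  (tM : type_I_infty M \/ type_III M) (tN : type_I_infty N \/ type_III N)
  (Psi : operator H -> operator K)
  (hPsi : ring_isomorphism (LS M) (LS N) Psi) :
  exists (psi : operator H -> operator K) (y y' : operator K),
    [/\ real_star_isomorphism M N psi,
        real_star_isomorphism (LS M) (LS N) psi,
        LS N y /\ LS N y',
        ls_mul y y' = op1 K /\ ls_mul y' y = op1 K &
        forall x, LS M x -> Psi x = ls_mul (ls_mul y (psi x)) y'].
Proof.
have [LM fA] := LS_lbE hM tM; have [LN fB] := LS_lbE hN tN; rewrite LM LN in hPsi *.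
have hA := vna_bops hM; have hB := vna_bops hN.
have [Phi iso] := iso_liso hPsi.
have [D [oD dD]] := ofam_dense hA hB fA fB iso.
have [w|GT hGT] := @choice (bop K) (bop K * bop K)%type (fun w p => D w -> loc (bops M) (bops N) Psi w p.1 p.2).
  have [Dw|nDw] := pselect (D w); last by exists (0, 0).
  by have [g [h l]] := oD.1 _ Dw; exists (g, h).
pose G w := (GT w).1; pose T w := (GT w).2.
have hl w : D w -> loc (bops M) (bops N) Psi w (G w) (T w) by exact: hGT.
pose f := psi Psi D G T; pose f' := phi Phi D G T.
have If : liso (bops M) (bops N) f f' := psi_liso hB iso oD dD hl.
have fs X : lb (bops M) X -> f (op_adj X) = op_adj (f X) by exact: (psi_star hA hB iso oD dD hl).
have If' := liso_sym hA hB If; have [k1 k2 kD kM] := If.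
have fs' Y : lb (bops N) Y -> f' (op_adj Y) = op_adj (f' Y).
  move=> lY; have [l e] := k2 _ lY; have [lX _] := op_adj_lb hA l.
  by rewrite -{1}e -fs // (k1 _ lX).2.
have fr (r : R) X : lb (bops M) X -> f (ls_scale r%:C X) = ls_scale r%:C (f X).
  move=> lX; have Ar := vna_sc hA r%:C; have [lf _] := k1 _ lX.
  rewrite (ls_scale_mul hA r lX) kM ?(psi_gr_real hA hB If fs) ?(ls_scale_mul hB r lf) //.
  exact: (gr_lb hA Ar).
have Mlb X : M X -> lb (bops M) X by move=> /(M_gr hM)[a Aa ->]; exact: (gr_lb hA).
have finj X Y : lb (bops M) X -> lb (bops M) Y -> f X = f Y -> X = Y.
  by move=> lX lY e; rewrite -(k1 _ lX).2 e (k1 _ lY).2.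
(* [f] was formed as [yg Psi yt], so the conjugating element that returns [Psi] is [yt], with
   inverse [yg]. *)
exists f, (yt D T), (yg D G); split.
- split; [split|by move=> r X /Mlb; exact: fr|by move=> X /Mlb; exact: fs].
  + split.
    * move=> X /(M_gr hM)[a Aa ->]; have [b [Bb ->]] := star_bounded hA hB If fs Aa.
      exact: Bb.
    * by move=> X Y; rewrite !inE => /Mlb lX /Mlb lY; exact: finj.
    * move=> Y /(M_gr hN)[b Bb ->]; have [a [Aa e]] := star_bounded hB hA If' fs' Bb.
      exists (gr a); first exact: Aa.
      by rewrite -e (k2 _ (gr_lb hB Bb)).2.
  + by move=> X Y /Mlb lX /Mlb lY; exact: kD.
  + by move=> X Y /Mlb lX /Mlb lY; exact: kM.
- split; [split|by move=> r X; exact: fr|by move=> X; exact: fs].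
  + split.
    * by move=> X lX; have [] := k1 _ lX.
    * by move=> X Y; rewrite !inE; exact: finj.
    * by move=> Y lY; have [l e] := k2 _ lY; exists (f' Y).
  + exact: kD.
  + exact: kM.
- by split; [exact: (yt_lb oD dD hl)|exact: (yg_lb oD dD hl)].
- by split; [exact: (ytg hB oD dD hl)|exact: (ygt hB oD dD hl)].
by move=> X lX; exact: (psi_Psi hB iso oD dD hl).
Qed.
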